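(* The following decision problem is $\mathsf{EXPSPACE}$-complete: given a one-counter net $\mathcal{N}$ whose transitions carry integer counter updates written in binary, decide whether $\mathcal{N}$ is history-deterministic.
   Context: A (succinct) one-counter net is a tuple $\mathcal{N}=(Q,\Sigma,\Delta,q_0,F)$ with $Q$ finite, $\Sigma$ a finite alphabet, $q_0\in Q$, $F\subseteq Q$, and $\Delta\subseteq Q\times\Sigma\times\mathbb{Z}\times Q$ finite, the integers being encoded in binary in the input. Configurations are $(q,n)\in Q\times\mathbb{N}$, with a step $(q,n)\xrightarrow{a,d}(p,n+d)$ if $(q,a,d,p)\in\Delta$ and $n+d\ge0$. Runs start at $(q_0,0)$, are accepting if the last state is in $F$, and $\mathcal{L}(\mathcal{N})$ is the set of words with an accepting run. The letter game: positions $(c,w)$, start $((q_0,0),\varepsilon)$; each round Adam picks $a\in\Sigma$, Eve picks a step $c\xrightarrow{a,d}c'$. If Eve has no step and $wa$ is a prefix of a word in $\mathcal{L}(\mathcal{N})$, Eve loses; if $wa\in\mathcal{L}(\mathcal{N})$ but the state of $c'$ is not in $F$, Adam wins; otherwise play continues from $(c',wa)$, and Eve wins infinite plays. $\mathcal{N}$ is history-deterministic if Eve has a winning strategy in the letter game. *)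

(* Defs.v *)
From HB Require Import structures.
From Stdlib Require Import ZArith List.
From mathcomp Require Import all_boot.

Set Implicit Arguments.
Unset Strict Implicit.
Unset Printing Implicit Defensive.

(* States are 0..nstates-1, letters are 0..nletters-1.                      *)
(* A transition (q, a, d, p) : q --a,d--> p with d : Z (written in binary   *)
(* in the input encoding below).                                            *)

Record OCN := {
  nstates : nat;
  nletters : nat;
  trans : list (nat * nat * Z * nat);
  init : nat;
  final : nat -> bool
}.

Definition wf (N : OCN) : Prop :=
  (init N < nstates N)%N /\
  forall q a d p, List.In (q, a, d, p) (trans N) ->
    [/\ (q < nstates N)%N, (a < nletters N)%N & (p < nstates N)%N].

Definition config := (nat * nat)%type.

Definition ostep (N : OCN) (c : config) (a : nat) (c' : config) : Prop :=
  exists d, List.In (c.1, a, d, c'.1) (trans N) /\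
    (0 <= Z.of_nat c.2 + d)%Z /\ Z.of_nat c'.2 = (Z.of_nat c.2 + d)%Z.

Inductive reach (N : OCN) : list nat -> config -> Prop :=
| reach0 : reach N nil (init N, 0)
| reachS w c a c' : reach N w c -> ostep N c a c' -> reach N (w ++ a :: nil) c'.

Definition inL (N : OCN) (w : list nat) : Prop :=
  exists c, reach N w c /\ final N c.1.

Definition prefixL (N : OCN) (w : list nat) : Prop :=
  exists u, inL N (w ++ u).

(* The letter game.  An Eve strategy maps the word played so far, the      *)
(* current configuration and Adam's new letter to a successor configuration *)
(* (Some c') or to None ("no step").                                        *)

Definition strategy := list nat -> config -> nat -> option config.

(* configuration reached by following the strategy, indexed by reversed word *)
Fixpoint playr (N : OCN) (s : strategy) (rw : list nat) : option config :=
  match rw with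
  | nil => Some (init N, 0)
  | a :: rw' =>
      match playr N s rw' with
      | Some c => s (List.rev rw') c a
      | None => None
      end
  end.

Definition play (N : OCN) (s : strategy) (w : list nat) : option config :=
  playr N s (List.rev w).

Definition letters_ok (N : OCN) (w : list nat) : Prop :=
  forall a, List.In a w -> (a < nletters N)%N.

(* Eve's strategy s is winning: in every round of every play consistent with
   s, Eve picks a legal step whenever one exists (if none exists, the play
   stops and Eve loses iff w a is a prefix of a word of the language), and
   whenever w a is in the language the chosen configuration is accepting. *)
Definition eve_wins (N : OCN) (s : strategy) : Prop :=
  forall (w : list nat) (a : nat) (c : config),
    letters_ok N w -> (a < nletters N)%N -> play N s w = Some c ->
    match s w c a with
    | Some c' => ostep N c a c' /\ (inL N (w ++ a :: nil) -> final N c'.1)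
    | None => (forall c', ~ ostep N c a c') /\ ~ prefixL N (w ++ a :: nil)
    end.

Definition history_deterministic (N : OCN) : Prop :=
  exists s : strategy, eve_wins N s.

(* Input encoding over the alphabet {0, 1, #}.                              *)

Inductive sym := S0 | S1 | Sh.

Definition sym_code (s : sym) : 'I_3 :=
  match s with S0 => @Ordinal 3 0 isT | S1 => @Ordinal 3 1 isT | Sh => @Ordinal 3 2 isT end.
Definition sym_decode (i : 'I_3) : sym :=
  match val i with 0 => S0 | 1 => S1 | _ => Sh end.
Lemma sym_codeK : cancel sym_code sym_decode. Proof. by case. Qed.
HB.instance Definition _ := Equality.copy sym (can_type sym_codeK).
HB.instance Definition _ := Finite.copy sym (can_type sym_codeK).

(* binary, most significant bit first, no leading zeros; 0 is "0" *)
Fixpoint pos_bits (p : positive) : list sym :=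
  match p with
  | xH => S1 :: nil
  | xO p' => pos_bits p' ++ S0 :: nil
  | xI p' => pos_bits p' ++ S1 :: nil
  end.

Definition nat_bits (n : nat) : list sym :=
  match N.of_nat n with N0 => S0 :: nil | Npos p => pos_bits p end.

Definition enc_nat (n : nat) : list sym := nat_bits n ++ Sh :: nil.

Definition enc_Z (z : Z) : list sym :=
  (if (z <? 0)%Z then S1 else S0) :: enc_nat (Z.abs_nat z).

Definition enc_unary (n : nat) : list sym := List.repeat S1 n ++ Sh :: nil.

Definition enc_trans (t : nat * nat * Z * nat) : list sym :=
  match t with (q, a, d, p) => enc_nat q ++ enc_nat a ++ enc_Z d ++ enc_nat p end.

Definition encode (N : OCN) : list sym :=
  enc_unary (nstates N) ++ enc_unary (nletters N) ++ enc_nat (init N)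
  ++ (List.map (fun q => if final N q then S1 else S0) (List.seq 0 (nstates N)) ++ Sh :: nil)
  ++ List.flat_map enc_trans (trans N).

Definition HD_problem (x : list sym) : Prop :=
  exists N, wf N /\ encode N = x /\ history_deterministic N.

(* Deterministic single-tape Turing machines (one-way infinite tape).       *)

Inductive dir := DL | DR | DS.

Record TM (G : finType) := {
  tm_state : finType;
  tm_tape : finType;
  tm_blank : tm_tape;
  tm_inp : G -> tm_tape;
  tm_start : tm_state;
  tm_acc : tm_state;
  tm_rej : tm_state;
  tm_delta : tm_state -> tm_tape -> tm_state * tm_tape * dir
}.

Section TMsem.
Variables (G : finType) (M : TM G).

(* state, cells left of the head (nearest first), head cell, cells right *)
Definition tconf := (tm_state M * (list (tm_tape M) * tm_tape M * list (tm_tape M)))%type.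

Definition halted (c : tconf) : bool := (c.1 == tm_acc M) || (c.1 == tm_rej M).

Definition tstep (c : tconf) : tconf :=
  if halted c then c else
  match c with
  | (q, (l, h, r)) =>
    match @tm_delta _ M q h with
    | (q', h', DS) => (q', (l, h', r))
    | (q', h', DR) =>
        match r with
        | nil => (q', (h' :: l, tm_blank M, nil))
        | x :: r' => (q', (h' :: l, x, r'))
        end
    | (q', h', DL) =>
        match l with
        | nil => (q', (nil, h', r))
        | x :: l' => (q', (l', x, h' :: r))
        end
    end
  end.

Definition tinit (x : list G) : tconf :=
  match x with
  | nil => (tm_start M, (nil, tm_blank M, nil))
  | y :: x' => (tm_start M, (nil, tm_inp M y, List.map (tm_inp M) x'))
  end.

Definition trun (x : list G) (t : nat) : tconf := iter t tstep (tinit x).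

Definition tspace (c : tconf) : nat :=
  match c with (_, (l, _, r)) => (size l + 1 + size r)%N end.

Definition decides_in_space (L : list G -> Prop) (s : nat -> nat) : Prop :=
  forall x, exists t,
    halted (trun x t) /\ ((trun x t).1 = tm_acc M <-> L x) /\
    forall i, (i <= t)%N -> (tspace (trun x i) <= s (size x))%N.

(* Output of a halted transducer: tape contents from cell 0 up to the first
   cell not carrying an output symbol. *)
Fixpoint read_out (H : finType) (out : tm_tape M -> option H) (cs : list (tm_tape M))
  : list H :=
  match cs with
  | nil => nil
  | y :: cs' => match out y with Some h => h :: read_out out cs' | None => nil end
  end.

Definition tape_contents (c : tconf) : list (tm_tape M) :=
  match c with (_, (l, h, r)) => List.rev l ++ h :: r end.

Definition computes_in_time (H : finType) (out : tm_tape M -> option H)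
  (f : list G -> list H) (p : nat -> nat) : Prop :=
  forall x, exists t, (t <= p (size x))%N /\ halted (trun x t) /\
    read_out out (tape_contents (trun x t)) = f x.

End TMsem.

Definition EXPSPACE (G : finType) (L : list G -> Prop) : Prop :=
  exists (M : TM G) (k : nat),
    decides_in_space M L (fun n => 2 ^ (k * (n + 1) ^ k))%N.

Definition poly_time_computable (G H : finType) (f : list G -> list H) : Prop :=
  exists (M : TM G) (out : tm_tape M -> option H) (k : nat),
    computes_in_time out f (fun n => k * (n + 1) ^ k)%N.

Definition poly_reduces (G H : finType) (L1 : list G -> Prop) (L2 : list H -> Prop)
  : Prop :=
  exists f : list G -> list H, poly_time_computable f /\ forall x, L1 x <-> L2 (f x).

Definition EXPSPACE_hard (H : finType) (L : list H -> Prop) : Prop :=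
  forall (G : finType) (L' : list G -> Prop), EXPSPACE L' -> poly_reduces L' L.

Definition EXPSPACE_complete (H : finType) (L : list H -> Prop) : Prop :=
  EXPSPACE L /\ EXPSPACE_hard L.

(* Main.v *)
(** Membership.  The net is history-deterministic iff Eve wins the game in which she
    follows, transition by transition, a second run controlled by Adam.  This is a safety
    game on two counters, monotone in both.  For each pair of control states the winning
    region is a half plane up to a belt of width exponential in the input (binary updates): a
    first-cycle game decides, for each rational slope of bounded size, which player wins on
    which side.  Inside the belts the region may be taken periodic, by the pigeonhole
    principle on snapshots of the belts, so cutting both counters at a doubly exponential
    bound does not change the winner.  The cut region is described by its columns, which are
    checked through a sliding window of exponential bit length; Savitch's algorithm finds a
    consistent sequence of windows in exponential space.

    Hardness.  The counter holds the index of a cell in the tableau of an exponential-space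
    computation; Adam claims a symbol at that cell and justifies it by the three symbols
    above, Eve picks the one she disputes, and a binary update of about the row width moves the
    counter to that cell.  Adam, who starts from a rejecting cell, is refuted iff the machine
    accepts.

    Space-bounded deciders and polynomial-time reductions are written as terms and printing
    programs over natural numbers, compiled to single-tape Turing machines whose tape stores
    the registers in binary. *)

(* One predicate serves all variants of the safety game: a set closed under play outside an escape
   region that counts as won for Eve. Cutting the counters enlarges this region, so a winning set of
   the full game stays closed, and the whole difficulty is the converse. It needs a quantitative
   statement about Adam: below a belt he must win before either counter leaves the box, which is
   shown with an explicit potential that drops whenever a cycle is closed. Belts of different
   directions drift apart, so far out an edge that stays inside belts joins parallel ones; a common
   period, measured along [x + y], then lets one pigeonhole argument repeat all belts at once.
   Monotonicity in Eve's counter makes a column small: per pair of states only her least winning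
   counter is stored. On the machine side, a term whose values stay below a doubly exponential bound
   has registers of exponential length. This is why every operation saturates at one precomputed
   number, and why Savitch's recursion becomes the iteration of a function on numbers, with its
   stack in a single register. *)
Require Import Defs.
From HB Require Import structures.
From Stdlib Require Import ZArith List Lia Classical ClassicalEpsilon FunctionalExtensionality.
From mathcomp Require Import all_boot.
From mathcomp Require Import zify.

Set Implicit Arguments.
Unset Strict Implicit.
Unset Printing Implicit Defensive.

(** * Sweeping Turing machines *)

Module SweepMachine.

Section Sweep.
Variables (G P C : finType) (blank : C) (inp : G -> C) (lm : C -> bool).
Variables (act : P -> C -> C * (P + P)) (p0 acc rej : P).

(** The boolean is the direction. With [false] the head moves right and [act] rewrites cells, an
    [inr] result ending the sweep; with [true] it runs back to the marked cell without changing
    anything. Each sweep thus starts and ends on cell 0, and sweeps compose. *)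
Definition sweepTM : TM G := {|
  tm_state := (P * bool)%type; tm_tape := C; tm_blank := blank; tm_inp := inp;
  tm_start := (p0, false); tm_acc := (acc, false); tm_rej := (rej, false);
  tm_delta := fun s c =>
    if s.2 then (if lm c then ((s.1, false), c, DS) else ((s.1, true), c, DL))
    else match act s.1 c with
         | (c', inl p) => ((p, false), c', DR)
         | (c', inr p) => if lm c' then ((p, false), c', DS) else ((p, true), c', DL)
         end |}.

Local Notation M := sweepTM.
Local Notation conf := (tconf M).

Definition trace (c c' : conf) (t S : nat) :=
  iter t (@tstep _ M) c = c' /\
  forall i, i <= t -> tspace (iter i (@tstep _ M) c) <= S.

Lemma trace_refl c S : tspace c <= S -> trace c c 0 S.
Proof. by move=> h; split=> // i; rewrite leqn0 => /eqP ->. Qed.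

Lemma trace_trans c1 c2 c3 t1 t2 S :
  trace c1 c2 t1 S -> trace c2 c3 t2 S -> trace c1 c3 (t1 + t2) S.
Proof.
move=> [e1 h1] [e2 h2]; split; first by rewrite addnC iterD e1.
move=> i hi; case: (leqP i t1) => hi1; first exact: h1.
by rewrite -(subnK (ltnW hi1)) iterD e1; apply: h2; lia.
Qed.

Lemma trace_step c c' S :
  tstep c = c' -> tspace c <= S -> tspace c' <= S -> trace c c' 1 S.
Proof. by move=> <- h1 h2; split=> // -[|[|i]]. Qed.

Lemma trace_leS c c' t S S' : S <= S' -> trace c c' t S -> trace c c' t S'.
Proof. by move=> h [e hs]; split=> // i /hs /leq_trans; apply. Qed.

(* The tape holds f 0 .. f (n - 1) and the head is on cell j < n. *)
Definition tconf_at (s : P * bool) (j : nat) (f : nat -> C) (n : nat) : conf :=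
  (s, (rev (mkseq f j), f j, mkseq (fun i => f (j.+1 + i)) (n - j.+1))).

Lemma tspace_at s j f n : j < n -> tspace (tconf_at s j f n) = n.
Proof. by move=> h; rewrite /= size_rev !size_mkseq; lia. Qed.

Lemma tconf_at_ext s j f g n :
  j < n -> (forall i, i < n -> f i = g i) -> tconf_at s j f n = tconf_at s j g n.
Proof.
move=> hj h; rewrite /tconf_at h //; congr (_, (rev _, _, _)).
  by apply/eq_in_map => i; rewrite mem_iota => /andP[_]; rewrite add0n => hi; apply: h; lia.
by apply/eq_in_map => i; rewrite mem_iota => /andP[_]; rewrite add0n => hi; apply: h; lia.
Qed.

Lemma mkseq_S (T : Type) (g : nat -> T) n : mkseq g n.+1 = g 0 :: mkseq (g \o S) n.
Proof. by rewrite /mkseq /= -[1]addn0 iotaDl -map_comp. Qed.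

Lemma rev_mkseqS (T : Type) (g : nat -> T) n : rev (mkseq g n.+1) = g n :: rev (mkseq g n).
Proof. by rewrite /mkseq -addn1 iotaD add0n map_cat rev_cat. Qed.

Definition nonhalting (p : P) := (p != acc) && (p != rej).

Lemma halted_at p b j f n :
  (~~ b -> nonhalting p) -> halted (tconf_at (p, b) j f n) = false.
Proof.
rewrite /halted /= !xpair_eqE; case: b => /= [_|]; first by rewrite !andbF.
by rewrite !andbT => /(_ isT) /andP[/negPf -> /negPf ->].
Qed.

Lemma step_right p p' c' j f n :
  nonhalting p -> j < n -> (forall i, n <= i -> f i = blank) ->
  act p (f j) = (c', inl p') ->
  tstep (tconf_at (p, false) j f n) =
  tconf_at (p', false) j.+1 (fun i => if i == j then c' else f i) (maxn n j.+2).
Proof.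
move=> hp hj hb ha; rewrite /tstep (halted_at _ _ _ (fun _ => hp)) /= ha.
have e1 : rev (mkseq (fun i => if i == j then c' else f i) j.+1) = c' :: rev (mkseq f j).
  rewrite rev_mkseqS eqxx; congr (_ :: rev _).
  by apply/eq_in_map => i; rewrite mem_iota => /andP[_ hi]; rewrite ifN //; apply/eqP; lia.
rewrite /tconf_at e1.
case E: (n - j.+1) => [|d].
  (* The head stood on the last cell of the tape, so moving right supplies a fresh blank. *)
  rewrite [mkseq _ 0]/=; have -> : n = j.+1 by lia.
  have -> : maxn j.+1 j.+2 - j.+2 = 0 by lia.
  have -> : (j.+1 == j) = false by apply/eqP; lia.
  by rewrite hb //; lia.
rewrite mkseq_S addn0 [in RHS]ifN; last by apply/eqP; lia.
have -> : maxn n j.+2 - j.+2 = d by lia.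
congr (_, (_, _, _)); apply: eq_mkseq => i /=.
by case: eqP => [e|_]; [exfalso; lia | congr (f _); lia].
Qed.

Lemma step_left q c c' j f n s :
  halted (tconf_at s j.+1 f n) = false -> j.+1 < n -> c = f j.+1 ->
  @tm_delta _ M s c = (q, c', DL) ->
  tstep (tconf_at s j.+1 f n) = tconf_at q j (fun i => if i == j.+1 then c' else f i) n.
Proof.
move=> hh hj -> hd; rewrite /tstep hh /tconf_at.
rewrite rev_mkseqS hd; congr (_, (rev _, _, _)).
- by apply/eq_in_map => i; rewrite mem_iota => /andP[_ hi]; rewrite ifN //; apply/eqP; lia.
- by rewrite ifN //; apply/eqP; lia.
have -> : n - j.+1 = (n - j.+2).+1 by lia.
rewrite mkseq_S addn0 eqxx; congr (_ :: _); apply: eq_mkseq => i /=.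
by case: eqP => [e|_]; [exfalso; lia | congr (f _); lia].
Qed.

Lemma go_home q j f n :
  j < n -> (forall i, i <= j -> lm (f i) = (i == 0)) ->
  trace (tconf_at (q, true) j f n) (tconf_at (q, false) 0 f n) j.+1 n.
Proof.
elim: j => [|j IH] hj hl.
  apply: trace_step; rewrite ?tspace_at //.
  by rewrite /tstep halted_at //= hl //= /tconf_at.
rewrite -[X in trace _ _ X _]add1n; apply: trace_trans; last first.
  by apply: IH => [|i hi]; [lia | apply: hl; lia].
apply: trace_step; rewrite ?tspace_at //; try lia.
rewrite (@step_left (q, true) (f j.+1) (f j.+1)) //; last 1 first.
- by rewrite /= hl.
- by apply: tconf_at_ext => [|i _]; [lia | case: eqP => // ->].
by rewrite halted_at.
Qed.

(** A sweep ending on cell [k > 0] takes [k] moves out, one turning step and [k] steps home, the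
    last of which only changes direction on the mark. The mark is required of the rewritten cells
    [c'], not of [f], because the very first sweep is the one that writes it. *)
Lemma sweep_run k (ps : nat -> P) (c' : nat -> C) f n q :
  0 < n -> (forall i, n <= i -> f i = blank) ->
  (forall i, i <= k -> nonhalting (ps i)) ->
  (forall i, i < k -> act (ps i) (f i) = (c' i, inl (ps i.+1))) ->
  act (ps k) (f k) = (c' k, inr q) ->
  (forall i, i <= k -> lm (c' i) = (i == 0)) ->
  exists2 t, t <= k.*2.+2 &
  trace (tconf_at (ps 0, false) 0 f n)
        (tconf_at (q, false) 0 (fun i => if i <= k then c' i else f i) (maxn n k.+1))
        t (maxn n k.+1).
Proof.
move=> hn hb hp hc hf hl.
set N := maxn n k.+1.
pose g j := fun i => if i < j then c' i else f i.
have fwd j : j <= k ->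
  trace (tconf_at (ps 0, false) 0 f n) (tconf_at (ps j, false) j (g j) (maxn n j.+1)) j N.
  elim: j => [|j IH] hj.
    have -> : maxn n 1 = n by lia.
    by apply: trace_refl; rewrite tspace_at // /N; lia.
  rewrite -[X in trace _ _ X _]addn1; apply: trace_trans; first by apply: IH; lia.
  apply: trace_step; rewrite ?tspace_at /N; try lia.
  rewrite (@step_right _ (ps j.+1) (c' j)).
  - have -> : maxn (maxn n j.+1) j.+2 = maxn n j.+2 by lia.
    apply: tconf_at_ext => [|i _]; first by lia.
    by rewrite /g ltnS; case: ltngtP => // ->.
  - by apply: hp; lia.
  - by lia.
  - by move=> i hi; rewrite /g ifN; [apply: hb; lia | rewrite -leqNgt; lia].
  by rewrite /g ltnn hc.
have {}fwd := fwd k (leqnn k).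
move: fwd; rewrite /N => {N} fwd.
case: k hp hc hf hl fwd => [|k] hp hc hf hl fwd.
  exists 1 => //; rewrite -[X in trace _ _ X _](add0n 1); apply: trace_trans fwd _.
  apply: trace_step; rewrite ?tspace_at; try lia.
  rewrite /tstep halted_at /=; last by move=> _; apply: hp.
  by rewrite hf hl.
exists (k.+1 + (1 + k.+1)); first by lia.
apply: trace_trans fwd _; apply: trace_trans; last first.
  apply: (@go_home q k) => [|i hi]; first lia.
  by rewrite ifT; [apply: hl; lia | lia].
apply: trace_step; rewrite ?tspace_at; try lia.
rewrite (@step_left (q, true) (f k.+1) (c' k.+1)).
- apply: tconf_at_ext => [|i hi]; first by lia.
  by rewrite /g; case: (ltngtP i k.+1) => // ->.
- by rewrite halted_at // => _; apply: hp.
- by lia.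
- by rewrite /g ltnn.
by rewrite /= hf hl.
Qed.

End Sweep.

End SweepMachine.
Import SweepMachine.

(** * Register machines *)

Module RegisterMachine.

Fixpoint binval (s : seq bool) : nat := if s is b :: s' then b + (binval s').*2 else 0.

Fixpoint incb (s : seq bool) : seq bool :=
  match s with [::] => [:: true] | true :: s' => false :: incb s' | false :: s' => true :: s' end.

(** Leading zeros are kept, so digit strings never shrink and zero has many representations; it is
    recognised by the absence of [true]. *)
Fixpoint decb (s : seq bool) : seq bool :=
  match s with [::] => [::] | false :: s' => true :: decb s' | true :: s' => false :: s' end.

Lemma binval_incb s : binval (incb s) = (binval s).+1.
Proof. by elim: s => //= -[] s IH //=; rewrite IH; lia. Qed.

Lemma binval_decb s : 0 < binval s -> binval (decb s) = (binval s).-1.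
Proof.
by elim: s => //= -[] s IH //=; first lia; rewrite add0n => h; rewrite IH; lia.
Qed.

Lemma size_decb s : size (decb s) = size s.
Proof. by elim: s => //= -[] s IH //=; rewrite IH. Qed.

Lemma binval_gt0 s : (0 < binval s) = (true \in s).
Proof. by elim: s => //= -[] s IH //=; rewrite inE /= -IH; lia. Qed.

Lemma size_incb s W : size s <= W -> (binval s).+1 < 2 ^ W -> size (incb s) <= W.
Proof.
elim: s W => [|[] s IH] [|W] //=; rewrite !expnS => h1 h2; apply: IH => //; lia.
Qed.

Lemma onth_incb s i : onth (incb s) i =
  if i < index false s then Some false else if i == index false s then Some true else onth s i.
Proof. by elim: s i => [|[] s IH] [|i] //=; rewrite ?IH //; case: i. Qed.

Lemma onth_decb s i : true \in s -> onth (decb s) i =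
  if i < index true s then Some true else if i == index true s then Some false else onth s i.
Proof.
elim: s i => [|[] s IH] [|i] //= h; rewrite IH //.
Qed.

Lemma onth_lt_index b s i : i < index b s -> onth s i = Some (~~ b).
Proof.
by case: b; elim: s i => [|[] s IH] [|i] //= h; apply: IH.
Qed.

Lemma onth_index (b : bool) (s : seq bool) :
  onth s (index b s) = (if b \in s then Some b else None).
Proof.
elim: s => //= c s IH; rewrite inE eq_sym; case: eqP => [->//|_] /=; exact: IH.
Qed.

Lemma onth_rcons (T : Type) (s : seq T) a i :
  onth (rcons s a) i = if i == size s then Some a else onth s i.
Proof. by elim: s i => [|b s IH] [|i] //=; case: i. Qed.

Lemma onth_ge (T : Type) (s : seq T) i : size s <= i -> onth s i = None.
Proof. by elim: s i => [|b s IH] [|i] //=; apply: IH. Qed.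

Lemma onth_lt (T : Type) (s : seq T) i : i < size s -> exists a, onth s i = Some a.
Proof. by elim: s i => [|b s IH] [|i] //= h; [exists b | apply: IH]. Qed.

Section RegMachine.
Variables (G H : finType) (R : nat).

Inductive instr :=
  | IInit of nat | IInc of nat & nat | IDec of nat & nat
  | ITest of nat & nat & nat | IOut of H & nat
  | IClr of nat | ISet of nat | IAdv of nat & nat | IRead of (option G -> nat) | IHalt.

(* left-end mark, input letter, input pointer, output letter, one binary
   digit of every register (least significant digit on cell 0) *)
Notation cell := (bool * option G * bool * option H * {ffun 'I_R.+1 -> option bool})%type.

Definition cell_blank : cell := (false, None, false, None, [ffun=> None]).
Definition cell_inp (g : G) : cell := (false, Some g, false, None, [ffun=> None]).
Definition cell_mark (c : cell) : bool := c.1.1.1.1.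
Definition cell_out (c : cell) : option H := c.1.2.
Definition set_bit (c : cell) (r : nat) (b : bool) : cell :=
  (c.1, [ffun i => if i == inord r then Some b else c.2 i]).
Definition set_ptr (c : cell) (b : bool) : cell := (c.1.1.1, b, c.1.2, c.2).
Definition set_out (c : cell) (h : H) : cell := (c.1.1, Some h, c.2).

Variable code : seq instr.
Notation N := (size code).+1.

Definition pcs (q : nat) : 'I_N.+1 := inord q.

(** An [inl] result continues the sweep, so an increment is carry propagation in one pass.
    [IAdv s q] erases the pointer and goes on in instruction [s], meant to be an [ISet], which sets
    it one cell further in the same pass; on a cell without input letter the pointer stays. *)
Definition reg_act (p : 'I_N.+1) (c : cell) : cell * ('I_N.+1 + 'I_N.+1) :=
  match nth IHalt code p with
  | IInit q => ((true, c.1.1.1.2, true, c.1.2, c.2), inr (pcs q))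
  | IInc r q => if c.2 (inord r) == Some true then (set_bit c r false, inl p)
                else (set_bit c r true, inr (pcs q))
  | IDec r q => if c.2 (inord r) == Some false then (set_bit c r true, inl p)
                else (set_bit c r false, inr (pcs q))
  | ITest r z nz => match c.2 (inord r) with
                    | Some true => (c, inr (pcs nz))
                    | Some false => (c, inl p)
                    | None => (c, inr (pcs z)) end
  | IOut h q => if c.1.2 is None then (set_out c h, inr (pcs q)) else (c, inl p)
  | IClr q => if c.1.1.2 then (set_ptr c false, inr (pcs q)) else (c, inl p)
  | ISet q => (set_ptr c true, inr (pcs q))
  | IAdv s q => if c.1.1.2 then
                  if c.1.1.1.2 is None then (c, inr (pcs q))
                  else (set_ptr c false, inl (pcs s))
                else (c, inl p)
  | IRead T => if c.1.1.2 then (c, inr (pcs (T c.1.1.1.2))) else (c, inl p)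
  | IHalt => (c, inr p)
  end.

(** The address [size code] accepts and the one after it rejects, so programs halt by an ordinary
    jump. *)
Definition regTM : TM G :=
  sweepTM cell_blank cell_inp cell_mark reg_act (pcs 0) (pcs (size code)) (pcs N).

Record st := St { rg : nat -> nat; pt : option nat; ot : seq H }.

Definition upd (s : st) (r v : nat) : st :=
  St (fun i => if i == r then v else rg s i) (pt s) (ot s).

Variable x : seq G.

(** The pointer saturates just past the last letter, where reading returns [None]. *)
Definition adv (p : option nat) : option nat :=
  if p is Some i then Some (if i < size x then i.+1 else i) else None.

Inductive istep (a : nat) (s : st) : nat -> st -> Prop :=
  | istep_inc r q : nth IHalt code a = IInc r q -> r <= R -> istep a s q (upd s r (rg s r).+1)
  | istep_dec r q : nth IHalt code a = IDec r q -> r <= R -> 0 < rg s r ->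
      istep a s q (upd s r (rg s r).-1)
  | istep_test r z nz : nth IHalt code a = ITest r z nz -> r <= R ->
      istep a s (if rg s r == 0 then z else nz) s
  | istep_out h q : nth IHalt code a = IOut h q -> istep a s q (St (rg s) (pt s) (rcons (ot s) h))
  | istep_clr i q : nth IHalt code a = IClr q -> pt s = Some i -> i <= size x ->
      istep a s q (St (rg s) None (ot s))
  | istep_set q : nth IHalt code a = ISet q -> pt s = None ->
      istep a s q (St (rg s) (Some 0) (ot s))
  | istep_adv i b q : nth IHalt code a = IAdv b q -> nth IHalt code b = ISet q ->
      b < size code -> pt s = Some i -> i <= size x -> istep a s q (St (rg s) (adv (pt s)) (ot s))
  | istep_read i T : nth IHalt code a = IRead T -> pt s = Some i -> i <= size x ->
      istep a s (T (onth x i)) s.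

Definition cellf (bits : 'I_R.+1 -> seq bool) (p : option nat) (o : seq H) (i : nat) : cell :=
  (i == 0, onth x i, Some i == p, onth o i, [ffun r => onth (bits r) i]).

Definition tape_inv (s : st) (f : nat -> cell) (n W : nat) : Prop :=
  [/\ 0 < n, forall i, n <= i -> f i = cell_blank &
  exists bits, (forall i, f i = cellf bits (pt s) (ot s) i) /\
    forall r : 'I_R.+1, binval (bits r) = rg s r /\ size (bits r) <= W].

Lemma nonhalting_pcs a : a < size code -> nonhalting (pcs (size code)) (pcs N) (pcs a).
Proof.
move=> h; apply/andP; split; apply/eqP => /(congr1 val); rewrite /= !inordK; lia.
Qed.

Definition hconf a f n := tconf_at (cell_blank) (cell_inp) cell_mark reg_act (pcs 0)
   (pcs (size code)) (pcs N) (pcs a, false) 0 f n.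

(** Common frame for all instructions: what remains is to name the cell [k] where the sweep stops,
    the addresses [ps] on the way and the new digits. Only the pointer move changes its address in
    mid-sweep. *)
Lemma sweep_sim k (ps : nat -> nat) (c' : nat -> cell) a s f n W S q s' bits' :
  tape_inv s f n W -> n <= S -> k < S -> ps 0 = a ->
  (forall i, i <= k -> ps i < size code) ->
  (forall i, i < k -> reg_act (pcs (ps i)) (f i) = (c' i, inl (pcs (ps i.+1)))) ->
  reg_act (pcs (ps k)) (f k) = (c' k, inr (pcs q)) ->
  (forall i, (if i <= k then c' i else f i) = cellf bits' (pt s') (ot s') i) ->
  (forall r : 'I_R.+1, binval (bits' r) = rg s' r /\ size (bits' r) <= W) ->
  exists t f' n', [/\ t <= S.*2, trace (hconf a f n) (hconf q f' n') t S,
     tape_inv s' f' n' W & n' <= S].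
Proof.
move=> [hn hb _] hS hk <- hps hc hf hi hbits.
have [|i hik|t ht tr] := @sweep_run G _ _ cell_blank cell_inp cell_mark reg_act (pcs 0)
   (pcs (size code)) (pcs N) k (fun i => pcs (ps i)) c' f n (pcs q) hn hb _ hc hf.
- by move=> i hik; apply: nonhalting_pcs; apply: hps.
- by have := hi i; rewrite hik => ->.
exists t, (fun i => if i <= k then c' i else f i), (maxn n k.+1); split; last by lia.
- by lia.
- by apply: trace_leS tr; lia.
split; first by lia.
  by move=> i hi'; rewrite ifN; [apply: hb; lia | lia].
by exists bits'.
Qed.

Lemma cellf_bits bits bits' p o (r : 'I_R.+1) i b :
  (forall r', r' != r -> bits' r' = bits r') -> onth (bits' r) i = Some b ->
  set_bit (cellf bits p o i) r b = cellf bits' p o i.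
Proof.
move=> h1 h2; rewrite /set_bit /cellf; congr (_, _).
apply/ffunP => r'; rewrite !ffunE inord_val.
by case: eqP => [->|/eqP /h1 ->].
Qed.

Lemma cellf_bits_same bits bits' p o (r : 'I_R.+1) i :
  (forall r', r' != r -> bits' r' = bits r') -> onth (bits' r) i = onth (bits r) i ->
  cellf bits p o i = cellf bits' p o i.
Proof.
move=> h1 h2; rewrite /cellf; congr (_, _).
by apply/ffunP => r'; rewrite !ffunE; case: (eqVneq r' r) => [->|/h1 ->].
Qed.

Definition bits_upd (bits : 'I_R.+1 -> seq bool) r b : 'I_R.+1 -> seq bool :=
  fun r' => if r' == r then b else bits r'.

(** The bound on register values is asked of the state after the step: it is what keeps an
    incremented digit string within [W] cells. *)
Lemma istep_sim a s a' s' f n W S :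
  istep a s a' s' -> a < size code -> tape_inv s f n W ->
  (forall r, r <= R -> rg s' r < 2 ^ W) ->
  n <= S -> W < S -> size x < S -> size (ot s') <= S ->
  exists t f' n', [/\ t <= S.*2, trace (hconf a f n) (hconf a' f' n') t S,
     tape_inv s' f' n' W & n' <= S].
Proof.
move=> hst ha hinv hreg hn hW hx ho.
have [hn0 hb [bits [hf hbits]]] := hinv.
have pca b : b < size code -> val (pcs b) = b by move=> hb'; rewrite /= inordK //; lia.
have actE b c : b < size code -> reg_act (pcs b) c = 
   match nth IHalt code b with
  | IInit q => ((true, c.1.1.1.2, true, c.1.2, c.2), inr (pcs q))
  | IInc r q => if c.2 (inord r) == Some true then (set_bit c r false, inl (pcs b))
                else (set_bit c r true, inr (pcs q))
  | IDec r q => if c.2 (inord r) == Some false then (set_bit c r true, inl (pcs b))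
                else (set_bit c r false, inr (pcs q))
  | ITest r z nz => match c.2 (inord r) with
                    | Some true => (c, inr (pcs nz))
                    | Some false => (c, inl (pcs b))
                    | None => (c, inr (pcs z)) end
  | IOut h q => if c.1.2 is None then (set_out c h, inr (pcs q)) else (c, inl (pcs b))
  | IClr q => if c.1.1.2 then (set_ptr c false, inr (pcs q)) else (c, inl (pcs b))
  | ISet q => (set_ptr c true, inr (pcs q))
  | IAdv s q => if c.1.1.2 then
                  if c.1.1.1.2 is None then (c, inr (pcs q))
                  else (set_ptr c false, inl (pcs s))
                else (c, inl (pcs b))
  | IRead T => if c.1.1.2 then (c, inr (pcs (T c.1.1.1.2))) else (c, inl (pcs b))
  | IHalt => (c, inr (pcs b))
  end.
  by move=> hb'; rewrite /reg_act pca.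
case: hst hreg ho => {a' s'}.
- move=> r q e hr hreg _.
  have er : r = nat_of_ord (inord r : 'I_R.+1) by rewrite inordK.
  have [v1 v2] := hbits (inord r); rewrite -er in v1.
  pose bits' := bits_upd bits (inord r) (incb (bits (inord r))).
  have b1 r' : r' != inord r -> bits' r' = bits r' by rewrite /bits' /bits_upd => /negPf ->.
  have b2 : bits' (inord r) = incb (bits (inord r)) by rewrite /bits' /bits_upd eqxx.
  pose k := index false (bits (inord r)).
  apply: (@sweep_sim k (fun=> a) (fun i => cellf bits' (pt s) (ot s) i) _ s _ _ _ _ _ _ bits') => //.
  + by rewrite /k; apply: leq_ltn_trans hW; apply: leq_trans v2; apply: index_size.
  + move=> i hi; rewrite actE // e hf /= ffunE (onth_lt_index hi) /=.
    rewrite {1}er (@cellf_bits _ bits') // b2 onth_incb -/k hi //.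
  + rewrite actE // e hf /= ffunE onth_index.
    have -> : (if false \in bits (inord r) then Some false else None) == Some true = false by case: ifP.
    rewrite {1}er (@cellf_bits _ bits') // b2 onth_incb -/k ltnn eqxx //.
  + move=> i; case: leqP => // hi; rewrite hf; apply: (@cellf_bits_same _ _ _ _ (inord r)) => //.
    by rewrite b2 onth_incb -/k ifN ?ifN //; [apply/eqP; lia | rewrite -leqNgt; lia].
  move=> r' /=; have [w1 w2] := hbits r'.
  case: (eqVneq r' (inord r)) => [->|hr'].
    rewrite b2 -er eqxx binval_incb v1; split=> //.
    by apply: size_incb => //; have := hreg r hr; rewrite /= eqxx v1.
  rewrite b1 // ifN //; apply/eqP => e'; case/eqP: hr'; apply: val_inj; rewrite /= e'; exact: er.
- move=> r q e hr hpos hreg _.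
  have er : r = nat_of_ord (inord r : 'I_R.+1) by rewrite inordK.
  have [v1 v2] := hbits (inord r); rewrite -er in v1.
  pose bits' := bits_upd bits (inord r) (decb (bits (inord r))).
  have b1 r' : r' != inord r -> bits' r' = bits r' by rewrite /bits' /bits_upd => /negPf ->.
  have b2 : bits' (inord r) = decb (bits (inord r)) by rewrite /bits' /bits_upd eqxx.
  have ht : true \in bits (inord r) by rewrite -binval_gt0 v1.
  pose k := index true (bits (inord r)).
  apply: (@sweep_sim k (fun=> a) (fun i => cellf bits' (pt s) (ot s) i) _ s _ _ _ _ _ _ bits') => //.
  + by rewrite /k; apply: leq_ltn_trans hW; apply: leq_trans v2; apply: index_size.
  + move=> i hi; rewrite actE // e hf /= ffunE (onth_lt_index hi) /=.
    rewrite {1}er (@cellf_bits _ bits') // b2 onth_decb // -/k hi //.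
  + rewrite actE // e hf /= ffunE onth_index ht /=.
    rewrite {1}er (@cellf_bits _ bits') // b2 onth_decb // -/k ltnn eqxx //.
  + move=> i; case: leqP => // hi; rewrite hf; apply: (@cellf_bits_same _ _ _ _ (inord r)) => //.
    by rewrite b2 onth_decb // -/k ifN ?ifN //; [apply/eqP; lia | rewrite -leqNgt; lia].
  move=> r' /=; have [w1 w2] := hbits r'.
  case: (eqVneq r' (inord r)) => [->|hr'].
    by rewrite b2 -er eqxx binval_decb v1 // size_decb.
  rewrite b1 // ifN //; apply/eqP => e'; case/eqP: hr'; apply: val_inj; rewrite /= e'; exact: er.
- move=> r z nz e hr hreg _.
  have er : r = nat_of_ord (inord r : 'I_R.+1) by rewrite inordK.
  have [v1 v2] := hbits (inord r); rewrite -er in v1.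
  pose k := index true (bits (inord r)).
  apply: (@sweep_sim k (fun=> a) f _ s _ _ _ _ _ _ bits) => //.
  + by rewrite /k; apply: leq_ltn_trans hW; apply: leq_trans v2; apply: index_size.
  + by move=> i hi; rewrite actE // e hf /= ffunE (onth_lt_index hi).
  + rewrite actE // e hf /= ffunE onth_index -v1.
    by rewrite -[_ == 0]negbK -lt0n binval_gt0; case: ifP.
  + by move=> i; rewrite if_same.
- move=> h q e hreg ho.
  rewrite /= size_rcons in ho.
  apply: (@sweep_sim (size (ot s)) (fun=> a) 
    (fun i => cellf bits (pt s) (rcons (ot s) h) i) _ s _ _ _ _ _ _ bits) => //.
  + move=> i hi; rewrite actE // e hf /=.
    have [g hg] := onth_lt hi; rewrite hg; congr (_, _); rewrite /cellf onth_rcons ifN //.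
    by apply/eqP; lia.
  + by rewrite actE // e hf /= onth_ge //= /set_out /cellf /= onth_rcons eqxx.
  + move=> i; case: leqP => // hi; rewrite hf /cellf /= onth_rcons ifN //; apply/eqP; lia.
- move=> i0 q e hpt hi0 hreg ho.
  apply: (@sweep_sim i0 (fun=> a) 
    (fun i => cellf bits None (ot s) i) _ s _ _ _ _ _ _ bits) => //; first by lia.
  + move=> i hi; rewrite actE // e hf /cellf /= hpt.
    by have -> : (Some i == Some i0) = false by apply/eqP => -[]; lia.
  + by rewrite actE // e hf /= hpt eqxx.
  + move=> i; case: leqP => // hi; rewrite hf /cellf hpt.
    by have -> : (Some i == Some i0) = false by apply/eqP => -[]; lia.
- move=> q e hpt hreg ho.
  apply: (@sweep_sim 0 (fun=> a)
    (fun i => cellf bits (Some 0) (ot s) i) _ s _ _ _ _ _ _ bits) => //; first by lia.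
  + by rewrite actE // e hf.
  by case=> // i; rewrite hf /cellf hpt.
- move=> i0 b q e eb hb' hpt hi0 hreg ho.
  case: (ltnP i0 (size x)) => hi0x.
    have [g hg] := onth_lt hi0x.
    apply: (@sweep_sim i0.+1 (fun i => if i <= i0 then a else b)
      (fun i => cellf bits (Some i0.+1) (ot s) i) _ s _ _ _ _ _ _ bits) => //; first by lia.
    + by move=> i _; case: ifP.
    + move=> i; rewrite ltnS => hi; rewrite hi actE // e hf /cellf /= hpt.
      case: (eqVneq i i0) => [->|ne]; last first.
        rewrite (_ : i < i0); last by lia.
        have -> : (Some i == Some i0) = false by apply/eqP => -[]; lia.
        by have -> : (Some i == Some i0.+1) = false by apply/eqP => -[]; lia.
      rewrite eqxx hg ltnn.
      by have -> : (Some i0 == Some i0.+1) = false by apply/eqP => -[]; lia.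
    + by rewrite ltnn actE // eb hf /cellf /= eqxx.
    + move=> i; rewrite /= hpt /= hi0x; case: leqP => // hi; rewrite hf /cellf hpt.
      have -> : (Some i == Some i0) = false by apply/eqP => -[]; lia.
      by have -> : (Some i == Some i0.+1) = false by apply/eqP => -[]; lia.
  apply: (@sweep_sim i0 (fun=> a) f _ s _ _ _ _ _ _ bits) => //; first by lia.
  + move=> i hi; rewrite actE // e hf /cellf /= hpt.
    by have -> : (Some i == Some i0) = false by apply/eqP => -[]; lia.
  + by rewrite actE // e hf /= hpt eqxx onth_ge.
  + by move=> i; rewrite if_same /= hpt /= ltnNge hi0x /= -hpt.
- move=> i0 T e hpt hi0 hreg ho.
  apply: (@sweep_sim i0 (fun=> a) f _ s _ _ _ _ _ _ bits) => //; first by lia.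
  + move=> i hi; rewrite actE // e hf /cellf /= hpt.
    by have -> : (Some i == Some i0) = false by apply/eqP => -[]; lia.
  + by rewrite actE // e hf /= hpt eqxx.
  + by move=> i; rewrite if_same.
Qed.

End RegMachine.

End RegisterMachine.
Import RegisterMachine.

(** * Structured programs *)

Module Commands.

Inductive cmd (H : Type) :=
  | CSkip | CSeq of cmd H & cmd H | CInc of nat | CLoop of nat & cmd H
  | CIf of nat & cmd H & cmd H | COut of H | CReset | CAdv | CRead of nat.
Arguments CSkip {H}.
Arguments CInc {H}.
Arguments CReset {H}.
Arguments CAdv {H}.
Arguments CRead {H}.

Section Commands.
Variables (G H : finType) (R : nat).
Notation instr := (instr G H).
Notation st := (st H).
Notation cmd := (cmd H).
Notation IHalt := (@IHalt G H).

(** Letters are numbered from 1, so that 0 can stand for the end of the input. *)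
Definition lcode (o : option G) : nat := if o is Some g then (enum_rank g).+1 else 0.

Lemma lcode_le o : lcode o <= #|G|.
Proof. by case: o => //= g; apply: ltn_ord. Qed.

Fixpoint clen (c : cmd) : nat :=
  match c with
  | CSkip => 0 | CSeq c1 c2 => clen c1 + clen c2 | CInc _ => 1
  | CLoop _ c => (clen c).+3 | CIf _ c1 c2 => (clen c1 + clen c2).+2
  | COut _ => 1 | CReset => 2 | CAdv => 2 | CRead _ => #|G|.+1 end.

(** [CRead] jumps into a chain of [#|G|] increments so that as many remain as the code of the letter
    read. A test with equal targets serves as an unconditional jump. *)
Fixpoint comp (c : cmd) (a : nat) : seq instr :=
  match c with
  | CSkip => [::]
  | CSeq c1 c2 => comp c1 a ++ comp c2 (a + clen c1)
  | CInc r => [:: IInc G H r a.+1]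
  | CLoop r c => [:: ITest G H r (a + (clen c).+3) a.+1; IDec G H r a.+2] ++ comp c a.+2 ++
                 [:: ITest G H r a a]
  | CIf r c1 c2 => [:: ITest G H r a.+1 (a + (clen c1).+2)] ++ comp c1 a.+1 ++
                   [:: ITest G H r (a + (clen c1 + clen c2).+2) (a + (clen c1 + clen c2).+2)] ++
                   comp c2 (a + (clen c1).+2)
  | COut h => [:: IOut G h a.+1]
  | CReset => [:: IClr G H a.+1; ISet G H a.+2]
  | CAdv => [:: IAdv G H a.+1 a.+2; ISet G H a.+2]
  | CRead r => [:: IRead H (fun o => a.+1 + (#|G| - lcode o))] ++
               mkseq (fun i => IInc G H r (a.+2 + i)) #|G|
  end.

Lemma size_comp c a : size (comp c a) = clen c.
Proof.
elim: c a => //= [c1 IH1 c2 IH2|r c IH|r c1 IH1 c2 IH2|r] a.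
- by rewrite size_cat IH1 IH2.
- by rewrite size_cat IH /=; lia.
- by rewrite size_cat /= IH1 IH2; lia.
by rewrite size_mkseq.
Qed.

Variable x : seq G.
Variable bd : st -> Prop.

(** Timed semantics that imposes [bd] on the states the compiled code passes through, such as the
    state without pointer inside [CReset]. The predicate is later a limit on register values and
    output length. *)
Inductive exec : cmd -> st -> st -> nat -> Prop :=
  | exec_skip s : exec CSkip s s 0
  | exec_seq c1 c2 s1 s2 s3 t1 t2 : exec c1 s1 s2 t1 -> exec c2 s2 s3 t2 ->
      exec (CSeq c1 c2) s1 s3 (t1 + t2)
  | exec_inc r s : r <= R -> bd (upd s r (rg s r).+1) -> exec (CInc r) s (upd s r (rg s r).+1) 1
  | exec_loop0 r c s : r <= R -> rg s r = 0 -> bd s -> exec (CLoop r c) s s 1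
  | exec_loopS r c s s1 s2 t1 t2 : r <= R -> 0 < rg s r -> bd s -> bd (upd s r (rg s r).-1) ->
      bd s1 -> exec c (upd s r (rg s r).-1) s1 t1 -> exec (CLoop r c) s1 s2 t2 ->
      exec (CLoop r c) s s2 (t1 + t2 + 3)
  | exec_ifz r c1 c2 s s' t : r <= R -> rg s r = 0 -> bd s -> bd s' -> exec c1 s s' t ->
      exec (CIf r c1 c2) s s' t.+2
  | exec_ifn r c1 c2 s s' t : r <= R -> 0 < rg s r -> bd s -> exec c2 s s' t ->
      exec (CIf r c1 c2) s s' t.+2
  | exec_out h s : bd (St (rg s) (pt s) (rcons (ot s) h)) ->
      exec (COut h) s (St (rg s) (pt s) (rcons (ot s) h)) 1
  | exec_reset i s : pt s = Some i -> i <= size x -> (forall p, bd (St (rg s) p (ot s))) ->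
      exec CReset s (St (rg s) (Some 0) (ot s)) 2
  | exec_adv i s : pt s = Some i -> i <= size x -> bd (St (rg s) (adv x (pt s)) (ot s)) ->
      exec CAdv s (St (rg s) (adv x (pt s)) (ot s)) 2
  | exec_read i r s : r <= R -> pt s = Some i -> i <= size x ->
      (forall j, j <= lcode (onth x i) -> bd (upd s r (rg s r + j))) ->
      exec (CRead r) s (upd s r (rg s r + lcode (onth x i))) #|G|.+1.

Section Code.
Variable code : seq instr.

Inductive isteps : nat -> st -> nat -> st -> nat -> Prop :=
  | isteps0 a s : isteps a s a s 0
  | istepsS a s a1 s1 a2 s2 t : istep R code x a s a1 s1 -> a < size code -> bd s1 ->
      isteps a1 s1 a2 s2 t -> isteps a s a2 s2 t.+1.

Lemma isteps_trans a1 s1 a2 s2 a3 s3 t1 t2 :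
  isteps a1 s1 a2 s2 t1 -> isteps a2 s2 a3 s3 t2 -> isteps a1 s1 a3 s3 (t1 + t2).
Proof. by move=> h; elim: h => // a s a' s' a4 s4 t h1 h2 h3 _ IH /IH; apply: istepsS. Qed.

Lemma isteps1 a s a1 s1 : istep R code x a s a1 s1 -> a < size code -> bd s1 -> isteps a s a1 s1 1.
Proof. by move=> h1 h2 h3; apply: istepsS h1 h2 h3 _; constructor. Qed.

Definition code_at (c : seq instr) (a : nat) :=
  a + size c <= size code /\ forall i, i < size c -> nth IHalt code (a + i) = nth IHalt c i.

Lemma code_at_cat c1 c2 a : code_at (c1 ++ c2) a -> code_at c1 a /\ code_at c2 (a + size c1).
Proof.
rewrite /code_at size_cat => -[h1 h2]; split; split; try lia.
  by move=> i hi; rewrite h2 ?nth_cat ?hi //; lia.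
move=> i hi; rewrite -addnA h2 ?nth_cat; last by lia.
by rewrite ifN ?addKn // -leqNgt; lia.
Qed.

Lemma code_at_nth c a i : code_at c a -> i < size c -> nth IHalt code (a + i) = nth IHalt c i /\ a + i < size code.
Proof. by move=> [h1 h2] hi; split; [apply: h2 | lia]. Qed.

Lemma upd_upd (s : st) r u v : upd (upd s r u) r v = upd s r v.
Proof.
by rewrite /upd; congr (St _ _ _); apply: functional_extensionality => i /=; case: eqP.
Qed.

Lemma upd_id (s : st) r : upd s r (rg s r) = s.
Proof.
case: s => f p o; rewrite /upd /=; congr (St _ _ _).
by apply: functional_extensionality => i; case: eqP => // ->.
Qed.

Lemma read_chain (s : st) r b n : r <= R ->
  (forall j, j < n -> nth IHalt code (b + j) = IInc G H r (b + j).+1 /\ b + j < size code) ->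
  (forall j, j <= n -> bd (upd s r (rg s r + j))) ->
  isteps b s (b + n) (upd s r (rg s r + n)) n.
Proof.
move=> hr hc hbd; elim: n hc hbd => [|n IH] hc hbd.
  by rewrite !addn0 upd_id; constructor.
rewrite -[X in isteps _ _ _ _ X]addn1; apply: isteps_trans.
  by apply: IH => j hj; [apply: hc | apply: hbd]; lia.
have [e h] := hc n (ltnSn n).
have -> : upd s r (rg s r + n.+1) =
  upd (upd s r (rg s r + n)) r (rg (upd s r (rg s r + n)) r).+1.
  by rewrite upd_upd /= eqxx addnS.
apply: isteps1 => //; first by rewrite addnS; apply: istep_inc.
by rewrite upd_upd /= eqxx -addnS; apply: hbd.
Qed.

Lemma comp_sim c s s' t : exec c s s' t -> forall a, code_at (comp c a) a ->
  exists2 t', t' <= t & isteps a s (a + clen c) s' t'.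
Proof.
elim=> {c s s' t}.
- by move=> s a _; exists 0 => //=; rewrite addn0; constructor.
- move=> c1 c2 s1 s2 s3 t1 t2 _ IH1 _ IH2 a /=.
  move=> /code_at_cat [/IH1 [u1 h1 k1]]; rewrite size_comp => /IH2 [u2 h2 k2].
  exists (u1 + u2); first by lia.
  by rewrite addnA; apply: isteps_trans k1 k2.
- move=> r s hr hb a /= /code_at_nth /(_ (ltn0Sn 0)) [/= e h]; rewrite addn0 in e h.
  by exists 1 => //; rewrite addn1; apply: isteps1 => //; apply: istep_inc.
- move=> r c s hr e0 hb a /= hc.
  have [/= e h] := code_at_nth hc (ltn0Sn _); rewrite addn0 in e h.
  exists 1 => //; apply: isteps1 => //.
  by have := istep_test x s e hr; rewrite e0 /=; apply.
- move=> r c s s1 s2 t1 t2 hr hpos hb hb' hb1 _ IH1 _ IH2 a hc.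
  have [u2 h2 k2] := IH2 _ hc.
  have hc' := hc; rewrite /comp -/comp in hc'.
  have [h1a /code_at_cat [h1b h1c]] := code_at_cat hc'.
  have [/= e0 l0] := code_at_nth h1a (ltn0Sn _); rewrite addn0 in e0 l0.
  have [/= e1 l1] := code_at_nth h1a (ltnSn _); rewrite addn1 in e1 l1.
  have [e2 l2] := code_at_nth h1c (ltnSn _).
  rewrite /= addn2 size_comp addn0 in h1b e2 l2.
  have [u1 h1 k1] := IH1 _ h1b.
  exists (1 + (1 + (u1 + (1 + u2)))); first by lia.
  apply: (@isteps_trans _ _ a.+1 s).
    apply: isteps1 => //; have := istep_test x s e0 hr.
    by rewrite gtn_eqF.
  apply: (@isteps_trans _ _ a.+2 (upd s r (rg s r).-1)).
    by apply: isteps1 => //; exact: (istep_dec x e1 hr hpos).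
  apply: isteps_trans k1 _.
  apply: isteps_trans k2; apply: isteps1 => //.
  by have := istep_test x s1 e2 hr; rewrite if_same.
- move=> r c1 c2 s s' t hr e0 hb hb' _ IH a hc; rewrite /comp -/comp in hc.
  have [h1 /code_at_cat [h2 /code_at_cat [h3 _]]] := code_at_cat hc.
  have [/= e l] := code_at_nth h1 (ltnSn _); rewrite addn0 in e l.
  have [e2 l2] := code_at_nth h3 (ltnSn _); rewrite /= addn1 size_comp addn0 in h2 e2 l2.
  have [u hu k] := IH _ h2.
  exists (1 + (u + 1)); first by lia.
  apply: (@isteps_trans _ _ a.+1 s).
    apply: isteps1 => //; have := istep_test x s e hr.
    by rewrite e0 eqxx.
  apply: isteps_trans k _; apply: isteps1 => //.
  by have := istep_test x s' e2 hr; rewrite if_same.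
- move=> r c1 c2 s s' t hr hpos hb _ IH a hc; rewrite /comp -/comp in hc.
  have [h1 /code_at_cat [h2 /code_at_cat [h3 h4]]] := code_at_cat hc.
  have [/= e l] := code_at_nth h1 (ltnSn _); rewrite addn0 in e l.
  rewrite /= size_comp in h4.
  have ea : a + 1 + clen c1 + 1 = a + (clen c1).+2 by lia.
  rewrite ea in h4.
  have [u hu k] := IH _ h4.
  exists (1 + u); first by lia.
  apply: (@isteps_trans _ _ (a + (clen c1).+2) s).
    apply: isteps1 => //; have := istep_test x s e hr.
    by rewrite gtn_eqF.
  by have -> : a + (clen c1 + clen c2).+2 = a + (clen c1).+2 + clen c2 by lia.
- move=> h s hb a /= /code_at_nth /(_ (ltn0Sn 0)) [/= e l]; rewrite addn0 in e l.
  by exists 1 => //; rewrite addn1; apply: isteps1 => //; apply: istep_out.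
- move=> i s hp hi hb a /= hc.
  have [/= e0 l0] := code_at_nth hc (ltn0Sn _); rewrite addn0 in e0 l0.
  have [/= e1 l1] := code_at_nth hc (ltnSn _); rewrite addn1 in e1 l1.
  exists 2 => //; rewrite addn2; apply: (@istepsS _ _ a.+1 (St (rg s) None (ot s))) => //.
    by apply: istep_clr e0 hp hi.
  by apply: isteps1 => //; exact: (istep_set R x e1).
- move=> i s hp hi hb a /= hc.
  have [/= e0 l0] := code_at_nth hc (ltn0Sn _); rewrite addn0 in e0 l0.
  have [/= e1 l1] := code_at_nth hc (ltnSn _); rewrite addn1 in e1 l1.
  by exists 1 => //; rewrite addn2; apply: isteps1 => //; exact: istep_adv e0 e1 l1 hp hi.
move=> i r s hr hp hi hb a hc; rewrite /comp -/comp in hc.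
have [h1 h2] := code_at_cat hc.
have [/= e l] := code_at_nth h1 (ltnSn _); rewrite addn0 in e l.
move: (lcode_le (onth x i)) hb; move ev: (lcode (onth x i)) => v hv hb.
exists v.+1; first by rewrite ltnS.
apply: (@istepsS _ _ (a.+1 + (#|G| - v)) s) => //.
- by rewrite -ev; exact: istep_read e hp hi.
- by have := hb 0; rewrite addn0 upd_id; apply.
(* From the jump target exactly [v] increments remain until the end of the block. *)
have -> : a + #|G|.+1 = a.+1 + (#|G| - v) + v by lia.
apply: read_chain => // j hj; rewrite [size _]/= in h2.
have hj' : #|G| - v + j < size (mkseq (fun i => IInc G H r (a.+2 + i)) #|G|).
  by rewrite size_mkseq; lia.
have [e2 l2] := code_at_nth h2 hj'; rewrite size_mkseq in hj'; rewrite nth_mkseq // in e2.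
have -> : a.+1 + (#|G| - v) + j = a + 1 + (#|G| - v + j) by lia.
by rewrite e2; split=> //; congr (IInc _ _ _ _); lia.
Qed.

End Code.
End Commands.

(** * Running a compiled command on a Turing machine *)

Section RunCommand.
Variables (G H : finType) (R : nat) (c : cmd H).

(** The last test sends a nonzero register 0 to address [size prog], which accepts, and zero to the
    next one, which rejects. *)
Definition prog : seq (instr G H) :=
  [:: IInit G H 1] ++ comp G c 1 ++ [:: ITest G H 0 (clen G c).+3 (clen G c).+2].

Definition cmdTM : TM G := regTM R prog.

Lemma size_prog : size prog = (clen G c).+2.
Proof. by rewrite /prog /= size_cat size_comp /=; lia. Qed.

Definition st0 : st H := St (fun=> 0) (Some 0) [::].

Lemma isteps_sim (x : seq G) bd W S a s a' s' t f n :
  isteps R x bd prog a s a' s' t ->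
  (forall s, bd s -> (forall r, r <= R -> rg s r < 2 ^ W) /\ size (ot s) <= S) ->
  W < S -> size x < S -> tape_inv x s f n W -> n <= S ->
  exists u f' n', [/\ u <= t * S.*2, trace (@hconf G H R prog a f n) (@hconf G H R prog a' f' n') u S,
     tape_inv x s' f' n' W & n' <= S].
Proof.
move=> h hbd hW hx; elim: h f n => {a s a' s' t} [a s|a s a1 s1 a2 s2 t hs ha hb _ IH] f n hi hn.
  exists 0, f, n; split=> //; apply: trace_refl.
  by case: hi => hn0 _ _; rewrite /hconf tspace_at.
have [b1 b2] := hbd _ hb.
have [u1 [f1 [n1 [k1 k2 k3 k4]]]] := istep_sim hs ha hi b1 hn hW hx b2.
have [u2 [f2 [n2 [j1 j2 j3 j4]]]] := IH _ _ k3 k4.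
exists (u1 + u2), f2, n2; split=> //; first by lia.
exact: trace_trans k2 j2.
Qed.

Lemma read_out_mkseq (x : seq G) (s : st H) f n W :
  tape_inv (R := R) x s f n W ->
  @read_out G cmdTM H (@cell_out G H R) (mkseq f n) = ot s.
Proof.
move=> [_ hb [bits [hf _]]].
have : forall m k, n = k + m -> 
  @read_out G cmdTM H (@cell_out G H R) (mkseq (fun i => f (k + i)) m) = drop k (ot s).
  elim=> [|m IH] k e.
    rewrite /= drop_oversize //; rewrite leqNgt; apply/negP => /onth_lt [g hg].
    have hk : n <= k by lia.
    by have := congr1 (@cell_out G H R) (hb k hk); rewrite hf /cell_out /cellf /= hg.
  rewrite mkseq_S addn0 /=.
  have -> : cell_out (f k) = onth (ot s) k by rewrite hf.
  have := IH k.+1; rewrite (_ : k.+1 + m = n); last by lia.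
  move=> /(_ erefl) e1.
  have -> : mkseq ((fun i => f (k + i)) \o S) m = mkseq (fun i => f (k.+1 + i)) m.
    by apply: eq_mkseq => i /=; rewrite addnS.
  rewrite e1; case E: (onth (ot s) k) => [h|].
    have hk : k < size (ot s).
      by rewrite ltnNge; apply/negP => /onth_ge; rewrite E.
    rewrite [in RHS](drop_nth h) //; congr (_ :: _).
    by have := onthE (ot s) k; rewrite E (nth_map h) // => -[].
  by rewrite drop_oversize // leqNgt; apply/negP => /onth_lt [g hg]; rewrite E in hg.
by move=> /(_ n 0 erefl); rewrite drop0.
Qed.

(** One statement for deciders and transducers: the former read the verdict off register 0, the
    latter read the output track. *)
Theorem cmdTM_run (x : seq G) bd s' t W S :
  exec (G := G) R x bd c st0 s' t ->
  (forall s, bd s -> (forall r, r <= R -> rg s r < 2 ^ W) /\ size (ot s) <= S) ->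
  bd st0 -> bd s' -> W < S -> size x < S ->
  exists u, [/\ u <= (t + 2) * S.*2, halted (trun cmdTM x u),
    (trun cmdTM x u).1 = tm_acc cmdTM <-> rg s' 0 <> 0,
    @read_out G cmdTM H (@cell_out G H R) (tape_contents (trun cmdTM x u)) = ot s' &
    forall i, i <= u -> tspace (trun cmdTM x i) <= S].
Proof.
move=> hex hbd hb0 hb' hW hx.
pose f0 i : bool * option G * bool * option H * {ffun 'I_R.+1 -> option bool} :=
  (false, onth x i, false, None, [ffun=> None]).
pose n0 := maxn 1 (size x).
have ei : tinit cmdTM x = @hconf G H R prog 0 f0 n0.
  rewrite /tinit /hconf /tconf_at /n0; case: x @f0 {hex hx n0} => [|y x'] f0 //.
  congr (_, (_, _, _)); have -> : maxn 1 (size (y :: x')) - 1 = size x' by rewrite /=; lia.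
  rewrite /f0 /= -[LHS]/(map (@cell_inp G H R) x').
  have e g (z : seq G) : mkseq (fun i => g (onth z i)) (size z) = map (g \o Some) z
    :> seq (bool * option G * bool * option H * {ffun 'I_R.+1 -> option bool}).
    by elim: z => //= y' z IH; rewrite mkseq_S; congr (_ :: _).
  by have := e (fun o => (false, o, false, None, [ffun=> None])) x' => /= ->.
have hinit : exists u f' n', [/\ u <= S.*2,
   trace (@hconf G H R prog 0 f0 n0) (@hconf G H R prog 1 f' n') u S,
   tape_inv x st0 f' n' W & n' <= S].
  pose bits := fun _ : 'I_R.+1 => [::] : seq bool.
  have e0 : nth (@IHalt G H) prog 0 = IInit G H 1 by [].
  have a0 : pcs prog 0 = 0 :> nat by rewrite inordK.
  have hb i : n0 <= i -> f0 i = cell_blank G H R.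
    by rewrite /f0 /n0 => hi; rewrite onth_ge //; lia.
  have [||i hi|i||i|t' ht tr] := @sweep_run G _ _ (cell_blank G H R) (@cell_inp G H R)
     (@cell_mark G H R) (@reg_act G H R prog) (pcs prog 0) (pcs prog (size prog))
     (pcs prog (size prog).+1) 0 (fun=> pcs prog 0) (fun i => cellf x bits (Some 0) [::] i)
     f0 n0 (pcs prog 1).
  - by rewrite /n0; lia.
  - exact: hb.
  - by apply: nonhalting_pcs; rewrite size_prog.
  - by [].
  - by rewrite /reg_act a0 e0 /f0 /cellf /=; congr (_, _, _).
  - by rewrite leqn0 => /eqP ->.
  exists t', (fun i => if i <= 0 then cellf x bits (Some 0) [::] i else f0 i), (maxn n0 1).
  split; try by rewrite /n0; lia.
    by apply: trace_leS tr; rewrite /n0; lia.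
  split; first by lia.
    by move=> i hi; rewrite ifN; [apply: hb; lia | lia].
  by exists bits; split=> // -[|i] //=; rewrite /f0 /cellf /=; congr (_, _).
have [u1 [f1 [n1 [h1 h2 h3 h4]]]] := hinit.
have hc : code_at prog (comp G c 1) 1.
  split; first by rewrite size_comp size_prog; lia.
  by move=> i hi; rewrite /prog /= nth_cat hi.
have [t' ht' his] := comp_sim hex hc.
have [u2 [f2 [n2 [k1 k2 k3 k4]]]] := isteps_sim his hbd hW hx h3 h4.
have el : nth (@IHalt G H) prog (1 + clen G c) = ITest G H 0 (clen G c).+3 (clen G c).+2.
  by rewrite /prog /= nth_cat size_comp ltnn subnn.
have [b1 b2] := hbd _ hb'.
have hl : 1 + clen G c < size prog by rewrite size_prog.
have [u3 [f3 [n3 [l1 l2 l3 l4]]]] := istep_sim (istep_test x s' el (leq0n R)) hl k3 b1 k4 hW hx b2.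
have [etr sp] := trace_trans h2 (trace_trans k2 l2).
exists (u1 + (u2 + u3)).
have et : trun cmdTM x (u1 + (u2 + u3)) =
   @hconf G H R prog (if rg s' 0 == 0 then (clen G c).+3 else (clen G c).+2) f3 n3.
  by rewrite /trun ei; exact: etr.
have eacc : tm_acc cmdTM = (pcs prog (clen G c).+2, false) by rewrite -size_prog.
have erej : tm_rej cmdTM = (pcs prog (clen G c).+3, false) by rewrite -size_prog.
split.
- have := ht'; have := leq_mul2r S.*2 t' t; nia.
- by rewrite et /hconf /halted eacc erej; case: ifP => _; rewrite eqxx ?orbT.
- rewrite et eacc /hconf [LHS]/=; case: eqP => [->|hne]; split=> //.
  have ev b : b <= (clen G c).+3 -> nat_of_ord (pcs prog b) = b.
    by move=> hb; rewrite inordK // size_prog.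
  by move/(congr1 fst)/(congr1 (@nat_of_ord _)); rewrite /= !ev //; lia.
- have -> : tape_contents (trun cmdTM x (u1 + (u2 + u3))) = mkseq f3 n3.
    rewrite et /hconf /tconf_at /tape_contents.
    by case: l3 => hn _ _; rewrite -[in RHS](prednK hn) mkseq_S subn1.
  exact: read_out_mkseq l3.
by move=> i hi; rewrite /trun ei; apply: sp.
Qed.

End RunCommand.

End Commands.
Import Commands.

(** * Primitive recursive terms *)

Module Terms.

(** Variables are positions in the environment, and [TShift] drops the innermost one. The input is
    queried through an oracle, which keeps evaluation independent of machines. [TRec] binds the
    accumulator and the loop index in its body. *)
Inductive term :=
  | TVar | TShift of term | TZero | TSucc of term | TInp of term
  | TRec of term & term & term | TLet of term & term.

Section Eval.
Variable o : nat -> nat.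

Fixpoint teval (e : seq nat) (t : term) : nat :=
  match t with
  | TVar => head 0 e
  | TShift t => teval (behead e) t
  | TZero => 0
  | TSucc t => (teval e t).+1
  | TInp t => o (teval e t)
  | TRec c i b => iteri (teval e c) (fun j acc => teval (acc :: j :: e) b) (teval e i)
  | TLet t b => teval (teval e t :: e) b
  end.

Definition trec e i b n := iteri n (fun j acc => teval (acc :: j :: e) b) (teval e i).

(** The largest value a register has to hold during evaluation. With binary registers its logarithm
    governs the space. *)
Fixpoint tcost (e : seq nat) (t : term) : nat :=
  match t with
  | TVar => head 0 e
  | TShift t => tcost (behead e) t
  | TZero => 0
  | TSucc t => (tcost e t).+1
  | TInp t => maxn (tcost e t) (o (teval e t))
  | TRec c i b => maxn (tcost e c) (maxn (tcost e i)
      (\max_(j < teval e c) tcost [:: trec e i b j, (j : nat) & e] b))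
  | TLet t b => maxn (tcost e t) (tcost (teval e t :: e) b)
  end.

Lemma teval_cost e t : teval e t <= tcost e t.
Proof.
elim: t e => //= [t IH|c IHc i IHi b IHb|t IHt b IHb] e; try by rewrite leq_max ?leqnn ?orbT.
  case E: (teval e c) => [|n]; first by rewrite !leq_max IHi orbT.
  rewrite iteriS !leq_max; apply/orP; right; apply/orP; right.
  by apply: leq_trans (IHb _) _; apply: (leq_bigmax (@ord_max n)).
by rewrite leq_max IHb orbT.
Qed.
End Eval.

Section Compile.
Variables (G H : finType).
Notation cmd := (cmd H).

Definition cclear (r : nat) : cmd := CLoop r CSkip.
Definition cmove (a d : nat) : cmd := CLoop a (CInc d).
Definition ccopy (a d tmp : nat) : cmd :=
  CSeq (cclear d) (CSeq (cclear tmp)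
    (CSeq (CLoop a (CSeq (CInc d) (CInc tmp))) (cmove tmp a))).

(** [rho] lists the registers of the variables, [d] is the destination, and registers from [k] on
    are scratch. For [TRec], [k] counts down, [k.+1] holds the accumulator, [k.+2] the index, and
    [k.+3] the new value before it replaces the old one. *)
Fixpoint tcomp (t : term) (rho : seq nat) (d k : nat) : cmd :=
  match t with
  | TVar => if rho is r :: _ then ccopy r d k else cclear d
  | TShift t => tcomp t (behead rho) d k
  | TZero => cclear d
  | TSucc t => CSeq (tcomp t rho d k) (CInc d)
  | TInp t => CSeq (tcomp t rho k k.+1) (CSeq (cclear d) (CSeq CReset
                (CSeq (CLoop k CAdv) (CRead d))))
  | TRec c i b =>
      CSeq (tcomp c rho k (k + 4)) (CSeq (tcomp i rho k.+1 (k + 4)) (CSeq (cclear k.+2)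
      (CSeq (CLoop k (CSeq (tcomp b [:: k.+1, k.+2 & rho] k.+3 (k + 4))
                     (CSeq (cclear k.+1) (CSeq (cmove k.+3 k.+1) (CInc k.+2)))))
      (CSeq (cclear d) (cmove k.+1 d)))))
  | TLet t b => CSeq (tcomp t rho k k.+1) (tcomp b (k :: rho) d k.+1)
  end.

Fixpoint treg (t : term) (k : nat) : nat :=
  match t with
  | TVar | TZero => k
  | TShift t => treg t k
  | TSucc t => treg t k
  | TInp t => treg t k.+1
  | TRec c i b => maxn (treg c (k + 4)) (maxn (treg i (k + 4)) (treg b (k + 4)))
  | TLet t b => maxn (treg t k.+1) (treg b k.+1)
  end.

Lemma treg_ge t k : k <= treg t k.
Proof.
elim: t k => //= [t IH|c IHc i IHi b IHb|t IHt b IHb] k.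
- by have := IH k.+1; lia.
- by have := IHc (k + 4); lia.
by have := IHt k.+1; lia.
Qed.

Fixpoint ttime (t : term) (M : nat) : nat :=
  match t with
  | TVar | TZero => 20 * M.+1
  | TShift t => ttime t M
  | TSucc t => (ttime t M).+1
  | TInp t => ttime t M + 20 * M.+1 + #|G|
  | TRec c i b => ttime c M + ttime i M + M * (ttime b M + 10 * M.+1) + 20 * M.+1
  | TLet t b => ttime t M + ttime b M
  end.

Variables (R : nat) (x : seq G) (M Z : nat).

Definition orc (i : nat) : nat := lcode (onth x i).

Definition bd (s : st H) : Prop := (forall r, rg s r <= M) /\ size (ot s) <= Z.

Notation exec := (exec (G := G) R x bd).

Lemma bd_upd s r v : bd s -> v <= M -> bd (upd s r v).
Proof. by move=> [h1 h2] hv; split=> //= i; case: eqP. Qed.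

Definition pt_ok (s : st H) : Prop := exists2 i, i <= size x & pt s = Some i.

(** The body runs after the decrement: it starts from [upd s r j] when the invariant held at [j.+1]
    before the test. *)
Lemma exec_loop (P : nat -> st H -> Prop) r c T n s : r <= R ->
  (forall j s, P j s -> bd s /\ rg s r = j) ->
  (forall j s, j < n -> P j.+1 s ->
     exists s1 t, [/\ exec c (upd s r j) s1 t, t <= T & P j s1]) ->
  P n s -> exists s' t, [/\ exec (CLoop r c) s s' t, t <= n * (T + 3) + 1 & P 0 s'].
Proof.
move=> hr hP; elim: n s => [|n IH] s hs hn.
  by have [h1 h2] := hP _ _ hn; exists s, 1; split=> //; apply: exec_loop0.
have [hb e] := hP _ _ hn.
have [s1 [t1 [k1 k2 k3]]] := hs n s (ltnSn n) hn.
have [s2 [t2 [l1 l2 l3]]] := IH s1 (fun j s' hj => hs j s' (ltnW hj)) k3.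
have [hb1 _] := hP _ _ k3.
exists s2, (t1 + t2 + 3); split=> //; last by rewrite mulSn; lia.
have en : (rg s r).-1 = n by rewrite e.
apply: (exec_loopS hr _ hb _ hb1 _ l1); first by rewrite e.
  by apply: bd_upd => //; have := hb.1 r; lia.
by rewrite en.
Qed.

Definition frame (A : nat -> bool) (s s' : st H) :=
  [/\ forall r, A r -> rg s' r = rg s r, pt s' = pt s & ot s' = ot s].

Lemma exec_clear r s : r <= R -> bd s ->
  exists s' t, [/\ exec (cclear r) s s' t, t <= 3 * M + 1, bd s', rg s' r = 0 &
    frame (fun i => i != r) s s'].
Proof.
move=> hr hb.
pose P j s' := [/\ bd s', rg s' r = j & frame (fun i => i != r) s s'].
have [|j s1 hj||s' [t [h1 h2 [h3 h4 h5]]]] := @exec_loop P r CSkip 0 (rg s r) s hr.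
- by move=> j s' [].
- move=> [hb1 e [f1 f2 f3]]; exists (upd s1 r j), 0; split=> //; first by constructor.
  split; first by apply: bd_upd => //; have := hb1.1 r; lia.
    by rewrite /= eqxx.
  by split=> //= i hi; rewrite (negPf hi) f1.
- by split.
exists s', t; split=> //; have := hb.1 r; nia.
Qed.

Lemma exec_move a d s : a <= R -> d <= R -> a != d -> bd s -> rg s d + rg s a <= M ->
  exists s' t, [/\ exec (cmove a d) s s' t, t <= 4 * M + 1, bd s', 
    rg s' a = 0 /\ rg s' d = rg s d + rg s a &
    frame (fun i => (i != a) && (i != d)) s s'].
Proof.
move=> ha hd had hb hM.
pose P j s' := [/\ bd s', rg s' a = j, rg s' d + j = rg s d + rg s a &
   frame (fun i => (i != a) && (i != d)) s s'].
have [|j s1 hj||s' [t [h1 h2 [h3 h4 h5 h6]]]] := @exec_loop P a (CInc d) 1 (rg s a) s ha.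
- by move=> j s' [].
- move=> [hb1 e ed [f1 f2 f3]].
  have hb2 : bd (upd s1 a j) by apply: bd_upd => //; have := hb1.1 a; lia.
  have ed' : rg (upd s1 a j) d = rg s1 d by rewrite /= eq_sym (negPf had).
  exists (upd (upd s1 a j) d (rg (upd s1 a j) d).+1), 1; split=> //.
    by apply: exec_inc => //; apply: bd_upd => //; rewrite ed'; lia.
  split.
  + by apply: bd_upd => //; rewrite ed'; lia.
  + by rewrite /= (negPf had) eqxx.
  + by rewrite ed' /= eqxx; lia.
  + by split=> //= i /andP[/negPf hi1 /negPf hi2]; rewrite hi1 hi2 f1 // hi1 hi2.
- by split=> //; lia.
exists s', t; split=> //; last by lia.
by have := hb.1 a; nia.
Qed.

Lemma exec_copy a d tmp s : a <= R -> d <= R -> tmp <= R -> a != d -> a != tmp -> d != tmp ->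
  bd s -> exists s' t, [/\ exec (ccopy a d tmp) s s' t, t <= 20 * M.+1, bd s',
    rg s' d = rg s a & frame (fun i => (i != d) && (i != tmp)) s s'].
Proof.
move=> ha hd ht n1 n2 n3 hb.
have [s1 [t1 [e1 l1 b1 z1 [f1 g1 k1]]]] := exec_clear hd hb.
have [s2 [t2 [e2 l2 b2 z2 [f2 g2 k2]]]] := exec_clear ht b1.
pose P j s' := [/\ bd s', rg s' a = j, rg s' d + j = rg s a, rg s' tmp = rg s' d &
   frame (fun i => [&& i != a, i != d & i != tmp]) s s'].
have [|j s3 hj||s3 [t3 [e3 l3 [b3 z3 w3 v3 [f3 g3 k3]]]]] :=
  @exec_loop P a (CSeq (CInc d) (CInc tmp)) 2 (rg s a) s2 ha.
- by move=> j s' [].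
- move=> [hb1 e ed et [f3 f4 f5]].
  have hM := hb.1 a.
  have hb2 : bd (upd s3 a j) by apply: bd_upd => //; lia.
  set s4 := upd s3 a j in hb2 *.
  have d4 : rg s4 d = rg s3 d by rewrite /= eq_sym (negPf n1).
  set s5 := upd s4 d (rg s4 d).+1.
  have hb5 : bd s5 by apply: bd_upd => //; lia.
  have t5 : rg s5 tmp = rg s3 d.
    by rewrite /s5 /= eq_sym (negPf n3) eq_sym (negPf n2) et.
  set s6 := upd s5 tmp (rg s5 tmp).+1.
  have hb6 : bd s6 by apply: bd_upd => //; lia.
  have d6 : rg s6 d = (rg s3 d).+1 by rewrite -d4 /s6 /s5 /= (negPf n3) eqxx.
  exists s6, 2; split=> //; first by apply: (exec_seq (t1 := 1) (t2 := 1)); apply: exec_inc.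
  split=> //.
  + by rewrite /s6 /s5 /s4 /= (negPf n1) (negPf n2) eqxx.
  + by rewrite d6; lia.
  + by rewrite d6 -t5 /s6 /= eqxx.
  + by split=> //= i /and3P[/negPf i1 /negPf i2 /negPf i3]; rewrite i1 i2 i3 f3 // i1 i2 i3.
- split=> //.
  + by rewrite f2 // f1.
  + by rewrite f2 // z1.
  + by rewrite z2 f2 // z1.
  + by split; [move=> i /and3P[i1 i2 i3]; rewrite f2 // f1 | rewrite g2 | rewrite k2].
have hM3 : rg s3 a + rg s3 tmp <= M by rewrite z3; have := hb.1 a; lia.
have n4 : tmp != a by rewrite eq_sym.
have [s4 [t4 [e4 l4 b4 [z4 w4] [f4 g4 k4]]]] := exec_move ht ha n4 b3 hM3.
exists s4, (t1 + (t2 + (t3 + t4))); split=> //.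
- by do 3 (apply: exec_seq; first by eassumption).
- by have := hb.1 a; nia.
- by rewrite f4; [lia | rewrite n3 eq_sym n1].
split.
- move=> i /andP[i1 i2]; case: (eqVneq i a) => [->|i3]; first by rewrite w4; lia.
  by rewrite f4 ?i2 ?i3 // f3 // i1 i2 i3.
- by rewrite g4 g3.
- by rewrite k4 k3.
Qed.

Definition tres (t : term) rho d k (s s' : st H) (tm : nat) :=
  [/\ exec (tcomp t rho d k) s s' tm, tm <= ttime t M, bd s' /\ pt_ok s',
     rg s' d = teval orc (map (rg s) rho) t &
     (forall r, r < k -> r != d -> rg s' r = rg s r) /\ ot s' = ot s].

Lemma frame_pt A s s' : frame A s s' -> pt_ok s -> pt_ok s'.
Proof. by move=> [_ e _] [i h1 h2]; exists i; rewrite ?e. Qed.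

Lemma map_rg_same (s s' : st H) (rho : seq nat) (A : pred nat) :
  all A rho -> (forall r, A r -> rg s' r = rg s r) -> map (rg s') rho = map (rg s) rho.
Proof. by move=> /allP h1 h2; apply/eq_in_map => r /h1 /h2. Qed.

(** Advancing the saturating pointer [v] times ends at [minn v (size x)]; this says that the letter
    read there is the right one. *)
Lemma onth_minn v : onth x (minn v (size x)) = onth x v.
Proof. by case: (leqP v (size x)) => h //; rewrite !onth_ge //; lia. Qed.

(** Scratch registers are not assumed to be clear, since loops reuse them; each is emptied or
    overwritten before use. In return only the registers below [k] other than [d] are promised to
    survive. *)
Lemma tcomp_ok t rho d k s :
  all (fun r => (r < k) && (r != d)) rho -> d < k -> treg t k <= R -> bd s -> pt_ok s ->
  tcost orc (map (rg s) rho) t <= M -> exists s' tm, tres t rho d k s s' tm.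
Proof.
rewrite /tres.
elim: t rho d k s => [|t IH||t IH|t IH|c IHc i IHi b IHb|t IHt b IHb] rho d k s hrho hd hR hb hp hM /=.
- rewrite /= in hR.
  case: rho hrho hM => [|r rho] /= hrho hM.
    have [|s' [t [e1 l1 b1 z1 f1]]] := exec_clear (r := d) _ hb; first by lia.
    exists s', t; split=> //; [by lia | by split=> //; apply: frame_pt hp; exact: f1 |].
    by case: f1 => f1 f2 f3; split=> // r hr; apply: f1.
  case/andP: hrho => /andP[hr1 hr2] _.
  have [|||||s' [t [e1 l1 b1 z1 f1]]] := @exec_copy r d k s _ _ _ hr2 _ _ hb; try (by lia);
    try (by apply/eqP; lia).
  exists s', t; split=> //; first by split=> //; apply: frame_pt hp; exact: f1.
  by case: f1 => f1 f2 f3; split=> // r' h1 h2; apply: f1; rewrite h2 /=; lia.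
- have hrho' : all (fun r => (r < k) && (r != d)) (behead rho).
    by apply/allP => r /mem_behead; move/allP: hrho; apply.
  have [] := IH (behead rho) d k s hrho' hd hR hb hp; first by rewrite -behead_map.
  by move=> s' [tm [h1 h2 h3 h4 h5]]; exists s', tm; rewrite behead_map.
- rewrite /= in hR.
  have [|s' [t [e1 l1 b1 z1 f1]]] := exec_clear (r := d) _ hb; first by lia.
  exists s', t; split=> //; [by lia | by split=> //; apply: frame_pt hp; exact: f1 |].
  by case: f1 => f1 f2 f3; split=> // r hr; apply: f1.
- rewrite /= in hM hR.
  have [s' [tm [h1 h2 [h3 h3'] h4 [h5 h6]]]] := IH rho d k s hrho hd hR hb hp (ltnW hM).
  have hb' : bd (upd s' d (rg s' d).+1).
    by apply: bd_upd => //; rewrite h4; apply: leq_ltn_trans hM; apply: teval_cost.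
  exists (upd s' d (rg s' d).+1), (tm + 1); split=> //; last first.
  + by split=> //= r hr hrd; rewrite (negPf hrd) h5.
  + by rewrite /= eqxx h4.
  + by lia.
  apply: exec_seq h1 _; apply: exec_inc => //.
  by have := treg_ge t k; lia.
- rewrite /= geq_max in hM; case/andP: hM => hM1 hM2; rewrite /= in hR.
  have hk := treg_ge t k.+1.
  have hrho1 : all (fun r => (r < k.+1) && (r != k)) rho.
    by apply: sub_all hrho => r /andP[h1 _]; apply/andP; split; [lia | apply/eqP; lia].
  have [s1 [t1 [h1 h2 [h3 h3'] h4 [h5 h6]]]] := IH rho k k.+1 s hrho1 (ltnSn k) hR hb hp hM1.
  set v := teval orc _ t in hM2 h4 *.
  have [|s2 [t2 [e2 l2 b2 z2 [f2 g2 k2]]]] := exec_clear (r := d) _ h3; first by lia.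
  have [p2 hp2 ep2] : pt_ok s2 by apply: frame_pt h3'; split; [exact: f2 | |].
  pose s3 := St (rg s2) (Some 0) (ot s2).
  have b3 : bd s3 by [].
  pose P j s' := [/\ bd s', rg s' k = j, pt s' = Some (minn (v - j) (size x)) &
    (forall r, r != k -> rg s' r = rg s2 r) /\ ot s' = ot s2].
  have kd : k != d by apply/eqP; lia.
  have [||||s4 [t4 [e4 l4 [b4 z4 w4 [v4 u4]]]]] := @exec_loop P k CAdv 2 v s3.
  + by lia.
  + by move=> j s' [].
  + move=> j s4 hj [b4 z4 w4 [v4 u4]].
    have b5 : bd (upd s4 k j) by apply: bd_upd => //; have := b4.1 k; lia.
    exists (St (rg (upd s4 k j)) (adv x (pt (upd s4 k j))) (ot (upd s4 k j))), 2; split=> //.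
      apply: (@exec_adv _ _ _ _ _ (minn (v - j.+1) (size x))) => //; by lia.
    split=> //; first by rewrite /= eqxx.
      by rewrite /= w4 /=; congr Some; case: ltnP => h; lia.
    by split=> //= r hr; rewrite (negPf hr) v4.
  + split=> //; first by rewrite /s3 /= f2.
    by rewrite /= subnn min0n.
  rewrite subn0 in w4.
  have z4d : rg s4 d = 0 by rewrite v4 1?eq_sym.
  have hlc : lcode (onth x (minn v (size x))) <= M by rewrite onth_minn.
  exists (upd s4 d (rg s4 d + lcode (onth x (minn v (size x))))), (t1 + (t2 + (2 + (t4 + #|G|.+1)))).
  split=> //.
  + apply: exec_seq h1 _; apply: exec_seq e2 _; apply: (exec_seq (s2 := s3)).
      by apply: (exec_reset _ ep2 hp2) => p; exact: b2.
    apply: exec_seq e4 _; apply: exec_read => //; first by lia.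
      by lia.
    by move=> j hj; apply: bd_upd => //; lia.
  + have hv : v <= M by apply: leq_trans hM1; apply: teval_cost.
    have l4' : t4 <= 5 * M + 1 by nia.
    move: h2 l2 l4'; move: (ttime t M) => T0; move: #|G| => g.
    by clear; lia.
  + split; first by apply: bd_upd => //; lia.
    by exists (minn v (size x)) => //; lia.
  + by rewrite /= eqxx z4d add0n onth_minn.
  split; last by rewrite /= u4 k2 h6.
  move=> r hr hrd; rewrite /= (negPf hrd) v4; last by apply/eqP; lia.
  by rewrite f2 // h5; [| lia | apply/eqP; lia].
- rewrite /= !geq_max in hM; case/and3P: hM => hMc hMi hMb; rewrite /= !geq_max in hR.
  case/and3P: hR => hRc hRi hRb.
  have hk := treg_ge c (k + 4).
  have hrho' r1 : k <= r1 -> all (fun r => (r < k + 4) && (r != r1)) rho.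
    by move=> hr1; apply: sub_all hrho => r /andP[h1 _]; apply/andP; split; [lia | apply/eqP; lia].
  have [|s1 [t1 [h1 h2 [h3 h3'] h4 [h5 h6]]]] := IHc rho k (k + 4) s (hrho' k (leqnn k)) _ hRc hb hp hMc.
    by lia.
  have em1 : map (rg s1) rho = map (rg s) rho.
    by apply: (map_rg_same hrho) => r /andP[r1 r2]; apply: h5; [lia | apply/eqP; lia].
  have [||s2 [t2 [i1 i2 [i3 i3'] i4 [i5 i6]]]] := IHi rho k.+1 (k + 4) s1 (hrho' _ (leqnSn k)) _ hRi h3 h3'.
  + by lia.
  + by rewrite em1.
  rewrite em1 in i4.
  have [|s3 [t3 [e3 l3 b3 z3 fr3]]] := exec_clear (r := k.+2) _ i3; first by lia.
  have [f3 g3 k3] := fr3.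
  set e := map (rg s) rho in h4 i4 em1 hMc hMi hMb *.
  set n := teval orc e c in h4 hMb *.
  have hn : n <= M by apply: leq_trans hMc; apply: teval_cost.
  pose P j s' := [/\ bd s' /\ pt_ok s', rg s' k = j, j <= n, 
     rg s' k.+1 = trec orc e i b (n - j) /\ rg s' k.+2 = n - j &
     (forall r, r < k -> rg s' r = rg s r) /\ ot s' = ot s].
  have ne a a' : a <> a' -> a != a' by move/eqP.
  pose body := CSeq (tcomp b [:: k.+1, k.+2 & rho] k.+3 (k + 4))
                     (CSeq (cclear k.+1) (CSeq (cmove k.+3 k.+1) (CInc k.+2))).
  have [|j s' hP|j s4 hj hP||s4 [t4 [e4 l4 [[b4 p4] z4 _ [w4 _] [v4 u4]]]]] := 
     @exec_loop P k body (ttime b M + 7 * M + 3) n s3.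
  + by lia.
  + by case: hP => -[].
  + case: hP => -[b4 p4] z4 hjn [w4 w4'] [v4 u4].
    have b5 : bd (upd s4 k j) by apply: bd_upd => //; lia.
    set s5 := upd s4 k j in b5 *.
    have em5 : map (rg s5) rho = e.
      apply: (map_rg_same hrho) => r /andP[r1 r2]; rewrite /s5 /= ifN ?v4 //; apply: ne; lia.
    have v51 : rg s5 k.+1 = trec orc e i b (n - j.+1) by rewrite /s5 /= ifN // ; apply: ne; lia.
    have v52 : rg s5 k.+2 = n - j.+1 by rewrite /s5 /= ifN // ; apply: ne; lia.
    have emb : map (rg s5) [:: k.+1, k.+2 & rho] = [:: trec orc e i b (n - j.+1), n - j.+1 & e].
      by rewrite -v51 -v52 -em5.
    have hm : n - j.+1 < n by lia.
    have hrb : all (fun r => (r < k + 4) && (r != k.+3)) [:: k.+1, k.+2 & rho].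
      rewrite /= hrho' ?andbT; last by lia.
      by apply/andP; split; apply/andP; split; rewrite ?ne //; lia.
    have [|||s6 [t6 [j1 j2 [j3 j3'] j4 [j5 j6]]]] := IHb _ k.+3 (k + 4) s5 hrb _ hRb b5.
    * by lia.
    * by case: p4 => p hp1 hp2; exists p.
    * rewrite emb; apply: leq_trans hMb.
      exact: (leq_bigmax (F := fun j : 'I_n => tcost orc [:: trec orc e i b j, (j : nat) & e] b) (Ordinal hm)).
    rewrite emb in j4.
    have [|s7 [t7 [e7 l7 b7 z7 fr7]]] := exec_clear (r := k.+1) _ j3; first by lia.
    have [f7 g7 k7] := fr7.
    have v7 : rg s7 k.+3 = rg s6 k.+3 by apply: f7; apply: ne; lia.
    have [||||s8 [t8 [e8 l8 b8 [z8 w8] fr8]]] := @exec_move k.+3 k.+1 s7 _ _ _ b7.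
    * by lia.
    * by lia.
    * by apply: ne; lia.
    * by rewrite z7 add0n b7.1.
    have [f8 g8 k8] := fr8.
    have v82 : rg s8 k.+2 = n - j.+1.
      rewrite f8 ?f7 ?j5 //; try (by apply: ne; lia); lia.
    have b9 : bd (upd s8 k.+2 (rg s8 k.+2).+1) by apply: bd_upd => //; lia.
    exists (upd s8 k.+2 (rg s8 k.+2).+1), (t6 + (t7 + (t8 + 1))); split; last first.
    * have rk r : r <= k -> rg (upd s8 k.+2 (rg s8 k.+2).+1) r = rg s5 r.
        move=> hr; rewrite /= ifN; last by apply: ne; lia.
        rewrite f8 ?f7 ?j5 //; try (by apply: ne; lia); lia.
      split.
      - by split=> //; apply: (frame_pt fr8); apply: (frame_pt fr7).
      - by rewrite rk // /s5 /= eqxx.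
      - by lia.
      - split; last by rewrite /= eqxx v82; lia.
        rewrite /= ifN; last by apply: ne; lia.
        rewrite w8 z7 add0n v7 j4; have -> : n - j = (n - j.+1).+1 by lia.
        by rewrite /trec iteriS.
      - split; last by rewrite /= k8 k7 j6.
        move=> r hr; rewrite rk; last by lia.
        by rewrite /s5 /= ifN ?v4 //; apply: ne; lia.
    * by lia.
    apply: exec_seq j1 _; apply: exec_seq e7 _; apply: exec_seq e8 _; apply: exec_inc => //; lia.
  + split=> //.
    * by split=> //; apply: frame_pt fr3 i3'.
    * by rewrite f3 ?i5 //; try (by apply: ne; lia); lia.
    * by rewrite subnn f3 ?i4 //; apply: ne; lia.
    * split; last by rewrite k3 i6.
      by move=> r hr; rewrite f3 ?i5 ?h5 //; try (by apply: ne; lia); lia.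
  rewrite subn0 in w4.
  have [|s5 [t5 [e5 l5 b5 z5 fr5]]] := exec_clear (r := d) _ b4; first by lia.
  have [f5 g5 k5] := fr5.
  have v5 : rg s5 k.+1 = rg s4 k.+1 by apply: f5; apply: ne; lia.
  have [||||s6 [t6 [e6 l6 b6 [z6 w6] fr6]]] := @exec_move k.+1 d s5 _ _ _ b5.
  + by lia.
  + by lia.
  + by apply: ne; lia.
  + by rewrite z5 add0n b5.1.
  have [f6 g6 k6] := fr6.
  exists s6, (t1 + (t2 + (t3 + (t4 + (t5 + t6))))); split.
  + by do 5 (apply: exec_seq; first by eassumption).
  + by nia.
  + by split=> //; apply: (frame_pt fr6); apply: (frame_pt fr5).
  + by rewrite w6 z5 add0n v5 w4.
  split; last by rewrite k6 k5 u4.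
  move=> r hr hrd; rewrite f6 ?f5 ?v4 // hrd andbT; apply: ne; lia.
rewrite /= geq_max in hM; case/andP: hM => hM1 hM2.
rewrite /= geq_max in hR; case/andP: hR => hR1 hR2.
have hrho1 : all (fun r => (r < k.+1) && (r != k)) rho.
  by apply: sub_all hrho => r /andP[h1 _]; apply/andP; split; [lia | apply/eqP; lia].
have [s1 [t1 [h1 h2 [h3 h3'] h4 [h5 h6]]]] := IHt rho k k.+1 s hrho1 (ltnSn k) hR1 hb hp hM1.
have em1 : map (rg s1) rho = map (rg s) rho.
  by apply: (map_rg_same hrho1) => r /andP[r1 r2]; apply: h5.
have [|||s2 [t2 [i1 i2 [i3 i3'] i4 [i5 i6]]]] := IHb (k :: rho) d k.+1 s1 _ _ hR2 h3 h3'.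
- rewrite /= ltnSn; apply/andP; split; first by apply/eqP; lia.
  by apply: sub_all hrho => r /andP[r1 ->]; rewrite andbT; lia.
- by lia.
- by rewrite /= h4 em1.
exists s2, (t1 + t2); split=> //; first by apply: exec_seq h1 i1.
- by lia.
- by rewrite i4 /= h4 em1.
split; last by rewrite i6 h6.
by move=> r r1 r2; rewrite i5 // ?h5 //; try lia; apply/eqP; lia.
Qed.

End Compile.

End Terms.
Import Terms.

(** * Printing programs *)

Module Writers.

(** One constant serves as coefficient and as degree, to match the time bound in the definition of
    polynomial time. *)
Definition polyb (f : nat -> nat) := exists K, forall M, f M <= K * M.+1 ^ K.

Lemma polyb_le f g : (forall M, f M <= g M) -> polyb g -> polyb f.
Proof. by move=> h [K hK]; exists K => M; apply: leq_trans (h M) (hK M). Qed.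

Lemma polyb_const c : polyb (fun=> c).
Proof. by exists c => M; rewrite leq_pmulr // expn_gt0. Qed.

Lemma polyb_id : polyb id.
Proof. by exists 1 => M; rewrite mul1n expn1. Qed.

Lemma polyb_add f g : polyb f -> polyb g -> polyb (fun M => f M + g M).
Proof.
move=> [K hK] [K' hK']; exists (K + K') => M; rewrite mulnDl.
apply: leq_add; [apply: leq_trans (hK M) _ | apply: leq_trans (hK' M) _];
  by rewrite leq_mul2l leq_pexp2l ?orbT //; lia.
Qed.

Lemma polyb_mul f g : polyb f -> polyb g -> polyb (fun M => f M * g M).
Proof.
move=> [K hK] [K' hK']; exists (K * K' + K + K') => M.
apply: leq_trans (leq_mul (hK M) (hK' M)) _.
rewrite mulnACA -expnD; apply: leq_mul; first by lia.
by apply: leq_pexp2l => //; lia.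
Qed.

Lemma polyb_S f : polyb f -> polyb (fun M => (f M).+1).
Proof. by move=> h; apply: (@polyb_le _ (fun M => f M + 1)) (polyb_add h (polyb_const 1)) => M; lia. Qed.

Lemma polyb_expn_base f K : polyb f -> polyb (fun M => f M ^ K).
Proof.
move=> h; elim: K => [|K IH]; first exact: polyb_const.
by apply: (@polyb_le _ (fun M => f M * f M ^ K)) (polyb_mul h IH) => M; rewrite expnS.
Qed.

Lemma polyb_comp f g : (forall a b, a <= b -> f a <= f b) -> polyb f -> polyb g -> polyb (fun M => f (g M)).
Proof.
move=> mf [K hK] hg; apply: (@polyb_le _ (fun M => K * (g M).+1 ^ K)); first by move=> M; apply: hK.
by apply: polyb_mul; [apply: polyb_const | apply: polyb_expn_base; apply: polyb_S].
Qed.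

Lemma ttime_poly (G : finType) t : polyb (ttime G t).
Proof.
have c20 : polyb (fun M => 20 * M.+1).
  by apply: polyb_mul; [apply: polyb_const | apply: polyb_S polyb_id].
elim: t => //= [t IH|t IH|c IHc i IHi b IHb|t IHt b IHb].
- exact: polyb_S.
- by apply: polyb_add (polyb_const _); apply: polyb_add.
- apply: polyb_add c20; apply: polyb_add; first by apply: polyb_add.
  apply: polyb_mul polyb_id _; apply: polyb_add => //.
  by apply: polyb_mul; [apply: polyb_const | apply: polyb_S polyb_id].
exact: polyb_add.
Qed.

Lemma ttime_mono (G : finType) t a b : a <= b -> ttime G t a <= ttime G t b.
Proof.
move=> h; elim: t => [|t IH||t IH|t IH|c IHc i IHi b' IHb|t IHt b' IHb] /=; try by [].
- by rewrite leq_mul2l ltnS h orbT.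
- by rewrite leq_mul2l ltnS h orbT.
- by rewrite leq_add2r; apply: leq_add => //; rewrite leq_mul2l ltnS h orbT.
- have hS : a.+1 <= b.+1 by [].
  apply: leq_add; last by rewrite leq_mul2l hS orbT.
  apply: leq_add; first exact: leq_add.
  by apply: leq_mul => //; apply: leq_add => //; rewrite leq_mul2l hS orbT.
exact: leq_add.
Qed.

Inductive wr (H : Type) :=
  | WSkip | WOut of H | WSeq of wr H & wr H | WFor of term & wr H
  | WIf of term & wr H & wr H | WLet of term & wr H.
Arguments WSkip {H}.

Section Writers.
Variables (G H : finType).

Fixpoint weval (o : nat -> nat) (e : seq nat) (w : wr H) : seq H :=
  match w with
  | WSkip => [::]
  | WOut h => [:: h]
  | WSeq w1 w2 => weval o e w1 ++ weval o e w2
  | WFor t w => flatten (mkseq (fun j => weval o (j :: e) w) (teval o e t))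
  | WIf t w1 w2 => if teval o e t == 0 then weval o e w2 else weval o e w1
  | WLet t w => weval o (teval o e t :: e) w
  end.

Fixpoint wcost (o : nat -> nat) (e : seq nat) (w : wr H) : nat :=
  match w with
  | WSkip | WOut _ => 0
  | WSeq w1 w2 => maxn (wcost o e w1) (wcost o e w2)
  | WFor t w => maxn (tcost o e t) (\max_(j < teval o e t) wcost o ((j : nat) :: e) w)
  | WIf t w1 w2 => maxn (tcost o e t) (maxn (wcost o e w1) (wcost o e w2))
  | WLet t w => maxn (tcost o e t) (wcost o (teval o e t :: e) w)
  end.

Fixpoint wcomp (w : wr H) (rho : seq nat) (k : nat) : cmd H :=
  match w with
  | WSkip => CSkip
  | WOut h => COut h
  | WSeq w1 w2 => CSeq (wcomp w1 rho k) (wcomp w2 rho k)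
  | WFor t w => CSeq (tcomp H t rho k (k + 2)) (CSeq (cclear H k.+1)
      (CLoop k (CSeq (wcomp w (k.+1 :: rho) (k + 2)) (CInc k.+1))))
  | WIf t w1 w2 => CSeq (tcomp H t rho k k.+1) (CIf k (wcomp w2 rho k.+1) (wcomp w1 rho k.+1))
  | WLet t w => CSeq (tcomp H t rho k k.+1) (wcomp w (k :: rho) k.+1)
  end.

Fixpoint wreg (w : wr H) (k : nat) : nat :=
  match w with
  | WSkip | WOut _ => k
  | WSeq w1 w2 => maxn (wreg w1 k) (wreg w2 k)
  | WFor t w => maxn (treg t (k + 2)) (wreg w (k + 2))
  | WIf t w1 w2 => maxn (treg t k.+1) (maxn (wreg w1 k.+1) (wreg w2 k.+1))
  | WLet t w => maxn (treg t k.+1) (wreg w k.+1)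
  end.

Fixpoint wtime (w : wr H) (M : nat) : nat :=
  match w with
  | WSkip | WOut _ => 1
  | WSeq w1 w2 => wtime w1 M + wtime w2 M
  | WFor t w => ttime G t M + 10 * M.+1 + M * (wtime w M + 4)
  | WIf t w1 w2 => ttime G t M + (wtime w1 M + wtime w2 M + 2)
  | WLet t w => ttime G t M + wtime w M
  end.

Lemma wtime_poly w : polyb (wtime w).
Proof.
have hS f : polyb f -> polyb (fun M => f M + 10 * M.+1).
  move=> hf; apply: polyb_add => //.
  by apply: polyb_mul; [apply: polyb_const | apply: polyb_S polyb_id].
elim: w => [|h|w1 IH1 w2 IH2|t w IH|t w1 IH1 w2 IH2|t w IH] /=; try exact: polyb_const.
- exact: polyb_add.
- apply: polyb_add; first by apply: hS; apply: ttime_poly.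
  by apply: polyb_mul polyb_id _; apply: polyb_add IH (polyb_const 4).
- apply: polyb_add (ttime_poly _ _) _; apply: polyb_add (polyb_const 2); exact: polyb_add.
- exact: polyb_add (ttime_poly _ _) IH.
Qed.

Lemma wtime_mono w a b : a <= b -> wtime w a <= wtime w b.
Proof.
move=> h; elim: w => [|h'|w1 IH1 w2 IH2|t w IH|t w1 IH1 w2 IH2|t w IH] //=; try lia.
- have := ttime_mono G t h; have := leq_mul h IH; nia.
- have := ttime_mono G t h; lia.
- have := ttime_mono G t h; lia.
Qed.

Lemma size_flatten_mkseq (T : Type) (f : nat -> seq T) n B :
  (forall j, j < n -> size (f j) <= B) -> size (flatten (mkseq f n)) <= n * B.
Proof.
elim: n => // n IH h; rewrite /mkseq -[in iota _ _]addn1 iotaD map_cat flatten_cat size_cat /= add0n cats0.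
rewrite mulSn addnC; apply: leq_add; first exact: h.
by apply: IH => j hj; apply: h; lia.
Qed.

(** Printing a letter takes a step, so the running time also bounds the length of the output
    track. *)
Lemma size_weval o e w M : wcost o e w <= M -> size (weval o e w) <= wtime w M.
Proof.
elim: w e => [|h|w1 IH1 w2 IH2|t w IH|t w1 IH1 w2 IH2|t w IH] e //=.
- by rewrite size_cat geq_max => /andP[h1 h2]; have := IH1 e h1; have := IH2 e h2; lia.
- rewrite geq_max => /andP[h1 /bigmax_leqP h2].
  have hn : teval o e t <= M by apply: leq_trans (teval_cost _ _ _) h1.
  apply: leq_trans (size_flatten_mkseq (B := wtime w M) _) _.
    by move=> j hj; apply: IH; have := h2 (Ordinal hj) isT.
  by have := leq_mul hn (leqnn (wtime w M)); lia.
- rewrite !geq_max => /and3P[h1 h2 h3]; case: ifP => _; [have := IH2 e h3|have := IH1 e h2]; lia.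
- rewrite geq_max => /andP[h1 h2]; have := IH _ h2; lia.
Qed.

Section Run.
Variables (R : nat) (x : seq G) (M Z : nat).
Notation exec := (exec (G := G) R x (bd (H := H) M Z)).
Notation o := (orc x).

Lemma wcomp_ok w rho k s :
  all (fun r => r < k) rho -> wreg w k <= R -> bd M Z s -> pt_ok x s ->
  wcost o (map (rg s) rho) w <= M -> size (ot s ++ weval o (map (rg s) rho) w) <= Z ->
  exists s' tm, [/\ exec (wcomp w rho k) s s' tm, tm <= wtime w M, bd M Z s' /\ pt_ok x s',
     forall r, r < k -> rg s' r = rg s r & ot s' = ot s ++ weval o (map (rg s) rho) w].
Proof.
have ne a a' : a <> a' -> a != a' by move/eqP.
have allS rh r1 k1 k2 : k1 <= k2 -> k1 <= r1 -> all (fun r => r < k1) rh ->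
    all (fun r => (r < k2) && (r != r1)) rh.
  by move=> h1 h2; apply: sub_all => r h3; apply/andP; split; [lia | apply: ne; lia].
elim: w rho k s => [|h|w1 IH1 w2 IH2|t w IH|t w1 IH1 w2 IH2|t w IH] rho k s hrho hR hb hp hM hZ /=.
- by exists s, 0; split=> //; [constructor | rewrite cats0].
- have hb' : bd M Z (St (rg s) (pt s) (rcons (ot s) h)).
    by split; [exact: hb.1 | rewrite /= -cats1].
  exists (St (rg s) (pt s) (rcons (ot s) h)), 1; split=> //; last by rewrite -cats1.
  by apply: exec_out.
- rewrite /= geq_max in hM; case/andP: hM => hM1 hM2.
  rewrite /= geq_max in hR; case/andP: hR => hR1 hR2.
  rewrite /= in hZ.
  have [|s1 [t1 [h1 h2 [h3 h3'] h4 h5]]] := IH1 rho k s hrho hR1 hb hp hM1.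
    by move: hZ; rewrite !size_cat; lia.
  have em : map (rg s1) rho = map (rg s) rho by apply: (map_rg_same hrho) => r hr; apply: h4.
  have [||s2 [t2 [i1 i2 i3 i4 i5]]] := IH2 rho k s1 hrho hR2 h3 h3'.
  + by rewrite em.
  + by rewrite em h5 -catA.
  exists s2, (t1 + t2); split=> //; first by apply: exec_seq h1 i1.
  + by lia.
  + by move=> r hr; rewrite i4 ?h4.
  + by rewrite i5 em h5 catA.
- rewrite /= geq_max in hM; case/andP: hM => hM1 /bigmax_leqP hM2.
  rewrite /= geq_max in hR; case/andP: hR => hR1 hR2.
  have hk := treg_ge t (k + 2); rewrite /= in hZ.
  have [||s1 [t1 [h1 h2 [h3 h3'] h4 [h5 h6]]]] :=
    @tcomp_ok G H R x M Z t rho k (k + 2) s _ _ hR1 hb hp hM1.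
  + by apply: allS hrho; lia.
  + by lia.
  have [|s2 [t2 [e2 l2 b2 z2 fr2]]] := exec_clear (G := G) (R := R) x (r := k.+1) _ h3; first by lia.
  have [f2 g2 k2] := fr2.
  set e := map (rg s) rho in hM1 hM2 hZ h4 *.
  set n := teval o e t in hM2 hZ h4 *.
  have hn : n <= M by apply: leq_trans hM1; apply: teval_cost.
  pose W := mkseq (fun j => weval o (j :: e) w).
  pose P j s' := [/\ bd M Z s' /\ pt_ok x s', rg s' k = j, j <= n /\ rg s' k.+1 = n - j,
     forall r, r < k -> rg s' r = rg s r & ot s' = ot s ++ flatten (W (n - j))].
  have WS m : W m.+1 = W m ++ [:: weval o (m :: e) w].
    by rewrite /W /mkseq -addn1 iotaD map_cat.
  have Wle m : m <= n -> size (ot s ++ flatten (W m)) <= Z.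
    move=> hm; apply: leq_trans hZ; rewrite !size_cat leq_add2l -(subnKC hm) /mkseq iotaD.
    by rewrite map_cat flatten_cat size_cat leq_addr.
  have [|j s' hP|j s4 hj hP||s3 [t3 [e3 l3 [[b3 p3] z3 _ v3 u3]]]] := 
    @exec_loop G H R x M Z P k (CSeq (wcomp w (k.+1 :: rho) (k + 2)) (CInc k.+1)) (wtime w M).+1 n s2.
  + by lia.
  + by case: hP => -[].
  + case: hP => -[b4 p4] z4 [hjn w4] v4 u4.
    have b5 : bd M Z (upd s4 k j) by apply: bd_upd => //; lia.
    have v5 r : r != k -> rg (upd s4 k j) r = rg s4 r by move=> /negPf hr; rewrite /= hr.
    set s5 := upd s4 k j in b5 v5 *.
    have em5 : map (rg s5) (k.+1 :: rho) = (n - j.+1) :: e.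
      rewrite map_cons v5 ?w4; last by apply: ne; lia.
      congr (_ :: _); apply: (map_rg_same hrho) => r hr.
      by rewrite v5 ?v4 //; apply: ne; lia.
    have hm : n - j.+1 < n by lia.
    have ej : n - j = (n - j.+1).+1 by lia.
    have hZ5 : size (ot s4 ++ weval o (n - j.+1 :: e) w) <= Z.
      by have := Wle (n - j); rewrite ej WS flatten_cat /= cats0 catA -u4; apply; lia.
    have [||||s6 [t6 [j1 j2 [j3 j3'] j4 j5]]] := IH (k.+1 :: rho) (k + 2) s5 _ hR2 b5.
    * rewrite /=; apply/andP; split; first by lia.
      by apply: sub_all hrho => r; lia.
    * by case: p4 => p hp1 hp2; exists p.
    * by rewrite em5; have := hM2 (Ordinal hm) isT.
    * by rewrite em5.
    rewrite em5 in j5.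
    have v6 : rg s6 k.+1 = n - j.+1 by rewrite j4 ?v5 ?w4 //; [apply: ne; lia | lia].
    have b7 : bd M Z (upd s6 k.+1 (rg s6 k.+1).+1) by apply: bd_upd => //; lia.
    exists (upd s6 k.+1 (rg s6 k.+1).+1), (t6 + 1); split; last first.
    * split=> //=.
      - rewrite ifN; last by apply: ne; lia.
        by rewrite j4 ?/s5 /= ?eqxx //; lia.
      - by rewrite eqxx v6; split; lia.
      - move=> r hr; rewrite ifN; last by apply: ne; lia.
        by rewrite j4 ?v5 ?v4 //; [apply: ne; lia | lia].
      - by rewrite j5 /= u4 ej WS flatten_cat /= cats0 catA.
    * by lia.
    apply: exec_seq j1 _; apply: exec_inc => //; lia.
  + split.
    * by split=> //; apply: frame_pt fr2 h3'.
    * by rewrite f2 //; apply: ne; lia.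
    * by rewrite z2 subnn.
    * by move=> r hr; rewrite f2 ?h5 //; try (by apply: ne; lia); lia.
    * by rewrite k2 h6 subnn /W /= cats0.
  exists s3, (t1 + (t2 + t3)); split=> //.
  + by apply: exec_seq h1 _; apply: exec_seq e2 e3.
  + have : n * ((wtime w M).+1 + 3) <= M * (wtime w M + 4) by apply: leq_mul => //; lia.
    by lia.
  + by rewrite u3 subn0.
- rewrite /= !geq_max in hM; case/and3P: hM => hM0 hM1 hM2.
  rewrite /= !geq_max in hR; case/and3P: hR => hR0 hR1 hR2.
  have hk := treg_ge t k.+1; rewrite /= in hZ.
  have [||s1 [t1 [h1 h2 [h3 h3'] h4 [h5 h6]]]] :=
    @tcomp_ok G H R x M Z t rho k k.+1 s _ _ hR0 hb hp hM0.
  + by apply: allS hrho; lia.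
  + by lia.
  have em : map (rg s1) rho = map (rg s) rho.
    by apply: (map_rg_same hrho) => r hr; apply: h5; [lia | apply: ne; lia].
  have hrho1 : all (fun r => r < k.+1) rho by apply: sub_all hrho => r; lia.
  case: (eqVneq (teval o (map (rg s) rho) t) 0) hZ => [e0|e0] hZ.
    have [||s2 [t2 [i1 i2 [i3 i3'] i4 i5]]] := IH2 rho k.+1 s1 hrho1 hR2 h3 h3'.
    + by rewrite em.
    + by rewrite em h6.
    exists s2, (t1 + t2.+2); split=> //.
    + apply: exec_seq h1 _; apply: exec_ifz => //; first by lia.
      by rewrite h4 e0.
    + by lia.
    + by move=> r hr; rewrite i4 ?h5 //; try lia; apply: ne; lia.
    + by rewrite i5 em h6.
  have [||s2 [t2 [i1 i2 [i3 i3'] i4 i5]]] := IH1 rho k.+1 s1 hrho1 hR1 h3 h3'.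
  + by rewrite em.
  + by rewrite em h6.
  exists s2, (t1 + t2.+2); split=> //.
  + apply: exec_seq h1 _; apply: exec_ifn => //; first by lia.
    by rewrite h4 lt0n.
  + by lia.
  + by move=> r hr; rewrite i4 ?h5 //; try lia; apply: ne; lia.
  + by rewrite i5 em h6.
rewrite /= !geq_max in hM; case/andP: hM => hM0 hM1.
rewrite /= !geq_max in hR; case/andP: hR => hR0 hR1.
have hk := treg_ge t k.+1; rewrite /= in hZ.
have [||s1 [t1 [h1 h2 [h3 h3'] h4 [h5 h6]]]] :=
  @tcomp_ok G H R x M Z t rho k k.+1 s _ _ hR0 hb hp hM0.
- by apply: allS hrho; lia.
- by lia.
have em : map (rg s1) (k :: rho) = teval o (map (rg s) rho) t :: map (rg s) rho.
  rewrite /= h4; congr (_ :: _).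
  by apply: (map_rg_same hrho) => r hr; apply: h5; [lia | apply: ne; lia].
have [|||s2 [t2 [i1 i2 i3 i4 i5]]] := IH (k :: rho) k.+1 s1 _ hR1 h3 h3'.
- by rewrite /= ltnSn; apply: sub_all hrho => r; lia.
- by rewrite em.
- by rewrite em h6.
exists s2, (t1 + t2); split=> //; first by apply: exec_seq h1 i1.
- by lia.
- by move=> r hr; rewrite i4 ?h5 //; try lia; apply: ne; lia.
by rewrite i5 em h6.
Qed.

(** Measures the input into register 1. Register 2 is a flag that each turn of the loop consumes and
    that the body restores as long as register 3 shows a letter, which turns the counted loop into a
    while loop. *)
Definition csize : cmd H :=
  CSeq (CInc 2) (CLoop 2 (CSeq (CRead 3) (CIf 3 CSkip
    (CSeq (CInc 1) (CSeq CAdv (CSeq (CInc 2) (cclear H 3))))))).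

Lemma csize_ok : 3 <= R -> size x < M -> #|G| < M ->
  exists s' tm, [/\ exec csize (st0 H) s' tm, tm <= (size x).+1 * (10 * M.+1 + #|G|),
    bd M Z s' /\ pt_ok x s', rg s' 1 = size x & ot s' = [::]].
Proof.
move=> hR hx hG.
have hb0 : bd M Z (st0 H) by [].
have hb1 : bd M Z (upd (st0 H) 2 1) by apply: bd_upd => //; lia.
pose Q m (s : st H) := [/\ bd M Z s, rg s 1 = size x - m /\ rg s 2 = 1, rg s 3 = 0,
  pt s = Some (size x - m) & ot s = [::]].
suff h m s : m <= size x -> Q m s ->
   exists s' tm, [/\ exec (CLoop 2 (CSeq (CRead 3) (CIf 3 CSkip
    (CSeq (CInc 1) (CSeq CAdv (CSeq (CInc 2) (cclear H 3))))))) s s' tm,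
    tm.+1 <= m.+1 * (10 * M.+1 + #|G|),
    bd M Z s' /\ pt_ok x s', rg s' 1 = size x & ot s' = [::]].
  have [|s' [tm [h1 h2 h3 h4 h5]]] := h (size x) (upd (st0 H) 2 1) (leqnn _).
    by split=> //=; rewrite subnn.
  exists s', (1 + tm); split=> //.
  by apply: exec_seq h1; apply: exec_inc => //; lia.
have hlc := lcode_le (onth x (size x - m)).
elim: m s {hlc} => [|m IH] s hm [b1 [v1 v2] v3 hp ho].
  rewrite subn0 in v1 hp.
  pose s1 := upd s 2 (rg s 2).-1.
  have b2 : bd M Z s1 by apply: bd_upd => //; rewrite v2.
  have el : lcode (onth x (size x)) = 0 by rewrite onth_ge.
  pose s2 := upd s1 3 (rg s1 3 + lcode (onth x (size x))).
  have b3 : bd M Z s2 by apply: bd_upd => //; rewrite /s1 /= v3 el.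
  have e23 : rg s2 3 = 0 by rewrite /s2 /= v3 el.
  exists s2, ((#|G|.+1 + 0.+2) + 1 + 3); split=> //.
  + apply: (exec_loopS (s1 := s2)) => //; try lia.
    * apply: (exec_seq (s2 := s2)).
        apply: (exec_read (i := size x)) => //.
        by move=> j; rewrite el leqn0 => /eqP ->; apply: bd_upd => //; rewrite /s1 /= v3.
      by apply: exec_ifz => //; constructor.
    * by apply: exec_loop0 => //; [lia | rewrite /s2 /s1 /= v2].
  + by move: #|G| => g; rewrite mul1n; clear -hx; lia.
  + by split=> //; exists (size x).
have hlt : size x - m.+1 < size x by lia.
have [g hg] := onth_lt hlt.
pose l := lcode (onth x (size x - m.+1)).
have hl : 0 < l by rewrite /l hg.
have hl2 : l <= #|G| by apply: lcode_le.
pose s1 := upd s 2 (rg s 2).-1.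
have b2 : bd M Z s1 by apply: bd_upd => //; rewrite v2.
pose s2 := upd s1 3 (rg s1 3 + l).
have b3 : bd M Z s2 by apply: bd_upd => //; rewrite /s1 /= v3 add0n; apply: leq_trans hl2 (ltnW hG).
pose s3 := upd s2 1 (rg s2 1).+1.
have b4 : bd M Z s3 by apply: bd_upd => //; rewrite /s2 /s1 /= v1; lia.
pose s4 := St (rg s3) (adv x (pt s3)) (ot s3).
have b5 : bd M Z s4 by [].
pose s5 := upd s4 2 (rg s4 2).+1.
have b6 : bd M Z s5 by apply: bd_upd => //; rewrite /s4 /s3 /s2 /s1 /= v2; lia.
have [|s6 [t6 [e6 l6 b7 z6 [f6 g6 k6]]]] := exec_clear (G := G) (R := R) x (r := 3) _ b6; first by lia.
have [||s' [tm [h1 h2 h3 h4 h5]]] := IH s6.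
- by lia.
- split=> //.
  + by rewrite !f6 // /s5 /s4 /s3 /s2 /s1 /= v1 v2; split; lia.
  + by rewrite g6 /s5 /s4 /= hp /= hlt; congr Some; lia.
  + by rewrite k6.
exists s', ((#|G|.+1 + (1 + (2 + (1 + t6))).+2) + tm + 3); split=> //.
- apply: (exec_loopS (s1 := s6)) h1 => //; try lia.
  apply: (exec_seq (s2 := s2)).
    apply: (exec_read (i := size x - m.+1)) => //; first by lia.
    by move=> j hj; apply: bd_upd => //; rewrite /s1 /= v3 add0n; apply: leq_trans hj (leq_trans hl2 (ltnW hG)).
  apply: exec_ifn => //.
    by rewrite /s2 /s1 /= v3 add0n.
  apply: (exec_seq (s2 := s3)); first by apply: exec_inc => //; lia.
  apply: (exec_seq (s2 := s4)).
    by apply: (@exec_adv _ _ _ _ _ (size x - m.+1)) => //; lia.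
  apply: exec_seq e6; apply: exec_inc => //; lia.
- have M0 : 0 < M by lia.
  move: M0 h2 l6; rewrite [m.+2 * _]mulSn; move: (m.+1 * _) => B; move: #|G| => g'; clear; lia.
Qed.

End Run.
End Writers.

End Writers.
Import Writers.

(** * Complexity of terms and printing programs *)

Module TermSpace.

(** Loops run as often as the values they count, so the time is a polynomial in the largest value;
    values polynomial in the input length therefore give polynomial time. *)
Theorem writer_poly_time (G H : finType) (w : wr H) (K : nat) :
  (forall x : seq G, wcost (orc x) [:: size x] w <= K * (size x).+1 ^ K) ->
  poly_time_computable (fun x : seq G => weval (orc x) [:: size x] w).
Proof.
move=> hK.
pose R := maxn 3 (wreg w 4).
pose c : cmd H := CSeq (csize H) (wcomp w [:: 1] 4).
pose M n := K * n.+1 ^ K + n + #|G| + 1.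
pose S n := M n + wtime G w (M n) + n + 2.
pose T n := (n.+1 * (10 * (M n).+1 + #|G|) + wtime G w (M n) + 2) * (S n).*2.
have pM : polyb M.
  apply: polyb_add (polyb_const 1); apply: polyb_add (polyb_const _); apply: polyb_add polyb_id.
  by apply: polyb_mul (polyb_const K) _; apply: polyb_expn_base; apply: polyb_S polyb_id.
have pW : polyb (fun n => wtime G w (M n)).
  by apply: polyb_comp pM; [apply: wtime_mono | apply: wtime_poly].
have pT : polyb T.
  apply: polyb_mul.
    apply: polyb_add (polyb_const 2); apply: polyb_add pW; apply: polyb_mul (polyb_S polyb_id) _.
    by apply: polyb_add (polyb_const _); apply: polyb_mul (polyb_const 10) (polyb_S pM).
  apply: (@polyb_le _ (fun n => 2 * S n)); first by move=> n; lia.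
  apply: polyb_mul (polyb_const 2) _; apply: polyb_add (polyb_const 2); apply: polyb_add polyb_id.
  exact: polyb_add.
have [k hk] := pT.
exists (cmdTM G R c), (@cell_out G H R), k => x.
set n := size x; set Mn := M n; set Z := wtime G w Mn.
have hR : 3 <= R by rewrite /R; lia.
have g1 : size x < Mn by rewrite /Mn /M /n; lia.
have g2 : #|G| < Mn by rewrite /Mn /M; move: #|G| => g; lia.
have [s1 [t1 [h1 h2 [h3 h3'] h4 h5]]] := @csize_ok G H R x Mn Z hR g1 g2.
have hc : wcost (orc x) (map (rg s1) [:: 1]) w <= Mn.
  by rewrite /= h4; apply: leq_trans (hK x) _; rewrite /Mn /M -!addnA leq_addr.
have hZ : size (ot s1 ++ weval (orc x) (map (rg s1) [:: 1]) w) <= Z.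
  by rewrite h5 /=; apply: size_weval; exact: hc.
have hRw : wreg w 4 <= R by rewrite /R leq_maxr.
have [s2 [t2 [i1 i2 [i3 i3'] i4 i5]]] := @wcomp_ok G H R x Mn Z w [:: 1] 4 s1 isT hRw h3 h3' hc hZ.
have hex : exec (G := G) R x (bd Mn Z) c (st0 H) s2 (t1 + t2) by apply: exec_seq h1 i1.
have hbd s : bd (H := H) Mn Z s -> (forall r, r <= R -> rg s r < 2 ^ Mn) /\ size (ot s) <= S n.
  move=> [b1 b2]; split; first by move=> r _; apply: leq_ltn_trans (b1 r) (ltn_expl _ _).
  by rewrite /S -/Mn -/Z; lia.
have [|||u [u1 u2 u3 u4 u5]] := cmdTM_run hex hbd _ i3 (_ : Mn < S n).
- by split.
- by rewrite /S -/Mn; lia.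
- by rewrite /S -/Mn -/n; lia.
exists u; split; last by split=> //; rewrite u4 i5 h5 /= h4.
rewrite addn1; apply: leq_trans (hk n); apply: leq_trans u1 _.
rewrite /T leq_mul2r; apply/orP; right.
by rewrite leq_add2r -/Mn; apply: leq_add.
Qed.

Lemma leq_exp2_add a b : 0 < b -> 2 ^ a + b <= 2 ^ (a + b).
Proof.
move=> hb; rewrite expnD; have h1 : 0 < 2 ^ a by rewrite expn_gt0.
have h2 : b < 2 ^ b by apply: ltn_expl.
move: (2 ^ a) (2 ^ b) h1 h2 => A B h1 h2; nia.
Qed.

(** Values below a doubly exponential bound fit into exponentially many binary digits. Only space
    counts, so a term may loop doubly exponentially often. *)
Theorem term_expspace (G : finType) (t : term) (L : seq G -> Prop) (k : nat) :
  (forall x, L x <-> teval (orc x) [:: size x] t <> 0) ->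
  (forall x : seq G, tcost (orc x) [:: size x] t <= 2 ^ (2 ^ (k * (size x).+1))) ->
  EXPSPACE L.
Proof.
move=> hL hK.
pose H : finType := bool.
pose R := maxn 3 (treg t 4).
pose c : cmd H := CSeq (csize H) (tcomp H t [:: 1] 0 4).
pose g := #|G|.
(* [g] and 10 absorb the additive terms coming from the alphabet and the input length, so that the
   bound takes the required shape with one constant. *)
pose k' := k + g + 10.
exists (cmdTM G R c), k' => x.
set n := size x.
pose Mn := 2 ^ (2 ^ (k * n.+1)) + (n + g + 1).
pose W := 2 ^ (k * n.+1) + (n + g + 2).
pose S := 2 ^ (k * n.+1) + (2 * n + g + 5).
have hMW : Mn < 2 ^ W.
  rewrite /Mn /W; apply: leq_trans (leq_exp2_add _ _); last by lia.
  by rewrite -addnS leq_add2l; lia.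
have hS : S <= 2 ^ (k' * (n + 1) ^ k').
  apply: leq_trans (leq_exp2_add _ _) _; first by lia.
  rewrite leq_exp2l //; apply: (@leq_trans (k' * n.+1)); first by rewrite /k'; nia.
  by rewrite leq_mul2l addn1 -{1}(expn1 n.+1) leq_pexp2l ?orbT // /k'; lia.
have hR : 3 <= R by rewrite /R; lia.
have [s1 [t1 [h1 h2 [h3 h3'] h4 h5]]] : exists s' tm, [/\ exec (G := G) R x (bd Mn 0) (csize H) (st0 H) s' tm, tm <= (size x).+1 * (10 * Mn.+1 + #|G|),
    bd Mn 0 s' /\ pt_ok x s', rg s' 1 = size x & ot s' = [::]].
  apply: csize_ok => //; rewrite /Mn -/n -/g; have := expn_gt0 2 (2 ^ (k * n.+1)); lia.
have hc : tcost (orc x) (map (rg s1) [:: 1]) t <= Mn.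
  by rewrite /= h4; apply: leq_trans (hK x) _; rewrite /Mn leq_addr.
have hRw : treg t 4 <= R by rewrite /R leq_maxr.
have [||s2 [t2 [i1 i2 [i3 i3'] i4 [i5 i6]]]] := @tcomp_ok G H R x Mn 0 t [:: 1] 0 4 s1 _ _ hRw h3 h3' hc.
- by [].
- by [].
have hex : exec (G := G) R x (bd Mn 0) c (st0 H) s2 (t1 + t2) by apply: exec_seq h1 i1.
have hbd s : bd (H := H) Mn 0 s -> (forall r, r <= R -> rg s r < 2 ^ W) /\ size (ot s) <= S.
  move=> [b1 b2]; split; first by move=> r _; apply: leq_ltn_trans (b1 r) hMW.
  by lia.
have [|||u [u1 u2 u3 u4 u5]] := cmdTM_run hex hbd _ i3 (_ : W < S).
- by split.
- by rewrite /S /W; lia.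
- by rewrite /S -/n; lia.
exists u; split=> //; split.
  by rewrite u3 i4 /= h4 hL.
by move=> i hi; apply: leq_trans (u5 i hi) hS.
Qed.

End TermSpace.
Import TermSpace.

(** * Terms of polynomially bounded cost *)

Module TermClass.

Definition maxl (e : seq nat) : nat := foldr maxn 0 e.

Lemma head_maxl e : head 0 e <= maxl e.
Proof. by case: e => //= a e; rewrite leq_maxl. Qed.

Lemma behead_maxl e : maxl (behead e) <= maxl e.
Proof. by case: e => //= a e; rewrite leq_maxr. Qed.

Section EClass.
Variable g : nat.

Definition obnd (o : nat -> nat) := forall i, o i <= g.

Definition pbnd (F : (nat -> nat) -> seq nat -> nat) :=
  exists c, forall o e, obnd o -> F o e <= (maxl e + 2) ^ c.

(** The cost is polynomial in the entries of the environment. With the input length as entry this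
    gives polynomial values, with a doubly exponential number as entry doubly exponential ones, so
    the same class serves the reduction and the decision procedure. *)
Definition E (F : (nat -> nat) -> seq nat -> nat) :=
  exists t, (forall o e, obnd o -> teval o e t = F o e) /\ pbnd (fun o e => tcost o e t).

Lemma exp_le a b m : a <= b -> (m + 2) ^ a <= (m + 2) ^ b.
Proof. by move=> h; rewrite leq_exp2l //; lia. Qed.

Lemma E_pbnd F : E F -> pbnd F.
Proof.
by move=> [t [h [c hc]]]; exists c => o e ho; rewrite -h //; apply: leq_trans (teval_cost _ _ _) (hc o e ho).
Qed.

Lemma E_ext F F' : (forall o e, obnd o -> F o e = F' o e) -> E F -> E F'.
Proof. by move=> h [t [h1 h2]]; exists t; split=> // o e ho; rewrite h1 // h. Qed.

Lemma pbnd_le F F' : (forall o e, obnd o -> F o e <= F' o e) -> pbnd F' -> pbnd F.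
Proof. by move=> h [c hc]; exists c => o e ho; apply: leq_trans (h o e ho) (hc o e ho). Qed.

Lemma pbnd_max F F' : pbnd F -> pbnd F' -> pbnd (fun o e => maxn (F o e) (F' o e)).
Proof.
move=> [c hc] [c' hc']; exists (c + c') => o e ho; rewrite geq_max; apply/andP; split.
  by apply: leq_trans (hc o e ho) _; apply: exp_le; lia.
by apply: leq_trans (hc' o e ho) _; apply: exp_le; lia.
Qed.

Lemma pbnd_const n : pbnd (fun _ _ => n).
Proof.
exists n => o e _; apply: ltnW; apply: ltn_expl; lia.
Qed.

Lemma pbnd_maxl : pbnd (fun _ e => maxl e).
Proof. by exists 1 => o e _; rewrite expn1 leq_addr. Qed.

Lemma pbnd_add F F' : pbnd F -> pbnd F' -> pbnd (fun o e => F o e + F' o e).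
Proof.
move=> [c hc] [c' hc']; exists (c + c').+1 => o e ho.
have h1 := hc o e ho; have h2 := hc' o e ho.
have h3 := @exp_le c (c + c') (maxl e) (leq_addr _ _).
have h4 := @exp_le c' (c + c') (maxl e) (leq_addl _ _).
have : 2 * (maxl e + 2) ^ (c + c') <= (maxl e + 2) ^ (c + c').+1 by rewrite expnS leq_mul2r; lia.
by lia.
Qed.

Lemma pbnd_mul F F' : pbnd F -> pbnd F' -> pbnd (fun o e => F o e * F' o e).
Proof. by move=> [c hc] [c' hc']; exists (c + c') => o e ho; rewrite expnD; apply: leq_mul; auto. Qed.

Lemma pbnd_exp F n : pbnd F -> pbnd (fun o e => F o e ^ n).
Proof.
move=> h; elim: n => [|n IH]; first exact: pbnd_const.
by apply: (@pbnd_le _ (fun o e => F o e * F o e ^ n)) (pbnd_mul h IH) => o e _; rewrite expnS.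
Qed.

Lemma pbnd_subst F K : pbnd F -> pbnd K -> pbnd (fun o e => F o (K o e :: e)).
Proof.
move=> [c hc] hK.
apply: (@pbnd_le _ (fun o e => (maxn (K o e) (maxl e) + 2) ^ c)); first by move=> o e ho; apply: hc.
apply: pbnd_exp; apply: pbnd_add (pbnd_const 2); exact: pbnd_max hK pbnd_maxl.
Qed.

Lemma E_var0 : E (fun o e => head 0 e).
Proof. by exists TVar; split=> //; apply: pbnd_le pbnd_maxl => o e _; apply: head_maxl. Qed.

Lemma expn_mono a b c : a <= b -> a ^ c <= b ^ c.
Proof. by move=> h; elim: c => // c IH; rewrite !expnS leq_mul. Qed.

Lemma E_shift F : E F -> E (fun o e => F o (behead e)).
Proof.
move=> [t [h1 [c hc]]]; exists (TShift t); split=> [o e ho|]; first exact: h1.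
exists c => o e ho; apply: leq_trans (hc o (behead e) ho) _.
by apply: expn_mono; rewrite leq_add2r behead_maxl.
Qed.

Lemma E_nth i : E (fun o e => nth 0 e i).
Proof.
elim: i => [|i IH]; first by apply: E_ext E_var0 => o e _; case: e.
by apply: E_ext (E_shift IH) => o e _; rewrite nth_behead.
Qed.

Lemma E_const n : E (fun _ _ => n).
Proof.
elim: n => [|n [t [h [c hc]]]].
  by exists TZero; split=> //; apply: (pbnd_const 0).
exists (TSucc t); split=> [o e ho|]; first by rewrite /= h.
by apply: (@pbnd_le _ (fun o e => tcost o e t + 1)); [move=> *; rewrite /= addn1 | apply: pbnd_add (pbnd_const 1); exists c].
Qed.

Lemma E_succ F : E F -> E (fun o e => (F o e).+1).
Proof.
move=> [t [h hc]]; exists (TSucc t); split=> [o e ho|]; first by rewrite /= h.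
by apply: (@pbnd_le _ (fun o e => tcost o e t + 1)); [move=> *; rewrite /= addn1 | apply: pbnd_add (pbnd_const 1)].
Qed.

Lemma E_inp F : E F -> E (fun o e => o (F o e)).
Proof.
move=> [t [h hc]]; exists (TInp t); split=> [o e ho|]; first by rewrite /= h.
apply: (@pbnd_le _ (fun o e => maxn (tcost o e t) g)); last exact: pbnd_max (pbnd_const g).
by move=> o e ho /=; have := ho (teval o e t); lia.
Qed.

Lemma E_let F K : E K -> E F -> E (fun o e => F o (K o e :: e)).
Proof.
move=> EK; have pK := E_pbnd EK; move: EK => [t [h hc]] [t' [h' hc']].
exists (TLet t t'); split=> [o e ho|]; first by rewrite /= h // h'.
apply: (@pbnd_le _ (fun o e => maxn (tcost o e t) (tcost o (K o e :: e) t'))).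
  by move=> o e ho; rewrite /= h.
exact: pbnd_max hc (pbnd_subst hc' pK).
Qed.

(** Iteration leaves the class in general, as repeated squaring shows. Hence a polynomial bound on
    all intermediate accumulators must be supplied with each use. *)
Lemma E_rec N I B : E N -> E I -> E B ->
  (exists2 C, pbnd C & forall o e j, obnd o -> j <= N o e ->
     iteri j (fun j acc => B o [:: acc, j & e]) (I o e) <= C o e) ->
  E (fun o e => iteri (N o e) (fun j acc => B o [:: acc, j & e]) (I o e)).
Proof.
move=> EN EI EB [C pC hC]; have pN := E_pbnd EN.
move: EN EI EB => [tN [hN cN]] [tI [hI cI]] [tB [hB [cB hcB]]].
have hrec o e j : obnd o -> trec o e tI tB j = iteri j (fun j acc => B o [:: acc, j & e]) (I o e).
  by move=> ho; rewrite /trec hI //; elim: j => //= j ->; rewrite hB.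
exists (TRec tN tI tB); split=> [o e ho|].
  by rewrite /= -/(trec o e tI tB _) hrec // hN.
apply: (@pbnd_le _ (fun o e => maxn (tcost o e tN) (maxn (tcost o e tI)
   ((maxn (C o e) (maxn (N o e) (maxl e)) + 2) ^ cB)))); last first.
  apply: pbnd_max => //; apply: pbnd_max => //; apply: pbnd_exp; apply: pbnd_add (pbnd_const 2).
  by apply: pbnd_max => //; apply: pbnd_max => //; apply: pbnd_maxl.
move=> o e ho /=; rewrite !geq_max leq_maxl /= leq_max leq_maxl orbT /=.
rewrite leq_max; apply/orP; right; rewrite leq_max; apply/orP; right.
apply/bigmax_leqP => j _; apply: leq_trans (hcB _ _ ho) _; apply: expn_mono.
rewrite leq_add2r /= !geq_max hrec //.
have hj : j < N o e by apply: leq_trans (ltn_ord j) _; rewrite hN.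
have := hC o e j ho (ltnW hj).
by move: (iteri _ _ _) => it; lia.
Qed.

(** Reduces a composite to the case where its arguments are variables. Arguments are then evaluated
    once, and loop bodies find them at fixed positions. *)
Lemma E_app1 f : E (fun o e => f o (nth 0 e 0)) -> forall A, E A -> E (fun o e => f o (A o e)).
Proof. by move=> h A hA; exact: (E_let hA h). Qed.

Lemma E_app2 f : E (fun o e => f o (nth 0 e 0) (nth 0 e 1)) ->
  forall A B, E A -> E B -> E (fun o e => f o (A o e) (B o e)).
Proof. by move=> h A B hA hB; exact: (E_let hB (E_let (E_shift hA) h)). Qed.

Lemma E_app3 f : E (fun o e => f o (nth 0 e 0) (nth 0 e 1) (nth 0 e 2)) ->
  forall A B C, E A -> E B -> E C -> E (fun o e => f o (A o e) (B o e) (C o e)).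
Proof.
by move=> h A B C hA hB hC; exact: (E_let hC (E_let (E_shift hB) (E_let (E_shift (E_shift hA)) h))).
Qed.

Lemma E_app4 f : E (fun o e => f o (nth 0 e 0) (nth 0 e 1) (nth 0 e 2) (nth 0 e 3)) ->
  forall A B C D, E A -> E B -> E C -> E D -> E (fun o e => f o (A o e) (B o e) (C o e) (D o e)).
Proof.
by move=> h A B C D hA hB hC hD; exact: (E_let hD (E_let (E_shift hC) (E_let (E_shift (E_shift hB))
  (E_let (E_shift (E_shift (E_shift hA))) h)))).
Qed.

Lemma E_app5 f : E (fun o e => f o (nth 0 e 0) (nth 0 e 1) (nth 0 e 2) (nth 0 e 3) (nth 0 e 4)) ->
  forall A B C D F, E A -> E B -> E C -> E D -> E F ->
  E (fun o e => f o (A o e) (B o e) (C o e) (D o e) (F o e)).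
Proof.
by move=> h A B C D F hA hB hC hD hF; exact: (E_let hF (E_let (E_shift hD) (E_let (E_shift (E_shift hC))
  (E_let (E_shift (E_shift (E_shift hB))) (E_let (E_shift (E_shift (E_shift (E_shift hA)))) h))))).
Qed.

Lemma E_add A B : E A -> E B -> E (fun o e => A o e + B o e).
Proof.
move: A B; apply: (E_app2 (f := fun _ a b => a + b)).
apply: E_ext (E_rec (E_nth 0) (E_nth 1) (E_succ (E_nth 0)) _).
  by move=> o e _ /=; elim: (nth 0 e 0) => //= n ->.
exists (fun o e => nth 0 e 0 + nth 0 e 1).
  by apply: pbnd_add; apply: E_pbnd; apply: E_nth.
move=> o e j _ hj; have -> : iteri j (fun j acc => (nth 0 [:: acc, j & e] 0).+1) (nth 0 e 1) = j + nth 0 e 1.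
  by elim: j {hj} => //= j ->.
by rewrite leq_add2r.
Qed.

Lemma E_mul A B : E A -> E B -> E (fun o e => A o e * B o e).
Proof.
move: A B; apply: (E_app2 (f := fun _ a b => a * b)).
have aux e j : iteri j (fun j acc => nth 0 [:: acc, j & e] 0 + nth 0 [:: acc, j & e] 3) 0 = j * nth 0 e 1.
  by elim: j => //= j IH; rewrite IH mulSn addnC.
apply: E_ext (E_rec (E_nth 0) (E_const 0) (E_add (E_nth 0) (E_nth 3)) _).
  by move=> o e _; exact: aux.
exists (fun o e => nth 0 e 0 * nth 0 e 1).
  by apply: pbnd_mul; apply: E_pbnd; apply: E_nth.
by move=> o e j _ hj; rewrite aux // leq_mul2r hj orbT.
Qed.

Lemma E_pred A : E A -> E (fun o e => (A o e).-1).
Proof.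
move: A; apply: (E_app1 (f := fun _ a => a.-1)).
apply: E_ext (E_rec (E_nth 0) (E_const 0) (E_nth 1) _).
  by move=> o e _ /=; case: (nth 0 e 0).
exists (fun o e => nth 0 e 0); first by apply: E_pbnd; apply: E_nth.
by move=> o e [|j] _ hj //=; lia.
Qed.

Lemma E_sub A B : E A -> E B -> E (fun o e => A o e - B o e).
Proof.
move: A B; apply: (E_app2 (f := fun _ a b => a - b)).
have aux e j : iteri j (fun j acc => (nth 0 [:: acc, j & e] 0).-1) (nth 0 e 0) = nth 0 e 0 - j.
  by elim: j => [|j IH]; rewrite ?subn0 //= IH subnS.
apply: E_ext (E_rec (E_nth 1) (E_nth 0) (E_pred (E_nth 0)) _).
  by move=> o e _; exact: aux.
exists (fun o e => nth 0 e 0); first by apply: E_pbnd; apply: E_nth.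
by move=> o e j _ hj; rewrite aux leq_subr.
Qed.

Notation Eb P := (E (fun o e => nat_of_bool (P o e))).

Lemma E_if (P : _ -> _ -> bool) A B : Eb P -> E A -> E B -> E (fun o e => if P o e then A o e else B o e).
Proof.
move=> hP hA hB.
apply: E_ext (E_rec hP hB (E_shift (E_shift hA)) _).
  by move=> o e _; case: (P o e).
exists (fun o e => A o e + B o e); first by apply: pbnd_add; apply: E_pbnd.
by move=> o e j _; case: (P o e) => /=; case: j => [|[|j]] //= _; lia.
Qed.

Lemma E_isz A : E A -> Eb (fun o e => A o e == 0).
Proof. by move=> h; apply: E_ext (E_sub (E_const 1) h) => o e _; case: (A o e). Qed.

Lemma E_neg P : Eb P -> Eb (fun o e => ~~ P o e).
Proof. by move=> h; apply: E_ext (E_isz h) => o e _; case: (P o e). Qed.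

Lemma E_le A B : E A -> E B -> Eb (fun o e => A o e <= B o e).
Proof. by move=> hA hB; apply: E_ext (E_isz (E_sub hA hB)) => o e _; rewrite subn_eq0. Qed.

Lemma E_and P Q : Eb P -> Eb Q -> Eb (fun o e => P o e && Q o e).
Proof. by move=> hP hQ; apply: E_ext (E_mul hP hQ) => o e _; case: (P o e); case: (Q o e). Qed.

Lemma E_or P Q : Eb P -> Eb Q -> Eb (fun o e => P o e || Q o e).
Proof.
by move=> hP hQ; apply: E_ext (E_neg (E_and (E_neg hP) (E_neg hQ))) => o e _; case: (P o e); case: (Q o e).
Qed.

Lemma E_imp P Q : Eb P -> Eb Q -> Eb (fun o e => P o e ==> Q o e).
Proof.
by move=> hP hQ; apply: E_ext (E_or (E_neg hP) hQ) => o e _; rewrite implybE.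
Qed.

Lemma E_eq A B : E A -> E B -> Eb (fun o e => A o e == B o e).
Proof.
by move=> hA hB; apply: E_ext (E_and (E_le hA hB) (E_le hB hA)) => o e _; rewrite eqn_leq.
Qed.

Lemma E_ex N P : E N -> Eb (fun o e => P o (behead e) (head 0 e)) ->
  Eb (fun o e => has (P o e) (iota 0 (N o e))).
Proof.
move=> hN hP.
have aux o e n : iteri n (fun j acc => (acc != 0) || P o e j : nat) 0 = has (P o e) (iota 0 n) :> nat.
  elim: n => // n IH; rewrite iteriS IH -[n.+1]addn1 iotaD has_cat /= add0n orbF.
  by case: (has _ _).
apply: E_ext (E_rec hN (E_const 0) (E_or (E_neg (E_isz (E_nth 0))) (E_shift hP)) _).
  by move=> o e _; exact: aux.
exists (fun _ _ => 1); first exact: pbnd_const.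
by move=> o e j _ _; rewrite aux; case: (has _ _).
Qed.

Lemma E_all N P : E N -> Eb (fun o e => P o (behead e) (head 0 e)) ->
  Eb (fun o e => all (P o e) (iota 0 (N o e))).
Proof.
move=> hN hP; apply: E_ext (E_neg (E_ex (P := fun o e j => ~~ P o e j) hN (E_neg hP))) => o e _.
by rewrite -all_predC; congr (nat_of_bool _); apply: eq_all => j /=; rewrite negbK.
Qed.

Lemma E_div A B : E A -> E B -> E (fun o e => A o e %/ B o e).
Proof.
move: A B; apply: (E_app2 (f := fun _ a b => a %/ b)).
(* The quotient counts the positive multiples of [b] up to [a], for which [a] turns of the loop
   suffice. *)
have aux a b n : 0 < b -> iteri n (fun j acc => acc + (j.+1 * b <= a)) 0 = minn n (a %/ b).
  move=> hb; elim: n => [|n IH]; first by rewrite min0n.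
  by rewrite iteriS IH -leq_divRL //; case: leqP => h; lia.
apply: E_ext (E_if (P := fun o e => nth 0 e 1 == 0) (E_isz (E_nth 1)) (E_const 0)
  (E_rec (E_nth 0) (E_const 0) (E_add (E_nth 0) (E_le (E_mul (E_succ (E_nth 1)) (E_nth 3)) (E_nth 2))) _)).
  move=> o e _ /=; case: eqP => [->|/eqP h]; first by rewrite divn0.
  by rewrite aux ?lt0n //; have := leq_div (nth 0 e 0) (nth 0 e 1); lia.
exists (fun o e => nth 0 e 0); first by apply: E_pbnd; apply: E_nth.
move=> o e j _ hj; apply: leq_trans hj.
by elim: j => //= j IH; rewrite -[j.+1]addn1; apply: leq_add => //; apply: leq_b1.
Qed.

Lemma E_mod A B : E A -> E B -> E (fun o e => A o e %% B o e).
Proof.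
move=> hA hB; apply: E_ext (E_sub hA (E_mul (E_div hA hB) hB)) => o e _.
by rewrite {1}(divn_eq (A o e) (B o e)) addKn.
Qed.

Lemma E_min A B : E A -> E B -> E (fun o e => minn (A o e) (B o e)).
Proof. by move=> hA hB; apply: E_ext (E_if (E_le (E_succ hA) hB) hA hB) => o e _; rewrite /minn. Qed.

(* iteration with a cap, so that the values stay bounded *)
Definition cpow (C b n : nat) := iteri n (fun _ acc => minn C (acc * b)) (minn C 1).

Lemma cpowE C b n : 0 < b -> cpow C b n = minn C (b ^ n).
Proof.
move=> hb; rewrite /cpow; elim: n => // n IH; rewrite iteriS IH expnSr.
case: (leqP C (b ^ n)) => h; last by [].
have h2 : C <= C * b by rewrite leq_pmulr.
have h3 : C <= b ^ n * b by apply: leq_trans h _; rewrite leq_pmulr.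
by rewrite !(minn_idPl _).
Qed.

Lemma E_cpow A B C : E A -> E B -> E C -> E (fun o e => cpow (A o e) (B o e) (C o e)).
Proof.
move: A B C; apply: (E_app3 (f := fun _ a b c => cpow a b c)).
apply: E_ext (E_rec (E_nth 2) (E_min (E_nth 0) (E_const 1)) (E_min (E_nth 2) (E_mul (E_nth 0) (E_nth 3))) _).
  by [].
exists (fun o e => nth 0 e 0); first by apply: E_pbnd; apply: E_nth.
by move=> o e [|j] _ _ /=; rewrite geq_minl.
Qed.

Lemma E_iterdiv A B C : E A -> E B -> E C -> E (fun o e => iter (C o e) (fun v => v %/ B o e) (A o e)).
Proof.
move: A B C; apply: (E_app3 (f := fun _ a b c => iter c (fun v => v %/ b) a)).
have aux e j : iteri j (fun j acc => nth 0 [:: acc, j & e] 0 %/ nth 0 [:: acc, j & e] 3) (nth 0 e 0) =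
   iter j (fun v => v %/ nth 0 e 1) (nth 0 e 0) by elim: j => //= j ->.
apply: E_ext (E_rec (E_nth 2) (E_nth 0) (E_div (E_nth 0) (E_nth 3)) _).
  by move=> o e _; exact: aux.
exists (fun o e => nth 0 e 0); first by apply: E_pbnd; apply: E_nth.
move=> o e j _ _; rewrite aux; elim: j => //= j IH.
by apply: leq_trans (leq_div _ _) IH.
Qed.

End EClass.

End TermClass.
Import TermClass.

(** * The one-token game *)

Module TokenGame.

Section Token.
Variable N : OCN.

Inductive run : config -> list nat -> config -> Prop :=
  | run0 c : run c nil c
  | runS c a c1 w c2 : ostep N c a c1 -> run c1 w c2 -> run c (a :: w) c2.

Definition accepts (c : config) (w : list nat) := exists2 c', run c w c' & final N c'.1.
Definition live (c : config) := exists w, accepts c w.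

Lemma run_cat c w1 c1 w2 c2 : run c w1 c1 -> run c1 w2 c2 -> run c (w1 ++ w2) c2.
Proof. by move=> h; elim: h => //= c' a c3 w c4 h1 _ IH /IH; apply: runS. Qed.

Lemma run_catE c w1 w2 c2 : run c (w1 ++ w2) c2 -> exists2 c1, run c w1 c1 & run c1 w2 c2.
Proof.
elim: w1 c => [|a w1 IH] c /= h; first by exists c => //; constructor.
by inversion h; subst; have [c3 h1 h2] := IH _ H4; exists c3 => //; apply: runS h1.
Qed.

Lemma reach_run w c : reach N w c <-> run (init N, 0) w c.
Proof.
split=> [h|].
  elim: h => [|w' c' a c1 _ IH hs]; first by constructor.
  by apply: run_cat IH _; apply: runS hs (run0 _).
elim/last_ind: w c => [|w a IH] c; first by move=> h; inversion h; subst; constructor.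
rewrite -cats1 => /run_catE [c1 /IH h1 h2].
inversion h2; subst; inversion H4; subst; exact: reachS h1 H2.
Qed.

Lemma inL_accepts w : inL N w <-> accepts (init N, 0) w.
Proof. by split=> [[c [/reach_run h1 h2]]|[c /reach_run h1 h2]]; exists c. Qed.

Lemma accepts_cons c a w : accepts c (a :: w) <-> exists2 c1, ostep N c a c1 & accepts c1 w.
Proof.
split=> [[c2 h hf]|[c1 h1 [c2 h2 hf]]].
  by inversion h; subst; exists c1 => //; exists c2.
by exists c2 => //; apply: runS h1 h2.
Qed.

Hypothesis wfN : wf N.

Lemma ostep_letter c a c' : ostep N c a c' -> a < nletters N.
Proof. by move=> [d [/(proj2 wfN) []]]. Qed.

(** The one-token game, with Eve at [c] and Adam's token at [c']. After the letter Eve moves first,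
    whence the order of quantifiers. Dead successors of the token are harmless, since no word of the
    language can be exhibited from them. *)
Definition token_closed (R : config -> config -> Prop) := forall c c', R c c' ->
  (final N c'.1 -> final N c.1) /\
  forall a, a < nletters N ->
    (exists2 c1, ostep N c a c1 & forall c1', ostep N c' a c1' -> R c1 c1') \/
    (forall c1', ostep N c' a c1' -> ~ live c1').

Lemma live_step c a c1 : ostep N c a c1 -> live c1 -> live c.
Proof. by move=> h [w hw]; exists (a :: w); apply/accepts_cons; exists c1. Qed.

Lemma token_closed_or_dead R : token_closed R -> token_closed (fun c c' => R c c' \/ ~ live c').
Proof.
move=> hR c c' [/hR [h1 h2]|hd].
  split=> // a /h2 [[c1 h3 h4]|h3]; [left | by right].
  by exists c1 => // c1' /h4; left.
split=> [hf|a ha]; first by case: hd; exists nil, c' => //; constructor.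
by right=> c1' hs hl; apply: hd; apply: live_step hs hl.
Qed.

Lemma token_closed_accepts R : token_closed R -> forall w c c', R c c' -> accepts c' w -> accepts c w.
Proof.
move=> hR; elim=> [|a w IH] c c' /hR [h1 h2].
  by move=> [c2 h hf]; inversion h; subst; exists c; [constructor | apply: h1].
move=> /accepts_cons [c1' hs hw].
have [[c1 h3 h4]|h3] := h2 _ (ostep_letter hs).
  by apply/accepts_cons; exists c1 => //; apply: IH (h4 _ hs) hw.
by case: (h3 _ hs); exists w.
Qed.

Lemma play_rcons s w a :
  play N s (w ++ [:: a]) = if play N s w is Some c then s w c a else None.
Proof.
have e : List.rev (w ++ [:: a]) = a :: List.rev w by exact: List.rev_app_distr w [:: a].
by rewrite /play e /= List.rev_involutive.
Qed.

Lemma letters_ok_rcons w a : letters_ok N (w ++ [:: a]) <-> letters_ok N w /\ a < nletters N.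
Proof.
split=> [h|[h1 h2] b /List.in_app_iff [/h1 //|[<-|[]]] //].
split=> [b hb|]; apply: h; apply/List.in_app_iff; [by left | by right; left].
Qed.

(** From left to right, Eve's strategy is paired with every run on the same word. From right to left
    she keeps [R c c]: she plays against a copy of her own token and picks a successor that beats
    all its siblings. An accepting continuation through a sibling is then available from the chosen
    successor, so no word of the language is ever lost. *)
Theorem HD_token_closed : history_deterministic N <->
  exists2 R, token_closed R & R (init N, 0) (init N, 0).
Proof.
split=> [[s hs]|[R0 hR0 h0]].
  pose R c c' := (exists w, [/\ letters_ok N w, play N s w = Some c & reach N w c']) \/ ~ live c'.
  exists R; last by left; exists nil; split=> //; constructor.
  have hsafe c c' : R c c' -> final N c'.1 -> final N c.1.
    move=> [[w [hw hp hr]]|hd] hf; last by case: hd; exists nil, c' => //; constructor.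
    elim/last_ind: w hw hp hr => [|w a _] hw hp hr.
      by move: hp => [<-]; move/reach_run: hr => hr; inversion hr; subst.
    rewrite -cats1 in hw hp hr.
    have [hw1 ha] := iffLR (letters_ok_rcons w a) hw.
    move: hp; rewrite play_rcons; case E: (play N s w) => [c0|//] e.
    by have := hs w a c0 hw1 ha E; rewrite e => -[_]; apply; exists c'.
  move=> c c' h; split; first exact: hsafe h.
  case: h => [[w [hw hp hr]]|hd] a ha; last first.
    by right=> c1' h hl; apply: hd; apply: live_step h hl.
  have := hs w a c hw ha hp; case E: (s w c a) => [c1|] [h1 h2]; [left|right].
    exists c1 => // c1' hst; left; exists (w ++ [:: a]); split.
    - by apply/letters_ok_rcons.
    - by rewrite play_rcons hp.
    - exact: reachS hr hst.
  move=> c1' hst [u [c2 hrun hf]]; apply: h2; exists u; rewrite -catA /=.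
  apply/inL_accepts; exists c2 => //; apply: run_cat (runS hst hrun).
  by apply/reach_run.
pose R c c' := R0 c c' \/ ~ live c'.
have hR : token_closed R by apply: token_closed_or_dead.
pose good c a c1 := ostep N c a c1 /\ forall c1', ostep N c a c1' -> R c1 c1'.
pose s (w : list nat) c a : option config :=
  match excluded_middle_informative (exists c1, good c a c1) with
  | left h => Some (proj1_sig (constructive_indefinite_description _ h))
  | right _ => None end.
have sP w c a : if s w c a is Some c1 then good c a c1 else forall c1, ~ good c a c1.
  rewrite /s; case: excluded_middle_informative => [h|h]; first by case: constructive_indefinite_description.
  by move=> c1 hc1; apply: h; exists c1.
(* Eve must move whenever she can. If all successors are dead any of them is good, because [R] was
   enlarged by the dead tokens. *)
have key c a : R c c -> a < nletters N -> (exists c1, good c a c1) \/ (forall c1, ~ ostep N c a c1).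
  move=> hc ha; have [_ /(_ a ha) [[c1 h1 h2]|h]] := hR _ _ hc; first by left; exists c1.
  case: (classic (exists c1, ostep N c a c1)) => [[c1 h1]|hn]; last by right=> c1 h1; apply: hn; exists c1.
  by left; exists c1; split=> // c1' /h hd; right.
have inv w c : letters_ok N w -> play N s w = Some c ->
   R c c /\ forall u, inL N (w ++ u) -> accepts c u.
  elim/last_ind: w c => [|w a IH] c hw hp.
    by case: hp => <-; split; [left | move=> u /inL_accepts].
  rewrite -cats1 in hw hp; have [hw1 ha] := iffLR (letters_ok_rcons w a) hw.
  move: hp; rewrite play_rcons; case E: (play N s w) => [c0|//] e.
  have [h1 h2] := IH _ hw1 E; have := sP w c0 a; rewrite e => -[g1 g2].
  split=> [|u]; first exact: g2.
  rewrite -cats1 -catA /= => /h2 /accepts_cons [c1 /g2 hc1 hu].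
  exact: token_closed_accepts hR _ _ _ hc1 hu.
exists s => w a c hw ha hp.
have [h1 h2] := inv w c hw hp.
have := sP w c a; case E: (s w c a) => [c1|] hg.
  split; first by case: hg.
  move=> /[dup] hin; rewrite -[w ++ _]cats0 -catA /= => _.
  have hp' : play N s (w ++ [:: a]) = Some c1 by rewrite play_rcons hp.
  have [|_ hacc] := inv (w ++ [:: a]) c1 _ hp'; first by apply/letters_ok_rcons.
  have [|c2 hr hf] := hacc nil; first by rewrite cats0.
  by inversion hr; subst.
have hno c1 : ~ ostep N c a c1.
  by case: (key c a h1 ha) => [[c2 /hg]|] //; apply.
by split=> // -[u]; rewrite -catA /= => /h2 /accepts_cons [c1 /hno].
Qed.

End Token.

End TokenGame.
Import TokenGame.

(** * The input encoding *)

Module Encoding.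

Definition bit_sym (b : bool) : sym := if b then S1 else S0.

(** Peels off the last, least significant digit; it replaces the recursion on [positive] in the
    later facts about binary words. *)
Lemma nat_bits_rec v :
  nat_bits v = (if v %/ 2 == 0 then [::] else nat_bits (v %/ 2)) ++ [:: bit_sym (odd v)].
Proof.
rewrite /nat_bits; case: v => [|v] //.
case E: (N.of_nat v.+1) => [|[q|q|]]; first by lia.
- have e1 : v.+1 %/ 2 = Pos.to_nat q by lia.
  have e2 : N.of_nat (Pos.to_nat q) = Npos q by lia.
  have e3 : odd v.+1 = true by lia.
  by rewrite e1 e2 e3; case: eqP => //; lia.
- have e1 : v.+1 %/ 2 = Pos.to_nat q by lia.
  have e2 : N.of_nat (Pos.to_nat q) = Npos q by lia.
  have e3 : odd v.+1 = false by lia.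
  by rewrite e1 e2 e3; case: eqP => //; lia.
have e1 : v = 0 by lia.
by rewrite e1.
Qed.

Fixpoint bits_val (v : nat) (s : seq sym) : nat :=
  match s with [::] => v | c :: s' => bits_val (if c == S1 then v.*2.+1 else v.*2) s' end.

Lemma bits_val_cat v s1 s2 : bits_val v (s1 ++ s2) = bits_val (bits_val v s1) s2.
Proof. by elim: s1 v => //= c s1 IH v. Qed.

Lemma nat_bits_val v : bits_val 0 (nat_bits v) = v.
Proof.
elim/ltn_ind: v => v IH; rewrite nat_bits_rec bits_val_cat.
have e : bits_val 0 (if v %/ 2 == 0 then [::] else nat_bits (v %/ 2)) = v %/ 2.
  by case: eqP => [->//|h]; apply: IH; lia.
rewrite e /=; case E: (odd v) => /=; lia.
Qed.

Lemma nat_bits_inj : injective nat_bits.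
Proof. by move=> a b /(congr1 (bits_val 0)); rewrite !nat_bits_val. Qed.

Lemma nat_bits_noSh v : all (fun c => c != Sh) (nat_bits v).
Proof.
elim/ltn_ind: v => v IH; rewrite nat_bits_rec all_cat; apply/andP; split; last by case: (odd v).
by case: eqP => // h; apply: IH; lia.
Qed.

(** The separator never occurs inside a field, so fields can be cut off one at a time. *)
Lemma cat_Sh_inj (l1 l2 s1 s2 : seq sym) : all (fun c => c != Sh) l1 -> all (fun c => c != Sh) l2 ->
  l1 ++ Sh :: s1 = l2 ++ Sh :: s2 -> l1 = l2 /\ s1 = s2.
Proof.
elim: l1 l2 => [|c l1 IH] [|d l2] /=; first by move=> _ _ [->].
- by move=> _ /andP[/negP h _] [e]; case: h; rewrite -e.
- by move=> /andP[/negP h _] _ [e]; case: h; rewrite e.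
by move=> /andP[_ h1] /andP[_ h2] [<-] /(IH _ h1 h2) [<- <-].
Qed.

Lemma enc_nat_inj a b s1 s2 : enc_nat a ++ s1 = enc_nat b ++ s2 -> a = b /\ s1 = s2.
Proof.
rewrite /enc_nat -!catA /= => /cat_Sh_inj [||/nat_bits_inj -> ->] //; exact: nat_bits_noSh.
Qed.

Lemma enc_unary_inj a b s1 s2 : enc_unary a ++ s1 = enc_unary b ++ s2 -> a = b /\ s1 = s2.
Proof.
have rp k : all (fun c => c != Sh) (List.repeat S1 k) by elim: k.
have sz k : size (List.repeat S1 k) = k by elim: k => //= k ->.
rewrite /enc_unary -!catA /= => /cat_Sh_inj [//|//|e ->]; split=> //.
by rewrite -(sz a) e sz.
Qed.

Lemma enc_Z_inj a b s1 s2 : enc_Z a ++ s1 = enc_Z b ++ s2 -> a = b /\ s1 = s2.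
Proof.
rewrite /enc_Z !cat_cons => -[hs /enc_nat_inj [e ->]]; split=> //.
by move: hs; case: (Z.ltb_spec a 0); case: (Z.ltb_spec b 0) => //; lia.
Qed.

Lemma enc_trans_inj t1 t2 s1 s2 : enc_trans t1 ++ s1 = enc_trans t2 ++ s2 -> t1 = t2 /\ s1 = s2.
Proof.
have cA (a b c d s : seq sym) : (a ++ b ++ c ++ d) ++ s = a ++ b ++ c ++ d ++ s by rewrite -!catA.
case: t1 t2 => [[[q a] d] p] [[[q' a'] d'] p']; rewrite /enc_trans !cA.
by move=> /enc_nat_inj [-> /enc_nat_inj [-> /enc_Z_inj [-> /enc_nat_inj [-> ->]]]].
Qed.

Lemma enc_trans_nonnil t : enc_trans t <> [::].
Proof. by case: t => [[[q a] d] p]; rewrite /enc_trans /enc_nat; case: (nat_bits q). Qed.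

Lemma flat_map_enc_trans_inj l1 l2 :
  List.flat_map enc_trans l1 = List.flat_map enc_trans l2 -> l1 = l2.
Proof.
elim: l1 l2 => [|t l1 IH] [|t' l2] //=.
- by have := @enc_trans_nonnil t'; case: (enc_trans t').
- by have := @enc_trans_nonnil t; case: (enc_trans t).
by move=> /enc_trans_inj [-> /IH ->].
Qed.

Lemma encode_inj N N' : encode N = encode N' ->
  [/\ nstates N = nstates N', nletters N = nletters N', init N = init N', trans N = trans N' &
   forall q, q < nstates N -> final N q = final N' q].
Proof.
rewrite /encode => /enc_unary_inj [e1 /enc_unary_inj [e2 /enc_nat_inj [e3]]].
have fin f k : all (fun c => c != Sh) (List.map (fun q => if f q : bool then S1 else S0) (List.seq 0 k)).
  by elim: (List.seq 0 k) => //= a l ->; case: (f a).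
rewrite -!catA /= => /cat_Sh_inj [||e4 /flat_map_enc_trans_inj e5]; try exact: fin.
split=> // q hq; rewrite -e1 in e4.
have [h1 h2] : List.nth_error (List.map (fun q => if final N q then S1 else S0) (List.seq 0 (nstates N))) q
   = Some (if final N q then S1 else S0) /\
   List.nth_error (List.map (fun q => if final N' q then S1 else S0) (List.seq 0 (nstates N))) q
   = Some (if final N' q then S1 else S0).
  have e : List.nth_error (List.seq 0 (nstates N)) q = Some q.
    by rewrite List.nth_error_seq; case: Nat.ltb_spec => //; lia.
  by rewrite !List.nth_error_map e.
by move: h1; rewrite e4 h2 => -[]; case: (final N q); case: (final N' q).
Qed.

(** An encoding determines [final] on the actual states only. Well-formedness keeps all runs among
    them, so the remaining values do not influence the game. *)
Lemma HD_equiv N N' : wf N ->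
  nstates N = nstates N' -> nletters N = nletters N' -> init N = init N' -> trans N = trans N' ->
  (forall q, q < nstates N -> final N q = final N' q) ->
  history_deterministic N -> history_deterministic N'.
Proof.
move=> wfN e1 e2 e3 e4 e5 [s hs].
have st c a c' : ostep N c a c' <-> ostep N' c a c' by rewrite /ostep e4.
have lt c a c' : ostep N c a c' -> c'.1 < nstates N by move=> [d [/(proj2 wfN) []]].
have rch w c : reach N w c -> reach N' w c /\ c.1 < nstates N.
  elim=> [|w' c1 a c2 _ [IH _] h]; first by rewrite e3; split; [constructor | rewrite -e3; case: wfN].
  by split; [apply: reachS IH _; apply/st | apply: lt h].
have rch' w c : reach N' w c -> reach N w c.
  elim=> [|w' c1 a c2 _ IH h]; first by rewrite -e3; constructor.
  by apply: reachS IH _; apply/st.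
have il w : inL N w <-> inL N' w.
  split=> -[c [h1 h2]]; exists c.
    by have [h3 h4] := rch _ _ h1; rewrite -e5.
  by have h3 := rch' _ _ h1; have [_ h4] := rch _ _ h3; rewrite e5.
have pl w : play N' s w = play N s w.
  by rewrite /play; elim: (List.rev w) => [|a rw IH] /=; rewrite ?e3 ?IH.
exists s => w a c hw ha; rewrite pl => hp.
have hw' : letters_ok N w by move=> b /hw; rewrite e2.
rewrite -e2 in ha; have := hs w a c hw' ha hp; case: (s w c a) => [c1|] [h1 h2]; split.
- by apply/st.
- by move=> /il /h2; rewrite e5 //; apply: lt h1.
- by move=> c' /st; apply: h1.
- by move=> [u /il h]; apply: h2; exists u.
Qed.

Lemma HD_problem_encode N : wf N -> (HD_problem (encode N) <-> history_deterministic N).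
Proof.
move=> wfN; split=> [[N' [wf' [e hd]]]|]; last by exists N.
have [h1 h2 h3 h4 h5] := encode_inj e.
exact: (HD_equiv wf' h1 h2 h3 h4 h5 hd).
Qed.

End Encoding.
Import Encoding.

(** * Computation tableaux *)

Module Tableau.

Section Tableau.
Variables (G : finType) (M : TM G) (x : seq G).

(* [None] is the left border of a row; [Some (Some q, a)] is the scanned cell. *)
Definition tsym : finType := option (option (tm_state M) * tm_tape M).

Definition tconf_sym (c : tconf M) (p : nat) : tsym :=
  let: (q, (l, h, r)) := c in
  if p is p'.+1 then Some (if p' == size l then Some q else None, nth (tm_blank M) (rev l ++ h :: r) p')
  else None.

Definition hstate (q : tm_state M) := (q == tm_acc M) || (q == tm_rej M).

(** The local rule of the tableau. A left move next to the border leaves the head in place, as in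
    [tstep], and a halted head is copied, so rows can be continued for ever. *)
Definition next_sym (s1 s2 s3 : tsym) : tsym :=
  match s2 with
  | None => None
  | Some (Some q, a) =>
      if hstate q then s2 else
      let: (q', a', d) := tm_delta q a in
      match d with
      | DS => Some (Some q', a')
      | DR => Some (None, a')
      | DL => if s1 is None then Some (Some q', a') else Some (None, a')
      end
  | Some (None, a) =>
      let right := if s1 is Some (Some q, b) then
          if hstate q then None else
          if tm_delta q b is (q', _, DR) then Some q' else None
        else None in
      let left := if s3 is Some (Some q, b) then
          if hstate q then None else
          if tm_delta q b is (q', _, DL) then Some q' else None
        else None in
      Some (if right is Some q' then Some q' else left, a)
  end.

Lemma nth_tape (T : Type) (b : T) l h r i :
  nth b (rev l ++ h :: r) i = if i < size l then nth b l (size l - i.+1)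
   else if i == size l then h else nth b r (i - (size l).+1).
Proof.
rewrite nth_cat size_rev; case: ltnP => hi; first by rewrite nth_rev.
case: eqP => [->|ne]; first by rewrite subnn.
by have -> : i - size l = (i - (size l).+1).+1 by lia.
Qed.

(** A row described by head position and cell function, which frees the local rule from the zipper
    form of the tape. *)
Definition row_sym (q : tm_state M) (k : nat) (f : nat -> tm_tape M) (p : nat) : tsym :=
  if p is p'.+1 then Some (if p' == k then Some q else None, f p') else None.

Lemma row_sym_step q k f q' h' d p :
  hstate q = false -> tm_delta q (f k) = (q', h', d) ->
  row_sym q' (match d with DS => k | DR => k.+1 | DL => k.-1 end)
    (fun i => if i == k then h' else f i) p.+1 =
  next_sym (row_sym q k f p) (row_sym q k f p.+1) (row_sym q k f p.+2).
Proof.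
move=> hq D; rewrite /row_sym.
have nS m : (m.+1 == m) = false by apply/eqP; lia.
have Sn m : (m == m.+1) = false by apply/eqP; lia.
case: (eqVneq p k) => [->|ne] /=.
  by rewrite hq D; case: d D => D; rewrite ?eqxx ?Sn //; case: k D => [|k] D /=; rewrite ?eqxx ?nS.
case: (eqVneq p.+1 k) => [e|ne2].
  have hp : (if p is p'.+1 then Some (if p' == k then Some q else None, f p') else None) =
            (if p is p'.+1 then Some (None, f p') else None) :> tsym.
    by case: (p) e => // p' e; have -> : (p' == k) = false by apply/eqP; lia.
  rewrite hp -e /= in D *; rewrite hq D.
  have -> : (if p is p'.+1 then Some (None, f p') else None : tsym) = 
     (if p is p'.+1 then Some (None, f p') else None) by [].
  by case: d D => D; rewrite ?eqxx ?Sn; case: (p) => // p'; rewrite ?Sn //; have -> : (p'.+1 == p'.+3) = false by apply/eqP; lia.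
case: p ne ne2 => [|p] ne ne2.
  case: d D => D; rewrite ?(negPf ne) //; case: k ne ne2 D => [|[|k]] //=.
case: (eqVneq p k) => [->|ne3].
  rewrite hq D; case: d D => D; rewrite ?eqxx ?nS //; case: k {ne ne2 D} => [|k] //=.
  by have -> : (k.+2 == k) = false by apply/eqP; lia.
case: d D => D; rewrite ?(negPf ne) //.
  by have -> : (p.+1 == k.-1) = false by apply/eqP; move/eqP: ne2; lia.
by have -> : (p.+1 == k.+1) = false by rewrite eqSS; apply/negbTE.
Qed.

Lemma row_sym_ext q k f f' p : f =1 f' -> row_sym q k f p = row_sym q k f' p.
Proof. by move=> h; case: p => //= p; rewrite h. Qed.

Lemma tconf_sym_step c p :
  tconf_sym (tstep c) p.+1 = next_sym (tconf_sym c p) (tconf_sym c p.+1) (tconf_sym c p.+2).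
Proof.
case: c => q [[l h] r]; rewrite /tstep /halted [(_, _).1]/=.
pose f i := nth (tm_blank M) (rev l ++ h :: r) i.
have hf : f (size l) = h by rewrite /f nth_tape ltnn eqxx.
have eS p' : tconf_sym (q, (l, h, r)) p' = row_sym q (size l) f p' by [].
rewrite !eS; case E: (_ || _).
  have hq : hstate q by [].
  rewrite eS /row_sym /next_sym /=; case: (p == size l); first by rewrite hq.
  case: p => [|p]; first by case: (1 == size l); rewrite ?hq.
  by case: (p == size l); case: (p.+2 == size l); rewrite ?hq.
have hq : hstate q = false by [].
case D: (tm_delta q h) => [[q' h'] d].
rewrite -(@row_sym_step q _ f q' h' d) // ?hf //.
case: d {D}.
- case: l @f hf {eS} => [|b l] f hf.
    rewrite -[LHS]/(row_sym q' 0 (fun i => nth (tm_blank M) (h' :: r) i) p.+1).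
    by apply: row_sym_ext => i; case: i.
  rewrite -[LHS]/(row_sym q' (size l) (fun i => nth (tm_blank M) (rev l ++ [:: b, h' & r]) i) p.+1).
  apply: row_sym_ext => i; rewrite /f !nth_tape /=; case: (ltngtP i (size l)) => hi.
  + rewrite ltnS (ltnW hi) ifN; last by apply/eqP; lia.
    by have -> : (size l).+1 - i.+1 = (size l - i.+1).+1 by lia.
  + case: (eqVneq i (size l).+1) => [->|ne]; first by rewrite subnn.
    rewrite ifN; last by rewrite -leqNgt.
    by have -> : i - (size l).+1 = (i - (size l).+2).+1 by move/eqP: ne; lia.
  + rewrite hi ltnSn subnn ifN //; apply/eqP; lia.
- set c' := match r with [::] => _ | _ :: _ => _ end.
  have -> : tconf_sym c' p.+1 = row_sym q' (size l).+1
     (fun i => nth (tm_blank M) (rev l ++ h' :: r) i) p.+1.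
    rewrite /c'; case: (r) => [|b r'] /=; rewrite rev_cons -cats1 -catA /=; congr (Some (_, _)).
    rewrite !nth_cat /= size_rev; case: ltnP => // hp.
    by case: (p - size l) => [|[|m]] //=; rewrite nth_nil.
  by apply: row_sym_ext => i; rewrite /f !nth_tape; case: ltngtP.
- rewrite -[LHS]/(row_sym q' (size l) (fun i => nth (tm_blank M) (rev l ++ h' :: r) i) p.+1).
  by apply: row_sym_ext => i; rewrite /f !nth_tape; case: ltngtP.
Qed.

Variable W : nat.
Hypothesis hW : 1 < W.

Definition hpos (c : tconf M) : nat := let: (_, (l, _, _)) := c in size l.

Hypothesis hhead : forall t, hpos (trun M x t) + 1 < W.

(** Rows are laid end to end, so the three cells above cell [i] are at distances [W + 1], [W] and
    [W - 1]: constants that a net can subtract. *)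
Definition tab (i : nat) : tsym := tconf_sym (trun M x (i %/ W)) (i %% W).

Lemma tconf_sym_None c p : (tconf_sym c p == None) = (p == 0).
Proof. by case: c => q [[l h] r]; case: p. Qed.

Lemma tab_border i : (tab i == None) = (i %% W == 0).
Proof. exact: tconf_sym_None. Qed.

Lemma tab_border_step i : W <= i -> (tab (i - W) == None) = (tab i == None).
Proof. by move=> h; rewrite !tab_border -{2}(subnK h) modnDr. Qed.

Lemma tab_step i : W <= i -> tab i != None ->
  tab i = next_sym (tab (i - (W + 1))) (tab (i - W)) (tab (i - (W - 1))).
Proof.
move=> hi; rewrite tab_border => hne.
have eW := divn_eq (i - W) W.
have ei : i = ((i - W) %/ W).+1 * W + (i - W) %% W by rewrite mulSn; lia.
set r := (i - W) %/ W in eW ei; set p := (i - W) %% W in eW ei.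
have hp : p < W by rewrite ltn_mod; lia.
have tabE r' p' : p' < W -> tab (r' * W + p') = tconf_sym (trun M x r') p'.
  by move=> hp'; rewrite /tab divnMDl ?modnMDl ?(divn_small hp') ?(modn_small hp') ?addn0 //; lia.
have p0 : 0 < p by rewrite lt0n; move: hne; rewrite {1}ei modnMDl modn_small.
case Ep: p p0 => [//|p'] _; rewrite Ep in ei eW hp.
have -> : i - (W + 1) = r * W + p' by lia.
rewrite eW {1}ei !tabE //; last by lia.
have -> : trun M x r.+1 = tstep (trun M x r) by [].
rewrite tconf_sym_step.
case: (ltnP p'.+2 W) => h2.
  have -> : i - (W - 1) = r * W + p'.+2 by lia.
  by rewrite tabE.
(* In the last column the third cell is the border of the row of [i] itself. The true right
   neighbour carries no head by [hhead], so [next_sym] gives the same result. *)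
have -> : i - (W - 1) = r.+1 * W + 0 by rewrite mulSn; lia.
rewrite tabE; last by lia.
rewrite (_ : tconf_sym _ 0 = None); last by apply/eqP; rewrite tconf_sym_None.
have ep : p'.+2 = W by lia.
have := hhead r; rewrite /hpos; case: (trun M x r) => q [[l h] rr] hl /=.
by have -> : (p'.+1 == size l) = false by apply/eqP; lia.
Qed.

End Tableau.

End Tableau.
Import Tableau.

(** * The tableau game *)

Module TableauGame.

Section Net.
Variables (G : finType) (M : TM G) (x : seq G) (W : nat).
Notation sy := (tsym M).
Notation n := (size x).

(** Adam plays from [U], Eve from [Pm]. [Cl g] carries the claim that the current cell holds [g],
    [Tr t j] says that Eve disputes the [j]-th symbol of [t], and [Fx], [G1], [G2] test claims about
    the first row. [Cp], [Ce], [Cd] imitate [U], [Ue], [Ud], and [Top] reads every letter. *)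
Inductive hst :=
  | Q0 | U | Ue | Ud | Pm | Cp | Ce | Cd | Top | Fx | G1 | G2
  | Cl of sy | Tr of sy * sy * sy & 'I_3.

Definition hst_code (s : hst) : 'I_12 + sy + (sy * sy * sy * 'I_3) :=
  match s with
  | Q0 => inl (inl (inord 0)) | U => inl (inl (inord 1)) | Ue => inl (inl (inord 2))
  | Ud => inl (inl (inord 3)) | Pm => inl (inl (inord 4)) | Cp => inl (inl (inord 5))
  | Ce => inl (inl (inord 6)) | Cd => inl (inl (inord 7)) | Top => inl (inl (inord 8))
  | Fx => inl (inl (inord 9)) | G1 => inl (inl (inord 10)) | G2 => inl (inl (inord 11))
  | Cl s => inl (inr s) | Tr t j => inr (t, j)
  end.
Definition hst_decode (c : 'I_12 + sy + (sy * sy * sy * 'I_3)) : hst :=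
  match c with
  | inl (inl i) => nth Q0 [:: Q0; U; Ue; Ud; Pm; Cp; Ce; Cd; Top; Fx; G1; G2] i
  | inl (inr s) => Cl s | inr (t, j) => Tr t j
  end.
Lemma hst_codeK : cancel hst_code hst_decode.
Proof. by case=> //=; rewrite inordK. Qed.
HB.instance Definition _ := Equality.copy hst (can_type hst_codeK).
HB.instance Definition _ := Finite.copy hst (can_type hst_codeK).

Inductive hlt :=
  | LA | LInc | LHs | LB | LY | LZ | LD | LStart of sy | LTr of sy * sy * sy | LJ of 'I_3.

Definition hlt_code (a : hlt) : 'I_7 + sy + (sy * sy * sy) + 'I_3 :=
  match a with
  | LA => inl (inl (inl (inord 0))) | LInc => inl (inl (inl (inord 1)))
  | LHs => inl (inl (inl (inord 2))) | LB => inl (inl (inl (inord 3)))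
  | LY => inl (inl (inl (inord 4))) | LZ => inl (inl (inl (inord 5)))
  | LD => inl (inl (inl (inord 6)))
  | LStart s => inl (inl (inr s)) | LTr t => inl (inr t) | LJ j => inr j
  end.
Definition hlt_decode (c : 'I_7 + sy + (sy * sy * sy) + 'I_3) : hlt :=
  match c with
  | inl (inl (inl i)) => nth LA [:: LA; LInc; LHs; LB; LY; LZ; LD] i
  | inl (inl (inr s)) => LStart s | inl (inr t) => LTr t | inr j => LJ j
  end.
Lemma hlt_codeK : cancel hlt_code hlt_decode.
Proof. by case=> //=; rewrite inordK. Qed.
HB.instance Definition _ := Equality.copy hlt (can_type hlt_codeK).
HB.instance Definition _ := Finite.copy hlt (can_type hlt_codeK).

(** Updates are symbolic because the reduction must print those of size about [W] without computing
    their values. *)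
Inductive wt := W0 | Wp | Wm | WK of 'I_3 | WW | WN | WPos.

Definition jump (j : 'I_3) : nat := match val j with 0 => W + 1 | 1 => W | _ => W - 1 end.

(* [k] is the position announced by the letter, used by [WPos] only *)
Definition wz (k : nat) (w : wt) : Z :=
  (match w with
  | W0 => 0 | Wp => 1 | Wm => -1 | WK j => - Z.of_nat (jump j)
  | WW => - Z.of_nat W | WN => - Z.of_nat n.+2 | WPos => - Z.of_nat k
  end)%Z.

Inductive cls := CU | CE | CD.

(** The phase of a state: claims are being justified, a final test is pending, the test is over.
    Eve's invariant compares phases, and counters until the last phase. *)
Definition cls_of (s : hst) : option cls :=
  match s with
  | Q0 | Top => None
  | U | Pm | Cp | Cl _ | Tr _ _ => Some CU
  | Ue | Ce | Fx | G1 | G2 => Some CE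
  | Ud | Cd => Some CD
  end.

Definition mirror (c : cls) := match c with CU => U | CE => Ue | CD => Ud end.
Definition copy (c : cls) := match c with CU => Cp | CE => Ce | CD => Cd end.

Definition mstep (c : cls) (a : hlt) : option (wt * cls) :=
  match c, a with
  | CU, LInc => Some (Wp, CU) | CU, LStart _ => Some (W0, CU) | CU, LTr _ => Some (W0, CU)
  | CU, LJ j => Some (WK j, CU) | CU, LHs => Some (WW, CU) | CU, LB => Some (W0, CE)
  | CE, LZ => Some (W0, CD) | CE, LY => Some (WN, CD)
  | _, _ => None
  end.

Definition tr3 (t : sy * sy * sy) (j : 'I_3) : sy :=
  match val j with 0 => t.1.1 | 1 => t.1.2 | _ => t.2 end.

Definition rejsym (s : sy) : bool :=
  if s is Some (Some q, _) then (q == tm_rej M) && (q != tm_acc M) else false.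

Definition blanksym : sy := Some (None, tm_blank M).

(** Where Eve cannot simply imitate. A letter that does not fit the current claim is absent here and
    falls back to imitation, so illegal justifications gain Adam nothing. In the tests, [LZ] costs
    [Fx] one unit and [G1] a full row, while [G2] has no answer to [LY]. *)
Definition special (s : hst) (a : hlt) : option (seq (wt * hst)) :=
  match s, a with
  | Pm, LInc => Some [:: (Wp, Pm)]
  | Pm, LStart g => if rejsym g then Some [:: (W0, Cl g)] else None
  | Cl g, LTr t => if (g != None) && (next_sym t.1.1 t.1.2 t.2 == g) then
       Some [:: (W0, Tr t (inord 0)); (W0, Tr t (inord 1)); (W0, Tr t (inord 2))] else None
  | Cl g, LHs => if g == None then Some [:: (WW, Cl g)] else None
  | Cl g, LB => if g == blanksym then Some [:: (W0, G1); (W0, G2)] else None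
  | Tr t j, LJ i => if i == j then Some [:: (WK j, Cl (tr3 t j))] else None
  | Fx, LZ => Some [:: (Wm, Cd)]
  | G1, LZ => Some [:: (WW, Cd)]
  | G2, LY => Some [::]
  | _, _ => None
  end.

Definition mtrans (f : cls -> hst) (c : cls) (a : hlt) : seq (wt * hst) :=
  if mstep c a is Some (w, c') then [:: (w, f c')] else [::].

(** [LD] forces Eve to answer the first letter with [Pm]: had she taken [U], Adam would take [Pm]
    and read [LD], which [U] cannot follow. *)
Definition delta (s : hst) (a : hlt) : seq (wt * hst) :=
  match s with
  | Q0 => if a is LA then [:: (W0, U); (W0, Pm)] else [::]
  | Top => [:: (W0, Top)]
  | U => mtrans mirror CU a | Ue => mtrans mirror CE a | Ud => mtrans mirror CD a
  | _ => if a is LD then [:: (W0, Top)] else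
         if special s a is Some l then l
         else if cls_of s is Some c then mtrans copy c a else [::]
  end.

(** A position letter announces the cell number and subtracts it. If the claimed symbol is the one
    at the announced cell, Eve lands in [Fx], where she survives [LZ] only with a positive counter,
    that is, if the announced position was not the actual one. *)
Definition dpos (sk : sy) (s : hst) : seq (wt * hst) :=
  match s with
  | Top => [:: (W0, Top)]
  | U => [:: (WPos, Ue)]
  | Pm | Cp | Tr _ _ => [:: (WPos, Ce)]
  | Cl g => [:: (WPos, if g == sk then Fx else Ce)]
  | _ => [::]
  end.

Definition row0 (k : nat) : sy := tconf_sym (tinit M x) k.

Definition letter := (hlt + nat)%type.

Definition deltaL (s : hst) (a : letter) : seq (wt * hst) :=
  match a with inl a => delta s a | inr k => dpos (row0 k) s end.

Definition lpos (a : letter) : nat := if a is inr k then k else 0.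

Definition astep (s : hst) (v : nat) (a : letter) (s' : hst) (v' : nat) : Prop :=
  exists w, [/\ List.In (w, s') (deltaL s a), (0 <= Z.of_nat v + wz (lpos a) w)%Z &
    Z.of_nat v' = (Z.of_nat v + wz (lpos a) w)%Z].

Definition lvalid (a : letter) : bool := if a is inr k then k < n.+2 else true.

Definition aclosed (R : hst -> nat -> hst -> nat -> Prop) := forall s v s' v', R s v s' v' ->
  forall a, lvalid a ->
   (exists s1 v1, astep s v a s1 v1 /\ forall s1' v1', astep s' v' a s1' v1' -> R s1 v1 s1' v1') \/
   (forall s1' v1', ~ astep s' v' a s1' v1').

Hypothesis hW : n.+2 < W.
Hypothesis hhead : forall t, hpos (trun M x t) + 1 < W.
Notation tab := (tab M x W).

Let hW1 : 1 < W. Proof. by lia. Qed.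

Lemma tab_row0 k : k < W -> tab k = row0 k.
Proof. by move=> h; rewrite /tab divn_small ?modn_small. Qed.

Lemma row0_blank k : n.+1 < k -> row0 k = blanksym.
Proof.
rewrite /row0 /tinit => hk; case E: x => [|y x'] /=; move: hk; rewrite E;
  case: k => [|[|k]] //= hk; first by rewrite nth_nil.
by rewrite nth_default // -[List.map _ _]/(map (tm_inp M) x') size_map; lia.
Qed.

(** The pending claim is false, or the pending test comes out in Eve's favour. In [Tr] the premise
    is there because a jump larger than the counter cannot be played. *)
Definition good (s : hst) (v : nat) : Prop :=
  match s with
  | Pm | Cp | Ce | Cd => True
  | Cl g => g <> tab v
  | Tr t j => jump j <= v -> tr3 t j <> tab (v - jump j)
  | Fx => 0 < v
  | G1 => W <= v
  | G2 => v < n.+2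
  | _ => False
  end.

Definition Rgood s v s' v' : Prop :=
  [\/ [/\ s = Q0, v = 0, s' = Q0 & v' = 0], s = Top |
      [/\ good s v, cls_of s' = cls_of s & (cls_of s <> Some CD -> v = v')]].

(** Adam's token need not be in a mirror state. Whatever its state, its update is the one prescribed
    by the phase, until the last phase is entered. *)
Lemma mirror_step s v a s1 v1 c : cls_of s = Some c -> astep s v (inl a) s1 v1 -> a <> LD ->
  exists w c', [/\ mstep c a = Some (w, c'), cls_of s1 = Some c',
    (0 <= Z.of_nat v + wz 0 w)%Z & c' <> CD -> Z.of_nat v1 = (Z.of_nat v + wz 0 w)%Z].
Proof.
have main (f : cls -> hst) : (forall c, cls_of (f c) = Some c) ->
  (exists w, [/\ List.In (w, s1) (mtrans f c a), (0 <= Z.of_nat v + wz 0 w)%Z &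
    Z.of_nat v1 = (Z.of_nat v + wz 0 w)%Z]) ->
  exists w c', [/\ mstep c a = Some (w, c'), cls_of s1 = Some c',
    (0 <= Z.of_nat v + wz 0 w)%Z & c' <> CD -> Z.of_nat v1 = (Z.of_nat v + wz 0 w)%Z].
  move=> hf [w []]; rewrite /mtrans; case: (mstep c a) => [[w' c']|] //= [] // [<- <-] h1 h2.
  by exists w', c'; rewrite hf.
have hcopy d : cls_of (copy d) = Some d by case: d.
have hmirror d : cls_of (mirror d) = Some d by case: d.
rewrite /astep [lpos _]/= [deltaL _ _]/= => hc hs ha.
case: s hc hs => [||||||||||||g|t j] //= [ec]; rewrite -{c}ec in main *;
  try (by move=> h; apply: (main mirror));
  case: a main ha => [|||||||g'|t'|i] main ha;
  try (by case: ha); try (by move=> h; apply: (main copy)); rewrite /=.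
- by move=> [w [[] // [<- <-] h1 h2]]; exists Wp, CU.
- case: ifP => _; last by move=> h; apply: (main copy).
  by move=> [w [[] // [<- <-] h1 h2]]; exists W0, CU.
- by move=> [w [[] // [<- <-] /= h1 h2]]; exists W0, CD; split=> //=; lia.
- by move=> [w [[] // [<- <-] /= h1 h2]]; exists W0, CD; split=> //=; lia.
- by move=> [w [[]]].
- case: ifP => _; last by move=> h; apply: (main copy).
  by move=> [w [[] // [<- <-] h1 h2]]; exists WW, CU.
- case: ifP => _; last by move=> h; apply: (main copy).
  by move=> [w [[|[|[]]] // [<- <-] h1 h2]]; exists W0, CE.
- case: ifP => _; last by move=> h; apply: (main copy).
  by move=> [w [[|[|[|[]]]] // [<- <-] h1 h2]]; exists W0, CU.
case: eqP => [->|_]; last by move=> h; apply: (main copy).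
by move=> [w [[] // [<- <-] h1 h2]]; exists (WK j), CU.
Qed.

Lemma astepI s v a s' w : List.In (w, s') (deltaL s a) -> (0 <= Z.of_nat v + wz (lpos a) w)%Z ->
  exists v', astep s v a s' v' /\ Z.of_nat v' = (Z.of_nat v + wz (lpos a) w)%Z.
Proof.
move=> h1 h2; exists (Z.to_nat (Z.of_nat v + wz (lpos a) w)); split; last by rewrite Z2Nat.id.
by exists w; split=> //; rewrite Z2Nat.id.
Qed.

Lemma next_sym_None (t : sy * sy * sy) : next_sym t.1.1 t.1.2 t.2 <> None -> t.1.2 <> None.
Proof. by case: t => -[t1 [[o b]|]]. Qed.

(** A false claim cannot be justified by true ones: were all three symbols above correct, [tab_step]
    would make the claim true. Eve disputes a wrong one and stays good. *)
Lemma eve_move s v a w c c' : (forall i, ~~ rejsym (tab i)) -> good s v -> cls_of s = Some c -> a <> LD ->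
  mstep c a = Some (w, c') -> (0 <= Z.of_nat v + wz 0 w)%Z ->
  exists s1 v1, [/\ astep s v (inl a) s1 v1, good s1 v1, cls_of s1 = Some c' &
     c' <> CD -> Z.of_nat v1 = (Z.of_nat v + wz 0 w)%Z].
Proof.
move=> hacc hg hc ha hm hz.
have hcopy d : cls_of (copy d) = Some d by case: d.
have gcopy d u : good (copy d) u by case: d.
have dflt : delta s a = mtrans copy c a -> exists s1 v1, [/\ astep s v (inl a) s1 v1, good s1 v1,
     cls_of s1 = Some c' & c' <> CD -> Z.of_nat v1 = (Z.of_nat v + wz 0 w)%Z].
  move=> e; have hin : List.In (w, copy c') (deltaL s (inl a)).
    by rewrite /= e /mtrans hm; left.
  by have [v1 [h1 h2]] := astepI hin hz; exists (copy c'), v1; rewrite hcopy.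
have spec s1 : List.In (w, s1) (deltaL s (inl a)) -> cls_of s1 = Some c' ->
   (forall v1, Z.of_nat v1 = (Z.of_nat v + wz 0 w)%Z -> good s1 v1) ->
   exists s1 v1, [/\ astep s v (inl a) s1 v1, good s1 v1,
     cls_of s1 = Some c' & c' <> CD -> Z.of_nat v1 = (Z.of_nat v + wz 0 w)%Z].
  move=> hin h1 h2; have [v1 [h3 h4]] := astepI hin hz.
  by exists s1, v1; split=> //; apply: h2.
have fin w' : List.In (w', Cd) (deltaL s (inl a)) -> c' = CD -> (0 <= Z.of_nat v + wz 0 w')%Z ->
   exists s1 v1, [/\ astep s v (inl a) s1 v1, good s1 v1,
     cls_of s1 = Some c' & c' <> CD -> Z.of_nat v1 = (Z.of_nat v + wz 0 w)%Z].
  move=> hin -> h2; have [v1 [h3 h4]] := astepI hin h2.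
  by exists Cd, v1.
case: s hg hc dflt spec fin => //=.
- move=> _ [ec]; move: hm; rewrite -ec.
  case: a ha => //= [|||g|t|j] _ [? ?] dflt spec fin; subst; try exact: dflt.
    by apply: (spec Pm) => //; left.
  move: dflt spec; case: ifP => hr dflt spec; last exact: dflt.
  apply: (spec (Cl g)) => //; first by left.
  by move=> v1 _ e; have := hacc v1; rewrite -e hr.
- move=> _ [ec]; move: hm; rewrite -ec.
  by case: a ha => //= [|||g|t|j] _ [? ?] dflt spec fin; subst; exact: dflt.
- move=> _ [ec]; move: hm; rewrite -ec.
  by case: a ha => //= [|] _ [? ?] dflt spec fin; subst; exact: dflt.
- by move=> _ [ec]; move: hm; rewrite -ec.
- move=> hv [ec]; move: hm; rewrite -ec.
  case: a ha => //= [|] _ [? ?] dflt spec fin; subst; first exact: dflt.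
  by apply: (fin Wm) => //=; [left | lia].
- move=> hv [ec]; move: hm; rewrite -ec.
  case: a ha => //= [|] _ [? ?] dflt spec fin; subst; first exact: dflt.
  by apply: (fin WW) => //=; [left | lia].
- move=> hv [ec]; move: hm; rewrite -ec.
  case: a ha => //= [|] _ [? ?] dflt spec fin; subst; last exact: dflt.
  by move: hz => /=; lia.
- move=> g hg [ec]; move: hm; rewrite -ec.
  case: a ha => //= [|||g'|t|j] _ [? ?] dflt spec fin; subst; try exact: dflt.
  + move: dflt spec; case: eqP => [eg|_] dflt spec; last exact: dflt.
    apply: (spec (Cl g)) => //; first by left.
    move=> v1 /= e1; have ev : v1 = v - W by rewrite /= in hz; lia.
    have hWv : W <= v by rewrite /= in hz; lia.
    move=> e2; apply: hg; rewrite eg; apply/esym/eqP.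
    by rewrite -(tab_border_step M x (i := v)) // -ev -e2 eg.
  + move: dflt spec; case: eqP => [eg|_] dflt spec; last exact: dflt.
    (* A wrongly claimed blank lies beyond the first row, where [G1] can pay [W], or among the first
       [n.+2] cells, where Adam cannot pay [WN] and [G2] is safe. *)
    case: (leqP W v) => hv.
      by apply: (spec G1) => //; [left | move=> v1 /= e1; lia].
    apply: (spec G2) => //; first by right; left.
    move=> v1 /= e1; have -> : v1 = v by lia.
    rewrite ltnNge; apply/negP => hn; apply: hg; rewrite eg.
    by rewrite tab_row0 // row0_blank.
  + move: dflt spec; case: ifP => [/andP[hne /eqP hnx]|_] dflt spec; last exact: dflt.
    pose pick j := (forall v1, Z.of_nat v1 = (Z.of_nat v + 0)%Z -> good (Tr t j) v1).
    have val0 : val (inord 0 : 'I_3) = 0 by rewrite /= inordK.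
    have val1 : val (inord 1 : 'I_3) = 1 by rewrite /= inordK.
    have val2 : val (inord 2 : 'I_3) = 2 by rewrite /= inordK.
    have [h|[h|h]] : pick (inord 0) \/ pick (inord 1) \/ pick (inord 2).
    (* In the first row a jump by [W] is impossible, so disputing the middle symbol is safe. *)
    * case: (leqP W v) => hv; last first.
        right; left=> v1 e1 /=; rewrite /jump val1 => h.
        by exfalso; lia.
      have ev v1 : Z.of_nat v1 = (Z.of_nat v + 0)%Z -> v1 = v by lia.
      (* On a border cell the cell above is a border as well, whereas a rule producing the proper
         symbol [g] has a proper middle symbol; that one is wrong. *)
      case: (eqVneq (tab v) None) => [e0|e0].
        right; left=> v1 /ev -> /= _; rewrite /jump /tr3 val1 => e2.
        have ht2 : t.1.2 <> None by apply: next_sym_None; rewrite hnx; apply/eqP.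
        by apply: ht2; rewrite e2; apply/eqP; rewrite tab_border_step // e0.
      have hst := tab_step hW1 hhead hv e0.
      case: (eqVneq t.1.1 (tab (v - (W + 1)))) => [e1|e1]; last first.
        by left=> v1 /ev -> /= _; rewrite /jump /tr3 val0; apply/eqP.
      case: (eqVneq t.1.2 (tab (v - W))) => [e2|e2]; last first.
        by right; left=> v1 /ev -> /= _; rewrite /jump /tr3 val1; apply/eqP.
      case: (eqVneq t.2 (tab (v - (W - 1)))) => [e3|e3]; last first.
        by right; right=> v1 /ev -> /= _; rewrite /jump /tr3 val2; apply/eqP.
      by case: hg; rewrite hst -hnx e1 e2 e3.
    * by apply: (spec (Tr t (inord 0))) => //; left.
    * by apply: (spec (Tr t (inord 1))) => //; right; left.
    * by apply: (spec (Tr t (inord 2))) => //; right; right; left.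
- move=> t j hg [ec]; move: hm; rewrite -ec.
  case: a ha => //= [|||g'|t'|i] _ [? ?] dflt spec fin; subst; try exact: dflt.
  move: dflt spec; case: eqP => [ei|_] dflt spec; last exact: dflt.
  subst i; apply: (spec (Cl (tr3 t j))) => //; first by left.
  move=> v1 /= e1; rewrite /= in hz.
  have -> : v1 = v - jump j by lia.
  by apply: hg; lia.
Qed.

Lemma mirror_pos s v k s1 v1 : cls_of s <> None -> astep s v (inr k) s1 v1 ->
  [/\ cls_of s = Some CU, cls_of s1 = Some CE & Z.of_nat v1 = (Z.of_nat v - Z.of_nat k)%Z].
Proof.
move=> hc [w []] /=.
by case: s hc => [||||||||||||g|t j] //= _ [] // [<- <-] h1 h2; split=> //=; try lia; case: ifP.
Qed.

Lemma acc_aclosed : (forall i, ~~ rejsym (tab i)) -> aclosed Rgood.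
Proof.
move=> hacc s v s' v' [[-> -> -> ->]|->|[hg hc hv]] a ha.
- case: a ha => [a|k] _; last by right=> s1 v1 [w [[]]].
  case: a => [|||||||g|t|j]; try (by right=> s1 v1 [w [[]]]).
  left; have [||u [h1 h2]] := @astepI Q0 0 (inl LA) Pm W0.
  + by right; left.
  + by [].
  exists Pm, u; split=> // s1 v1 [w [hin h3 h4]]; rewrite /= in h2.
  by case: hin h3 h4 => [[<- <-]|[[<- <-]|[]]] /= h3 h4; constructor 3; split=> //; lia.
- left; case: a ha => [a|k] _.
    by have [||u [h1 h2]] := @astepI Top v (inl a) Top W0; [left | rewrite /=; lia | exists Top, u; split=> //; constructor 2].
  by have [||u [h1 h2]] := @astepI Top v (inr k) Top W0; [left | rewrite /=; lia | exists Top, u; split=> //; constructor 2].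
case Ec: (cls_of s) hv hc => [c|] hv hc; last by case: (s) Ec hg.
case: a ha => [a|k] ha.
  case: (a =P LD) => [->|hD].
    left; have [||u [h1 h2]] := @astepI s v (inl LD) Top W0.
    + by case: (s) hg => //= *; left.
    + by rewrite /=; lia.
    by exists Top, u; split=> //; constructor 2.
  case Em: (mstep c a) => [[w c']|]; last first.
    by right=> s1 v1 h; have [w [c' []]] := mirror_step hc h hD; rewrite Em.
  have hcd : c <> CD by move=> e; move: Em; rewrite e.
  have ev : v = v' by apply: hv => -[].
  case: (Z_lt_le_dec (Z.of_nat v + wz 0 w) 0) => hz.
    right=> s1 v1 h; have [w' [c2 []]] := mirror_step hc h hD; rewrite Em => -[<- _] _.
    by rewrite -ev; lia.
  left; have [s1 [v1 [h1 h2 h3 h4]]] := eve_move hacc hg Ec hD Em hz.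
  exists s1, v1; split=> // s2 v2 h; have [w' [c2 []]] := mirror_step hc h hD.
  rewrite Em => -[<- <-] h5 h6 h7; constructor 3; split=> //; first by rewrite h5 h3.
  rewrite h3 => hcd'; have hcd2 : c' <> CD by move=> e; apply: hcd'; rewrite e.
  by have := h4 hcd2; have := h7 hcd2; rewrite -ev; lia.
have hcn : cls_of s' <> None by rewrite hc.
case: c Ec hc hv => Ec hc hv; try by right=> s1 v1 /(mirror_pos hcn) []; rewrite hc.
have ev : v = v' by apply: hv.
case: (leqP k v) => hk; last first.
  by right=> s1 v1 /(mirror_pos hcn) [_ _]; rewrite -ev; lia.
left.
have [s1 [hin hcl hgood]] : exists s1, [/\ List.In (WPos, s1) (deltaL s (inr k)), cls_of s1 = Some CE &
   good s1 (v - k)].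
  case: (s) hg Ec => //=; try (by move=> *; exists Ce; split=> //; left).
  move=> g hg _; case: eqP => e; last by exists Ce; split=> //; left.
  exists Fx; split=> //; first by left.
  rewrite /= subn_gt0 ltn_neqAle hk andbT; apply/eqP => ek; apply: hg.
  by rewrite e -ek tab_row0 //; rewrite /= in ha; lia.
have [|u [h1 h2]] := @astepI s v (inr k) s1 WPos hin; first by rewrite /=; lia.
rewrite /= in h2; have eu : u = v - k by lia.
exists s1, u; split=> // s2 v2 /(mirror_pos hcn) [_ h3 h4].
by constructor 3; split; [rewrite eu | rewrite h3 hcl | move=> _; lia].
Qed.

(** Adam states only true symbols, so each dispute leads to another true claim at a smaller index.
    On the first row the tests leave Eve without a move. *)
Lemma rej_not_aclosed R i : aclosed R -> rejsym (tab i) -> ~ R Q0 0 Q0 0.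
Proof.
move=> hR hrej h0.
have forced s v s' v' a s1' v1' : R s v s' v' -> astep s' v' a s1' v1' -> lvalid a ->
   exists s1 v1, astep s v a s1 v1 /\ R s1 v1 s1' v1'.
  move=> h hs ha; have [[s1 [v1 [h1 h2]]]|/(_ s1' v1')] := hR _ _ _ _ h a ha; last by case.
  by exists s1, v1; split=> //; apply: h2.
have hP : R Pm 0 U 0.
  have hsU : astep Q0 0 (inl LA) U 0 by exists W0; split=> //; left.
  have hsP : astep Q0 0 (inl LA) Pm 0 by exists W0; split=> //; right; left.
  have [[s1 [v1 [h1 h2]]]|/(_ U 0)] := hR _ _ _ _ h0 (inl LA) isT; last by case.
  have hU := h2 _ _ hsU; have hPm := h2 _ _ hsP.
  case: h1 => w [[[? ?]|[[? ?]|[]]] _ ev]; subst.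
    have hD : astep Pm 0 (inl LD) Top 0 by exists W0; split=> //; left.
    by have [s2 [v2 [[w' [[]]]]]] := forced _ _ _ _ _ _ _ hPm hD isT.
  have e : v1 = 0 by rewrite /= in ev; lia.
  by rewrite e in hU.
have hPi : R Pm i U i.
  elim: (i) => // j IH.
  have hs : astep U j (inl LInc) U j.+1 by exists Wp; split=> //=; [left | lia | lia].
  have [s2 [v2 [[w [[[? ?]|[]] _ ev]] h]]] := forced _ _ _ _ _ _ _ IH hs isT; subst.
  have e : v2 = j.+1 by rewrite /= in ev; lia.
  by rewrite e in h.
have hCl : R (Cl (tab i)) i U i.
  have hs : astep U i (inl (LStart (tab i))) U i by exists W0; split=> //=; [left | lia | lia].
  have [s2 [v2 [[w [hin _ ev]] h]]] := forced _ _ _ _ _ _ _ hPi hs isT.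
  move: hin; rewrite /= hrej => -[[? ?]|[]]; subst.
  have e : v2 = i by rewrite /= in ev; lia.
  by rewrite e in h.
elim/ltn_ind: i {hrej hPi} hCl => i IH hCl.
case: (leqP W i) => hi.
  case: (eqVneq (tab i) None) => e0.
    have hs : astep U i (inl LHs) U (i - W) by exists WW; split=> //=; [left | lia | lia].
    have [s2 [v2 [[w [hin _ ev]] h]]] := forced _ _ _ _ _ _ _ hCl hs isT.
    move: hin; rewrite /= e0 /= => -[[? ?]|[]]; subst; rewrite /= in ev.
    have ev2 : v2 = i - W by lia.
    apply: (IH (i - W)); first by lia.
    have -> : tab (i - W) = None by apply/eqP; rewrite tab_border_step // e0.
    by rewrite -{1}ev2.
  have hst := tab_step hW1 hhead hi e0.
  set t := (tab (i - (W + 1)), tab (i - W), tab (i - (W - 1))).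
  have hs : astep U i (inl (LTr t)) U i by exists W0; split=> //=; [left | lia | lia].
  have [s2 [v2 [[w [hin _ ev]] h]]] := forced _ _ _ _ _ _ _ hCl hs isT.
  have [j ej hj] : exists2 j : 'I_3, s2 = Tr t j & w = W0.
    move: hin; rewrite /= e0 -hst eqxx /= => -[[<- <-]|[[<- <-]|[[<- <-]|[]]]]; by eexists.
  subst; rewrite /= in ev; have ev2 : v2 = i by lia.
  rewrite ev2 in h.
  have him : i %% W != 0 by rewrite -(tab_border M x).
  have hi1 : W < i by rewrite ltn_neqAle hi andbT; apply/eqP => e; move: him; rewrite -e modnn.
  have hji : 0 < jump j <= i by rewrite /jump; case: (val j) => [|[|?]]; lia.
  have hs2 : astep U i (inl (LJ j)) U (i - jump j) by exists (WK j); split=> //=; [left | lia | lia].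
  have [s3 [v3 [[w3 [hin3 _ ev3]] h3]]] := forced _ _ _ _ _ _ _ h hs2 isT.
  move: hin3; rewrite /= eqxx /= => -[[? ?]|[]]; subst; rewrite /= in ev3.
  have ev4 : v3 = i - jump j by lia.
  apply: (IH (i - jump j)); first by lia.
  have -> : tab (i - jump j) = tr3 t j by rewrite /tr3 /jump /t; case: (val j) => [|[|?]].
  by rewrite -{1}ev4.
(* The first [n.+2] cells are announced by position, after which [Fx] holds 0 and cannot pay for
   [LZ]. The rest of the first row is blank: there [G1] lacks the price of [LZ], and [LY] is
   affordable for Adam and fatal for [G2]. *)
case: (leqP i n.+1) => hin1.
  have hs : astep U i (inr i) Ue 0 by exists WPos; split=> //=; [left | lia | lia].
  have [s2 [v2 [[w [hin _ ev]] h]]] := forced _ _ _ _ _ _ _ hCl hs (hin1 : lvalid (inr i)).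
  move: hin; rewrite /= tab_row0 // eqxx => -[[? ?]|[]]; subst; rewrite /= in ev.
  have hs2 : astep Ue 0 (inl LZ) Ud 0 by exists W0; split=> //=; left.
  have [s3 [v3 [[w3 [hin3 hz _]] _]]] := forced _ _ _ _ _ _ _ h hs2 isT.
  by move: hin3 hz => /= -[[<- _]|[]] /=; lia.
have hs : astep U i (inl LB) Ue i by exists W0; split=> //=; [left | lia | lia].
have [s2 [v2 [[w [hin _ ev]] h]]] := forced _ _ _ _ _ _ _ hCl hs isT.
move: hin; rewrite /= tab_row0 // row0_blank // eqxx => -[[? ?]|[[? ?]|[]]]; subst; rewrite /= in ev.
  have hs2 : astep Ue i (inl LZ) Ud i by exists W0; split=> //=; [left | lia | lia].
  have [s3 [v3 [[w3 [hin3 hz _]] _]]] := forced _ _ _ _ _ _ _ h hs2 isT.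
  by move: hin3 hz => /= -[[<- _]|[]] /=; lia.
have hs2 : astep Ue i (inl LY) Ud (i - n.+2) by exists WN; split=> //=; [left | lia | lia].
by have [s3 [v3 [[w3 [[]]]]]] := forced _ _ _ _ _ _ _ h hs2 isT.
Qed.

End Net.

End TableauGame.
Import TableauGame.

(** * The net of the tableau game *)

Module TableauNet.

Lemma In_mem (T : eqType) (a : T) (s : seq T) : List.In a s <-> a \in s.
Proof.
elim: s => //= b s IH; rewrite inE; split.
  by case=> [->|/IH ->]; rewrite ?eqxx ?orbT.
by case/orP => [/eqP ->|/IH]; [left | right].
Qed.

Section Concrete.
Variables (G : finType) (M : TM G) (x : seq G) (W : nat).
Notation n := (size x).
Notation hst := (hst M).
Notation hlt := (hlt M).

Definition rk (s : hst) : nat := enum_rank s.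
Definition rl (a : hlt) : nat := enum_rank a.
Definition nfix : nat := #|{: hlt}|.
Definition lcd (a : letter M) : nat := match a with inl a => rl a | inr k => nfix + k end.

Definition fixT : seq (hst * hlt * (wt * hst)) :=
  List.flat_map (fun s => List.flat_map (fun a => List.map (fun p => (s, a, p)) (delta s a))
    (enum {: hlt})) (enum {: hst}).

Definition posT (k : nat) : seq (hst * (wt * hst)) :=
  List.flat_map (fun s => List.map (fun p => (s, p)) (dpos (row0 M x k) s)) (enum {: hst}).

Definition fixTr := List.map (fun t : hst * hlt * (wt * hst) =>
  (rk t.1.1, rl t.1.2, wz x W 0 t.2.1, rk t.2.2)) fixT.

Definition posTr k := List.map (fun t : hst * (wt * hst) =>
  (rk t.1, nfix + k, wz x W k t.2.1, rk t.2.2)) (posT k).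

Definition posTrs := List.flat_map posTr (List.seq 0 n.+2).

(** All states are final, so every configuration is live and the token game reduces to Eve being
    able to move whenever Adam can. *)
Definition net : OCN := {|
  nstates := #|{: hst}|;
  nletters := nfix + n.+2;
  trans := fixTr ++ posTrs;
  init := rk (Q0 M);
  final := fun _ => true |}.

Lemma rk_inj : injective rk.
Proof. by move=> a b /val_inj /enum_rank_inj. Qed.

Lemma rl_inj : injective rl.
Proof. by move=> a b /val_inj /enum_rank_inj. Qed.

Lemma rl_lt a : rl a < nfix. Proof. exact: ltn_ord. Qed.
Lemma rk_lt s : rk s < #|{: hst}|. Proof. exact: ltn_ord. Qed.

Lemma in_fixT s a p : List.In (s, a, p) fixT <-> List.In p (delta s a).
Proof.
rewrite /fixT List.in_flat_map; split.
  move=> [s' [_ /List.in_flat_map [a' [_ /List.in_map_iff [p' [[<- <- <-]]]]]]] //.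
move=> h; exists s; split; first by apply/In_mem; rewrite mem_enum.
apply/List.in_flat_map; exists a; split; first by apply/In_mem; rewrite mem_enum.
by apply/List.in_map_iff; exists p.
Qed.

Lemma in_posT k s p : List.In (s, p) (posT k) <-> List.In p (dpos (row0 M x k) s).
Proof.
rewrite /posT List.in_flat_map; split.
  move=> [s' [_ /List.in_map_iff [p' [[<- <-]]]]] //.
move=> h; exists s; split; first by apply/In_mem; rewrite mem_enum.
by apply/List.in_map_iff; exists p.
Qed.

Lemma in_trans q b d p : List.In (q, b, d, p) (trans net) <->
  exists s a w s', [/\ q = rk s, b = lcd a, d = wz x W (lpos a) w, p = rk s' &
    lvalid x a /\ List.In (w, s') (deltaL x s a)].
Proof.
rewrite /= List.in_app_iff; split.
  case.
    move=> /List.in_map_iff [[[s a] [w s']] [e /in_fixT h]].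
    by case: e => <- <- <- <-; exists s, (inl a), w, s'.
  move=> /List.in_flat_map [k [hk0]]; have hk := iffLR (List.in_seq _ _ _) hk0.
  move=> /List.in_map_iff [[s [w s']] [e /in_posT h]]; case: e => <- <- <- <-.
  by exists s, (inr k), w, s'; split=> //; split=> //=; lia.
move=> [s [[a|k] [w [s' [-> -> -> -> [hv h]]]]]]; [left | right].
  by apply/List.in_map_iff; exists (s, a, (w, s')); split=> //; apply/in_fixT.
apply/List.in_flat_map; exists k; split; first by apply: (iffRL (List.in_seq _ _ _)); rewrite /= in hv; lia.
by apply/List.in_map_iff; exists (s, (w, s')); split=> //; apply/in_posT.
Qed.

Lemma lcd_inj a b : lcd a = lcd b -> a = b.
Proof.
case: a b => [a|k] [b|k'] /=.
- by move=> /rl_inj ->.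
- by have := rl_lt a; lia.
- by have := rl_lt b; lia.
by move=> h; congr inr; lia.
Qed.

Lemma lcd_surj b : b < nfix + n.+2 -> exists2 a, lvalid x a & b = lcd a.
Proof.
case: (ltnP b nfix) => h hb.
  by exists (inl (enum_val (Ordinal h))) => //=; rewrite /rl enum_valK.
by exists (inr (b - nfix)) => /=; lia.
Qed.

Lemma net_wf : wf net.
Proof.
split; first exact: rk_lt.
move=> q b d p /in_trans [s [a [w [s' [-> -> _ -> [hv _]]]]]]; split; try exact: rk_lt.
by rewrite /=; case: a hv => [a|k] /=; have := rl_lt; [move=> /(_ a) |]; lia.
Qed.

Lemma ostep_astep s v a c' : lvalid x a ->
  ostep net (rk s, v) (lcd a) c' <-> exists s' v', c' = (rk s', v') /\ astep x W s v a s' v'.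
Proof.
move=> hv; split.
  move=> [d [/in_trans [s1 [a1 [w [s' [/rk_inj <- /lcd_inj <- -> e [_ h]]]]]] [h1 h2]]].
  by case: c' e h2 => q v' /= -> h2; exists s', v'; split=> //; exists w.
move=> [s' [v' [-> [w [h1 h2 h3]]]]]; exists (wz x W (lpos a) w); split=> //.
by apply/in_trans; exists s, a, w, s'.
Qed.

Lemma net_live c : live net c.
Proof. by exists nil, c => //; constructor. Qed.

Lemma net_HD : history_deterministic net <-> exists2 R, aclosed x W R & R (Q0 M) 0 (Q0 M) 0.
Proof.
rewrite (HD_token_closed net_wf); split=> -[R hR h0].
  exists (fun s v s' v' => R (rk s, v) (rk s', v')) => // s v s' v' h a ha.
  have hl : lcd a < nletters net.
    by rewrite /=; case: a ha => [a|k] /=; have := rl_lt; [move=> /(_ a) |]; lia.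
  have [_ /(_ _ hl) [[c1 /(ostep_astep _ _ _ ha) [s1 [v1 [-> h1]]] h2]|h1]] := hR _ _ h.
    by left; exists s1, v1; split=> // s2 v2 h3; apply: h2; apply/ostep_astep => //; exists s2, v2.
  right=> s2 v2 h3; apply: (h1 (rk s2, v2)); last exact: net_live.
  by apply/ostep_astep => //; exists s2, v2.
pose R' c c' := exists s v s' v', [/\ c = (rk s, v), c' = (rk s', v') & R s v s' v'].
exists R'; last by exists (Q0 M), 0, (Q0 M), 0.
move=> c c' [s [v [s' [v' [-> -> h]]]]]; split=> // b /lcd_surj [a ha ->].
have [[s1 [v1 [h1 h2]]]|h1] := hR _ _ _ _ h a ha; [left | right].
  exists (rk s1, v1); first by apply/ostep_astep => //; exists s1, v1.
  move=> c2 /(ostep_astep _ _ _ ha) [s2 [v2 [-> h3]]].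
  by exists s1, v1, s2, v2; split=> //; apply: h2.
by move=> c2 /(ostep_astep _ _ _ ha) [s2 [v2 [-> h3]]]; case: (h1 s2 v2).
Qed.

End Concrete.

(** * The net is history-deterministic exactly when the machine accepts *)

Section Correct.
Variables (G : finType) (M : TM G) (L : seq G -> Prop) (s : nat -> nat).
Hypothesis hdec : decides_in_space M L s.

Lemma tstep_halted (c : tconf M) k : halted c -> iter k (@tstep _ M) c = c.
Proof. by move=> h; elim: k => //= k ->; rewrite /tstep h. Qed.

Lemma trun_halted (x : seq G) t t' : halted (trun M x t) -> t <= t' -> trun M x t' = trun M x t.
Proof. by move=> h ht; rewrite /trun -(subnK ht) iterD tstep_halted. Qed.

(** The machine always halts, and a rejecting run shows a rejecting head in the row of its halting
    time. So acceptance means that no such cell occurs anywhere in the infinite tableau. *)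
Lemma net_correct (x : seq G) W : (size x).+2 < W -> s (size x) < W ->
  HD_problem (encode (net M x W)) <-> L x.
Proof.
move=> hW hs; rewrite (HD_problem_encode (net_wf M x W)) net_HD.
have [t [hh [hL hsp]]] := hdec x.
have hhead u : hpos (trun M x u) + 1 < W.
  wlog hu : u / u <= t.
    move=> hw; case: (leqP u t) => hu; first exact: hw.
    by rewrite (trun_halted hh (ltnW hu)); apply: hw.
  have := hsp u hu; rewrite /hpos /tspace; case: (trun M x u) => q [[l h] r]; lia.
split.
  move=> [R hR h0]; apply/hL; apply/eqP/negPn/negP => hna.
  case E: (trun M x t) hh hna => [q [[l h] r]] hh hna.
  pose i := t * W + (size l).+1.
  have hl : (size l).+1 < W by have := hhead t; rewrite E /=; lia.
  have hrej : rejsym (tab M x W i).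
    rewrite /tab /i divnMDl; last by lia.
    rewrite modnMDl (divn_small hl) (modn_small hl) addn0 E /= eqxx.
    by move: hh; rewrite /halted /= in hna *; rewrite (negPf hna) /= => ->.
  exact: (rej_not_aclosed hW hhead hR hrej h0).
move=> hLx; exists (Rgood (M := M) x W); last by constructor 1.
apply: acc_aclosed => // i; apply/negP; rewrite /tab.
have := iffRL hL hLx; case E: (trun M x (i %/ W)) => [q [[l h] r]].
move=> eacc; rewrite /tconf_sym; case: (i %% W) => [//|p] /=; case: eqP => // _.
move=> /andP[/eqP eq hne].
have hh' : halted (trun M x (i %/ W)) by rewrite E /halted /= eq eqxx orbT.
case: (leqP t (i %/ W)) => ht.
  by move: hne; rewrite -(_ : (trun M x (i %/ W)).1 = q) ?E // -E (trun_halted hh ht) eacc eqxx.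
by move: hne; rewrite -eacc (trun_halted hh' (ltnW ht)) E eqxx.
Qed.

End Correct.

End TableauNet.
Import TableauNet.

(** * The reduction *)

Module Reduction.

Section WClass.
Variables (H : finType) (g : nat).
Notation E := (E g).
Notation pbnd := (pbnd g).
Notation obnd := (obnd g).

Definition Wc (F : (nat -> nat) -> seq nat -> seq H) :=
  exists w, (forall o e, obnd o -> weval o e w = F o e) /\ pbnd (fun o e => wcost o e w).

Lemma Wc_ext F F' : (forall o e, obnd o -> F o e = F' o e) -> Wc F -> Wc F'.
Proof. by move=> h [w [h1 h2]]; exists w; split=> // o e ho; rewrite h1 // h. Qed.

Lemma Wc_nil : Wc (fun _ _ => [::]).
Proof. by exists WSkip; split=> //; apply: (pbnd_const g 0). Qed.

Lemma Wc_cat F F' : Wc F -> Wc F' -> Wc (fun o e => F o e ++ F' o e).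
Proof.
move=> [w [h1 h2]] [w' [h1' h2']]; exists (WSeq w w'); split; last exact: pbnd_max.
by move=> o e ho; rewrite /= h1 ?h1'.
Qed.

Lemma Wc_const s : Wc (fun _ _ => s).
Proof.
elim: s => [|c s IH]; first exact: Wc_nil.
apply: (@Wc_ext (fun _ _ => [:: c] ++ s)) => //; apply: Wc_cat IH.
by exists (WOut c); split=> //; apply: (pbnd_const g 0).
Qed.

Lemma Wc_cons c F : Wc F -> Wc (fun o e => c :: F o e).
Proof. exact: Wc_cat (Wc_const [:: c]). Qed.

Lemma Wc_if (P : _ -> _ -> bool) F F' : E (fun o e => P o e : nat) -> Wc F -> Wc F' ->
  Wc (fun o e => if P o e then F o e else F' o e).
Proof.
move=> [t [k1 k2]] [w [h1 h2]] [w' [h1' h2']]; exists (WIf t w w'); split.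
  by move=> o e ho; rewrite /= k1 // h1 // h1' //; case: (P o e).
by apply: pbnd_max k2 _; apply: pbnd_max.
Qed.

Lemma Wc_for N F : E N -> Wc F ->
  Wc (fun o e => flatten (mkseq (fun j => F o (j :: e)) (N o e))).
Proof.
move=> EN; have pN := E_pbnd EN; move: EN => [t [k1 k2]] [w [h1 [c hc]]].
exists (WFor t w); split.
  by move=> o e ho; rewrite /= k1 //; congr flatten; apply: eq_mkseq => j; rewrite h1.
apply: (@pbnd_le _ _ (fun o e => maxn (tcost o e t) ((maxn (N o e) (maxl e) + 2) ^ c))); last first.
  apply: pbnd_max => //; apply: pbnd_exp; apply: pbnd_add (pbnd_const _ 2).
  exact: pbnd_max (pbnd_maxl _).
move=> o e ho /=; rewrite geq_max leq_maxl /= leq_max; apply/orP; right.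
apply/bigmax_leqP => j _; apply: leq_trans (hc _ _ ho) _; apply: expn_mono.
rewrite leq_add2r /=; have hj : j < N o e by apply: leq_trans (ltn_ord j) _; rewrite k1.
by lia.
Qed.

Lemma Wc_flat_map (A : Type) (l : seq A) (F : A -> _ -> _ -> seq H) :
  (forall a, Wc (F a)) -> Wc (fun o e => List.flat_map (fun a => F a o e) l).
Proof.
move=> h; elim: l => [|a l IH]; first exact: Wc_nil.
exact: Wc_cat (h a) IH.
Qed.

Lemma Wc_nseq N c : E N -> Wc (fun o e => nseq (N o e) c).
Proof.
move=> hN; apply: Wc_ext (Wc_for hN (Wc_const [:: c])) => o e _.
by elim: (N o e) => // k IH; rewrite mkseq_S /=; congr (_ :: _).
Qed.

End WClass.

Lemma flat_map_flatten (A B : Type) (f : A -> seq B) (l : seq A) : List.flat_map f l = flatten (map f l).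
Proof. by elim: l => //= a l ->. Qed.

Lemma List_seq_iota a k : List.seq a k = iota a k.
Proof. by elim: k a => //= k IH a; rewrite IH. Qed.

(** Digits by repeated halving, with one loop turn per unit of [v] and leading zeros suppressed.
    This is affordable because it is applied only to numbers of polynomial size. *)
Lemma nat_bits_seq v :
  nat_bits v = flatten (mkseq (fun j => if (iter (v - j) (fun u => u %/ 2) v == 0) && (v - j != 0) then [::]
     else [:: if iter (v - j) (fun u => u %/ 2) v %% 2 == 1 then S1 else S0]) v.+1).
Proof.
pose el v i := if (iter i (fun u => u %/ 2) v == 0) && (i != 0) then [::]
     else [:: if iter i (fun u => u %/ 2) v %% 2 == 1 then S1 else S0].
have key B u : u < 2 ^ B.+1 -> nat_bits u = flatten (mkseq (fun j => el u (B - j)) B.+1).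
  elim: B u => [|B IH] u hu.
    rewrite /mkseq /= /el /=; case: u hu => [|[|u]] //; rewrite expn1; lia.
  rewrite nat_bits_rec /mkseq -[X in iota _ X]addn1 iotaD map_cat flatten_cat; congr (_ ++ _); last first.
    by rewrite /= add0n subnn /el andbF /= modn2; case: (odd u).
  have e1 : map (fun j => el u (B.+1 - j)) (iota 0 B.+1) =
     map (fun j => if (iter (B - j) (fun u => u %/ 2) (u %/ 2) == 0) then [::]
     else [:: if iter (B - j) (fun u => u %/ 2) (u %/ 2) %% 2 == 1 then S1 else S0]) (iota 0 B.+1).
    apply/eq_in_map => j; rewrite mem_iota add0n => /andP[_ hj].
    by rewrite /el subSn // iterSr andbT.
  rewrite e1; case: eqP => [-> | hne].
    apply/esym; elim: (iota 0 B.+1) => //= j s ->.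
    by have -> : iter (B - j) (fun u0 : nat => u0 %/ 2) 0 = 0 by elim: (B - j) => //= m ->.
  rewrite (IH (u %/ 2)); last by rewrite ltn_divLR // -expnSr.
  congr flatten; apply/eq_in_map => j; rewrite mem_iota add0n => /andP[_ hj]; rewrite /el.
  case: (eqVneq (B - j) 0) => [->|_]; last by rewrite andbT.
  by rewrite andbF [iter 0 _ _]/=; move/eqP/negPf: hne => ->.
apply: key; rewrite expnS; have := ltn_expl v (ltnSn 1); lia.
Qed.

Lemma nseq_rcons (T : Type) k (c : T) : nseq k.+1 c = rcons (nseq k c) c.
Proof. by elim: k => //= k <-. Qed.

(** The row width is chosen as a power of two, so that it and its two neighbours have binary forms
    that a loop can print although their values are exponential. *)
Lemma nat_bits_pow m : nat_bits (2 ^ m) = S1 :: nseq m S0.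
Proof.
elim: m => // m IH; rewrite nat_bits_rec expnS mulKn // IH oddM /=.
rewrite ifN; last by rewrite -lt0n expn_gt0.
by rewrite cat_cons cats1 /bit_sym /= -nseq_rcons.
Qed.

Lemma nat_bits_pow_succ m : nat_bits (2 ^ m.+1 + 1) = S1 :: nseq m S0 ++ [:: S1].
Proof.
rewrite nat_bits_rec; have -> : (2 ^ m.+1 + 1) %/ 2 = 2 ^ m by rewrite expnS; lia.
rewrite nat_bits_pow ifN; last by rewrite -lt0n expn_gt0.
by rewrite oddD expnS oddM.
Qed.

Lemma nat_bits_pow_pred m : nat_bits (2 ^ m.+1 - 1) = nseq m.+1 S1.
Proof.
elim: m => // m IH; rewrite nat_bits_rec.
have h : 0 < 2 ^ m by rewrite expn_gt0.
have -> : (2 ^ m.+2 - 1) %/ 2 = 2 ^ m.+1 - 1 by rewrite !expnS; lia.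
rewrite IH ifN; last by rewrite !expnS; lia.
have -> : odd (2 ^ m.+2 - 1) by rewrite !expnS; lia.
by rewrite [in RHS]nseq_rcons cats1.
Qed.

Lemma enc_Z_opp v : enc_Z (- Z.of_nat v) = (if v == 0 then S0 else S1) :: enc_nat v.
Proof.
rewrite /enc_Z; congr (_ :: enc_nat _); last by lia.
by case: eqP => [->//|h]; case: Z.ltb_spec => //; lia.
Qed.

Section Reduction.
Variables (G : finType) (M : TM G) (k0 : nat).
Notation g := #|G|.
Notation E := (E g).
Notation Wc := (Wc (H := sym) g).

(** Exponent of the row width: the space bound of the machine, enlarged so that the width also
    exceeds [n.+2] and the exponent has a predecessor. *)
Definition mexp (n : nat) : nat := k0 * n.+1 ^ k0 + n + 2.

Lemma E_expc A c : E A -> E (fun o e => A o e ^ c).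
Proof.
move=> h; elim: c => [|c IH]; first exact: E_const.
by apply: E_ext (E_mul h IH) => o e _; rewrite expnS.
Qed.

Lemma E_mexp A : E A -> E (fun o e => mexp (A o e)).
Proof.
move=> h; apply: E_add (E_const _ 2); apply: (E_add _ h); apply: E_mul (E_const _ k0) _.
exact: E_expc (E_succ h).
Qed.

Lemma Wc_enc_nat A : E A -> Wc (fun o e => enc_nat (A o e)).
Proof.
move=> hA; apply: Wc_cat (Wc_const _ _).
pose q o e := iter (A o (behead e) - head 0 e) (fun u => u %/ 2) (A o (behead e)).
have Ed : E (fun o e => A o (behead e) - head 0 e) by apply: E_sub (E_shift hA) (E_var0 _).
have Eq : E q by apply: E_iterdiv (E_shift hA) (E_const _ 2) Ed.
apply: Wc_ext (Wc_for (E_succ hA) (F := fun o e => if (q o e == 0) && (A o (behead e) - head 0 e != 0)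
   then [::] else [:: if q o e %% 2 == 1 then S1 else S0]) _).
  by move=> o e _; rewrite nat_bits_seq.
apply: Wc_if (Wc_nil _ _) _.
  by apply: E_and; [apply: E_isz | apply: E_neg; apply: E_isz].
apply: (@Wc_ext _ _ (fun o e => if q o e %% 2 == 1 then [:: S1] else [:: S0])).
  by move=> o e _; case: ifP.
apply: Wc_if; try exact: Wc_const.
by apply: E_eq (E_const _ 1); apply: E_mod Eq (E_const _ 2).
Qed.

(* [A] is the position announced by the letter and [B] the length of the input *)
Lemma Wc_weight (w : wt) A B : E A -> E B ->
  Wc (fun o e => enc_Z (match w with
    | W0 => 0 | Wp => 1 | Wm => -1 | WK j => - Z.of_nat (jump (2 ^ (mexp (B o e))) j)
    | WW => - Z.of_nat (2 ^ (mexp (B o e))) | WN => - Z.of_nat (B o e).+2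
    | WPos => - Z.of_nat (A o e) end)%Z).
Proof.
move=> hA hB.
have hm : E (fun o e => (mexp (B o e)).-1) by apply: E_pred; apply: E_mexp.
have em o e : mexp (B o e) = ((mexp (B o e)).-1).+1 by rewrite /mexp addn2.
have nz p : (2 ^ p == 0) = false by apply/eqP; have := expn_gt0 2 p; lia.
case: w => [|||j||| ]; try exact: Wc_const.
- rewrite /jump; case: (val j) => [|[|_]].
  + apply: (@Wc_ext _ _ (fun o e => S1 :: (S1 :: nseq ((mexp (B o e)).-1) S0 ++ [:: S1]) ++ [:: Sh])).
      move=> o e _; rewrite enc_Z_opp addn1 -addn1 /enc_nat {2 3}em nat_bits_pow_succ.
      by rewrite addn1.
    apply: Wc_cons; apply: Wc_cat (Wc_const _ _); apply: Wc_cons; apply: Wc_cat (Wc_const _ _).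
    exact: Wc_nseq.
  + apply: (@Wc_ext _ _ (fun o e => S1 :: (S1 :: nseq (mexp (B o e)) S0) ++ [:: Sh])).
      by move=> o e _; rewrite enc_Z_opp /enc_nat nat_bits_pow nz.
    apply: Wc_cons; apply: Wc_cat (Wc_const _ _); apply: Wc_cons.
    exact: Wc_nseq (E_mexp hB).
  + apply: (@Wc_ext _ _ (fun o e => S1 :: (nseq (mexp (B o e)) S1) ++ [:: Sh])).
      move=> o e _; rewrite enc_Z_opp /enc_nat em nat_bits_pow_pred.
      have -> : (2 ^ (mexp (B o e)).-1.+1 - 1 == 0) = false; last by [].
      by apply/eqP; rewrite expnS; have := expn_gt0 2 ((mexp (B o e)).-1); lia.
    apply: Wc_cons; apply: Wc_cat (Wc_const _ _); exact: Wc_nseq (E_mexp hB).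
- apply: (@Wc_ext _ _ (fun o e => S1 :: (S1 :: nseq (mexp (B o e)) S0) ++ [:: Sh])).
    by move=> o e _; rewrite enc_Z_opp /enc_nat nat_bits_pow nz.
  apply: Wc_cons; apply: Wc_cat (Wc_const _ _); apply: Wc_cons.
  exact: Wc_nseq (E_mexp hB).
- apply: (@Wc_ext _ _ (fun o e => S1 :: enc_nat (B o e).+2)).
    by move=> o e _; rewrite enc_Z_opp.
  by apply: Wc_cons; apply: Wc_enc_nat; do 2 apply: E_succ.
apply: (@Wc_ext _ _ (fun o e => (if A o e == 0 then [:: S0] else [:: S1]) ++ enc_nat (A o e))).
  by move=> o e _; rewrite enc_Z_opp; case: ifP.
apply: Wc_cat; last exact: Wc_enc_nat.
by apply: Wc_if; [apply: E_isz | apply: Wc_const | apply: Wc_const].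
Qed.

Definition csym (c : nat) : tm_tape M :=
  if c is c'.+1 then if insub c' is Some i then tm_inp M (enum_val (i : 'I_#|G|)) else tm_blank M
  else tm_blank M.

Definition rowo (o : nat -> nat) (k : nat) : tsym M :=
  if k is k'.+1 then Some (if k' == 0 then Some (tm_start M) else None, csym (o k')) else None.

Lemma csym_orc (x : seq G) i : csym (orc x i) = nth (tm_blank M) (map (tm_inp M) x) i.
Proof.
elim: x i => [|y x IH] [|i]; [by [] | by [] | | exact: IH i].
rewrite /orc /csym /=.
by case: insubP => [u _ eu|]; [congr (tm_inp M _); rewrite -[RHS]enum_rankK; congr enum_val; apply: val_inj | rewrite ltn_ord].
Qed.

Lemma row0_rowo (x : seq G) k : row0 M x k = rowo (orc x) k.
Proof.
rewrite /row0 /rowo; case: k => [|k].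
  by rewrite /tinit; case: x.
rewrite csym_orc /tinit; case: x => [|y x] /=; first by case: k => [|k] //=; rewrite nth_nil.
by case: k.
Qed.

(** The oracle takes finitely many values, so a property of a letter becomes a finite disjunction of
    equalities fixed when the term is built. *)
Lemma E_rowo_eq (s : tsym M) A : E A -> E (fun o e => (s == rowo o (A o e)) : nat).
Proof.
move=> hA; case: s => [[h b]|]; last first.
  by apply: E_ext (E_isz hA) => o e _; case: (A o e).
pose ok c := csym c == b.
have Eok : E (fun o e => ok (o (A o e).-1) : nat).
  have : E (fun o e => has (fun c => ok c && (o (A o e).-1 == c)) (iota 0 g.+1) : nat).
    have aux l : E (fun o e => has (fun c => ok c && (o (A o e).-1 == c)) l : nat).
      elim: l => [|c l IH]; first exact: (E_const _ 0).
      apply: E_or IH; case: (ok c); last exact: (E_const _ 0).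
      by apply: E_eq (E_const _ c); apply: E_inp; apply: E_pred.
    exact: aux.
  apply: E_ext => o e ho; congr (nat_of_bool _); apply/hasP/idP.
    by move=> [c _ /andP[h1 /eqP ->]].
  move=> hok; exists (o (A o e).-1); last by rewrite hok eqxx.
  by rewrite mem_iota add0n ltnS ho.
apply: (@E_ext _ (fun o e => [&& A o e != 0, (if A o e == 1 then h == Some (tm_start M) else h == None)
    & ok (o (A o e).-1)] : nat)).
  move=> o e _; rewrite /rowo; case: (A o e) => [|a] //=; congr (nat_of_bool _).
  rewrite eqSS [X in _ = (X : bool)]/eq_op /= xpair_eqE /ok [_ == csym _]eq_sym.
  by case: (a == 0); rewrite eq_sym // ; case: (h).
apply: E_and; first by apply: E_neg; apply: E_isz.
apply: E_and => //.
apply: (@E_ext _ (fun o e => (A o e == 1) && (h == Some (tm_start M)) || (A o e != 1) && (h == None) : nat)).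
  by move=> o e _; case: (A o e == 1) => //=; rewrite orbF.
apply: E_or; apply: E_and; try exact: E_const.
  by apply: E_eq (E_const _ 1).
by apply: E_neg; apply: E_eq (E_const _ 1).
Qed.


Definition wtz (w : wt) (k n : nat) : Z :=
  (match w with
    | W0 => 0 | Wp => 1 | Wm => -1 | WK j => - Z.of_nat (jump (2 ^ (mexp n)) j)
    | WW => - Z.of_nat (2 ^ (mexp n)) | WN => - Z.of_nat n.+2
    | WPos => - Z.of_nat k end)%Z.

Definition txt (q a : nat) (w : wt) (k n p : nat) : seq sym :=
  enc_nat q ++ enc_nat a ++ enc_Z (wtz w k n) ++ enc_nat p.

Lemma Wc_txt q A w K B p : E A -> E K -> E B ->
  Wc (fun o e => txt q (A o e) w (K o e) (B o e) p).
Proof.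
move=> hA hK hB; apply: Wc_cat (Wc_const _ _) _; apply: Wc_cat (Wc_enc_nat hA) _.
by apply: Wc_cat (Wc_const _ _); apply: Wc_weight.
Qed.

Definition txtpos (o : nat -> nat) (k n : nat) : seq sym :=
  List.flat_map (fun s => List.flat_map (fun p : wt * hst M =>
    txt (rk s) (nfix M + k) p.1 k n (rk p.2)) (dpos (rowo o k) s)) (enum {: hst M}).

Lemma Wc_txtpos K B : E K -> E B -> Wc (fun o e => txtpos o (K o e) (B o e)).
Proof.
move=> hK hB; apply: Wc_flat_map => s.
have hk : E (fun o e => nfix M + K o e) by apply: E_add (E_const _ _) hK.
have const l : Wc (fun o e => List.flat_map (fun p : wt * hst M =>
    txt (rk s) (nfix M + K o e) p.1 (K o e) (B o e) (rk p.2)) l).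
  by apply: Wc_flat_map => p; apply: Wc_txt.
case: s const => [||||||||||||sg|t j] const; try exact: const.
apply: (@Wc_ext _ _ (fun o e => if sg == rowo o (K o e) then
   List.flat_map (fun p : wt * hst M =>
    txt (rk (Cl sg)) (nfix M + K o e) p.1 (K o e) (B o e) (rk p.2)) [:: (WPos, Fx M)] else
   List.flat_map (fun p : wt * hst M =>
    txt (rk (Cl sg)) (nfix M + K o e) p.1 (K o e) (B o e) (rk p.2)) [:: (WPos, Ce M)])).
  by move=> o e _; rewrite /dpos; case: ifP.
by apply: Wc_if => //; apply: E_rowo_eq.
Qed.

Lemma flat_map_cat (A B : Type) (f : A -> seq B) l1 l2 :
  List.flat_map f (l1 ++ l2) = List.flat_map f l1 ++ List.flat_map f l2.
Proof.
by elim: l1 => // a l1 IH; rewrite -[LHS]/(f a ++ List.flat_map f (l1 ++ l2)) IH catA.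
Qed.

Lemma flat_map_map (A B C : Type) (f : B -> seq C) (h : A -> B) l :
  List.flat_map f (List.map h l) = List.flat_map (fun a => f (h a)) l.
Proof. by elim: l => //= a l ->. Qed.

Lemma flat_map_flat_map (A B C : Type) (f : B -> seq C) (h : A -> seq B) l :
  List.flat_map f (List.flat_map h l) = List.flat_map (fun a => List.flat_map f (h a)) l.
Proof.
by elim: l => // a l IH; rewrite -[LHS]/(List.flat_map f (h a ++ List.flat_map h l)) flat_map_cat IH.
Qed.

Definition reduction (x : seq G) : seq sym := encode (net M x (2 ^ mexp (size x))).

Lemma reduction_Wc : exists2 F, Wc F & forall x, reduction x = F (orc x) [:: size x].
Proof.
pose fixtxt n := List.flat_map (fun t : hst M * hlt M * (wt * hst M) =>
   txt (rk t.1.1) (rl t.1.2) t.2.1 0 n (rk t.2.2)) (fixT M).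
pose F o e := enc_unary #|{: hst M}| ++ enc_unary (nfix M + (nth 0 e 0).+2) ++ enc_nat (rk (Q0 M)) ++
  (List.map (fun _ => S1) (List.seq 0 #|{: hst M}|) ++ [:: Sh]) ++
  (fixtxt (nth 0 e 0) ++ flatten (mkseq (fun k => txtpos o k (nth 0 e 0)) (nth 0 e 0).+2)).
exists F.
  apply: Wc_cat (Wc_const _ _) _; apply: Wc_cat; last first.
    apply: Wc_cat (Wc_const _ _) _; apply: Wc_cat (Wc_const _ _) _; apply: Wc_cat.
      by apply: Wc_flat_map => t; apply: Wc_txt; [apply: E_const | apply: E_const | apply: E_nth].
    apply: (Wc_for (F := fun o e => txtpos o (nth 0 e 0) (nth 0 e 1)) (N := fun o e => (nth 0 e 0).+2)).
      by do 2 apply: E_succ; apply: E_nth.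
    by apply: Wc_txtpos; apply: E_nth.
  apply: (@Wc_ext _ _ (fun o e => nseq (nfix M + (nth 0 e 0).+2) S1 ++ [:: Sh])).
    by move=> o e _; rewrite /enc_unary; congr (_ ++ _); elim: (nfix M + _) => //= k ->.
  apply: Wc_cat (Wc_const _ _); apply: Wc_nseq; apply: E_add (E_const _ _) _.
  by do 2 apply: E_succ; apply: E_nth.
move=> x; rewrite /reduction /encode /F; do 4 congr (_ ++ _).
rewrite flat_map_cat; congr (_ ++ _).
  by rewrite /fixTr flat_map_map.
rewrite /posTrs flat_map_flat_map flat_map_flatten List_seq_iota; congr flatten.
apply/eq_in_map => k _; rewrite /posTr flat_map_map /posT flat_map_flat_map /txtpos row0_rowo.
elim: (enum _) => //= s l ->; congr (_ ++ _); rewrite flat_map_map.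
by elim: (dpos _ s) => //= p l' ->.
Qed.

Lemma poly_time_ext (A B : finType) (f f' : seq A -> seq B) :
  f =1 f' -> poly_time_computable f -> poly_time_computable f'.
Proof.
move=> h [T [out [k hk]]]; exists T, out, k => x.
by have [t [h1 [h2 h3]]] := hk x; exists t; rewrite -h.
Qed.

Lemma reduction_poly : poly_time_computable reduction.
Proof.
have [F [w [h1 [c hc]]] h2] := reduction_Wc.
have ob (x : seq G) : obnd g (orc x) by move=> i; apply: lcode_le.
apply: (@poly_time_ext _ _ (fun x : seq G => weval (orc x) [:: size x] w)).
  by move=> x; rewrite h1 // h2.
apply: (@writer_poly_time _ _ w (2 ^ c + c)) => x.
apply: leq_trans (hc _ _ (ob x)) _; rewrite /= maxn0.
apply: (@leq_trans ((2 * (size x).+1) ^ c)); first by apply: expn_mono; lia.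
rewrite expnMn; apply: leq_mul; first by lia.
by apply: leq_pexp2l => //; lia.
Qed.

End Reduction.

Theorem HD_hard : EXPSPACE_hard HD_problem.
Proof.
move=> G L [M [k hM]]; exists (reduction M k); split; first exact: reduction_poly.
move=> x; rewrite /reduction (net_correct hM) //.
  rewrite /mexp; apply: leq_trans (ltn_expl _ (ltnSn 1)) _.
  by rewrite leq_exp2l //; lia.
by rewrite /mexp ltn_exp2l // addn1; lia.
Qed.

End Reduction.
Import Reduction.

(** * The belt theorem *)

Module Belts.

Section Game.
Variables (V : finType) (eve bad : V -> bool) (edges : V -> list (Z * Z * V)).

(* The escape set [U] collects the positions that count as won for Eve. *)
Definition gclosed (U : Z -> Z -> Prop) (S : V -> Z -> Z -> Prop) := forall v x y,
  S v x y -> ~ U x y ->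
  [/\ (0 <= y)%Z, bad v = false &
    if eve v then exists dx dy v', List.In (dx, dy, v') (edges v) /\
        (U (x + dx) (y + dy) \/ S v' (x + dx) (y + dy))%Z
    else forall dx dy v', List.In (dx, dy, v') (edges v) ->
        (U (x + dx) (y + dy) \/ S v' (x + dx) (y + dy))%Z].

Definition Ufull (x y : Z) : Prop := (x < 0)%Z.
(** Leaving the box counts for Eve, so the cut game is the easier one for her; it is Adam's wins
    that must be shown to survive the cut. *)
Definition Utrunc (L x y : Z) : Prop := (x < 0 \/ L < x \/ L < y)%Z.

Variable D : nat.
Hypothesis edge_bnd : forall v dx dy v', List.In (dx, dy, v') (edges v) ->
  (Z.abs dx <= Z.of_nat D /\ Z.abs dy <= Z.of_nat D)%Z.
Hypothesis edge_eve : forall v dx dy v', List.In (dx, dy, v') (edges v) ->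
  if eve v then dx = 0%Z else dy = 0%Z.

(** Bounds both coordinates of the displacement along a path or cycle that repeats no vertex. *)
Definition Kn := #|V| * D.
Notation K := (Z.of_nat Kn).

Definition hist := seq (V * (Z * Z)).

Fixpoint lk (h : hist) (v : V) : option (Z * Z) :=
  if h is (u, p) :: h' then if u == v then Some p else lk h' v else None.

(** * First-cycle games *)

Section FirstCycle.
Variable lf : Z -> Z -> V -> bool.

(** Play stops at the first repeated vertex and is judged by the displacement since its earlier
    visit; positions are relative to the start. With fuel [#|V| - size h] the default at 0 is not
    reached on repetition-free histories. *)
Fixpoint gm (fuel : nat) (h : hist) (v : V) (px py : Z) : bool :=
  match lk h v with
  | Some (qx, qy) => lf (px - qx) (py - qy) v
  | None => if bad v then false else
    match fuel with
    | 0 => true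
    | f.+1 =>
      if eve v then List.existsb (fun e : Z * Z * V =>
        gm f ((v, (px, py)) :: h) e.2 (px + e.1.1) (py + e.1.2)) (edges v)
      else List.forallb (fun e : Z * Z * V =>
        gm f ((v, (px, py)) :: h) e.2 (px + e.1.1) (py + e.1.2)) (edges v)
    end
  end.

Definition nodeval (h : hist) v px py := gm (#|V| - size h) h v px py.

(** A path that the winner with value [b] may have played: all its nodes have value [b], none
    repeats, and consecutive positions are one edge apart. *)
Fixpoint okh (b : bool) (h : hist) (px py : Z) : Prop :=
  match h with
  | [::] => px = 0%Z /\ py = 0%Z
  | (u, (ux, uy)) :: h' => [/\ (Z.abs (px - ux) <= Z.of_nat D)%Z, (Z.abs (py - uy) <= Z.of_nat D)%Z,
      nodeval h' u ux uy = b, lk h' u = None & okh b h' ux uy]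
  end.

Lemma lk_None h v : lk h v = None <-> v \notin map fst h.
Proof.
elim: h => //= -[u p] h IH; rewrite inE negb_or eq_sym /=.
by case: eqP => //= _; rewrite IH.
Qed.

Lemma okh_uniq b h px py : okh b h px py -> uniq (map fst h).
Proof.
elim: h px py => //= -[u [ux uy]] h IH px py [_ _ _ /lk_None h1 h2].
by rewrite h1 (IH _ _ h2).
Qed.

Lemma okh_size b h px py : okh b h px py -> size h <= #|V|.
Proof. by move=> /okh_uniq h1; rewrite -(size_map fst); rewrite -(card_uniqP h1) max_card. Qed.

Lemma okh_size_lt b h px py v : okh b h px py -> lk h v = None -> size h < #|V|.
Proof.
move=> /okh_uniq h1 /lk_None h2; rewrite -(size_map fst).
have : uniq (v :: map fst h) by rewrite /= h2 h1.
by move=> /card_uniqP /= <-; apply: max_card.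
Qed.

Lemma okh_bnd b h px py : okh b h px py ->
  (Z.abs px <= Z.of_nat (size h * D) /\ Z.abs py <= Z.of_nat (size h * D))%Z.
Proof.
elim: h px py => /= [|[u [ux uy]] h IH] px py; first by case=> -> ->.
by move=> [h1 h2 _ _ /IH [h3 h4]]; rewrite mulSn; lia.
Qed.

Lemma size_mulD b h px py : okh b h px py -> size h * D <= Kn.
Proof. by move=> /okh_size hs; rewrite leq_mul2r hs orbT. Qed.

Lemma okh_K b h px py : okh b h px py -> (Z.abs px <= K /\ Z.abs py <= K)%Z.
Proof. by move=> hh; have := okh_bnd hh; have := size_mulD hh; lia. Qed.

(** Forgets a closed cycle: play resumes from the earlier visit, and the displacement of the cycle
    passes from the history to the base point. In this way a finite game governs unbounded plays. *)
Lemma okh_cut b h px py v qx qy : okh b h px py -> lk h v = Some (qx, qy) ->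
  exists h2, [/\ okh b h2 qx qy, nodeval h2 v qx qy = b, lk h2 v = None &
    (Z.abs (px - qx) <= K /\ Z.abs (py - qy) <= K)%Z].
Proof.
move=> hh hl; suff [h2 [h3 h4 h5 h6]] : exists h2, [/\ okh b h2 qx qy, nodeval h2 v qx qy = b, lk h2 v = None &
    (Z.abs (px - qx) <= Z.of_nat (size h * D) /\ Z.abs (py - qy) <= Z.of_nat (size h * D))%Z].
  by exists h2; split=> //; have := size_mulD hh; lia.
elim: h px py hh hl => //= -[u [ux uy]] h IH px py [h1 h2 h3 h4 h5].
case: eqP => [<-|ne] => [[<- <-]|hl].
  by exists h; split=> //; lia.
have [h' [k1 k2 k3 k4]] := IH _ _ h5 hl.
by exists h'; split=> //; rewrite mulSn; lia.
Qed.

Lemma nodeval_step b h px py v : okh b h px py -> lk h v = None ->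
  nodeval h v px py = if bad v then false else
   if eve v then List.existsb (fun e : Z * Z * V =>
        nodeval ((v, (px, py)) :: h) e.2 (px + e.1.1) (py + e.1.2)) (edges v)
      else List.forallb (fun e : Z * Z * V =>
        nodeval ((v, (px, py)) :: h) e.2 (px + e.1.1) (py + e.1.2)) (edges v).
Proof.
move=> h1 h2; have hs := okh_size_lt h1 h2.
rewrite {1}/nodeval; have -> : #|V| - size h = (#|V| - (size h).+1).+1 by rewrite subnSK.
by rewrite /= h2.
Qed.

Lemma nodeval_leaf h px py v qx qy : lk h v = Some (qx, qy) ->
  nodeval h v px py = lf (px - qx) (py - qy) v.
Proof. by rewrite /nodeval; case: (#|V| - size h) => [|f] /= ->. Qed.

Lemma okh_child b h px py v dx dy v' : okh b h px py -> lk h v = None -> nodeval h v px py = b ->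
  List.In (dx, dy, v') (edges v) -> okh b ((v, (px, py)) :: h) (px + dx) (py + dy).
Proof. by move=> h1 h2 h3 /edge_bnd [h4 h5]; split=> //; lia. Qed.

End FirstCycle.

(** Cross product; it is positive when [(x, y)] lies above the ray of direction [(a, b)], which is
    Eve's side. *)
Definition det (a b x y : Z) : Z := (a * y - b * x)%Z.

(** A cycle that does not turn below the ray suits Eve. Among the others, one that lowers her
    counter lets Adam exhaust it; the rest point forward in a flatter direction, and the winner is
    whoever wins from [u] along that direction, supplied by [w]. *)
Definition leafv (w : Z -> Z -> V -> bool) (rx ry : Z) (kx ky : Z) (u : V) : bool :=
  if (0 <=? det rx ry kx ky)%Z then true else if (ky <? 0)%Z then false else w kx ky u.

Fixpoint win (n : nat) (rx ry : Z) (v : V) : bool :=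
  if n is n'.+1 then nodeval (leafv (win n') rx ry) [::] v 0 0 else false.

(** * From first-cycle wins of Eve to wins above a ray *)

Section EveTransfer.
Local Open Scope Z_scope.

(** Height kept in reserve above the ray, per unit of [rx]. Every change to a flatter direction
    consumes one portion. *)
Definition eA (n : nat) : Z := Z.of_nat n * (K * (K + 1) + 1).

Definition eve_inv n rx ry bx byy : Prop :=
  [/\ 0 <= rx, 0 <= ry & det rx ry bx byy >= rx * eA n + K * (rx + ry) + 1].

Definition eveS (v : V) (x y : Z) : Prop := exists n rx ry h px py,
  [/\ okh (leafv (win n) rx ry) true h px py, nodeval (leafv (win n) rx ry) h v px py = true &
      eve_inv n.+1 rx ry (x - px) (y - py)].

(** At a repeated vertex either the cycle keeps the base point above the ray and is cut, or Eve
    changes to the direction of the cycle one level down. A point high above the old ray is high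
    above the new one, because that is flatter and [x] is nonnegative. *)
Lemma eveS_norm n rx ry h px py v x y : 0 <= x ->
  okh (leafv (win n) rx ry) true h px py -> nodeval (leafv (win n) rx ry) h v px py = true ->
  eve_inv n.+1 rx ry (x - px) (y - py) ->
  exists n rx ry h px py, [/\ okh (leafv (win n) rx ry) true h px py,
   nodeval (leafv (win n) rx ry) h v px py = true,
   eve_inv n.+1 rx ry (x - px) (y - py) & lk h v = None].
Proof.
move=> hx; elim: n rx ry h px py => [|n IH] rx ry h px py hh hv hi.
  case E: (lk h v) => [[qx qy]|]; last by exists 0%N, rx, ry, h, px, py.
  have [h2 [k1 k2 k3 [k4 k5]]] := okh_cut hh E.
  have := hv; rewrite (nodeval_leaf _ _ _ E) /leafv.
  case: Z.leb_spec => hd; last by case: Z.ltb_spec.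
  move=> _; exists 0%N, rx, ry, h2, qx, qy; split=> //.
  by case: hi => i1 i2 i3; split=> //; move: hd i3; rewrite /det; lia.
case E: (lk h v) => [[qx qy]|]; last by exists n.+1, rx, ry, h, px, py.
have [h2 [k1 k2 k3 [k4 k5]]] := okh_cut hh E.
have := hv; rewrite (nodeval_leaf _ _ _ E) {1}/leafv.
case: Z.leb_spec => hd.
  move=> _; exists n.+1, rx, ry, h2, qx, qy; split=> //.
  by case: hi => i1 i2 i3; split=> //; move: hd i3; rewrite /det; lia.
case: Z.ltb_spec => // hy hw.
have [p1 p2] := okh_K hh.
apply: (IH (px - qx) (py - qy) [::] 0 0) => //.
rewrite !Z.sub_0_r; case: hi => i1 i2 i3.
move: (px - qx) (py - qy) hd hy k4 k5 {hw} => kx ky hd hy k4 k5.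
have hA : eA n.+2 = eA n.+1 + (K * (K + 1) + 1) by rewrite /eA; lia.
rewrite /eve_inv /det; move: (eA n.+1) hA i3 => A -> i3; rewrite /det in i3 hd.
have hkx : 0 < kx by nia.
have hrx : 0 < rx.
  case: (Z.eq_dec rx 0) => [e|]; last by lia.
  exfalso; rewrite e in i3; nia.
split; [by lia | by lia |].
have hP : rx * y - ry * x >= rx * (A + (K * (K + 1) + 1)).
  have : Z.abs (rx * py - ry * px) <= K * (rx + ry) by nia.
  by nia.
(* Height above the new ray in terms of the old height; the second summand is nonnegative. *)
have h1 : rx * (kx * y - ky * x) = kx * (rx * y - ry * x) + x * (kx * ry - rx * ky) by ring.
have h2' : rx * (kx * y - ky * x) >= rx * (kx * (A + (K * (K + 1) + 1))) by nia.
have h3 : kx * y - ky * x >= kx * (A + (K * (K + 1) + 1)) by nia.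
have h4 : kx * (K * (K + 1) + 1) >= K * (kx + ky) + 1 by nia.
by rewrite Z.mul_add_distr_l in h3; lia.
Qed.

Lemma eveS_closed : gclosed Ufull eveS.
Proof.
move=> v x y [n [rx [ry [h [px [py [h1 h2 h3]]]]]]] hU.
have hx : 0 <= x by rewrite /Ufull in hU; lia.
have {n rx ry h px py h1 h2 h3} [n [rx [ry [h [px [py [h1 h2 h3 h4]]]]]]] := eveS_norm hx h1 h2 h3.
have [p1 p2] := okh_K h1.
have hy : 0 <= y.
  case: h3 => i1 i2; rewrite /det => i3.
  have hA : 0 <= eA n.+1 by rewrite /eA; lia.
  have : rx * (y - py) >= K * rx + 1 by nia.
  by nia.
have := h2; rewrite (nodeval_step h1 h4); case: (bad v) => // hb; split=> //.
case: (eve v) hb.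
  move=> /List.existsb_exists [[[dx dy] v'] [hin hval]].
  exists dx, dy, v'; split=> //; right; exists n, rx, ry, ((v, (px, py)) :: h), (px + dx), (py + dy).
  split=> //; first exact: okh_child hin.
  have -> : x + dx - (px + dx) = x - px by ring.
  by have -> : y + dy - (py + dy) = y - py by ring.
move=> /List.forallb_forall hall dx dy v' hin; right.
exists n, rx, ry, ((v, (px, py)) :: h), (px + dx), (py + dy).
split=> //; [exact: okh_child hin | exact: (hall _ hin) |].
have -> : x + dx - (px + dx) = x - px by ring.
by have -> : y + dy - (py + dy) = y - py by ring.
Qed.

Lemma eve_transfer n rx ry v x y : win n.+1 rx ry v = true -> eve_inv n.+1 rx ry x y -> eveS v x y.
Proof.
by move=> h1 h2; exists n, rx, ry, [::], 0, 0; split=> //; rewrite !Z.sub_0_r.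
Qed.

End EveTransfer.

(** * From first-cycle wins of Adam to wins below a ray inside a box *)

Section AdamTransfer.

Definition gr := ('I_Kn.+1 * 'I_Kn.+1)%type.
Definition gx (k : gr) : Z := Z.of_nat k.1.
Definition gy (k : gr) : Z := Z.of_nat k.2.
Definition low (rx ry : Z) (k : gr) : bool := (0 < k.1) && (det rx ry (gx k) (gy k) <? 0)%Z.
(** Counts the strictly flatter grid vectors, the candidates for the next direction. It drops at
    each change of direction and so bounds the depth of the recursion in [win]. *)
Definition rank (rx ry : Z) : nat := #|[pred k | low rx ry k]|.

(** Exceeds the horizontal displacement of any cycle, so that one unit of [det] outweighs it. *)
Definition Mz : Z := (K + 1)%Z.
Definition C2 : Z := (2 * (2 * Mz * K * K + K))%Z.
Definition Cn : nat := (Kn + 1) * (Kn * Kn).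
Definition Bn : nat := #|{: gr}| * Cn + Kn + 1.
(** Height above a line of direction [k], tilted by the summand [- x]. Along the cycle [k] itself
    [det] is constant, and the tilt makes its repetition count as progress. [C2] keeps the value
    positive as long as Adam cannot yet change to direction [k]. *)
Definition qv (k : gr) (x y : Z) : Z := (Mz * det (gx k) (gy k) x y - x + C2)%Z.
Definition wgt (k : gr) : nat := Bn ^ (rank (gx k) (gy k)).+1.
(** Adam's potential: how far the point still is above each flatter direction, plus Eve's counter.
    It limits the number of cycles he has to close, and thereby the box he needs. *)
Definition Psi (rx ry x y : Z) : nat :=
  \sum_(k | low rx ry k) wgt k * Z.to_nat (qv k x y) + Z.to_nat (y + K).
Definition En : nat := #|{: gr}| * Bn ^ #|{: gr}|.+1 * (2 * (Kn + 1) * (Kn * Kn) + Kn) + 2 * Kn.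

Lemma g_bnd k : (0 <= gx k <= K /\ 0 <= gy k <= K)%Z.
Proof. by have := ltn_ord k.1; have := ltn_ord k.2; rewrite /gx /gy; lia. Qed.

Lemma lowP rx ry k : low rx ry k -> (0 < gx k /\ rx * gy k < ry * gx k)%Z.
Proof. by rewrite /low /det /gx => /andP[h1 /Z.ltb_lt h2]; lia. Qed.

Lemma lowI rx ry k : (0 < gx k)%Z -> (rx * gy k < ry * gx k)%Z -> low rx ry k.
Proof. by rewrite /low /det /gx => h1 h2; apply/andP; split; [lia | apply/Z.ltb_lt; lia]. Qed.

Lemma low_trans rx ry k k' : (0 <= rx)%Z -> (0 <= ry)%Z ->
  low rx ry k -> low (gx k) (gy k) k' -> low rx ry k'.
Proof.
move=> r0 r1 /lowP [h1 h2] /lowP [h3 h4]; have [g1 g2] := g_bnd k; have [g3 g4] := g_bnd k'.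
apply: lowI => //.
move: (gx k) (gy k) (gx k') (gy k') h1 h2 h3 h4 g1 g2 g3 g4 => a b c d h1 h2 h3 h4 g1 g2 g3 g4.
have e1 : (rx * b * c < ry * a * c)%Z by nia.
have e2 : (rx * a * d <= rx * b * c)%Z by nia.
by nia.
Qed.

Lemma rank_low rx ry k : (0 <= rx)%Z -> (0 <= ry)%Z -> low rx ry k ->
  rank (gx k) (gy k) < rank rx ry.
Proof.
move=> r0 r1 hk; apply: proper_card; apply/properP; split.
  by apply/subsetP => k'; rewrite !inE; apply: low_trans.
by exists k; rewrite !inE //; apply/negP => /lowP; lia.
Qed.

Lemma rank_le rx ry : rank rx ry <= #|{: gr}|.
Proof. exact: max_card. Qed.

Lemma grid_mem (kx ky : Z) : (0 < kx <= K)%Z -> (0 <= ky <= K)%Z ->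
  exists k : gr, gx k = kx /\ gy k = ky.
Proof.
move=> h1 h2; exists (inord (Z.to_nat kx), inord (Z.to_nat ky)).
by rewrite /gx /gy /= !inordK; lia.
Qed.

(** A cycle that turns below the ray while going down also turns below every flatter forward vector,
    so no height grows and the term for Eve's counter drops. *)
Lemma Psi_drain rx ry x y kx ky : (0 <= rx)%Z -> (0 <= ry)%Z -> (Z.abs kx <= K)%Z ->
  (det rx ry kx ky < 0)%Z -> (ky < 0)%Z -> (0 <= y + ky + K)%Z ->
  Psi rx ry (x + kx) (y + ky) < Psi rx ry x y.
Proof.
move=> r0 r1 hkx hd hky hy; rewrite /Psi -addnS; apply: leq_add; last by lia.
apply: leq_sum => k /lowP [h1 h2]; rewrite leq_mul2l; apply/orP; right.
have [g1 g2] := g_bnd k.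
suff : (qv k (x + kx) (y + ky) <= qv k x y)%Z by lia.
suff hdet : (gx k * ky - gy k * kx <= -1)%Z by rewrite /qv /det /Mz; nia.
rewrite /det in hd.
move: (gx k) (gy k) h1 h2 g1 g2 => a b h1 h2 g1 g2.
case: (Z.le_gt_cases 0 kx) => hx; first by nia.
have rx0 : (0 < rx)%Z by nia.
have e1 : (a * (rx * ky) < a * (ry * kx))%Z by nia.
have e2 : (kx * (ry * a) <= kx * (rx * b))%Z by nia.
by nia.
Qed.

(** The cycle [k] lowers its own height and those of the vectors that are not flatter. It may raise
    the flatter ones, but these have smaller rank, and the base [Bn] of the weights is large enough
    for the drop at [k] to outweigh all of them together with the change of [y]. Positivity at the
    new point keeps the truncation to naturals from hiding the drop. *)
Lemma Psi_cycle rx ry x y k : (0 <= rx)%Z -> (0 <= ry)%Z -> low rx ry k ->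
  (0 < qv k (x + gx k) (y + gy k))%Z ->
  Psi rx ry (x + gx k) (y + gy k) < Psi rx ry x y.
Proof.
move=> r0 r1 hk hq; rewrite /Psi.
set a' := fun i => Z.to_nat (qv i (x + gx k) (y + gy k)).
set a := fun i => Z.to_nat (qv i x y).
have [g1 g2] := g_bnd k; have [hk1 hk2] := lowP hk.
have pt i : low rx ry i ->
  wgt i * a' i + (i == k) * wgt i <= wgt i * a i + low (gx k) (gy k) i * (wgt i * Cn).
  move=> hi; have [h1 h2] := lowP hi; have [g3 g4] := g_bnd i.
  have eq : (qv i (x + gx k) (y + gy k) = qv i x y + Mz * (gx i * gy k - gy i * gx k) - gx k)%Z.
    by rewrite /qv /det; ring.
  case: (boolP (low (gx k) (gy k) i)) => hl.
    have ne : (i == k) = false by apply/eqP => e; move/lowP: hl; rewrite e; lia.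
    rewrite ne mul0n addn0 mul1n -mulnDr leq_mul2l; apply/orP; right.
    rewrite /a' /a eq; have : (Mz * (gx i * gy k - gy i * gx k) <= Z.of_nat Cn)%Z.
      have -> : Z.of_nat Cn = ((K + 1) * (K * K))%Z by rewrite /Cn; nia.
      have : (gx i * gy k - gy i * gx k <= K * K)%Z by nia.
      by rewrite /Mz; nia.
    by lia.
  rewrite mul0n addn0.
  have hd : (gx i * gy k - gy i * gx k <= 0)%Z.
    case: (Z.le_gt_cases (gx i * gy k - gy i * gx k) 0) => // hc.
    by exfalso; move/negP: hl; apply; apply: lowI => //; lia.
  have hq2 : (qv i (x + gx k) (y + gy k) < qv i x y)%Z by rewrite eq /Mz; nia.
  case: eqP => [e|_]; last by rewrite mul0n addn0 leq_mul2l; apply/orP; right; rewrite /a /a'; lia.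
  rewrite mul1n -mulnSr leq_mul2l; apply/orP; right.
  have hq' : (0 < qv i (x + gx k) (y + gy k))%Z by rewrite [in qv i]e.
  by rewrite /a /a'; lia.
have s1 : \sum_(i | low rx ry i) (wgt i * a' i) + wgt k <=
   \sum_(i | low rx ry i) (wgt i * a i) + \sum_(i | low rx ry i) (low (gx k) (gy k) i * (wgt i * Cn)).
  rewrite -big_split /=; apply: leq_trans (leq_sum _ pt).
  rewrite big_split /= leq_add2l (bigD1 k) //= eqxx mul1n.
  by rewrite leq_addr.
have s2 : \sum_(i | low rx ry i) (low (gx k) (gy k) i * (wgt i * Cn)) <=
   #|{: gr}| * (Bn ^ (rank (gx k) (gy k)) * Cn).
  apply: (@leq_trans (\sum_(i : gr) Bn ^ (rank (gx k) (gy k)) * Cn)); last first.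
    by rewrite sum_nat_const.
  rewrite big_mkcond /=; apply: leq_sum => i _; case: ifP => // _.
  case: (boolP (low _ _ _)) => hl; last by rewrite mul0n.
  rewrite mul1n leq_mul2r; apply/orP; right; rewrite /wgt.
  by apply: leq_pexp2l; [rewrite /Bn; lia | apply: rank_low hl; lia].
have hB : 0 < Bn ^ (rank (gx k) (gy k)) by rewrite expn_gt0 /Bn; lia.
have ty : Z.to_nat (y + gy k + K) <= Z.to_nat (y + K) + Kn by lia.
have ew : wgt k = Bn * Bn ^ (rank (gx k) (gy k)) by rewrite /wgt expnS.
move: s1 s2 hB ty; rewrite ew {1}/Bn.
move: (\sum_(i | _) _) (\sum_(i | _) _) (\sum_(i | _) _) => A1 A2 A3.
move: (Bn ^ _) => bb; move: #|_| => gg; move: Cn => cc; move: Kn => kk.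
move: (Z.to_nat _) (Z.to_nat _) => t1 t2; clear; nia.
Qed.

(** When the direction changes the history is emptied and the base point becomes the actual
    position. Terms for vectors no longer flatter disappear, and each remaining one moves by a
    bounded amount. *)
Lemma Psi_shift rx ry x y px py k : (0 <= rx)%Z -> (0 <= ry)%Z -> low rx ry k ->
  (Z.abs px <= K)%Z -> (Z.abs py <= K)%Z ->
  Psi (gx k) (gy k) (x + px) (y + py) <= Psi rx ry x y + En.
Proof.
move=> r0 r1 hk hx hy; rewrite /Psi.
set c := 2 * (Kn + 1) * (Kn * Kn) + Kn.
have s1 : \sum_(i | low (gx k) (gy k) i) wgt i * Z.to_nat (qv i (x + px) (y + py)) <=
   \sum_(i | low rx ry i) wgt i * Z.to_nat (qv i x y) + \sum_(i : gr) Bn ^ #|{: gr}|.+1 * c.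
  rewrite [X in X <= _]big_mkcond [X in _ <= X + _]big_mkcond -big_split /=.
  apply: leq_sum => i _; case: (boolP (low (gx k) (gy k) i)) => // hl.
  rewrite (low_trans r0 r1 hk hl).
  have [g1 g2] := g_bnd i.
  have hq : (qv i (x + px) (y + py) <= qv i x y + Z.of_nat c)%Z.
    have -> : (qv i (x + px) (y + py) = qv i x y + Mz * (gx i * py - gy i * px) - px)%Z.
      by rewrite /qv /det; ring.
    have -> : Z.of_nat c = (2 * (K + 1) * (K * K) + K)%Z by rewrite /c; nia.
    rewrite /Mz; have : (gx i * py - gy i * px <= 2 * (K * K))%Z by nia.
    by nia.
  have hw : wgt i <= Bn ^ #|{: gr}|.+1.
    by rewrite /wgt; apply: leq_pexp2l; [rewrite /Bn; lia | rewrite ltnS; apply: rank_le].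
  have : Z.to_nat (qv i (x + px) (y + py)) <= Z.to_nat (qv i x y) + c by lia.
  move: (Z.to_nat _) (Z.to_nat _) hw => t1 t2 hw ht.
  apply: leq_trans (leq_mul (leqnn _) ht) _; rewrite mulnDr leq_add2l.
  by rewrite leq_mul2r hw orbT.
rewrite sum_nat_const in s1; rewrite /En -/c -mulnA.
move: s1; move: (\sum_(i | _) _) (\sum_(i | _) _) => A1 A2; move: (#|_| * _) => t; clear -hy; lia.
Qed.

(** Room for [n] further changes of direction, each raising the potential by at most [En] at [Kn]
    per unit, and for the length of one history. *)
Definition slack (n : nat) : nat := n * (Kn * En + Kn) + Kn.

Definition adam_inv rx ry bx byy : Prop :=
  [/\ 0 <= rx, 0 <= ry & Mz * det rx ry bx byy <= bx - (Mz * K * (rx + ry) + K)]%Z.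

Definition adam_bnd n rx ry bx byy (L : Z) : Prop :=
  (bx + Z.of_nat (Kn * Psi rx ry bx byy + slack n) <= L /\
   byy + Z.of_nat (Kn * Psi rx ry bx byy + slack n) <= L)%Z.

(** Adam's counter cannot fail first: while Eve's is nonnegative, the constant in [adam_inv] leaves
    at least [K] in the horizontal coordinate of the base point. *)
Lemma adam_inv_pos rx ry bx byy px py : adam_inv rx ry bx byy ->
  (Z.abs px <= K)%Z -> (Z.abs py <= K)%Z -> (0 <= byy + py)%Z -> (0 <= bx + px)%Z.
Proof.
move=> [h1 h2 h3] hx hy hpos; rewrite /det in h3.
have hM : (0 < Mz)%Z by rewrite /Mz; lia.
suff : (K <= bx)%Z by lia.
have e1 : (Mz * rx * byy + Mz * K * (rx + ry) + K <= bx * (1 + Mz * ry))%Z.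
  have -> : (bx * (1 + Mz * ry) = bx + Mz * ry * bx)%Z by ring.
  by have : (Mz * (rx * byy - ry * bx) = Mz * rx * byy - Mz * ry * bx)%Z by [ring]; lia.
have e2 : (Mz * rx * (- K) <= Mz * rx * byy)%Z.
  by apply: Z.mul_le_mono_nonneg_l; [apply: Z.mul_nonneg_nonneg; lia | lia].
have e3 : (K * (1 + Mz * ry) <= bx * (1 + Mz * ry))%Z by lia.
apply/(Z.mul_le_mono_pos_r _ _ (1 + Mz * ry)) => //.
by have : (0 <= Mz * ry)%Z by [apply: Z.mul_nonneg_nonneg; lia]; lia.
Qed.

Lemma adam_cut n rx ry bx byy kx ky L : adam_inv rx ry bx byy -> adam_bnd n rx ry bx byy L ->
  (Z.abs kx <= K)%Z -> (Z.abs ky <= K)%Z -> (det rx ry kx ky < 0)%Z ->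
  Psi rx ry (bx + kx) (byy + ky) < Psi rx ry bx byy ->
  adam_inv rx ry (bx + kx) (byy + ky) /\ adam_bnd n rx ry (bx + kx) (byy + ky) L.
Proof.
move=> [h1 h2 h3] [h4 h5] hx hy hd hP; split.
  split=> //; have -> : (det rx ry (bx + kx) (byy + ky) = det rx ry bx byy + det rx ry kx ky)%Z.
    by rewrite /det; ring.
  by rewrite /Mz in h3 *; nia.
have : Kn * Psi rx ry (bx + kx) (byy + ky) + Kn <= Kn * Psi rx ry bx byy by rewrite -mulnSr leq_mul2l hP orbT.
by rewrite /adam_bnd; lia.
Qed.

(** Induction on the level, then on the potential, then on the vertices left before a repetition. A
    closed cycle is cut with a drop of the potential, unless the point is already below the tilted
    line of that cycle; in that case Adam changes to its direction, one level down. *)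
Lemma adam_main L S n : gclosed (Utrunc L) S -> forall rx ry, rank rx ry <= n ->
  forall N m h px py v x y, Psi rx ry (x - px) (y - py) < N -> #|V| - size h < m ->
  okh (leafv (win n) rx ry) false h px py -> nodeval (leafv (win n) rx ry) h v px py = false ->
  adam_inv rx ry (x - px) (y - py) -> adam_bnd n rx ry (x - px) (y - py) L -> (0 <= x)%Z ->
  ~ S v x y.
Proof.
move=> hS; elim/ltn_ind: n => n IHn rx ry hr.
elim=> [//|N IHN]; elim=> [//|m IHm] h px py v x y hN hm hh hv hi hb hx hSv.
have [p1 p2] := okh_K hh; have [r0 r1 _] := hi.
have hU : ~ Utrunc L x y by rewrite /Utrunc; move: hb; rewrite /adam_bnd /slack; lia.
have [hy hbad hstep] := hS _ _ _ hSv hU.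
case E: (lk h v) => [[qx qy]|].
  have [h2 [k1 k2 k3 [k4 k5]]] := okh_cut hh E; have [q1 q2] := okh_K k1.
  have ex : ((x - px) + (px - qx) = x - qx)%Z by ring.
  have ey : ((y - py) + (py - qy) = y - qy)%Z by ring.
  have := hv; rewrite (nodeval_leaf _ _ _ E) {1}/leafv; case: Z.leb_spec => // hd.
  have cut : Psi rx ry ((x - px) + (px - qx)) ((y - py) + (py - qy)) < Psi rx ry (x - px) (y - py) -> False.
    move=> hP; have [i1 i2] := adam_cut hi hb k4 k5 hd hP; rewrite ex ey in hP i1 i2.
    exact: (IHN _ _ _ _ _ _ _ (leq_trans hP hN) (ltnSn _) k1 k2 i1 i2 hx hSv).
  case: Z.ltb_spec => hky hw; first by apply: cut; apply: Psi_drain => //; lia.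
  have kx0 : (0 < px - qx)%Z by move: hd; rewrite /det; clear -r0 r1 hky; nia.
  have [||k [gkx gky]] := @grid_mem (px - qx) (py - qy); [lia | lia |].
  have hl : low rx ry k by apply: lowI; rewrite gkx ?gky // /det in hd *; lia.
  rewrite -gkx -gky in cut hw.
  case: (Z.le_gt_cases (Mz * det (gx k) (gy k) x y) (x - (Mz * K * (gx k + gy k) + K))) => hs.
    have hrk := rank_low r0 r1 hl.
    (* At level 0 no grid vector is flatter than the ray, so the case is void. *)
    destruct n as [|n']; first by move: hrk; rewrite (eqP (_ : rank rx ry == 0)) // -leqn0.
    have hPs := @Psi_shift rx ry (x - px) (y - py) px py k r0 r1 hl p1 p2.
    rewrite !Z.sub_add in hPs.
    apply: (IHn n' (ltnSn _) (gx k) (gy k) _ _ _ [::] 0%Z 0%Z v x y (ltnSn _) (ltnSn _)) => //.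
    - by have := leq_trans hrk hr; rewrite ltnS.
    - by rewrite !Z.sub_0_r; have [] := g_bnd k; split=> //; lia.
    rewrite !Z.sub_0_r.
    have hm2 : Kn * Psi (gx k) (gy k) x y <= Kn * Psi rx ry (x - px) (y - py) + Kn * En.
      by rewrite -mulnDr leq_mul2l hPs orbT.
    by move: hb; rewrite /adam_bnd /slack mulSn; lia.
  apply: cut; rewrite gkx gky ex ey -ex -ey -gkx -gky.
  apply: Psi_cycle => //; rewrite gkx gky ex ey.
  have [g1 g2] := g_bnd k.
  have -> : qv k (x - qx) (y - qy) =
     (Mz * det (gx k) (gy k) x y - x + qx + C2 - Mz * (gx k * qy - gy k * qx))%Z by rewrite /qv /det; ring.
  have b1 : (Mz * K * (gx k + gy k) <= Mz * K * (2 * K))%Z.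
    by apply: Z.mul_le_mono_nonneg_l; [rewrite /Mz; lia | lia].
  have b2 : (Mz * (gx k * qy - gy k * qx) <= Mz * (2 * (K * K)))%Z.
    by apply: Z.mul_le_mono_nonneg_l; [rewrite /Mz; lia | move: q1 q2 g1 g2; clear; nia].
  by move: hs b1 b2; rewrite /C2; lia.
have hv' := hv; rewrite (nodeval_step hh E) hbad in hv'.
have hsz := okh_size_lt hh E.
have child dx dy v' : List.In (dx, dy, v') (edges v) ->
    nodeval (leafv (win n) rx ry) ((v, (px, py)) :: h) v' (px + dx) (py + dy) = false ->
    (Utrunc L (x + dx) (y + dy) \/ S v' (x + dx) (y + dy))%Z -> False.
  move=> hin hcv; have hch := okh_child hh E hv hin; have [c1 c2] := okh_K hch.
  have ex : (x + dx - (px + dx) = x - px)%Z by ring.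
  have ey : (y + dy - (py + dy) = y - py)%Z by ring.
  have hx' : (0 <= x + dx)%Z.
    have := edge_eve hin; case: (eve v) => e0; first by rewrite e0; lia.
    have := adam_inv_pos hi c1 c2; rewrite e0; lia.
  case=> [hu|hs].
    by move: hu hb; rewrite /Utrunc /adam_bnd /slack; lia.
  apply: (IHm ((v, (px, py)) :: h) (px + dx)%Z (py + dy)%Z v' (x + dx)%Z (y + dy)%Z _ _ hch hcv _ _ hx' hs); rewrite ?ex ?ey //.
  by rewrite /= subnS -ltnS prednK // subn_gt0.
case: (eve v) hstep hv' => [[dx [dy [v' [hin hsu]]]]|hall] hv'.
  apply: (child dx dy v') => //; apply/negbTE/negP => hc.
  by move/negP: (negbT hv'); apply; apply/List.existsb_exists; exists (dx, dy, v').
move/negP: (negbT hv'); apply; apply/List.forallb_forall => -[[dx dy] v'] hin.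
by apply/negPn/negP => /negbTE hc; apply: (child dx dy v') => //; apply: hall.
Qed.

End AdamTransfer.

(** * Existence of belts *)

Section Belt.
Hypothesis Kpos : 0 < Kn.

Lemma gm_ext lf lf' (hlf : forall kx ky u, (Z.abs kx <= K)%Z -> (Z.abs ky <= K)%Z -> lf kx ky u = lf' kx ky u)
    f h v px py : f + size h <= #|V| ->
  (forall u qx qy, lk h u = Some (qx, qy) ->
     (Z.abs (px - qx) <= Z.of_nat (size h * D) /\ Z.abs (py - qy) <= Z.of_nat (size h * D))%Z) ->
  gm lf f h v px py = gm lf' f h v px py.
Proof.
elim: f h v px py => [|f IH] h v px py hs hb /=.
  case E: (lk h v) => [[qx qy]|] //.
  have [b1 b2] := hb _ _ _ E.
  have : size h * D <= Kn by rewrite leq_mul2r; apply/orP; right; rewrite add0n in hs.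
  by move=> b3; apply: hlf; lia.
case E: (lk h v) => [[qx qy]|].
  have [b1 b2] := hb _ _ _ E.
  have : size h * D <= Kn by rewrite leq_mul2r; apply/orP; right; apply: leq_trans hs; apply: leq_addl.
  by move=> b3; apply: hlf; lia.
have he e : List.In e (edges v) ->
    gm lf f ((v, (px, py)) :: h) e.2 (px + e.1.1) (py + e.1.2) =
    gm lf' f ((v, (px, py)) :: h) e.2 (px + e.1.1) (py + e.1.2).
  case: e => [[dx dy] v'] /edge_bnd /= [d1 d2]; apply: IH; first by rewrite /= addnS.
  move=> u qx qy /=; rewrite mulSn; case: eqP => [_ [<- <-]|_ /hb]; lia.
case: (bad v) => //; case: (eve v).
  apply/idP/idP => /List.existsb_exists [e [h1 h2]]; apply/List.existsb_exists; exists e.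
    by rewrite -he.
  by rewrite he.
apply/idP/idP => /List.forallb_forall h1; apply/List.forallb_forall => e h2.
  by rewrite -he // h1.
by rewrite he // h1.
Qed.

(** The ray is consulted only through the signs of [det] against bounded vectors; deeper levels take
    the cycle itself as direction. *)
Lemma win_ext n rx ry rx' ry' v :
  (forall kx ky, (Z.abs kx <= K)%Z -> (Z.abs ky <= K)%Z ->
    (0 <= det rx ry kx ky <-> 0 <= det rx' ry' kx ky)%Z) ->
  win n rx ry v = win n rx' ry' v.
Proof.
move=> hd; case: n => //= n; apply: gm_ext => //=; last by rewrite subn0 addn0.
move=> kx ky u h1 h2; rewrite /leafv; have := hd _ _ h1 h2.
by do 2! case: Z.leb_spec => //; lia.
Qed.

Definition n0 : nat := #|{: gr}|.
Definition W (rx ry : Z) (v : V) : bool := win n0.+1 rx ry v.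
Definition ew : Z := (K * eA n0.+1 + 2 * K * K + K + 1)%Z.
(** Size of a box in which Adam can carry out his win from counters up to [s]: the start, [Kn] times
    the largest initial potential, and the reserve for changes of direction. *)
Definition Lf (s : nat) : nat :=
  s + (Kn * (#|{: gr}| * (Bn ^ #|{: gr}|.+1 * ((Kn + 1) * Kn * s + 2 * (2 * (Kn + 1) * Kn * Kn + Kn)))
    + (s + Kn)) + slack n0).

Lemma Psi_le rx ry x y s : (0 <= x)%Z -> (0 <= y <= Z.of_nat s)%Z ->
  Psi rx ry x y <= #|{: gr}| * (Bn ^ #|{: gr}|.+1 * ((Kn + 1) * Kn * s + 2 * (2 * (Kn + 1) * Kn * Kn + Kn)))
    + (s + Kn).
Proof.
move=> hx hy; rewrite /Psi; apply: leq_add; last by lia.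
set c := (X in Bn ^ _ * X).
apply: (@leq_trans (\sum_(i : gr) Bn ^ #|{: gr}|.+1 * c)); last by rewrite sum_nat_const.
rewrite big_mkcond /=; apply: leq_sum => i _; case: ifP => // _.
apply: leq_mul.
  by rewrite /wgt; apply: leq_pexp2l; [rewrite /Bn; lia | rewrite ltnS; apply: rank_le].
have [g1 g2] := g_bnd i.
suff : (qv i x y <= Z.of_nat c)%Z by lia.
have -> : Z.of_nat c = ((K + 1) * (K * Z.of_nat s) + C2)%Z by rewrite /c /C2 /Mz; nia.
rewrite /qv /det /Mz.
have h1 : (gx i * y - gy i * x <= K * Z.of_nat s)%Z by nia.
by nia.
Qed.

Lemma adam_W L S v rx ry x y s : gclosed (Utrunc L) S -> W rx ry v = false ->
  adam_inv rx ry x y -> (0 <= x <= Z.of_nat s)%Z -> (0 <= y <= Z.of_nat s)%Z ->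
  (Z.of_nat (Lf s) <= L)%Z -> ~ S v x y.
Proof.
move=> hS hW hi hx hy hL.
apply: (@adam_main L S n0 hS rx ry (rank_le _ _) _ _ [::] 0%Z 0%Z v x y (ltnSn _) (ltnSn _)) => //.
- by rewrite !Z.sub_0_r.
- rewrite !Z.sub_0_r /adam_bnd; have hP := @Psi_le rx ry x y s.
  have {}hP : Kn * Psi rx ry x y <= Kn * (#|{: gr}| * (Bn ^ #|{: gr}|.+1 * ((Kn + 1) * Kn * s + 2 * (2 * (Kn + 1) * Kn * Kn + Kn)))
    + (s + Kn)) by rewrite leq_mul2l hP ?orbT //; lia.
  by move: hL hP; rewrite /Lf; move: (Kn * Psi _ _ _ _) (Kn * _) (slack _) => a b c; lia.
- by case: hx.
Qed.

(** Neighbours in the order of slopes, as in a Farey sequence: no grid vector lies strictly between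
    them. *)
Definition consec (k k' : gr) : Prop :=
  low (gx k') (gy k') k /\ forall i, low (gx k') (gy k') i -> (det (gx k) (gy k) (gx i) (gy i) <= 0)%Z.

(** A bounded vector separating two rays between the neighbours would, up to sign, be a grid vector
    between them. So all those rays see the same signs and, by [win_ext], have the same winner. *)
Lemma consec_sign k k' a b kx ky : consec k k' -> (0 < a)%Z -> (0 < b)%Z ->
  (Z.abs kx <= K)%Z -> (Z.abs ky <= K)%Z ->
  (0 <= det (a * gx k + b * gx k') (a * gy k + b * gy k') kx ky <->
   0 <= det (gx k + gx k') (gy k + gy k') kx ky)%Z.
Proof.
move=> [h1 h2] ha hb hx hy; have [l1 l2] := lowP h1; have [g1 g2] := g_bnd k; have [g3 g4] := g_bnd k'.
have btw cx cy : (Z.abs cx <= K)%Z -> (Z.abs cy <= K)%Z -> (0 < det (gx k) (gy k) cx cy)%Z ->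
    (det (gx k') (gy k') cx cy < 0)%Z -> False.
  rewrite /det => c1 c2 c3 c4.
  have e1 : (cx * (gx k * gy k' - gy k * gx k') =
     - (gx k' * cy - gy k' * cx) * gx k + (gx k * cy - gy k * cx) * gx k')%Z by ring.
  have e2 : (cy * (gx k * gy k' - gy k * gx k') =
     - (gx k' * cy - gy k' * cx) * gy k + (gx k * cy - gy k * cx) * gy k')%Z by ring.
  have d0 : (0 < gx k * gy k' - gy k * gx k')%Z by lia.
  move: (gx k * gy k' - gy k * gx k')%Z d0 e1 e2 => d d0 e1 e2.
  have x0 : (0 < cx)%Z by clear -c3 c4 e1 d0 l1 g3; nia.
  have y0 : (0 <= cy)%Z by clear -c3 c4 e2 d0 g2 g4; nia.
  have [||i [i1 i2]] := @grid_mem cx cy; [lia | lia |].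
  have := h2 i; rewrite /det i1 i2 => h; suff : low (gx k') (gy k') i by move=> /h; lia.
  by apply: lowI; rewrite i1 ?i2; lia.
have b1 := @btw kx ky hx hy.
have b2 := @btw (- kx)%Z (- ky)%Z; rewrite !Z.abs_opp in b2; have {}b2 := b2 hx hy.
have -> : det (a * gx k + b * gx k') (a * gy k + b * gy k') kx ky =
   (a * det (gx k) (gy k) kx ky + b * det (gx k') (gy k') kx ky)%Z by rewrite /det; ring.
have -> : det (gx k + gx k') (gy k + gy k') kx ky =
   (det (gx k) (gy k) kx ky + det (gx k') (gy k') kx ky)%Z by rewrite /det; ring.
have n1 : det (gx k) (gy k) (- kx) (- ky) = (- det (gx k) (gy k) kx ky)%Z by rewrite /det; ring.
have n2 : det (gx k') (gy k') (- kx) (- ky) = (- det (gx k') (gy k') kx ky)%Z by rewrite /det; ring.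
rewrite n1 n2 in b2; move: (det _ _ _ _) (det _ _ _ _) b1 b2 => s t b1 b2.
clear -ha hb b1 b2.
case: (Z.lt_trichotomy s 0) => [hs|[hs|hs]]; case: (Z.lt_trichotomy t 0) => [ht|[ht|ht]]; try nia.
all: exfalso; lia.
Qed.

Lemma W_consec k k' a b v : consec k k' -> (0 < a)%Z -> (0 < b)%Z ->
  W (a * gx k + b * gx k') (a * gy k + b * gy k') v = W (gx k + gx k') (gy k + gy k') v.
Proof. by move=> hc ha hb; apply: win_ext => kx ky h1 h2; apply: consec_sign. Qed.

Definition belt (v : V) (lx ly : Z) : Prop :=
  [/\ (0 <= lx <= K /\ 0 <= ly <= K)%Z, (0 < lx + ly)%Z,
   (forall x y, 0 <= x -> ew <= det lx ly x y -> eveS v x y)%Z &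
   (forall L S x y s, gclosed (Utrunc L) S -> 0 <= x <= Z.of_nat s -> 0 <= y <= Z.of_nat s ->
      Z.of_nat (Lf s) <= L -> det lx ly x y <= - ew -> ~ S v x y)%Z].

Lemma eA_ge0 n : (0 <= eA n)%Z.
Proof. by rewrite /eA; lia. Qed.

Lemma belt_eve k x y v : W (gx k) (gy k) v -> (ew <= det (gx k) (gy k) x y)%Z -> eveS v x y.
Proof.
move=> hW hd; apply: (@eve_transfer n0 (gx k) (gy k)) => //.
have [g1 g2] := g_bnd k; split; [lia | lia |]; have := @eA_ge0 n0.+1.
move: hd; rewrite /ew; move: (eA _) (det _ _ _ _) => a d.
by move: (gx k) (gy k) g1 g2 => p q g1 g2 h1 h2; nia.
Qed.

Lemma belt_adam L S k x y v s : W (gx k) (gy k) v = false ->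
  gclosed (Utrunc L) S -> (0 <= x <= Z.of_nat s)%Z -> (0 <= y <= Z.of_nat s)%Z ->
  (Z.of_nat (Lf s) <= L)%Z -> (det (gx k) (gy k) x y <= - ew)%Z -> ~ S v x y.
Proof.
move=> hW hS hx hy hL hd; apply: (adam_W hS hW _ hx hy hL).
have [g1 g2] := g_bnd k; split; [lia | lia |]; have := @eA_ge0 n0.+1.
move: hd; rewrite /ew; move: (eA _) (det _ _ _ _) => a d.
move: (gx k) (gy k) g1 g2 => p q g1 g2 h1 h2.
have h3 : (d <= - (2 * K * K + K))%Z by nia.
have h4 : (Mz * d <= Mz * - (2 * K * K + K))%Z by apply: Z.mul_le_mono_nonneg_l; rewrite /Mz; lia.
have h5 : (Mz * K * (p + q) <= Mz * K * (2 * K))%Z by apply: Z.mul_le_mono_nonneg_l; rewrite /Mz; lia.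
by move: h4 h5; rewrite /Mz; nia.
Qed.

(** Eve wins on the rays between the neighbours. Taking [N] copies of [k] brings such a ray as close
    to [k] as the given point demands, and her win does not depend on [N]. *)
Lemma belt_eve_above k k' x y v : consec k k' -> W (gx k + gx k') (gy k + gy k') v ->
  (ew <= det (gx k) (gy k) x y)%Z -> eveS v x y.
Proof.
move=> hc hW hd; have [g1 g2] := g_bnd k; have [g3 g4] := g_bnd k'; have hA := @eA_ge0 n0.+1.
pose N := (Z.abs (det (gx k') (gy k') x y) + ew)%Z.
have ew0 : (0 < ew)%Z by rewrite /ew; nia.
have N0 : (0 < N)%Z by rewrite /N; lia.
rewrite -(W_consec v hc N0 (Z.lt_0_1)) in hW.
apply: (eve_transfer hW); split; [nia | nia |].
have -> : det (N * gx k + 1 * gx k') (N * gy k + 1 * gy k') x y =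
   (N * det (gx k) (gy k) x y + det (gx k') (gy k') x y)%Z by rewrite /det; ring.
have h1 : (N * ew <= N * det (gx k) (gy k) x y)%Z by apply: Z.mul_le_mono_nonneg_l; lia.
have h2 : (gx k * eA n0.+1 + K * (gx k + gy k) + 1 <= ew)%Z.
  by rewrite /ew; move: (eA _) hA => a hA; nia.
have h2' : (gx k' * eA n0.+1 + K * (gx k' + gy k') + 1 <= ew)%Z.
  by rewrite /ew; move: (eA _) hA => a hA; nia.
have h3 : (N * (gx k * eA n0.+1 + K * (gx k + gy k) + 1) <= N * ew)%Z by apply: Z.mul_le_mono_nonneg_l; lia.
have h4 : (- N + ew <= det (gx k') (gy k') x y)%Z by rewrite /N; lia.
have -> : ((N * gx k + 1 * gx k') * eA n0.+1 + K * (N * gx k + 1 * gx k' + (N * gy k + 1 * gy k')) + 1 =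
  N * (gx k * eA n0.+1 + K * (gx k + gy k) + 1) - N + (gx k' * eA n0.+1 + K * (gx k' + gy k') + 1))%Z by ring.
by lia.
Qed.

Lemma belt_adam_below L S k k' x y v s : consec k k' -> W (gx k + gx k') (gy k + gy k') v = false ->
  gclosed (Utrunc L) S -> (0 <= x <= Z.of_nat s)%Z -> (0 <= y <= Z.of_nat s)%Z ->
  (Z.of_nat (Lf s) <= L)%Z -> (det (gx k') (gy k') x y <= - ew)%Z -> ~ S v x y.
Proof.
move=> hc hW hS hx hy hL hd.
have [g1 g2] := g_bnd k; have [g3 g4] := g_bnd k'; have hA := @eA_ge0 n0.+1.
pose N := (Z.abs (det (gx k) (gy k) x y) + ew)%Z.
have ew1 : (2 * K * K + K + 1 <= ew)%Z by rewrite /ew; nia.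
have K1 : (1 <= K)%Z by lia.
have N0 : (0 < N)%Z by rewrite /N; nia.
rewrite -(W_consec v hc (Z.lt_0_1) N0) in hW.
apply: (adam_W hS hW _ hx hy hL); split; [nia | nia |].
have -> : det (1 * gx k + N * gx k') (1 * gy k + N * gy k') x y =
   (N * det (gx k') (gy k') x y + det (gx k) (gy k) x y)%Z by rewrite /det; ring.
have h1 : (N * det (gx k') (gy k') x y <= N * (- (2 * K * K + K + 1)))%Z by apply: Z.mul_le_mono_nonneg_l; lia.
have h2 : (det (gx k) (gy k) x y <= N)%Z by rewrite /N; lia.
have h3 : (N * (K * (gx k' + gy k')) <= N * (2 * K * K))%Z by apply: Z.mul_le_mono_nonneg_l; nia.
have h4 : (K * (gx k + gy k) + K <= N * K)%Z.
  have : (2 * K * K + K <= N * K)%Z by rewrite /N; nia.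
  by nia.
have h5 : (N * det (gx k') (gy k') x y + det (gx k) (gy k) x y <=
    - (K * (1 * gx k + N * gx k' + (1 * gy k + N * gy k')) + K))%Z by lia.
have h6 := Z.mul_le_mono_nonneg_l _ _ Mz (ltac:(rewrite /Mz; lia)) h5.
apply: Z.le_trans h6 _.
have h7 : (K <= Mz * K)%Z by rewrite /Mz; nia.
by lia.
Qed.

(** The belt follows the flattest grid direction that Eve wins or its flatter neighbour, according
    to who wins the rays between the two. If she wins none it is vertical and has nothing above it;
    if she wins the horizontal direction it has nothing below it. *)
Lemma belt_exists v : exists lx ly, belt v lx ly.
Proof.
have K1 : (1 <= K)%Z by lia.
case: (boolP [exists k : gr, (0 < k.1 + k.2) && W (gx k) (gy k) v]); last first.
  rewrite negb_exists => /forallP hno.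
  have [k [k1 k2]] : exists k : gr, gx k = 0%Z /\ gy k = 1%Z.
    by exists (inord 0, inord 1); rewrite /gx /gy /= !inordK.
  have hW : W (gx k) (gy k) v = false.
    by have := hno k; rewrite (_ : 0 < k.1 + k.2) /=; [move=> /negbTE | move: k2; rewrite /gy; lia].
  exists (gx k), (gy k); split; [by have := g_bnd k | by rewrite k1 k2 | |].
    move=> x y hx; rewrite k1 k2 /det /ew; have := @eA_ge0 n0.+1; nia.
  by move=> L S x y s; apply: belt_adam.
move=> /existsP [k0 hk0].
case: (@arg_minnP gr k0 (fun k => (0 < k.1 + k.2) && W (gx k) (gy k) v) (fun k : gr => rank (gx k) (gy k)) hk0) => k' /andP[kp hW] kmin.
have [b1 b2] := g_bnd k'.
have pos : (0 < gx k' + gy k')%Z by move: kp; rewrite /gx /gy; clear; case: k' => a b /=; lia.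
case: (Z.eq_dec (gy k') 0) => hy0.
  exists (gx k'), (gy k'); split=> //; first by move=> x y _; apply: belt_eve.
  by move=> L S x y s hS hx hy hL; rewrite hy0 /det /ew; have := @eA_ge0 n0.+1; nia.
have [k1 [e1 e2]] : exists k : gr, gx k = 1%Z /\ gy k = 0%Z.
  by exists (inord 1, inord 0); rewrite /gx /gy /= !inordK.
have hk1 : low (gx k') (gy k') k1 by apply: lowI; rewrite e1 ?e2; lia.
case: (@arg_maxnP gr k1 (low (gx k') (gy k')) (fun k : gr => rank (gx k) (gy k)) hk1) => k hl kmax.
have [c1 c2] := g_bnd k; have [l1 l2] := lowP hl.
have hc : consec k k'.
  split=> // i /kmax hi; case: (Z.le_gt_cases (det (gx k) (gy k) (gx i) (gy i)) 0) => // hd.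
  have [i1 i2] := g_bnd i.
  have : low (gx i) (gy i) k by apply: lowI => //; move: hd; rewrite /det; lia.
  move=> /(rank_low (proj1 i1) (proj1 i2)); rewrite ltnNge => /negP hn.
  by case: hn; apply: hi.
have hWk : W (gx k) (gy k) v = false.
  apply/negbTE/negP => hw.
  have : rank (gx k') (gy k') <= rank (gx k) (gy k).
    by apply: kmin; rewrite hw andbT; move: l1; rewrite /gx; clear; case: k => a b /=; lia.
  by rewrite leqNgt rank_low //; lia.
case: (boolP (W (gx k + gx k') (gy k + gy k') v)) => hi.
  exists (gx k), (gy k); split=> //; [lia | by move=> x y _; apply: belt_eve_above hi |].
  by move=> L S x y s; apply: belt_adam.
exists (gx k'), (gy k'); split=> //; first by move=> x y _; apply: belt_eve.
by move=> L S x y s; apply: belt_adam_below hc _; apply/negbTE.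
Qed.

End Belt.
End Game.

End Belts.
Import Belts.

(** * Periodic extension of belts *)

Module Periodic.

Lemma abs_mul_le a b A B : (Z.abs a <= A -> Z.abs b <= B -> Z.abs (a * b) <= A * B)%Z.
Proof. by move=> h1 h2; rewrite Z.abs_mul; apply: Z.mul_le_mono_nonneg; lia. Qed.

Lemma abs_mul_cancel p a c : (0 < p -> Z.abs (p * a) <= c -> Z.abs a <= c)%Z.
Proof. by move=> h1; rewrite Z.abs_mul (Z.abs_eq p); last lia; nia. Qed.

Lemma mul_ge_cancel p P a c : (0 < p <= P -> 0 <= c -> P * c <= p * a -> c <= a)%Z.
Proof. by nia. Qed.

Section Periodic.
Local Open Scope Z_scope.
Variables (V : finType) (eve bad : V -> bool) (edges : V -> list (Z * Z * V)).
Variables (D K e T L s j1 j2 : Z) (lx ly mt : V -> Z) (eS R : V -> Z -> Z -> Prop).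
Hypothesis edge_bnd : forall v dx dy v', List.In (dx, dy, v') (edges v) -> Z.abs dx <= D /\ Z.abs dy <= D.
Hypothesis eS_closed : gclosed eve bad edges Ufull eS.
Hypothesis R_closed : gclosed eve bad edges (Utrunc L) R.
Hypothesis D0 : 0 <= D.
Hypothesis K1 : 1 <= K.
Hypothesis e1 : 1 <= e.
Hypothesis lam_bnd : forall v, [/\ 0 <= lx v <= K, 0 <= ly v <= K & 0 < lx v + ly v].
Hypothesis hE : forall v x y, 0 <= x -> e <= det (lx v) (ly v) x y -> eS v x y.
Hypothesis hA : forall v x y, 0 <= x <= s -> 0 <= y <= s -> det (lx v) (ly v) x y <= - e -> ~ R v x y.
Hypothesis mt_pos : forall v, 0 < mt v.
Hypothesis mtE : forall v, mt v * (lx v + ly v) = T.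
Hypothesis T_D : 2 * D < T.
Hypothesis j12 : j1 < j2.
Hypothesis far : 2 * D + 2 * (K * e) + 4 * (K * (K * D)) + 2 * (K * D) + 2 * (K * e) <= j1 * T.
Hypothesis top : j2 * T + e + 2 * D <= s.
Hypothesis sL : s <= L.
Hypothesis snap : forall v a b, Z.abs a <= e + 2 * K * D -> Z.abs b <= e + 2 * K * D ->
  (R v (j1 * (mt v * lx v) + a) (j1 * (mt v * ly v) + b) <->
   R v (j2 * (mt v * lx v) + a) (j2 * (mt v * ly v) + b)).

Let Dl := j2 - j1.
Let tx v := mt v * lx v.
Let ty v := mt v * ly v.
(** The number of periods to fold away. Progress can be measured by [x + y] for all vertices alike,
    because the belt vectors are scaled to the common sum [T]. *)
Definition kk (sg : Z) : Z := if sg <? j2 * T then 0 else (sg - j1 * T) / (Dl * T).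
(** Inside the belts the solution of the cut game is copied, with its part between levels [j1] and
    [j2] repeated for ever; above the belts [eS] takes over. *)
Definition Rp v x y : Prop := Z.abs (det (lx v) (ly v) x y) < e /\
  R v (x - kk (x + y) * Dl * tx v) (y - kk (x + y) * Dl * ty v).

Lemma txy v : tx v + ty v = T.
Proof. by rewrite /tx /ty -(mtE v); ring. Qed.

Lemma tx_ge0 v : 0 <= tx v /\ 0 <= ty v.
Proof. by have [h1 h2 _] := lam_bnd v; have := mt_pos v; rewrite /tx /ty; nia. Qed.

Lemma DlT : 2 * D < Dl * T.
Proof. by rewrite /Dl; nia. Qed.

Lemma j2T : j2 * T = j1 * T + Dl * T.
Proof. by rewrite /Dl; ring. Qed.

Lemma kk_shift sg k : 0 <= k -> sg < j2 * T -> (k = 0 \/ j1 * T <= sg) -> kk (sg + k * Dl * T) = k.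
Proof.
move=> hk h1 h2; rewrite /kk; have := DlT; have := j2T => e2 dt.
case: Z.ltb_spec => h3.
  case: h2 => // h2; case: (Z.eq_dec k 0) => // kn; exfalso.
  have : Dl * T <= k * (Dl * T) by nia.
  lia.
symmetry; apply: (Z.div_unique _ _ _ (sg - j1 * T)); last by ring.
left; case: h2 => h2; last by lia.
by rewrite h2 in h3; lia.
Qed.

(** Being near a level and near the belt confines the point to the window on which snapshots are
    compared. *)
Lemma window v x y j : Z.abs (x + y - j * T) <= 2 * D -> Z.abs (det (lx v) (ly v) x y) < e ->
  Z.abs (x - j * tx v) <= e + 2 * K * D /\ Z.abs (y - j * ty v) <= e + 2 * K * D.
Proof.
move=> h1 h2; have [b1 b2 b3] := lam_bnd v.
have : det (lx v) (ly v) x y = lx v * (y - j * ty v) - ly v * (x - j * tx v).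
  by rewrite /det /tx /ty; ring.
move=> e2; rewrite e2 in h2.
have e3 : x + y - j * T = (x - j * tx v) + (y - j * ty v) by rewrite -(txy v); ring.
rewrite e3 in h1; move: (x - _) (y - _) h1 h2 => a b h1 h2.
have f1 : (lx v + ly v) * b = (lx v * b - ly v * a) + ly v * (a + b) by ring.
have f2 : (lx v + ly v) * a = lx v * (a + b) - (lx v * b - ly v * a) by ring.
have g1 : Z.abs (ly v * (a + b)) <= 2 * K * D.
  by rewrite (_ : 2 * K * D = K * (2 * D)); [apply: abs_mul_le; lia | ring].
have g2 : Z.abs (lx v * (a + b)) <= 2 * K * D.
  by rewrite (_ : 2 * K * D = K * (2 * D)); [apply: abs_mul_le; lia | ring].
by split; apply: (abs_mul_cancel b3); lia.
Qed.

(** Parallel vectors with the same coordinate sum coincide, so an edge between parallel belts keeps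
    the translation. *)
Lemma tau_par v v' : det (lx v') (ly v') (lx v) (ly v) = 0 -> tx v = tx v' /\ ty v = ty v'.
Proof.
rewrite /det => h; have := txy v; have := txy v' => h1 h2.
have hh : tx v' * ty v = ty v' * tx v.
  have -> : tx v' * ty v = mt v * mt v' * (lx v' * ly v) by rewrite /tx /ty; ring.
  have -> : ty v' * tx v = mt v * mt v' * (ly v' * lx v) by rewrite /tx /ty; ring.
  by congr (_ * _); lia.
have T0 : 0 < T by lia.
move: (tx v) (ty v) (tx v') (ty v') h1 h2 hh => a b c d h1 h2 hh.
have : T * (a - c) = 0.
  have -> : T * (a - c) = (c + d) * a - (a + b) * c by rewrite h1 h2; ring.
  by lia.
move=> /Z.mul_eq_0; lia.
Qed.

(** Unfolds the end point of an edge. If the translation is trivial or the belts are parallel, the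
    point is recounted with one period more or less when it crosses a level. Otherwise [far] puts it
    well away from the belt of [v']: above that belt Eve wins, and below it membership in [R] is
    contradictory. *)
Lemma core v v' k x0 y0 : R v' x0 y0 -> 0 <= x0 <= s -> y0 <= s -> 0 <= k ->
  x0 + y0 <= j2 * T + 2 * D ->
  (k = 0 \/ (j1 * T - 2 * D <= x0 + y0 /\ Z.abs (det (lx v) (ly v) x0 y0) <= e + 2 * K * D)) ->
  Rp v' (x0 + k * Dl * tx v) (y0 + k * Dl * ty v) \/ eS v' (x0 + k * Dl * tx v) (y0 + k * Dl * ty v).
Proof.
move=> hR hx hy hk hs hcase; have [t1 t2] := tx_ge0 v.
have [y0p _ _] : [/\ (0 <= y0)%Z, bad v' = false & True].
  by have [] := R_closed hR; rewrite /Utrunc; [lia | split].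
have Dl0 : 0 < Dl by rewrite /Dl; lia.
have kD : 0 <= k * Dl by nia.
have xp : 0 <= x0 + k * Dl * tx v by nia.
have [b1 b2 b3] := lam_bnd v; have [c1 c2 c3] := lam_bnd v'.
have hnA : ~ det (lx v') (ly v') x0 y0 <= - e by move=> h; apply: (hA _ _ h hR); lia.
have hdet : det (lx v') (ly v') (x0 + k * Dl * tx v) (y0 + k * Dl * ty v) =
    det (lx v') (ly v') x0 y0 + k * Dl * (mt v * det (lx v') (ly v') (lx v) (ly v)).
  by rewrite /det /tx /ty; ring.
have [hpar|hnp] : (k = 0 \/ det (lx v') (ly v') (lx v) (ly v) = 0) \/
   (k <> 0 /\ det (lx v') (ly v') (lx v) (ly v) <> 0) by lia.
  have {}hdet : det (lx v') (ly v') (x0 + k * Dl * tx v) (y0 + k * Dl * ty v) = det (lx v') (ly v') x0 y0.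
    by rewrite hdet; case: hpar => ->; ring.
  case: (Z.le_gt_cases e (det (lx v') (ly v') x0 y0)) => hd; first by right; apply: hE => //; rewrite hdet.
  left; split; first by rewrite hdet; lia.
  have -> : x0 + k * Dl * tx v + (y0 + k * Dl * ty v) = x0 + y0 + k * Dl * T by rewrite -(txy v); ring.
  have hxe i : x0 + k * Dl * tx v - (k + i) * Dl * tx v' = x0 - i * Dl * tx v'.
    by case: hpar => [->|/tau_par [-> _]]; ring.
  have hye i : y0 + k * Dl * ty v - (k + i) * Dl * ty v' = y0 - i * Dl * ty v'.
    by case: hpar => [->|/tau_par [_ ->]]; ring.
  have dt := DlT; have jt := j2T.
  have hda : Z.abs (det (lx v') (ly v') x0 y0) < e by lia.
  (* The upper level has been crossed: one more period is removed, and the snapshot at [j1] replaces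
     the one at [j2]. *)
  case: (Z.le_gt_cases (j2 * T) (x0 + y0)) => hs2.
    have -> : x0 + y0 + k * Dl * T = (x0 + y0 - Dl * T) + (k + 1) * Dl * T by ring.
    rewrite kk_shift; [|lia|lia|right; lia].
    rewrite hxe hye.
    have [w1 w2] := @window v' x0 y0 j2 (ltac:(lia)) hda.
    have := @snap v' _ _ w1 w2; rewrite -/(tx v') -/(ty v').
    have -> : j2 * tx v' + (x0 - j2 * tx v') = x0 by ring.
    have -> : j2 * ty v' + (y0 - j2 * ty v') = y0 by ring.
    have -> : j1 * tx v' + (x0 - j2 * tx v') = x0 - 1 * Dl * tx v' by rewrite /Dl; ring.
    have -> : j1 * ty v' + (y0 - j2 * ty v') = y0 - 1 * Dl * ty v' by rewrite /Dl; ring.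
    by move=> ->.
  have [hin|[kp hlow]] : (k = 0 \/ j1 * T <= x0 + y0) \/ (k <> 0 /\ x0 + y0 < j1 * T) by lia.
    rewrite kk_shift //.
    have := hxe 0; have := hye 0; rewrite !Z.add_0_r !Z.mul_0_l !Z.sub_0_r => -> ->.
    exact: hR.
  (* The lower level has been crossed: one period fewer is removed, by the same equality read the
     other way. *)
  have -> : x0 + y0 + k * Dl * T = (x0 + y0 + Dl * T) + (k + -1) * Dl * T by ring.
  case: hcase => // -[hc1 hc2].
  rewrite kk_shift; [|lia|lia|right; lia].
  rewrite hxe hye.
  have [w1 w2] := @window v' x0 y0 j1 (ltac:(lia)) hda.
  have := @snap v' _ _ w1 w2; rewrite -/(tx v') -/(ty v').
  have -> : j1 * tx v' + (x0 - j1 * tx v') = x0 by ring.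
  have -> : j1 * ty v' + (y0 - j1 * ty v') = y0 by ring.
  have -> : j2 * tx v' + (x0 - j1 * tx v') = x0 - -1 * Dl * tx v' by rewrite /Dl; ring.
  have -> : j2 * ty v' + (y0 - j1 * ty v') = y0 - -1 * Dl * ty v' by rewrite /Dl; ring.
  by move=> <-.
case: hnp => kn dn; case: hcase => // -[hc1 hc2]; right.
(* Up to a bounded error the height above the belt of [v'] is the progress times the cross product
   of the two directions, an integer different from 0. *)
have id : (lx v + ly v) * det (lx v') (ly v') x0 y0 =
   (x0 + y0) * det (lx v') (ly v') (lx v) (ly v) + det (lx v) (ly v) x0 y0 * (lx v' + ly v').
  by rewrite /det; ring.
have a1 : Z.abs (det (lx v) (ly v) x0 y0 * (lx v' + ly v')) <= (e + 2 * K * D) * (2 * K).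
  by apply: abs_mul_le; lia.
move: (det (lx v) (ly v) x0 y0 * (lx v' + ly v')) a1 id => q a1 id.
set dd := det (lx v') (ly v') (lx v) (ly v) in dn hdet id.
set d0 := det (lx v') (ly v') x0 y0 in hnA hdet id.
case: (Z.le_gt_cases dd 0) => hdd.
  exfalso; apply: hnA.
  have h1 : (x0 + y0) * dd <= (x0 + y0) * -1 by apply: Z.mul_le_mono_nonneg_l; lia.
  have h2 : (lx v + ly v) * - d0 >= 2 * K * e by lia.
  suff : e <= - d0 by lia.
  by apply: (@mul_ge_cancel (lx v + ly v) (2 * K)); lia.
apply: hE => //; rewrite hdet.
have m1 : 0 <= k * Dl * (mt v * dd).
  by apply: Z.mul_nonneg_nonneg => //; apply: Z.mul_nonneg_nonneg; [have := mt_pos v; lia | lia].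
suff : e <= d0 by lia.
have h1 : (x0 + y0) * 1 <= (x0 + y0) * dd by apply: Z.mul_le_mono_nonneg_l; lia.
by apply: (@mul_ge_cancel (lx v + ly v) (2 * K)); lia.
Qed.

Lemma Rp_closed : gclosed eve bad edges Ufull (fun v x y => Rp v x y \/ eS v x y).
Proof.
move=> v x y [hR|hS] hU; last first.
  have [h1 h2 h3] := eS_closed hS hU; split=> //; case: (eve v) h3.
    move=> [dx [dy [v' [hin h]]]]; exists dx, dy, v'; split=> //; by tauto.
  by move=> h dx dy v' /h; tauto.
have hx : 0 <= x by rewrite /Ufull in hU; lia.
have [hd] := hR; set k := kk (x + y); set x0 := x - _; set y0 := y - _ => hR0.
have [b1 b2 b3] := lam_bnd v; have [t1 t2] := tx_ge0 v; have dt := DlT; have jt := j2T.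
have Dl0 : 0 < Dl by rewrite /Dl; lia.
have s0E : x0 + y0 = x + y - k * Dl * T by rewrite /x0 /y0 -(txy v); ring.
have hks : 0 <= k /\ x0 + y0 < j2 * T /\ (k = 0 \/ j1 * T <= x0 + y0).
  rewrite s0E /k /kk; case: Z.ltb_spec => h; first by lia.
  have p0 : 0 < Dl * T by lia.
  have := Z.mul_div_le (x + y - j1 * T) _ p0; have := Z.mul_succ_div_gt (x + y - j1 * T) _ p0.
  have := Z.div_pos (x + y - j1 * T) (Dl * T) (ltac:(lia)) p0.
  by move: (_ / _) => z; nia.
have [k0 [sg1 sg2]] := hks.
have d0E : det (lx v) (ly v) x0 y0 = det (lx v) (ly v) x y.
  by rewrite /x0 /y0 /det /tx /ty; ring.
have f2 : (lx v + ly v) * x0 = lx v * (x0 + y0) - det (lx v) (ly v) x0 y0 by rewrite /det; ring.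
(* An escape seen in folded coordinates must be a real one: either folding leaves [x] alone, or the
   folded [x] is too large to become negative in one step. *)
have xalt : (k * Dl * tx v = 0) \/ D <= x0.
  case: (Z.eq_dec k 0) => [->|kn]; first by left; ring.
  case: (Z.eq_dec (lx v) 0) => [l0|ln]; first by left; rewrite /tx l0; ring.
  right; case: sg2 => // sg2.
  have : j1 * T - e <= (lx v + ly v) * x0 by nia.
  move=> h1; have h2 : 2 * K * D <= (lx v + ly v) * x0 by nia.
  nia.
have x0p : 0 <= x0 by case: xalt => h; rewrite /x0; lia.
have y0l : y0 <= j2 * T by lia.
have x0l : x0 <= j2 * T + e.
  case: (Z.eq_dec (lx v) 0) => [l0|ln].
    have h0 : 0 <= j2 * T by nia.
    have z : lx v * (x0 + y0) = 0 by rewrite l0.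
    have : (lx v + ly v) * x0 <= e by lia.
    by nia.
  suff : - e <= y0 by lia.
  have z : 0 <= ly v * x0 by nia.
  have : - e <= lx v * y0 by rewrite -d0E /det in hd; lia.
  by nia.
have nU : ~ Utrunc L x0 y0 by rewrite /Utrunc; lia.
have [y0p hb hstep] := R_closed hR0 nU.
have kD : 0 <= k * Dl by nia.
have edge dx dy v' : List.In (dx, dy, v') (edges v) -> (Utrunc L (x0 + dx) (y0 + dy) \/ R v' (x0 + dx) (y0 + dy)) ->
   Ufull (x + dx) (y + dy) \/ (Rp v' (x + dx) (y + dy) \/ eS v' (x + dx) (y + dy)).
  move=> /edge_bnd [d1 d2] h.
  have ex : x + dx = (x0 + dx) + k * Dl * tx v by rewrite /x0; ring.
  have ey : y + dy = (y0 + dy) + k * Dl * ty v by rewrite /y0; ring.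
  case: (Z.lt_ge_cases (x0 + dx) 0) => hx'.
    by left; rewrite /Ufull ex; case: xalt; lia.
  case: h => h; first by move: h; rewrite /Utrunc; lia.
  right; rewrite ex ey; apply: core => //; try lia.
  case: sg2 => sg2; [by left | right; split; first by lia].
  have -> : det (lx v) (ly v) (x0 + dx) (y0 + dy) = det (lx v) (ly v) x0 y0 + (lx v * dy - ly v * dx).
    by rewrite /det; ring.
  have g1 : Z.abs (lx v * dy) <= K * D by apply: abs_mul_le; lia.
  have g2 : Z.abs (ly v * dx) <= K * D by apply: abs_mul_le; lia.
  by lia.
split=> //; first by move: y0p; rewrite /y0; nia.
case: (eve v) hstep.
  by move=> [dx [dy [v' [hin h]]]]; exists dx, dy, v'; split=> //; apply: edge.
by move=> h dx dy v' hin; apply: edge => //; apply: h.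
Qed.

Lemma Rp_origin v : R v 0 0 -> Rp v 0 0.
Proof.
move=> h; split; first by rewrite /det; lia.
rewrite /kk /=; case: Z.ltb_spec => h0; first by rewrite !Z.mul_0_l.
by exfalso; have := DlT; have := j2T; nia.
Qed.

End Periodic.

End Periodic.
Import Periodic.

(** * Truncation of the counters *)

Module Truncation.

Definition pbool (P : Prop) : bool := if excluded_middle_informative P then true else false.

Lemma pboolP P : reflect P (pbool P).
Proof. by rewrite /pbool; case: excluded_middle_informative => h; constructor. Qed.

Section Truncation.
Variables (V : finType) (eve bad : V -> bool) (edges : V -> list (Z * Z * V)) (D : nat).
Hypothesis edge_bnd : forall v dx dy v', List.In (dx, dy, v') (edges v) ->
  (Z.abs dx <= Z.of_nat D /\ Z.abs dy <= Z.of_nat D)%Z.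
Hypothesis edge_eve : forall v dx dy v', List.In (dx, dy, v') (edges v) ->
  if eve v then dx = 0%Z else dy = 0%Z.
Notation Kn := (Kn V D).
Hypothesis Kpos : 0 < Kn.

Definition ewn : nat := Kn * (((Kn + 1) * (Kn + 1)).+1 * (Kn * (Kn + 1) + 1)) + 2 * Kn * Kn + Kn + 1.

Lemma ewE : ew V D = Z.of_nat ewn.
Proof.
rewrite /ew /ewn /eA /n0 card_prod !card_ord; move: Kn => k.
rewrite !Nat2Z.inj_add !Nat2Z.inj_mul !Nat2Z.inj_succ !Nat2Z.inj_add !Nat2Z.inj_mul !Nat2Z.inj_add.
by lia.
Qed.

Definition wn : nat := ewn + 2 * Kn * D.
(** A multiple of every possible [lx v + ly v], all of which are at most [2 * Kn]. *)
Definition Tn : nat := (2 * Kn).+1`!.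
(** The number of snapshots: one truth value per vertex and point of its window. *)
Definition Fn : nat := 2 ^ (#|V| * ((2 * wn).+1 * (2 * wn).+1)).
(** Levels are counted from where belts of different directions have separated; the expression is
    the left-hand side of [far]. *)
Definition J0 : nat := 2 * D + 2 * (Kn * ewn) + 4 * (Kn * (Kn * D)) + 2 * (Kn * D) + 2 * (Kn * ewn).
Definition sn : nat := (J0 + Fn) * Tn + ewn + 2 * D.
Definition Lbound : nat := Lf V D sn.

Lemma Tn_gt : 2 * Kn < Tn.
Proof.
rewrite /Tn factS; apply: leq_trans (_ : (2 * Kn).+1 * 1 <= _); first by rewrite muln1.
by rewrite leq_mul2l fact_gt0 orbT.
Qed.

Lemma D_le : D <= Kn.
Proof. by rewrite /Belts.Kn; case: #|V| (Kpos : 0 < #|V| * D) => // n _; rewrite mulSn leq_addr. Qed.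

(** A snapshot records all belts at a level together, so among [Fn.+1] levels two agree for every
    vertex, and a single period serves them all. *)
Theorem trunc_sound L R v0 : (Z.of_nat Lbound <= L)%Z -> gclosed eve bad edges (Utrunc L) R -> R v0 0%Z 0%Z ->
  exists2 S, gclosed eve bad edges Ufull S & S v0 0%Z 0%Z.
Proof.
move=> hL hR h0.
have hbelt v : exists p : Z * Z, belt eve bad edges D v p.1 p.2.
  have [a [b h]] := belt_exists bad edge_bnd edge_eve Kpos v; by exists (a, b).
have [lam lamP] : exists lam : V -> Z * Z, forall v, belt eve bad edges D v (lam v).1 (lam v).2.
  exists (fun v => proj1_sig (constructive_indefinite_description _ (hbelt v))) => v.
  exact: (proj2_sig (constructive_indefinite_description _ (hbelt v))).
pose lx v := (lam v).1; pose ly v := (lam v).2.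
have lb v : [/\ (0 <= lx v <= Z.of_nat Kn)%Z, (0 <= ly v <= Z.of_nat Kn)%Z & (0 < lx v + ly v)%Z].
  by have [[h1 h2] h3 _ _] := lamP v.
pose mt v := (Z.of_nat Tn / (lx v + ly v))%Z.
have mtE v : (mt v * (lx v + ly v) = Z.of_nat Tn)%Z.
  have [h1 h2 h3] := lb v.
  have /dvdnP [q hq] : Z.to_nat (lx v + ly v) %| Tn by apply: dvdn_fact; lia.
  have hq' : Z.of_nat Tn = (Z.of_nat q * (lx v + ly v))%Z by rewrite hq; lia.
  by rewrite /mt hq' Z.div_mul; lia.
have Tg := Tn_gt; have Dl := D_le.
have mt_pos v : (0 < mt v)%Z by have [h1 h2 h3] := lb v; have := mtE v; nia.
pose cf (i : 'I_(2 * wn).+1) : Z := (Z.of_nat i - Z.of_nat wn)%Z.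
pose F := {ffun V * 'I_(2 * wn).+1 * 'I_(2 * wn).+1 -> bool}.
pose f (j : 'I_(Fn.+1)) : F := [ffun t => pbool (R t.1.1
   (Z.of_nat (J0 + j) * (mt t.1.1 * lx t.1.1) + cf t.1.2)%Z
   (Z.of_nat (J0 + j) * (mt t.1.1 * ly t.1.1) + cf t.2)%Z)].
have [i1 [i2 [i12 hf]]] : exists i1 i2 : 'I_Fn.+1, i1 < i2 /\ f i1 = f i2.
  have : ~~ injectiveb f.
    apply/negP => /injectiveP /leq_card; rewrite card_ffun card_bool !card_prod !card_ord.
    by rewrite -mulnA -/Fn ltnn.
  move=> /injectivePn [i1 [i2 ne e]].
  case: (ltngtP i1 i2) => h; [by exists i1, i2 | by exists i2, i1 | by case/eqP: ne; apply: val_inj].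
pose j1 := Z.of_nat (J0 + i1); pose j2 := Z.of_nat (J0 + i2).
have e_bnd (i : 'I_Fn.+1) : (J0 + i) * Tn + ewn + 2 * D <= sn.
  by rewrite /sn !leq_add2r leq_mul2r leq_add2l -ltnS ltn_ord orbT.
have snL : (Z.of_nat sn <= L)%Z by apply: Z.le_trans hL; rewrite /Lbound /Lf; lia.
have snap v a b : (Z.abs a <= Z.of_nat ewn + 2 * Z.of_nat Kn * Z.of_nat D)%Z ->
   (Z.abs b <= Z.of_nat ewn + 2 * Z.of_nat Kn * Z.of_nat D)%Z ->
  (R v (j1 * (mt v * lx v) + a) (j1 * (mt v * ly v) + b) <->
   R v (j2 * (mt v * lx v) + a) (j2 * (mt v * ly v) + b))%Z.
  have -> : (Z.of_nat ewn + 2 * Z.of_nat Kn * Z.of_nat D = Z.of_nat wn)%Z by rewrite /wn; lia.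
  move=> ha hb.
  have conv c : (Z.abs c <= Z.of_nat wn)%Z -> exists i, cf i = c.
    by move=> hc; exists (inord (Z.to_nat (c + Z.of_nat wn))); rewrite /cf inordK; lia.
  have [ia <-] := conv _ ha; have [ib <-] := conv _ hb.
  have := congr1 (fun g : F => g (v, ia, ib)) hf; rewrite !ffunE /= => hh.
  by split => /pboolP h; apply/pboolP; [rewrite -hh | rewrite hh].
exists (fun v x y => Rp (Z.of_nat ewn) (Z.of_nat Tn) j1 j2 lx ly mt R v x y \/ eveS eve bad edges D v x y).
  apply: (@Rp_closed V eve bad edges (Z.of_nat D) (Z.of_nat Kn) (Z.of_nat ewn) (Z.of_nat Tn) L (Z.of_nat sn) j1 j2 lx ly mt _ R) => //.
  - exact: eveS_closed.
  - by lia.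
  - by lia.
  - by rewrite /ewn; lia.
  - by move=> v x y hx hd; have [_ _ hE _] := lamP v; apply: hE => //; rewrite ewE.
  - move=> v x y hx hy hd; have [_ _ _ hA] := lamP v.
    by apply: (hA L R x y sn) => //; rewrite ewE.
  - by lia.
  - by rewrite /j1 /j2; lia.
  - rewrite /j1 -Nat2Z.inj_mul.
    have : J0 * 1 <= (J0 + i1) * Tn by apply: leq_mul; lia.
    rewrite /J0; lia.
  - by rewrite /j2 -Nat2Z.inj_mul; have := e_bnd i2; lia.
left; apply: (@Rp_origin V (Z.of_nat D) (Z.of_nat Kn) (Z.of_nat ewn) (Z.of_nat Tn)) => //; try lia.
- by rewrite /ewn; lia.
- rewrite /j1 -Nat2Z.inj_mul.
  have : J0 * 1 <= (J0 + i1) * Tn by apply: leq_mul; lia.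
  rewrite /J0; lia.
Qed.


(** * The cut is doubly exponential *)

Definition X := Kn + 2.
(** Coarse bookkeeping in which a sum or a product raises the index by one, [X] being at least 2. *)
Definition dexp (i a : nat) : Prop := a <= 2 ^ (X ^ i).

Lemma dexpS i : 2 * X ^ i <= X ^ i.+1.
Proof. by rewrite expnS leq_mul2r /X; lia. Qed.

Lemma dexp_mul i a b : dexp i a -> dexp i b -> dexp i.+1 (a * b).
Proof.
rewrite /dexp => h1 h2; apply: leq_trans (leq_mul h1 h2) _; rewrite -expnD addnn -mul2n.
by rewrite leq_exp2l // dexpS.
Qed.

Lemma dexp_le i j a b : i <= j -> a <= b -> dexp i b -> dexp j a.
Proof.
rewrite /dexp => h1 h2 h3; apply: leq_trans h2 (leq_trans h3 _).
by rewrite leq_exp2l // leq_pexp2l // /X; lia.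
Qed.

Lemma dexp_add i a b : dexp i a -> dexp i b -> dexp i.+1 (a + b).
Proof.
rewrite /dexp => h1 h2; apply: leq_trans (leq_add h1 h2) _; rewrite addnn -mul2n -expnS.
rewrite leq_exp2l //; apply: leq_trans (dexpS i).
by have : 0 < X ^ i by [rewrite expn_gt0 /X; lia]; lia.
Qed.

Lemma dexp_poly i a : a <= X ^ i -> dexp i a.
Proof. by move=> h; apply: leq_trans h _; apply: ltnW; apply: ltn_expl. Qed.

Lemma dexp_pow i j a b : a <= X ^ i -> b <= X ^ j -> dexp (i + j) (a ^ b).
Proof.
move=> h1 h2; rewrite /dexp expnD expnM.
have h3 : a <= 2 ^ (X ^ i) by apply: dexp_poly.
apply: leq_trans (_ : (2 ^ (X ^ i)) ^ b <= _).
  by case: b {h2} => // b; rewrite leq_exp2r.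
by rewrite leq_pexp2l // expn_gt0.
Qed.

Lemma pX_le i j : i <= j -> X ^ i <= X ^ j.
Proof. by move=> h; rewrite leq_pexp2l // /X; lia. Qed.

Lemma pX_add i a b : a <= X ^ i -> b <= X ^ i -> a + b <= X ^ i.+1.
Proof. by move=> h1 h2; apply: leq_trans (dexpS i); rewrite mul2n -addnn leq_add. Qed.

Lemma pX_mul i j a b : a <= X ^ i -> b <= X ^ j -> a * b <= X ^ (i + j).
Proof. by move=> h1 h2; rewrite expnD leq_mul. Qed.

Lemma K_X : Kn <= X ^ 1. Proof. by rewrite expn1 /X; lia. Qed.
Lemma D_X : D <= X ^ 1. Proof. by apply: leq_trans D_le K_X. Qed.
Lemma K1_X : Kn + 1 <= X ^ 1. Proof. by rewrite expn1 /X; lia. Qed.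
Lemma two_X : 2 <= X ^ 1. Proof. by rewrite expn1 /X; lia. Qed.

Lemma ewn_X : ewn <= X ^ 6.
Proof.
have h : ewn <= Kn.+2 ^ 6.
  by rewrite /ewn !expnS expn0; move: Kn => k; nia.
by apply: leq_trans h _; rewrite /X addn2.
Qed.

Lemma wn_X : wn <= X ^ 7.
Proof.
apply: pX_add ewn_X _; apply: leq_trans (pX_mul (pX_mul two_X K_X) D_X) _.
exact: pX_le.
Qed.

Lemma card_X : #|{: gr V D}| <= X ^ 2.
Proof.
rewrite card_prod !card_ord; apply: (@pX_mul 1 1); rewrite expn1 /X; lia.
Qed.

Lemma V_X : #|V| <= X ^ 1.
Proof.
apply: leq_trans K_X; rewrite /Belts.Kn; case: D (Kpos : 0 < #|V| * D) => [|d _]; first by rewrite muln0.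
by rewrite mulnS leq_addr.
Qed.

Lemma Fn_X : dexp 20 Fn.
Proof.
rewrite /dexp /Fn leq_exp2l //.
have h : (2 * wn).+1 <= X ^ 9.
  rewrite -addn1; apply: pX_add; first exact: (pX_mul two_X wn_X).
  by rewrite expn_gt0 /X; lia.
by apply: leq_trans (pX_mul V_X (pX_mul h h)) _; apply: pX_le.
Qed.

Lemma Tn_X : dexp 6 Tn.
Proof.
rewrite /Tn; have hf m : m`! <= m ^ m.
  elim: m => // m IH; rewrite factS expnS leq_mul2l /=; apply: leq_trans IH _.
  by case: m => // m; rewrite leq_exp2r.
have h : (2 * Kn).+1 <= X ^ 3.
  rewrite -addn1; apply: pX_add; first exact: (pX_mul two_X K_X).
  by rewrite expn_gt0 /X; lia.
by apply: leq_trans (hf _) _; apply: (@dexp_pow 3 3).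
Qed.

Lemma J0_X : J0 <= X ^ 20.
Proof.
have h2 : 2 <= X ^ 1 by exact: two_X.
have h4 : 4 <= X ^ 2 by rewrite expnS expn1 /X; nia.
rewrite /J0; apply: pX_add; last first.
  by apply: leq_trans (pX_mul h2 (pX_mul K_X ewn_X)) (pX_le _).
apply: pX_add; last by apply: leq_trans (pX_mul h2 (pX_mul K_X D_X)) (pX_le _).
apply: pX_add; last by apply: leq_trans (pX_mul h4 (pX_mul K_X (pX_mul K_X D_X))) (pX_le _).
apply: pX_add; last by apply: leq_trans (pX_mul h2 (pX_mul K_X ewn_X)) (pX_le _).
by apply: leq_trans (pX_mul h2 D_X) (pX_le _).
Qed.

Lemma sn_X : dexp 24 sn.
Proof.
rewrite /sn; apply: dexp_add; last first.
  by apply: dexp_poly; apply: leq_trans (pX_mul two_X D_X) (pX_le _).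
apply: dexp_add; last by apply: dexp_poly; apply: leq_trans ewn_X (pX_le _).
apply: dexp_mul; last by apply: dexp_le Tn_X.
by apply: dexp_add; [apply: dexp_poly; apply: J0_X | apply: Fn_X].
Qed.

Lemma Bn_X : Bn V D <= X ^ 8.
Proof.
rewrite /Bn /Cn; apply: pX_add; last by rewrite expn_gt0 /X; lia.
apply: pX_add; last by apply: leq_trans K_X (pX_le _).
by apply: leq_trans (pX_mul card_X (pX_mul K1_X (pX_mul K_X K_X))) (pX_le _).
Qed.

Lemma BG_X : dexp 11 (Bn V D ^ #|{: gr V D}|.+1).
Proof.
apply: (@dexp_pow 8 3) Bn_X _; rewrite -addn1; apply: pX_add; first exact: card_X.
by rewrite expn_gt0 /X; lia.
Qed.

Lemma slack_X : dexp 20 (slack V D (n0 V D)).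
Proof.
rewrite /slack; apply: dexp_add; last by apply: dexp_poly; apply: leq_trans K_X (pX_le _).
apply: dexp_mul; first by apply: dexp_poly; apply: leq_trans card_X (pX_le _).
apply: dexp_add; last by apply: dexp_poly; apply: leq_trans K_X (pX_le _).
apply: dexp_mul; first by apply: dexp_poly; apply: leq_trans K_X (pX_le _).
rewrite /En; apply: dexp_add; last by apply: dexp_poly; apply: leq_trans (pX_mul two_X K_X) (pX_le _).
apply: dexp_mul; last first.
  apply: dexp_poly; apply: pX_add; last by apply: leq_trans K_X (pX_le _).
  by apply: leq_trans (pX_mul (pX_mul two_X K1_X) (pX_mul K_X K_X)) (pX_le _).
apply: dexp_mul; last by apply: dexp_le BG_X.
by apply: dexp_poly; apply: leq_trans card_X (pX_le _).
Qed.

Lemma Lbound_X : dexp 40 Lbound.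
Proof.
have h2 : 2 <= X ^ 1 by exact: two_X.
rewrite /Lbound /Lf; apply: dexp_add; first by apply: dexp_le sn_X.
apply: dexp_add; last by apply: dexp_le slack_X.
apply: dexp_mul; first by apply: dexp_poly; apply: leq_trans K_X (pX_le _).
apply: dexp_add; last first.
  by apply: dexp_add; [apply: dexp_le sn_X | apply: dexp_poly; apply: leq_trans K_X (pX_le _)].
apply: dexp_mul; first by apply: dexp_poly; apply: leq_trans card_X (pX_le _).
apply: dexp_mul; first by apply: dexp_le BG_X.
apply: dexp_add; last first.
  apply: dexp_mul; first by apply: dexp_poly; apply: leq_trans h2 (pX_le _).
  apply: dexp_add; last by apply: dexp_poly; apply: leq_trans K_X (pX_le _).
  by apply: dexp_poly; apply: leq_trans (pX_mul (pX_mul (pX_mul h2 K1_X) K_X) K_X) (pX_le _).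
apply: dexp_mul; last by apply: dexp_le sn_X.
by apply: dexp_poly; apply: leq_trans (pX_mul K1_X K_X) (pX_le _).
Qed.

End Truncation.

End Truncation.
Import Truncation.

(** * Winning columns *)

Module Columns.

Section Columns.
Variables (N : OCN) (L : nat).
Hypothesis wfN : wf N.
Notation n := (nstates N).

(* [X x p q] is the least counter value with which Eve wins from state [p] (the sink if [p = n])
   against Adam in state [q] with counter [x]; it is [L.+1] if there is none up to [L]. *)
Definition aok (X : nat -> nat -> nat -> nat) x q a p' (y : Z) : Prop :=
  forall e q', List.In (q, a, e, q') (trans N) -> (0 <= Z.of_nat x + e <= Z.of_nat L)%Z ->
    (Z.of_nat (X (Z.to_nat (Z.of_nat x + e)) p' q') <= y)%Z.

(** The condition at column [x] refers only to columns within one update of it, which is what a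
    sliding window can check. An entry above [L] claims nothing. *)
Definition colok (X : nat -> nat -> nat -> nat) : Prop := forall x p q,
  x <= L -> p <= n -> q < n -> X x p q <= L ->
  (final N q -> p < n /\ final N p) /\
  forall a, a < nletters N -> aok X x q a n (Z.of_nat (X x p q)) \/
    exists d p', [/\ List.In (p, a, d, p') (trans N), (0 <= Z.of_nat (X x p q) + d)%Z &
      aok X x q a p' (Z.of_nat (X x p q) + d)].

(** From the least winning counter Eve's answer leads, for each reply of Adam, to a winning
    position, whose counter is at least the least one there; so the least counters satisfy the local
    condition. *)
Lemma HD_colok : history_deterministic N ->
  exists X, [/\ colok X, X 0 (init N) (init N) = 0 & forall x p q, X x p q <= L.+1].
Proof.
move=> /(HD_token_closed wfN) [R hR h0].
pose Rx p y q x := if p < n then R (p, y) (q, x) else ~ live N (q, x).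
pose X x p q := find (fun y => pbool (Rx p y q x)) (iota 0 L.+1).
have Xle x p q : X x p q <= L.+1 by rewrite -[X in _ <= X](size_iota 0) find_size.
have XR x p q : X x p q <= L -> Rx p (X x p q) q x.
  move=> h; have := @nth_find _ 0 (fun y => pbool (Rx p y q x)) (iota 0 L.+1).
  rewrite -/(X x p q) nth_iota ?ltnS // add0n has_find size_iota -/(X x p q) ltnS.
  by move=> /(_ h)/pboolP.
have RX x p q y : Rx p y q x -> X x p q <= y.
  move=> h; case: (leqP (X x p q) y) => // hl.
  have hy : y < L.+1 by apply: leq_trans hl (Xle _ _ _).
  have := @before_find _ 0 (fun y => pbool (Rx p y q x)) (iota 0 L.+1) y hl.
  by rewrite nth_iota // add0n => /pboolP.
have hin : init N < n by case: wfN.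
exists X; split=> //; last by apply/eqP; rewrite -leqn0; apply: RX; rewrite /Rx hin.
move=> x p q hx hp hq hX; have := XR _ _ _ hX; rewrite {1}/Rx.
have dead y a : (forall c1', ostep N (q, x) a c1' -> ~ live N c1') -> (0 <= y)%Z -> aok X x q a n y.
  move=> hd hy e q' hin' hxe; have : X (Z.to_nat (Z.of_nat x + e)) n q' <= 0.
    apply: RX; rewrite /Rx ltnn; apply: hd; exists e; split=> //=; lia.
  by lia.
case: ltnP => hpn hr.
  have [h1 h2] := hR _ _ hr; split=> [hf|a /h2 [[[p1 y1] hs hs']|hd]]; first by split=> //; apply: h1.
    right; case: hs => d /= [hd [hd1 hd2]]; exists d, p1; split=> // e q' he hxe.
    rewrite -hd2; apply: inj_le; apply/leP; apply: RX; rewrite /Rx.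
    have [_ _ ->] := (proj2 wfN) _ _ _ _ hd.
    by apply: hs'; exists e; split=> //=; lia.
  by left; apply: dead => //; lia.
split=> [hf|a ha]; first by case: hr; exists [::]; exists (q, x) => //; constructor.
left; apply: dead; last by lia.
by move=> c1' hs hl; apply: hr; apply: live_step hl; apply: hs.
Qed.

Variable D : nat.
Hypothesis Dpos : 0 < D.
Hypothesis trans_bnd : forall q a d p, List.In (q, a, d, p) (trans N) -> (Z.abs d <= Z.of_nat D)%Z.

(** Eve's state, or [None] when she has resigned because Adam's token is dead; Adam's state; and the
    phase, in the order of the token game: letter, Eve's move, Adam's move. *)
Definition vert := (option 'I_n * 'I_n * option (bool * 'I_(nletters N)))%type.

Definition veve (v : vert) : bool := if v.2 is Some (false, _) then true else false.
Definition vbad (v : vert) : bool :=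
  (v.2 == None) && final N v.1.2 && ~~ (if v.1.1 is Some p then final N p else false).

Definition vedges (v : vert) : list (Z * Z * vert) :=
  match v.2 with
  | None => [seq (0%Z, 0%Z, (v.1, Some (false, a))) | a <- enum 'I_(nletters N)]
  | Some (false, a) => (0%Z, 0%Z, (None, v.1.2, Some (true, a))) ::
     (if v.1.1 is Some p then List.flat_map (fun t : nat * nat * Z * nat =>
        if (t.1.1.1 == p) && (t.1.1.2 == a) then
          if insub t.2 is Some p' then [:: (0%Z, t.1.2, (Some p', v.1.2, Some (true, a)))] else [::]
        else [::]) (trans N) else [::])
  | Some (true, a) => List.flat_map (fun t : nat * nat * Z * nat =>
        if (t.1.1.1 == v.1.2) && (t.1.1.2 == a) then
          if insub t.2 is Some q' then [:: (t.1.2, 0%Z, (v.1.1, q', None))] else [::]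
        else [::]) (trans N)
  end.

Lemma vedges_letter pq dx dy v' : List.In (dx, dy, v') (vedges (pq, None)) <->
  exists a, [/\ dx = 0%Z, dy = 0%Z & v' = (pq, Some (false, a))].
Proof.
rewrite /vedges /=; split=> [/List.in_map_iff [a [[<- <- <-] _]]|[a [-> -> ->]]]; first by exists a.
apply/List.in_map_iff; exists a; split=> //; have := mem_enum 'I_(nletters N) a; rewrite inE.
elim: (enum _) => //= b l IH; rewrite inE => /orP [/eqP ->|/IH]; by [left | right].
Qed.

Lemma vedges_eve po q a dx dy v' : List.In (dx, dy, v') (vedges (po, q, Some (false, a))) <->
  dx = 0%Z /\ ((dy = 0%Z /\ v' = (None, q, Some (true, a))) \/
   exists p p' : 'I_n, [/\ po = Some p, List.In (p : nat, a : nat, dy, p' : nat) (trans N) &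
     v' = (Some p', q, Some (true, a))]).
Proof.
rewrite /vedges /=; split.
  move=> [[<- <- <-]|]; first by split=> //; left.
  case: po => // p /List.in_flat_map [[[[p1 a1] d1] p2] [hin]] /=.
  case: andP => // -[/eqP e1 /eqP e2]; case: insubP => // p' _ e3 [|//] [<- <- <-]; split=> //; right.
  by exists p, p'; split=> //; rewrite -e1 -e2 e3.
move=> [-> [[-> ->]|[p [p' [-> hin ->]]]]]; first by left.
right; apply/List.in_flat_map; exists (p : nat, a : nat, dy, p' : nat); split=> //=.
by rewrite !eqxx /= valK; left.
Qed.

Lemma vedges_adam po q a dx dy v' : List.In (dx, dy, v') (vedges (po, q, Some (true, a))) <->
  dy = 0%Z /\ exists q' : 'I_n, List.In (q : nat, a : nat, dx, q' : nat) (trans N) /\ v' = (po, q', None).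
Proof.
rewrite /vedges /=; split.
  move=> /List.in_flat_map [[[[p1 a1] d1] p2] [hin]] /=.
  case: andP => // -[/eqP e1 /eqP e2]; case: insubP => // p' _ e3 [|//] [<- <- <-]; split=> //.
  by exists p'; split=> //; rewrite -e1 -e2 e3.
move=> [-> [q' [hin ->]]].
apply/List.in_flat_map; exists (q : nat, a : nat, dx, q' : nat); split=> //=.
by rewrite !eqxx /= valK; left.
Qed.

Lemma vedges_bnd v dx dy v' : List.In (dx, dy, v') (vedges v) ->
  (Z.abs dx <= Z.of_nat D /\ Z.abs dy <= Z.of_nat D)%Z.
Proof.
case: v => [[po q] [[[] a]|]].
- by move=> /vedges_adam [-> [q' [/trans_bnd h _]]]; lia.
- by move=> /vedges_eve [-> [[-> _]|[p [p' [_ /trans_bnd h _]]]]]; lia.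
- by move=> /vedges_letter [a [-> -> _]]; lia.
Qed.

Lemma vedges_player v dx dy v' : List.In (dx, dy, v') (vedges v) -> if veve v then dx = 0%Z else dy = 0%Z.
Proof.
case: v => [[po q] [[[] a]|]] /=.
- by move=> /vedges_adam [].
- by move=> /vedges_eve [].
- by move=> /vedges_letter [a [_ ->]].
Qed.

Definition pn (po : option 'I_n) : nat := if po is Some p then p : nat else n.

Definition colR (X : nat -> nat -> nat -> nat) (v : vert) (x y : Z) : Prop :=
  (0 <= y)%Z /\ match v.2 with
  | None => (Z.of_nat (X (Z.to_nat x) (pn v.1.1) v.1.2) <= y)%Z
  | Some (false, a) => aok X (Z.to_nat x) v.1.2 a n y \/
     exists d p', [/\ List.In (pn v.1.1, a : nat, d, p') (trans N), (0 <= y + d)%Z &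
        aok X (Z.to_nat x) v.1.2 a p' (y + d)]
  | Some (true, a) => aok X (Z.to_nat x) v.1.2 a (pn v.1.1) y
  end.

Lemma pn_Some po a d p' : List.In (pn po, a, d, p') (trans N) -> exists2 p, po = Some p & p' < n.
Proof. by move=> /(proj2 wfN) [h1 _ h2]; case: po h1 => [p|] /=; [exists p | rewrite ltnn]. Qed.

Lemma colR_closed X : colok X -> gclosed veve vbad vedges (Utrunc (Z.of_nat L)) (colR X).
Proof.
move=> hX [[po q] ph] x y [hy hv] hU; have [hx hxL hyL] : [/\ (0 <= x)%Z, (x <= Z.of_nat L)%Z & (y <= Z.of_nat L)%Z].
  by move: hU; rewrite /Utrunc; split; lia.
case: ph hv => [[[] a]|] /= hv.
- split=> // dx dy v' /vedges_adam [-> [q' [hin ->]]]; rewrite Z.add_0_r.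
  case: (Z.lt_ge_cases (x + dx) 0) => h1; first by left; left.
  case: (Z.lt_ge_cases (Z.of_nat L) (x + dx)) => h2; first by left; right; left.
  right; split=> //=; have := hv _ _ hin; rewrite Z2Nat.id //; apply; lia.
- split=> //; case: hv => [hv|[d [p' [hin hyd hv]]]].
    by exists 0%Z, 0%Z, (None, q, Some (true, a)); split; [apply/vedges_eve; split=> //; left | right; rewrite !Z.add_0_r].
  have [p e hp'] := pn_Some hin.
  exists 0%Z, d, (Some (Ordinal hp'), q, Some (true, a)); split.
    by apply/vedges_eve; split=> //; right; exists p, (Ordinal hp'); split=> //; move: hin; rewrite e.
  by right; rewrite Z.add_0_r.
have hpn : pn po <= n by case: po {hv} => [p|] //=; apply: ltnW.
have hXL : X (Z.to_nat x) (pn po) q <= L by lia.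
have hx' : Z.to_nat x <= L by lia.
have [h1 h2] := hX _ _ _ hx' hpn (ltn_ord q) hXL.
split=> //.
  rewrite /vbad /=; case: (boolP (final N q)) => //= /h1 [].
  by case: po {hv hpn hXL h1 h2} => [p|] /=; [move=> _ -> | rewrite ltnn].
move=> dx dy v' /vedges_letter [a [-> -> ->]]; right; rewrite !Z.add_0_r; split=> //=.
have mono b p' y1 y2 : (y1 <= y2)%Z -> aok X (Z.to_nat x) q b p' y1 -> aok X (Z.to_nat x) q b p' y2.
  by move=> h3 h4 e q' h5 h6; apply: Z.le_trans (h4 _ _ h5 h6) h3.
case: (h2 a (ltn_ord a)) => [h3|[d [p' [h3 h4 h5]]]]; first by left; apply: mono h3.
by right; exists d, p'; split=> //; [lia | apply: mono h5; lia].
Qed.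

(** In the sink Eve is never in a final state, so surviving there means that Adam cannot reach
    one. *)
Lemma sink_not_live S q x y : gclosed veve vbad vedges Ufull S -> S (None, q, None) (Z.of_nat x) y ->
  ~ live N (q : nat, x).
Proof.
move=> hS hs [w]; elim: w q x hs => [|a w IH] q x hs.
  move=> [c h]; inversion h; subst => /= hf.
  by have [|_] := hS _ _ _ hs; [rewrite /Ufull; lia | rewrite /vbad /= hf].
move=> /accepts_cons [[q' x'] [e /= [hin [h1 h2]]] hw].
have [_ ha hq'] := (proj2 wfN) _ _ _ _ hin.
have nU : ~ Ufull (Z.of_nat x) y by rewrite /Ufull; lia.
have [_ _ /= /(_ 0%Z 0%Z (None, q, Some (false, Ordinal ha)))] := hS _ _ _ hs nU.
case; [by apply/vedges_letter; exists (Ordinal ha) | by rewrite /Ufull; lia |].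
rewrite !Z.add_0_r => hs1; have [_ _] := hS _ _ _ hs1 nU.
move=> [dx [dy [v' [/vedges_eve [-> [[-> ->]|[p [p' [//]]]]]]]]]; rewrite !Z.add_0_r => -[//|hs2].
have [_ _ /= /(_ e 0%Z (None, Ordinal hq', None))] := hS _ _ _ hs2 nU.
case; [by apply/vedges_adam; split=> //; exists (Ordinal hq') | by rewrite /Ufull; lia |].
by rewrite -h2 Z.add_0_r => hs3; apply: (IH (Ordinal hq') x').
Qed.

Lemma game_HD S (q0 : 'I_n) : init N = q0 -> gclosed veve vbad vedges Ufull S -> S (Some q0, q0, None) 0%Z 0%Z ->
  history_deterministic N.
Proof.
move=> e0 hS h0; apply/(HD_token_closed wfN).
exists (fun c c' : config => exists p q : 'I_n, [/\ c.1 = p :> nat, c'.1 = q :> nat & S (Some p, q, None) (Z.of_nat c'.2) (Z.of_nat c.2)]).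
  move=> [_ y] [_ x] [p [q [/= -> -> hs]]].
  have nU t : ~ Ufull (Z.of_nat x) t by rewrite /Ufull; lia.
  have [_ hb /= hst] := hS _ _ _ hs (nU _); split.
    by move: hb; rewrite /vbad /=; case: (final N q) => //= /negbFE.
  move=> a ha; have [|hu|hs1] := hst 0%Z 0%Z (Some p, q, Some (false, Ordinal ha)).
  - by apply/vedges_letter; exists (Ordinal ha).
  - by case: (nU (Z.of_nat y)); rewrite !Z.add_0_r in hu.
  rewrite !Z.add_0_r in hs1.
  have [_ _ [dx [dy [v' [/vedges_eve [-> hv'] hs2]]]]] := hS _ _ _ hs1 (nU _).
  rewrite Z.add_0_r in hs2; case: hs2 => [hu|hs2]; first by case: (nU (Z.of_nat y + dy)%Z).
  have [hy _ /=] := hS _ _ _ hs2 (nU _).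
  case: hv' => [[e1 e2]|[p1 [p' [[e1] hin e2]]]]; rewrite e2 /= => hst2.
    right => -[q1 x1] [e /= [hin [h1 h2]]]; have [_ _ hq1] := (proj2 wfN) _ _ _ _ hin.
    have [|hu|hs3] := hst2 e 0%Z (None, Ordinal hq1, None).
    - by apply/vedges_adam; split=> //; exists (Ordinal hq1).
    - by move: hu; rewrite /Ufull; lia.
    by apply: (@sink_not_live S (Ordinal hq1) x1 _ hS); rewrite h2; exact: hs3.
  left; exists (p' : nat, Z.to_nat (Z.of_nat y + dy)).
    by exists dy; rewrite /= e1 Z2Nat.id //; split=> //; split=> //.
  move=> [q1 x1] [e /= [hin1 [h1 h2]]]; have [_ _ hq1] := (proj2 wfN) _ _ _ _ hin1.
  have [|hu|hs3] := hst2 e 0%Z (Some p', Ordinal hq1, None).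
  - by apply/vedges_adam; split=> //; exists (Ordinal hq1).
  - by move: hu; rewrite /Ufull; lia.
  by exists p', (Ordinal hq1); split=> //=; rewrite h2 Z2Nat.id //; move: hs3; rewrite Z.add_0_r.
by exists q0, q0; rewrite /= e0.
Qed.

(** A locally consistent table is a winning set of the cut game, and the size of [L] lifts it to the
    full game. *)
Theorem colok_HD X : (Lbound vert D <= L) -> colok X -> X 0 (init N) (init N) = 0 -> history_deterministic N.
Proof.
move=> hL hX h0; have hin : init N < n by case: wfN.
have hK : 0 < Kn vert D.
  rewrite /Kn muln_gt0 Dpos andbT; apply/card_gt0P.
  by exists (None, Ordinal hin, None).
have [||S hS hS0] := trunc_sound vedges_bnd vedges_player hK _ (colR_closed hX) (v0 := (Some (Ordinal hin), Ordinal hin, None)).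
- by apply: inj_le; apply/leP; exact: hL.
- by split=> //=; rewrite h0.
exact: (@game_HD S (Ordinal hin)).
Qed.

End Columns.

End Columns.
Import Columns.

(** * Savitch's algorithm *)

Module Savitch.

Lemma find_iotaS (P : pred nat) r :
  find P (iota 0 r.+1) = if P 0 then 0 else (find (fun i => P i.+1) (iota 0 r)).+1.
Proof. by rewrite /= -[1]/(1 + 0) iotaDl find_map. Qed.

Section Savitch.
Variables (Bz : nat) (st : nat -> nat -> bool).
Hypothesis Bz_pos : 0 < Bz.

Fixpoint rch (l u v : nat) : bool :=
  if l is l'.+1 then has (fun z => rch l' u z && rch l' z v) (iota 0 Bz) else st u v.

Lemma rch_path l u v : rch l u v ->
  exists f : nat -> nat, [/\ f 0 = u, f (2 ^ l) = v & forall i, i < 2 ^ l -> st (f i) (f i.+1)].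
Proof.
elim: l u v => [|l IH] u v /=.
  by move=> h; exists (fun i => if i == 0 then u else v); split=> //; case.
move=> /hasP [z _ /andP [/IH [f [f0 f1 fs]] /IH [g [g0 g1 gs]]]].
exists (fun i => if i < 2 ^ l then f i else g (i - 2 ^ l)); split.
- by rewrite expn_gt0.
- by rewrite expnS mul2n -addnn ltnNge leq_addr /= addnK.
move=> i; rewrite expnS mul2n -addnn => hi.
case: (ltnP i (2 ^ l)) => h1.
  case: (ltnP i.+1 (2 ^ l)) => h2; first exact: fs.
  have e : i.+1 = 2 ^ l by lia.
  by rewrite e subnn g0 -f1 -e; apply: fs.
rewrite ltnNge (leq_trans h1 (leqnSn i)) /= subSn //; apply: gs; lia.
Qed.

Lemma path_rch (f : nat -> nat) l j : (forall i, i <= j + 2 ^ l -> f i < Bz) ->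
  (forall i, i < j + 2 ^ l -> st (f i) (f i.+1)) -> rch l (f j) (f (j + 2 ^ l)).
Proof.
elim: l j => [|l IH] j hB hs; first by rewrite /= addn1; apply: hs; rewrite addn1.
have e : j + 2 ^ l.+1 = j + 2 ^ l + 2 ^ l by rewrite expnS mul2n -addnn addnA.
rewrite e in hB hs *; apply/hasP; exists (f (j + 2 ^ l)).
  by rewrite mem_iota /= add0n hB // leq_addr.
by apply/andP; split; apply: IH => i hi; [apply: hB | apply: hs | apply: hB | apply: hs]; lia.
Qed.

Variables (S T k : nat).
Let b := 2 * Bz.

(** The stack to go to once the segment on top has succeeded, in units of its level: the first half
    hands over to the second, and the second passes the success to the enclosing segment. At the
    empty stack the values 1 here and 2 in [ufail] are the verdicts. *)
Fixpoint usucc (r h : nat) : nat :=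
  if r is r'.+1 then if odd h then b * usucc r' (h %/ b) else h.+1 else 1.
Fixpoint ufail (r h : nat) : nat :=
  if r is r'.+1 then if b - 2 <= h %% b then b * ufail r' (h %/ b) else (h %/ 2).+1 * 2 else 2.
(** The start of the current segment is the midpoint of the innermost enclosing segment that is in
    its second half; dually, [segv] looks for the innermost one in its first half. [S] and [T] are
    the outermost defaults. *)
Fixpoint segu (r h : nat) : nat :=
  if r is r'.+1 then if odd h then (h %% b) %/ 2 else segu r' (h %/ b) else S.
Fixpoint segv (r h : nat) : nat :=
  if r is r'.+1 then if odd h then segv r' (h %/ b) else (h %% b) %/ 2 else T.

(* The stack of Savitch's recursion as an odometer: the base-[b] digit [2 z + i] says that [z] is the
   current midpoint and that its [i]-th half is being checked. *)
Definition odo (s : nat) : nat :=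
  if b ^ k <= s then s else if st (segu k s) (segv k s) then usucc k s else ufail k s.

(** Each step of the walk increases the state, so the distance covered bounds the number of steps;
    this fixes the number of iterations in advance. *)
Definition go (s s' : nat) := s <= s' /\ exists2 t, t <= s' - s & iter t odo s = s'.

Lemma go_trans s1 s2 s3 : go s1 s2 -> go s2 s3 -> go s1 s3.
Proof.
move=> [h1 [t1 h2 h3]] [h4 [t2 h5 h6]]; split; first exact: leq_trans h4.
by exists (t2 + t1); [lia | rewrite iterD h3].
Qed.

Lemma b_pos : 0 < b. Proof. by rewrite /b; lia. Qed.

Lemma div_lt r h : h < b ^ r.+1 -> h %/ b < b ^ r.
Proof. by rewrite ltn_divLR ?b_pos // expnSr. Qed.

Lemma usucc_gt r h : h < b ^ r -> h < usucc r h <= b ^ r.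
Proof.
elim: r h => [|r IH] h hh /=; first by move: hh; rewrite expn0; lia.
case: ifP => ho; last by rewrite ltnSn.
have /andP[h1 h2] := IH _ (div_lt hh); rewrite expnS leq_mul2l h2 orbT andbT.
apply: leq_trans (_ : b * (h %/ b).+1 <= _); first by rewrite mulnC ltn_ceil ?b_pos.
by rewrite leq_mul2l h1 orbT.
Qed.

Lemma ufail_gt r h : h < b ^ r -> h < ufail r h <= 2 * b ^ r.
Proof.
elim: r h => [|r IH] h hh /=; first by move: hh; rewrite expn0; lia.
case: ifP => ho; last by apply/andP; split; lia.
have /andP[h1 h2] := IH _ (div_lt hh); rewrite expnS mulnCA leq_mul2l h2 orbT andbT.
apply: leq_trans (_ : b * (h %/ b).+1 <= _); first by rewrite mulnC ltn_ceil ?b_pos.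
by rewrite leq_mul2l h1 orbT.
Qed.

(** [h * b ^ l] is the first leaf below the stack [h]. The walk leaves that subtree at a place
    telling whether the segment of [h] is connected; the inner induction runs over the candidate
    midpoints. *)
Lemma go_level l r h : l + r = k -> h < b ^ r ->
  go (h * b ^ l) (b ^ l * (if rch l (segu r h) (segv r h) then usucc r h else ufail r h)).
Proof.
elim: l r h => [|l IH] r h hk hh.
  rewrite add0n in hk; subst r; rewrite expn0 muln1 mul1n.
  have h1 := usucc_gt hh; have h2 := ufail_gt hh.
  have eo : odo h = if rch 0 (segu k h) (segv k h) then usucc k h else ufail k h.
    by rewrite /odo leqNgt hh.
  rewrite -eo; split; last by exists 1 => //=; rewrite eo; case: (rch _ _ _); lia.
  by rewrite eo; case: (rch _ _ _); lia.
have hk' : l + r.+1 = k by rewrite addnS.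
have loop m z : z + m = Bz -> 0 < m ->
  go ((h * b + 2 * z) * b ^ l) (b ^ l.+1 *
    (if has (fun z => rch l (segu r h) z && rch l z (segv r h)) (iota z m) then usucc r h else ufail r h)).
  elim: m z => // m IHm z hz _.
  have hz1 : 2 * z + 1 < b by rewrite /b; lia.
  have odb : odd b = false by rewrite /b oddM.
  have d1 : (h * b + 2 * z) %/ b = h by rewrite divnMDl ?b_pos // divn_small ?addn0 //; lia.
  have m1 : (h * b + 2 * z) %% b = 2 * z by rewrite modnMDl modn_small //; lia.
  have d2 : (h * b + 2 * z).+1 %/ b = h by rewrite -addn1 -addnA divnMDl ?b_pos // divn_small ?addn0 //; lia.
  have m2 : (h * b + 2 * z).+1 %% b = 2 * z + 1 by rewrite -addn1 -addnA modnMDl modn_small //; lia.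
  have o1 : odd (h * b + 2 * z) = false by rewrite oddD [odd (h * b)]oddM odb andbF mul2n odd_double.
  have hb2 : (h.+1) * b <= b ^ r.+1 by rewrite expnSr leq_mul2r hh orbT.
  have B1 : h * b + 2 * z < b ^ r.+1 by apply: leq_trans hb2; rewrite mulSn; lia.
  have B2 : (h * b + 2 * z).+1 < b ^ r.+1 by apply: leq_trans hb2; rewrite mulSn; lia.
  have z1 : 2 * z %/ 2 = z by lia.
  have z2 : (2 * z + 1) %/ 2 = z by lia.
  have nxt : go ((h * b + 2 * z).+2 * b ^ l) (b ^ l.+1 *
      (if has (fun z => rch l (segu r h) z && rch l z (segv r h)) (iota z.+1 m) then usucc r h else ufail r h)) \/ m = 0.
    case: m IHm hz => [|m] IHm hz; [by right | left].
    have -> : (h * b + 2 * z).+2 = h * b + 2 * z.+1 by lia.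
    by apply: IHm => //; lia.
  have uf1 : ufail r.+1 (h * b + 2 * z) = if m == 0 then b * ufail r h else (h * b + 2 * z).+2.
    rewrite /= m1 d1; have -> : (b - 2 <= 2 * z) = (m == 0) by rewrite /b; apply/idP/eqP; lia.
    by case: ifP => // _; lia.
  have uf2 : ufail r.+1 (h * b + 2 * z).+1 = if m == 0 then b * ufail r h else (h * b + 2 * z).+2.
    rewrite /= m2 d2; have -> : (b - 2 <= 2 * z + 1) = (m == 0) by rewrite /b; apply/idP/eqP; lia.
    by case: ifP => // _; lia.
  have done_fail : go (b ^ l * (if m == 0 then b * ufail r h else (h * b + 2 * z).+2)) (b ^ l.+1 *
      (if has (fun z => rch l (segu r h) z && rch l z (segv r h)) (iota z.+1 m) then usucc r h else ufail r h)).
    case: eqP nxt => [-> _|_ [//|//]]; last by rewrite mulnC.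
    by rewrite expnSr mulnA; split=> //; exists 0.
  have := IH r.+1 _ hk' B1; rewrite uf1 [segu r.+1 _]/= [segv r.+1 _]/= o1 m1 d1 z1 /= o1.
  case: (rch l (segu r h) z) => /= g1; last exact: go_trans g1 done_fail.
  have := IH r.+1 _ hk' B2; rewrite uf2 [segu r.+1 _]/= [segv r.+1 _]/= o1 m2 d2 z2 /= o1 /= d2.
  rewrite [b ^ l * _]mulnC in g1.
  case: (rch l z (segv r h)) => /= g2; last exact: go_trans (go_trans g1 g2) done_fail.
  by rewrite expnSr -mulnA; apply: go_trans g1 g2.
by have := loop Bz 0 (add0n _) Bz_pos; rewrite muln0 addn0 -mulnA -expnS.
Qed.

(** States from [b ^ k] on are fixed points, so surplus iterations do no harm. *)
Theorem savitch_odo : iter (2 * b ^ k) odo 0 = (if rch k S T then 1 else 2) * b ^ k.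
Proof.
have := @go_level k 0 0 (addn0 _) isT; rewrite mul0n /= mulnC => -[_ [t ht e]]; rewrite -e.
have fx s : b ^ k <= s -> odo s = s by rewrite /odo => ->.
have hb : 0 < b ^ k by rewrite expn_gt0 b_pos.
have ht' : t <= 2 * b ^ k by apply: leq_trans ht _; rewrite subn0 leq_mul2r; case: (rch _ _ _); rewrite orbT.
rewrite -(subnK ht') iterD; move: (2 * b ^ k - t) => m.
have h1 : b ^ k <= iter t odo 0.
  by rewrite e leq_pmull //; case: (rch _ _ _).
by elim: m => //= m ->; apply: fx.
Qed.

Definition sh (i s : nat) := iter i (fun v => v %/ b) s.
Arguments sh : simpl never.

Lemma shS i s : sh i.+1 s = sh i (s %/ b).
Proof. by rewrite /sh iterSr. Qed.

(** Descending the stack amounts to searching for the first digit of the right parity, a form that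
    terms can express. *)
Lemma usuccE r h : h < b ^ r -> let i := find (fun i => ~~ odd (sh i h)) (iota 0 r) in
  usucc r h = (sh i h).+1 * b ^ i.
Proof.
elim: r h => [|r IH] h hh; first by rewrite /=; move: hh; rewrite expn0; case: h.
rewrite [usucc _ _]/= find_iotaS {1}/sh /=; case: (boolP (odd h)) => /= ho; last by rewrite expn0 muln1.
rewrite (IH _ (div_lt hh)) /= shS expnS.
rewrite (eq_find (a2 := fun i => ~~ odd (sh i (h %/ b)))); last by move=> i; rewrite /= shS.
by rewrite mulnCA.
Qed.

Lemma ufailE r h : h < b ^ r -> let i := find (fun i => sh i h %% b < b - 2) (iota 0 r) in
  ufail r h = (sh i h %/ 2).+1 * 2 * b ^ i.
Proof.
elim: r h => [|r IH] h hh; first by rewrite /=; move: hh; rewrite expn0; case: h.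
rewrite [ufail _ _]/= find_iotaS {1}/sh /= [h %% b < _]ltnNge; case: (boolP (b - 2 <= h %% b)) => /= ho; last by rewrite expn0 muln1.
rewrite (IH _ (div_lt hh)) /= shS expnS.
rewrite (eq_find (a2 := fun i => sh i (h %/ b) %% b < b - 2)); last by move=> i; rewrite /= shS.
by rewrite mulnCA.
Qed.

Lemma seguE r h : let i := find (fun i => odd (sh i h)) (iota 0 r) in
  segu r h = if i < r then (sh i h %% b) %/ 2 else S.
Proof.
elim: r h => [|r IH] h //; rewrite [segu _ _]/= find_iotaS {1}/sh /=; case: (boolP (odd h)) => //= ho.
rewrite IH /= shS ltnS.
by rewrite (eq_find (a2 := fun i => odd (sh i (h %/ b)))) // => i; rewrite /= shS.
Qed.

Lemma segvE r h : let i := find (fun i => ~~ odd (sh i h)) (iota 0 r) in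
  segv r h = if i < r then (sh i h %% b) %/ 2 else T.
Proof.
elim: r h => [|r IH] h //; rewrite [segv _ _]/= find_iotaS {1}/sh /=; case: (boolP (odd h)) => //= ho.
rewrite IH /= shS ltnS.
by rewrite (eq_find (a2 := fun i => ~~ odd (sh i (h %/ b)))) // => i; rewrite /= shS.
Qed.

End Savitch.

End Savitch.
Import Savitch.

(** * Parsing the input *)

Module Parsing.

Definition codeH : nat := lcode (Some Sh).
Definition code1 : nat := lcode (Some S1).

Definition cnt (o : nat -> nat) i := count (fun j => o j == codeH) (iota 0 i).
(** Start of field [k]: the positions preceded by fewer than [k] separators are exactly those before
    it. *)
Definition fpos o n k := count (fun i => cnt o i < k) (iota 0 n).
Definition flen o n k := (fpos o n k.+1 - fpos o n k).-1.
Definition fbit (o : nat -> nat) n k i := o (fpos o n k + i) == code1.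
(** Saturation at [Z] keeps the values of the term bounded; it has no effect once [2 ^ n <= Z]. *)
Definition fval o Z n k j := iteri (flen o n k - j) (fun i acc => minn Z (2 * acc + fbit o n k (j + i))) 0.
Definition canon o n k j := (j < flen o n k) && (fbit o n k j || (flen o n k == j.+1)).
Definition ntr o n := (cnt o n - 4) %/ 4.
Definition canon_tr o n t :=
  [&& canon o n (4 * t.+1) 0, canon o n (4 * t.+1 + 1) 0, canon o n (4 * t.+1 + 2) 1 &
   canon o n (4 * t.+1 + 3) 0].
(** The first clause excludes a negative zero, which [enc_Z] never prints. The sign is symbol 0 of
    the update field, so its digits start at 1. *)
Definition wf_tr o Z n t :=
  [&& ~~ (fbit o n (4 * t.+1 + 2) 0 && (fval o Z n (4 * t.+1 + 2) 1 == 0)),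
   fval o Z n (4 * t.+1) 0 < flen o n 0, fval o Z n (4 * t.+1 + 1) 0 < flen o n 1 &
   fval o Z n (4 * t.+1 + 3) 0 < flen o n 0].
Definition valid_hd o Z n :=
  [&& all (fbit o n 0) (iota 0 (flen o n 0)), all (fbit o n 1) (iota 0 (flen o n 1)), canon o n 2 0,
    flen o n 3 == flen o n 0 & fval o Z n 2 0 < flen o n 0].
Definition validb o Z n :=
  [&& 0 < n, o n.-1 == codeH, 4 <= cnt o n, cnt o n %% 4 == 0 &
    valid_hd o Z n && all (fun t => canon_tr o n t && wf_tr o Z n t) (iota 0 (ntr o n))].

Definition zval (s : bool) (m : nat) : Z := if s then (- Z.of_nat m)%Z else Z.of_nat m.

Definition mkN o Z n : OCN := {|
  nstates := flen o n 0;
  nletters := flen o n 1;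
  trans := [seq (fval o Z n (4 * t.+1) 0, fval o Z n (4 * t.+1 + 1) 0,
    zval (fbit o n (4 * t.+1 + 2) 0) (fval o Z n (4 * t.+1 + 2) 1), fval o Z n (4 * t.+1 + 3) 0)
    | t <- iota 0 (ntr o n)];
  init := fval o Z n 2 0;
  final := fbit o n 3 |}.

Lemma lcode_inj (G : finType) (a b : G) : (lcode (Some a) == lcode (Some b)) = (a == b).
Proof. by rewrite /= eqSS; apply/eqP/eqP => [/ord_inj/enum_rank_inj|->]. Qed.

Lemma cnt_take (x : seq sym) i : cnt (orc x) i = count_mem Sh (take i x).
Proof.
rewrite /cnt; elim: x i => [|c x IH] i.
  by rewrite (eq_count (a2 := pred0)) ?count_pred0 //; case.
case: i => // i; rewrite /= -[1]/(1 + 0) iotaDl count_map -IH; congr addn.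
by rewrite /orc /= /codeH lcode_inj.
Qed.

Definition joinf (fs : seq (seq sym)) : seq sym := flatten [seq f ++ [:: Sh] | f <- fs].
Definition noSh (f : seq sym) := all (fun c => c != Sh) f.

Lemma noSh_count f i : noSh f -> count_mem Sh (take i f) = 0.
Proof.
by elim: f i => [|c f IH] [|i] //= /andP[/negbTE -> /IH ->].
Qed.

Lemma joinf_cons f fs : joinf (f :: fs) = f ++ Sh :: joinf fs.
Proof. by rewrite /joinf /= -catA. Qed.

Lemma fposE fs k : all noSh fs -> fpos (orc (joinf fs)) (size (joinf fs)) k = size (joinf (take k fs)).
Proof.
rewrite /fpos => hn; rewrite (eq_count (a2 := fun i => count_mem Sh (take i (joinf fs)) < k)); last first.
  by move=> i; rewrite cnt_take.
elim: fs k hn => [|f fs IH] k; first by [].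
move=> /= /andP[hf hfs]; case: k => [|k]; first by rewrite take0 (eq_count (a2 := pred0)) ?count_pred0.
rewrite take_cons !joinf_cons !size_cat /= -!addSnnS iotaD count_cat -IH //; congr (_ + _).
  rewrite (@eq_in_count _ _ predT) ?count_predT ?size_iota // => i; rewrite mem_iota add0n /= ltnS => hi.
  by rewrite takel_cat // noSh_count.
rewrite add0n -[(size f).+1]addn0 iotaDl count_map; apply: eq_count => i /=.
have -> : take ((size f).+1 + i) (f ++ Sh :: joinf fs) = f ++ Sh :: take i (joinf fs).
  by rewrite addSnnS take_cat (_ : (_ < _) = false) ?addKn //; apply/negbTE; rewrite -leqNgt leq_addr.
rewrite count_cat /=.
by rewrite -{1}(take_size f) noSh_count.
Qed.

Lemma onth_size_cat (T : Type) (s1 s2 : seq T) i : onth (s1 ++ s2) (size s1 + i) = onth s2 i.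
Proof. by elim: s1. Qed.

Lemma onth_catl (T : Type) (x0 : T) (s1 s2 : seq T) i : i < size s1 -> onth (s1 ++ s2) i = Some (nth x0 s1 i).
Proof. by elim: s1 i => //= a s1 IH [|i] //=; apply: IH. Qed.

Lemma joinf_cat a b : joinf (a ++ b) = joinf a ++ joinf b.
Proof. by rewrite /joinf map_cat flatten_cat. Qed.

Section Fields.
Variable fs : seq (seq sym).
Hypothesis hfs : all noSh fs.
Notation x := (joinf fs).
Notation o := (orc (joinf fs)).
Notation n := (size (joinf fs)).

Lemma cnt_size : cnt o n = size fs.
Proof.
rewrite cnt_take take_size; elim: fs hfs => //= f l IH /andP[h1 /IH h2].
by rewrite joinf_cons count_cat /= h2 -{1}(take_size f) noSh_count.
Qed.

Lemma flenE k : k < size fs -> flen o n k = size (nth [::] fs k).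
Proof.
move=> hk; rewrite /flen !fposE // (take_nth [::] hk) -cats1 joinf_cat size_cat addKn.
by rewrite joinf_cons size_cat /= addn1.
Qed.

Lemma joinf_split k : x = joinf (take k fs) ++ joinf (drop k fs).
Proof. by rewrite -joinf_cat cat_take_drop. Qed.

Lemma fbitE k i : k < size fs -> i < size (nth [::] fs k) -> fbit o n k i = (nth S0 (nth [::] fs k) i == S1).
Proof.
move=> hk hi; rewrite /fbit fposE // /orc (joinf_split k) onth_size_cat.
by rewrite (drop_nth [::] hk) joinf_cons (onth_catl S0) // /code1 lcode_inj.
Qed.

Lemma bits_val_bnd v s : bits_val v s < v.+1 * 2 ^ size s.
Proof.
elim: s v => [|c s IH] v /=; first by rewrite muln1.
apply: leq_trans (IH _) _; rewrite expnS mulnA leq_mul2r; case: ifP => _; apply/orP; right; lia.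
Qed.

Lemma fvalE Z k j : 2 ^ n <= Z -> k < size fs -> fval o Z n k j = bits_val 0 (drop j (nth [::] fs k)).
Proof.
move=> hZ hk; set f := nth [::] fs k; rewrite /fval flenE // -/f -size_drop.
have hsz : size f <= n.
  rewrite (joinf_split k) size_cat (drop_nth [::] hk) joinf_cons size_cat /= -/f.
  by lia.
suff h m : m <= size (drop j f) ->
    iteri m (fun i acc => minn Z (2 * acc + fbit o n k (j + i))) 0 = bits_val 0 (take m (drop j f)).
  by rewrite h // take_size.
elim: m => [|m IH] hm; first by rewrite take0.
rewrite iteriS IH ?(ltnW hm) // (take_nth S0 hm) -cats1 bits_val_cat /=.
have hm' : j + m < size f by move: hm; rewrite size_drop; lia.
rewrite fbitE // nth_drop -/f.
set v := bits_val _ _.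
have hv : v < 2 ^ m.
  by have := bits_val_bnd 0 (take m (drop j f)); rewrite mul1n size_takel ?(ltnW hm).
have hv2 : (2 * v).+2 <= Z.
  apply: leq_trans hZ; apply: leq_trans (_ : 2 ^ m.+1 <= _); first by rewrite expnS; lia.
  by rewrite leq_exp2l //; lia.
by case: ifP => _; rewrite -mul2n (minn_idPr _) ?addn0 ?addn1 //; lia.
Qed.

End Fields.

Definition canonical (g : seq sym) := (0 < size g) && ((nth S0 g 0 == S1) || (size g == 1)).

Lemma canonical_nat_bits g : noSh g -> canonical g -> nat_bits (bits_val 0 g) = g.
Proof.
elim/last_ind: g => // g c IH; rewrite /noSh all_rcons => /andP[hc hg].
rewrite -cats1 bits_val_cat /= nat_bits_rec.
have -> : (if c == S1 then (bits_val 0 g).*2.+1 else (bits_val 0 g).*2) %/ 2 = bits_val 0 g by case: ifP; lia.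
have -> : bit_sym (odd (if c == S1 then (bits_val 0 g).*2.+1 else (bits_val 0 g).*2)) = c.
  by case: c hc => //= _; rewrite odd_double.
case: g IH hg => [|a g] IH hg //.
rewrite /canonical /= size_cat addn1 /= orbF => /eqP ea; subst a.
have {}IH := IH hg isT; rewrite IH.
by case: eqP => //= e0; move: IH => /=; rewrite e0; case: (g).
Qed.

Lemma nat_bits_canonical v : canonical (nat_bits v).
Proof.
elim/ltn_ind: v => v IH; rewrite nat_bits_rec; case: eqP => h; first by rewrite /canonical orbT.
have /andP[h1 h2] := IH (v %/ 2) (ltac:(lia)).
rewrite /canonical size_cat addn1 /= nth_cat h1; apply/orP; left.
by case/orP: h2 => // /eqP h2; move: (h2) h1 => _ _; move: (nat_bits_val (v %/ 2)) h2;
   case: (nat_bits _) => [|a [|]] //= e1 _; move: e1; case: a => //=; lia.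
Qed.

Definition fields_tr (t : nat * nat * Z * nat) : seq (seq sym) :=
  let: (q, a, d, p) := t in
  [:: nat_bits q; nat_bits a; (if (d <? 0)%Z then S1 else S0) :: nat_bits (Z.abs_nat d); nat_bits p].

Definition fieldsN (N : OCN) : seq (seq sym) :=
  [:: List.repeat S1 (nstates N); List.repeat S1 (nletters N); nat_bits (init N);
      List.map (fun q => if final N q then S1 else S0) (List.seq 0 (nstates N))]
  ++ flatten [seq fields_tr t | t <- trans N].

Lemma encode_joinf N : encode N = joinf (fieldsN N).
Proof.
have -> : encode N = enc_unary (nstates N) ++ enc_unary (nletters N) ++ enc_nat (init N)
  ++ (List.map (fun q => if final N q then S1 else S0) (List.seq 0 (nstates N)) ++ [:: Sh])
  ++ joinf (flatten [seq fields_tr t | t <- trans N]).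
  rewrite /encode; do 4 congr (_ ++ _).
  have appE (s1 s2 : seq sym) : app s1 s2 = s1 ++ s2 by [].
  elim: (trans N) => //= -[[[q a] d] p] l ->; rewrite appE joinf_cat !joinf_cons /enc_trans /enc_Z /enc_nat /joinf /=.
  by do 6 (rewrite -?catA /=).
by rewrite /fieldsN joinf_cat !joinf_cons /enc_unary /enc_nat -!catA /= -!catA /= -!catA /= -!catA.
Qed.

Lemma fieldsN_noSh N : all noSh (fieldsN N).
Proof.
have hr k : noSh (List.repeat S1 k) by elim: k.
rewrite /fieldsN all_cat /= !hr /= /noSh nat_bits_noSh /=; apply/andP; split.
  by rewrite andbT List_seq_iota; elim: (iota _ _) => //= a l ->; case: (final N a).
elim: (trans N) => //= -[[[q a] d] p] l; rewrite all_cat /= /noSh !nat_bits_noSh /= => ->.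
by case: (_ <? _)%Z.
Qed.

Lemma size_fields_tr ts : size (flatten [seq fields_tr t | t <- ts]) = 4 * size ts.
Proof. by elim: ts => //= -[[[q a] d] p] l; rewrite size_cat /= => ->; lia. Qed.

Lemma nth_fields_tr t0 ts i j : i < size ts -> j < 4 ->
  nth [::] (flatten [seq fields_tr t | t <- ts]) (4 * i + j) = nth [::] (fields_tr (nth t0 ts i)) j.
Proof.
elim: ts i => // t ts IH [|i] hi hj.
  by clear hi IH; case: t => [[[q a] d] p] /=; case: j hj => [|[|[|[|]]]].
have -> : 4 * i.+1 + j = 4 + (4 * i + j) by lia.
have e : size (fields_tr t) = 4 by clear hi; case: t => [[[q a] d] p].
by rewrite /= nth_cat e ltnNge leq_addr /= addKn; apply: IH.
Qed.

Lemma nth_fieldsN N t0 i j : i < size (trans N) -> j < 4 ->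
  nth [::] (fieldsN N) (4 * i.+1 + j) = nth [::] (fields_tr (nth t0 (trans N) i)) j.
Proof.
move=> hi hj; have -> : 4 * i.+1 + j = 4 + (4 * i + j) by lia.
by rewrite /fieldsN nth_cat ltnNge leq_addr /= addKn; apply: nth_fields_tr.
Qed.

Lemma nth_repeat k i : i < k -> nth S0 (List.repeat S1 k) i = S1.
Proof. by elim: k i => // k IH [|i] //=; apply: IH. Qed.

Lemma size_repeat (T : Type) (a : T) k : size (List.repeat a k) = k.
Proof. by elim: k => //= k ->. Qed.

Lemma valid_encode N Z : wf N -> 2 ^ size (encode N) <= Z -> validb (orc (encode N)) Z (size (encode N)).
Proof.
rewrite encode_joinf => -[hi hw] hZ; have hf := fieldsN_noSh N.
have hsz : size (fieldsN N) = 4 + 4 * size (trans N) by rewrite /fieldsN size_cat size_fields_tr.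
have ht : ntr (orc (joinf (fieldsN N))) (size (joinf (fieldsN N))) = size (trans N).
  by rewrite /ntr cnt_size // hsz; lia.
have l0 : flen (orc (joinf (fieldsN N))) (size (joinf (fieldsN N))) 0 = nstates N.
  by rewrite flenE ?hsz //= size_repeat.
have l1 : flen (orc (joinf (fieldsN N))) (size (joinf (fieldsN N))) 1 = nletters N.
  by rewrite flenE ?hsz //= size_repeat.
have cn k j : k < size (fieldsN N) -> canonical (drop j (nth [::] (fieldsN N) k)) ->
   canon (orc (joinf (fieldsN N))) (size (joinf (fieldsN N))) k j.
  move=> hk; rewrite /canonical /canon flenE // size_drop subn_gt0 nth_drop addn0 => /andP[h1 h2].
  by rewrite h1 /= fbitE //; case/orP: h2 => [->|/eqP h2] //; apply/orP; right; apply/eqP; lia.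
have hne : exists s, joinf (fieldsN N) = rcons s Sh.
  rewrite /joinf; have : fieldsN N <> [::] by [].
  elim/last_ind: (fieldsN N) => // l f _ _; rewrite -cats1 map_cat flatten_cat /= cats0.
  by exists (flatten [seq f0 ++ [:: Sh] | f0 <- l] ++ f); rewrite rcons_cat cats1.
rewrite /validb cnt_size // hsz ht; apply/and5P; split=> //.
- by have [s ->] := hne; rewrite size_rcons.
- have [s ->] := hne; rewrite size_rcons /= /orc onth_rcons eqxx; exact: eqxx.
- by lia.
rewrite /valid_hd l0 l1; apply/andP; split; first (apply/and5P; split).
- by apply/allP => i; rewrite mem_iota add0n /= => h; rewrite fbitE ?hsz //= ?size_repeat // nth_repeat.
- by apply/allP => i; rewrite mem_iota add0n /= => h; rewrite fbitE ?hsz //= ?size_repeat // nth_repeat.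
- by apply: cn; rewrite ?hsz //= drop0 nat_bits_canonical.
- by rewrite flenE ?hsz //= List_seq_iota size_map size_iota.
- by rewrite fvalE ?hsz //= drop0 nat_bits_val.
apply/allP => t; rewrite mem_iota add0n /= => {}h.
have [t0 _] : exists t0 : nat * nat * BinNums.Z * nat, True by exists (0, 0, 0%Z, 0).
have b3 j : j < 4 -> 4 * t.+1 + j < size (fieldsN N) by rewrite hsz; lia.
have e j : j < 4 -> nth [::] (fieldsN N) (4 * t.+1 + j) = nth [::] (fields_tr (nth t0 (trans N) t)) j.
  by move=> hj; apply: nth_fieldsN.
have hin : List.In (nth t0 (trans N) t) (trans N) by elim: (trans N) (t) h => // ? l IH [|i] /= ?; [left | right; apply: IH].
case et: (nth t0 (trans N) t) e hin => [[[q a] d] p] e /hw [hq ha hp].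
have e0 : nth [::] (fieldsN N) (4 * t.+1) = nat_bits q by have := e 0 isT; rewrite addn0.
have b0 : 4 * t.+1 < size (fieldsN N) by have := b3 0 isT; rewrite addn0.
have e1 : nth [::] (fieldsN N) (4 * t.+1 + 1) = nat_bits a := e 1 isT.
have e2 : nth [::] (fieldsN N) (4 * t.+1 + 2) =
  (if (d <? 0)%Z then S1 else S0) :: nat_bits (Z.abs_nat d) := e 2 isT.
have e3 : nth [::] (fieldsN N) (4 * t.+1 + 3) = nat_bits p := e 3 isT.
apply/andP; split.
  by apply/and4P; split; apply: cn; rewrite ?b0 ?b3 // ?e0 ?e1 ?e2 ?e3; rewrite /= ?drop0 nat_bits_canonical.
rewrite /wf_tr !fvalE ?b3 // e0 e1 e2 e3 /= !drop0 !nat_bits_val l0 l1 hq ha hp !andbT.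
rewrite fbitE ?b3 // e2 //=; case: Z.ltb_spec => //= hd.
by apply/eqP; lia.
Qed.

Lemma splitf (x : seq sym) : exists2 fs, all noSh fs & exists2 g, noSh g & x = joinf fs ++ g.
Proof.
elim: x => [|c x [fs h1 [g h2 ->]]]; first by exists [::] => //; exists [::].
case: (boolP (c == Sh)) => [/eqP ->|hc]; first by exists ([::] :: fs) => //; exists g.
case: fs h1 => [|f fs] /= h1; first by exists [::] => //; exists (c :: g) => //=; rewrite /noSh /= hc.
exists ((c :: f) :: fs); first by rewrite /= /noSh /= hc.
by exists g => //; rewrite !joinf_cons.
Qed.

Lemma fields4 (l : seq (seq sym)) m : size l = 4 * m ->
  l = flatten [seq [:: nth [::] l (4 * t); nth [::] l (4 * t + 1); nth [::] l (4 * t + 2); nth [::] l (4 * t + 3)]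
     | t <- iota 0 m].
Proof.
elim: m l => [|m IH] l; first by rewrite muln0 => /size0nil ->.
case: l => [|a [|b [|c [|d l]]]] //= hs; try by lia.
have -> : iota 1 m = map (addn 1) (iota 0 m) by rewrite -iotaDl.
rewrite -map_comp; do 4 congr cons; apply: etrans (IH l _) _; first by lia.
congr flatten; apply: eq_map => t; pose l4 := [:: a, b, c, d & l].
transitivity [:: nth [::] l4 (4 * (1 + t)); nth [::] l4 (4 * (1 + t) + 1); nth [::] l4 (4 * (1 + t) + 2);
  nth [::] l4 (4 * (1 + t) + 3)]; last by [].
by have -> : 4 * (1 + t) = (4 * t).+4 by lia.
Qed.

Lemma bits_all (f : seq sym) : all (fun i => nth S0 f i == S1) (iota 0 (size f)) -> f = List.repeat S1 (size f).
Proof.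
elim: f => //= c f IH /andP[/eqP -> h]; congr cons; apply: IH.
by move: h; rewrite -[1]/(1 + 0) iotaDl all_map.
Qed.

(** The checks in [validb] are those that make re-encoding the parsed net give back the input, so
    the net need not be searched for. *)
Lemma mkN_encode x Z : 2 ^ size x <= Z -> validb (orc x) Z (size x) ->
  wf (mkN (orc x) Z (size x)) /\ encode (mkN (orc x) Z (size x)) = x.
Proof.
move=> hZ hv; have [fs hfs [g hg ex]] := splitf x.
have eg : g = [::].
  case/lastP: g hg ex => // g c hg ex; case/and5P: hv => _ + _ _ _.
  rewrite ex -rcons_cat size_rcons /= /orc onth_rcons eqxx /codeH lcode_inj => /eqP ec.
  by move: hg; rewrite /noSh all_rcons ec eqxx.
rewrite eg cats0 in ex; subst x.
case/and5P: hv => _ _ hc4 hmod /andP[/and5P[ha0 ha1 hc2 hl3 hq0] /allP htr].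
rewrite cnt_size // in hc4 hmod.
have hnt : size fs = 4 + 4 * ntr (orc (joinf fs)) (size (joinf fs)).
  by rewrite /ntr cnt_size //; lia.
have cn k j : k < size fs -> canon (orc (joinf fs)) (size (joinf fs)) k j ->
    nat_bits (bits_val 0 (drop j (nth [::] fs k))) = drop j (nth [::] fs k).
  move=> hk /andP[]; rewrite flenE // => h1 h2; apply: canonical_nat_bits.
    have /allP := hfs => /(_ _ (mem_nth [::] hk)); rewrite /noSh -{1}(cat_take_drop j (nth [::] fs k)) all_cat.
    by move=> /andP[].
  rewrite /canonical size_drop subn_gt0 h1 nth_drop addn0 -fbitE //=.
  by case/orP: h2 => [->//|/eqP h2]; apply/orP; right; apply/eqP; lia.
set N := mkN _ _ _.
have wfN : wf N.
  split=> // q a d p /List.in_map_iff [t [[<- <- _ <-] hin]].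
  have {}hin : t \in iota 0 (ntr (orc (joinf fs)) (size (joinf fs))).
    by elim: (iota _ _) hin => //= b l IH [->|/IH h]; rewrite inE ?eqxx ?h ?orbT.
  by have /andP[_ /and4P[_ h1 h2 h3]] := htr _ hin.
split=> //; rewrite encode_joinf; congr joinf.
rewrite -(cat_take_drop 4 fs) /fieldsN; congr cat.
  case: fs hfs hZ hc4 {hmod htr hnt} cn @N {wfN} ha0 ha1 hc2 hl3 hq0 => [|a [|b [|c [|d l]]]] // hfs hZ hc4 cn N ha0 ha1 hc2 hl3 hq0.
  rewrite /= take0; congr [:: _; _; _; _].
  - rewrite /N /= flenE //=; rewrite flenE //= in ha0; rewrite -bits_all //.
    apply/allP => i hi; move/allP: ha0 => /(_ i hi); rewrite fbitE //=.
    by move: hi; rewrite mem_iota.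
  - rewrite /N /= flenE //=; rewrite flenE //= in ha1; rewrite -bits_all //.
    apply/allP => i hi; move/allP: ha1 => /(_ i hi); rewrite fbitE //=.
    by move: hi; rewrite mem_iota.
  - by rewrite /N /= fvalE // cn //= drop0.
  rewrite /N /= List_seq_iota -(eqP hl3) flenE //=.
  apply: (@eq_from_nth _ S0); first by rewrite size_map size_iota.
  move=> i; rewrite size_map size_iota => hi.
  rewrite (nth_map 0) ?size_iota // nth_iota // add0n fbitE //=.
  move: hfs => /= /and5P[_ _ _ hd _]; move/all_nthP: hd => /(_ S0 i hi).
  by case: (nth S0 d i).
have hd : size (drop 4 fs) = 4 * ntr (orc (joinf fs)) (size (joinf fs)) by rewrite size_drop hnt addKn.
rewrite {1}(fields4 hd) /N /= -map_comp; congr flatten.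
apply/eq_in_map => t hin /=; have /andP[/and4P[h1 h2 h3 h4] /and4P[h5 _ _ _]] := htr _ hin.
have htn : t < ntr (orc (joinf fs)) (size (joinf fs)) by move: hin; rewrite mem_iota.
have b j : j < 4 -> 4 * t.+1 + j < size fs by rewrite hnt; move: htn; clear; lia.
have b0 : 4 * t.+1 < size fs by rewrite hnt; move: htn; clear; lia.
have es j : 4 + (4 * t + j) = 4 * t.+1 + j by clear; lia.
have es0 : 4 + 4 * t = 4 * t.+1 by clear; lia.
rewrite !nth_drop !es es0 !fvalE ?b //; congr [:: _; _; _; _].
- by rewrite cn ?drop0.
- by rewrite cn ?drop0 ?b.
- have hsz : 1 < size (nth [::] fs (4 * t.+1 + 2)) by move: h3; rewrite /canon flenE ?b // => /andP[].
  have e1 : Z.abs_nat (zval (fbit (orc (joinf fs)) (size (joinf fs)) (4 * t.+1 + 2) 0)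
     (bits_val 0 (drop 1 (nth [::] fs (4 * t.+1 + 2))))) = bits_val 0 (drop 1 (nth [::] fs (4 * t.+1 + 2))).
    by move: (bits_val 0 _) (fbit _ _ _ _) => v [] /=; clear; lia.
  rewrite e1 cn ?b //; rewrite fvalE ?b // in h5.
  have hb := @fbitE fs hfs (4 * t.+1 + 2) 0 (b 2 isT) (ltnW hsz).
  have hn : noSh (nth [::] fs (4 * t.+1 + 2)) by apply: (allP hfs); rewrite mem_nth ?b.
  move: h5 hb; case: (fbit _ _ _ _) => /= h5 hb.
    rewrite (_ : (_ <? 0)%Z = true); last by apply/Z.ltb_lt; move: (bits_val 0 _) h5; clear => v /eqP; rewrite /zval; lia.
    by move: hsz hb; case: (nth [::] fs _) => //= c f _ /esym/eqP ->; rewrite drop0.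
  rewrite (_ : (_ <? 0)%Z = false); last by apply/Z.ltb_ge; move: (bits_val 0 _); clear => v; rewrite /zval; lia.
  by move: hsz hb hn; case: (nth [::] fs _) => //= c f _; rewrite drop0; case: c.
- by rewrite cn ?drop0 ?b.
Qed.

End Parsing.
Import Parsing.

(** * The decision procedure *)

Module Algorithm.

Section Algorithm.
Variable c : nat.

(** All sizes are capped at [Z], which keeps them within polynomial cost in [Z]; for the final
    choice of [Z] the caps have no effect. *)
Definition levels Z n := cpow Z 2 (c * n.+1).
Definition horizon Z n := cpow Z 2 (levels Z n).
Definition reachD Z n := cpow Z 2 n.
Definition base Z n := (horizon Z n).+1.
Definition colsz n := n.+1 * n.+1.
(** A node is a window written in base [base Z n]: digit 0 is the number of the current column,
    followed by the columns at distance up to [reachD] on both sides. An update has at most [n]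
    digits, hence this radius. *)
Definition nodes Z n := cpow Z (base Z n) (1 + (2 * reachD Z n).+1 * colsz n).
Definition dig Z n z i := iter i (fun v => v %/ base Z n) z %% base Z n.
Definition colv Z n z i p q := dig Z n z (1 + ((i * n.+1 + p) * n.+1 + q)).

Definition tq o Z n t := fval o Z n (4 * t.+1) 0.
Definition ta o Z n t := fval o Z n (4 * t.+1 + 1) 0.
Definition tneg o n t := fbit o n (4 * t.+1 + 2) 0.
Definition tabs o Z n t := fval o Z n (4 * t.+1 + 2) 1.
Definition tp o Z n t := fval o Z n (4 * t.+1 + 3) 0.

Definition aok1 o Z n z p' y t :=
  if tneg o n t then (tabs o Z n t <= dig Z n z 0) ==>
    (colv Z n z (reachD Z n - tabs o Z n t) p' (tp o Z n t) <= y)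
  else (dig Z n z 0 + tabs o Z n t < horizon Z n) ==>
    (colv Z n z (reachD Z n + tabs o Z n t) p' (tp o Z n t) <= y).
Definition aokb o Z n z q a p' y :=
  all (fun t => (tq o Z n t == q) && (ta o Z n t == a) ==> aok1 o Z n z p' y t) (iota 0 (ntr o n)).
Definition eok1 o Z n z q a y t :=
  if tneg o n t then (tabs o Z n t <= y) && aokb o Z n z q a (tp o Z n t) (y - tabs o Z n t)
  else aokb o Z n z q a (tp o Z n t) (y + tabs o Z n t).
Definition eokb o Z n z p q a y := aokb o Z n z q a (flen o n 0) y ||
  has (fun t => (tq o Z n t == p) && (ta o Z n t == a) && eok1 o Z n z q a y t) (iota 0 (ntr o n)).
Definition checky o Z n z p q y := (y < horizon Z n) ==>
  (fbit o n 3 q ==> (p < flen o n 0) && fbit o n 3 p) &&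
  all (fun a => eokb o Z n z p q a y) (iota 0 (flen o n 1)).
Definition checkpq o Z n z p q := checky o Z n z p q (colv Z n z (reachD Z n) p q).
Definition checkb o Z n z :=
  all (fun p => all (fun q => checkpq o Z n z p q) (iota 0 (flen o n 0))) (iota 0 (flen o n 0).+1).
(** Consecutive windows agree on their common columns, so a path of windows is one table; each
    window but the last has its central column checked. *)
Definition stepb o Z n z z' :=
  [&& dig Z n z' 0 == (dig Z n z 0).+1,
   all (fun j => dig Z n z' j.+1 == dig Z n z (j.+1 + colsz n)) (iota 0 (2 * reachD Z n * colsz n)) &
   checkb o Z n z].

Definition fE B k s := find (fun i => ~~ odd (sh B i s)) (iota 0 k).
Definition fO B k s := find (fun i => odd (sh B i s)) (iota 0 k).
Definition fF B k s := find (fun i => sh B i s %% (2 * B) < 2 * B - 2) (iota 0 k).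
Definition segux B k S s := if fO B k s < k then (sh B (fO B k s) s %% (2 * B)) %/ 2 else S.
Definition segvx B k T s := if fE B k s < k then (sh B (fE B k s) s %% (2 * B)) %/ 2 else T.
Definition usuccx Z B k s := (sh B (fE B k s) s).+1 * cpow Z (2 * B) (fE B k s).
Definition ufailx Z B k s := (sh B (fF B k s) s %/ 2).+1 * 2 * cpow Z (2 * B) (fF B k s).
Definition odox o Z n S T s := minn Z
  (if cpow Z (2 * nodes Z n) (levels Z n) <= s then s
   else if stepb o Z n (segux (nodes Z n) (levels Z n) S s) (segvx (nodes Z n) (levels Z n) T s)
   then usuccx Z (nodes Z n) (levels Z n) s else ufailx Z (nodes Z n) (levels Z n) s).
Definition savx o Z n S T :=
  iteri (2 * cpow Z (2 * nodes Z n) (levels Z n)) (fun _ s => odox o Z n S T s) 0 ==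
  cpow Z (2 * nodes Z n) (levels Z n).
(** A path of [2 ^ levels] steps, which is [horizon], starts at column 0 and so checks every column
    below [horizon]. *)
Definition pathb o Z n z0 z1 :=
  [&& dig Z n z0 0 == 0, colv Z n z0 (reachD Z n) (fval o Z n 2 0) (fval o Z n 2 0) == 0,
   dig Z n z1 0 == horizon Z n & savx o Z n z0 z1].
Definition decideb o Z n := validb o Z n &&
  has (fun z0 => has (fun z1 => pathb o Z n z0 z1) (iota 0 (nodes Z n))) (iota 0 (nodes Z n)).

(** * The decision procedure as a term *)

Section Terms.
Variable g : nat.
Notation E := (E g).
Notation Eb P := (E (fun o e => nat_of_bool (P o e))).

Lemma E_app6 f : E (fun o e => f o (nth 0 e 0) (nth 0 e 1) (nth 0 e 2) (nth 0 e 3) (nth 0 e 4) (nth 0 e 5)) ->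
  forall A B C D F G, E A -> E B -> E C -> E D -> E F -> E G ->
  E (fun o e => f o (A o e) (B o e) (C o e) (D o e) (F o e) (G o e)).
Proof.
by move=> h A B C D F G hA hB hC hD hF hG; exact: (E_let hG (E_let (E_shift hF) (E_let (E_shift (E_shift hD))
  (E_let (E_shift (E_shift (E_shift hC))) (E_let (E_shift (E_shift (E_shift (E_shift hB))))
  (E_let (E_shift (E_shift (E_shift (E_shift (E_shift hA))))) h)))))).
Qed.

Lemma E_app7 f : E (fun o e => f o (nth 0 e 0) (nth 0 e 1) (nth 0 e 2) (nth 0 e 3) (nth 0 e 4) (nth 0 e 5) (nth 0 e 6)) ->
  forall A B C D F G H, E A -> E B -> E C -> E D -> E F -> E G -> E H ->
  E (fun o e => f o (A o e) (B o e) (C o e) (D o e) (F o e) (G o e) (H o e)).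
Proof.
by move=> h A B C D F G H hA hB hC hD hF hG hH; exact: (E_let hH (E_let (E_shift hG) (E_let (E_shift (E_shift hF))
  (E_let (E_shift (E_shift (E_shift hD))) (E_let (E_shift (E_shift (E_shift (E_shift hC))))
  (E_let (E_shift (E_shift (E_shift (E_shift (E_shift hB)))))
  (E_let (E_shift (E_shift (E_shift (E_shift (E_shift (E_shift hA)))))) h))))))).
Qed.

Lemma E_b1 i : E (fun o e => nth 0 (behead e) i). Proof. exact: E_shift (E_nth g i). Qed.
Lemma E_b2 i : E (fun o e => nth 0 (behead (behead e)) i). Proof. exact: E_shift (E_b1 i). Qed.
Lemma E_h1 : E (fun o e => head 0 (behead e)). Proof. exact: E_shift (E_var0 g). Qed.

Lemma E_count N P : E N -> Eb (fun o e => P o (behead e) (head 0 e)) ->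
  E (fun o e => count (P o e) (iota 0 (N o e))).
Proof.
move=> hN hP.
have aux o e m : iteri m (fun j acc => acc + P o e j) 0 = count (P o e) (iota 0 m).
  by elim: m => // m IH; rewrite iteriS IH -[in RHS]addn1 iotaD count_cat /= add0n addn0.
apply: E_ext (E_rec hN (E_const g 0) (E_add (E_nth g 0) (E_shift hP)) _).
  by move=> o e _; exact: aux.
exists N; first exact: E_pbnd.
move=> o e j _ hj; rewrite aux; apply: leq_trans hj.
by rewrite -[X in _ <= X](size_iota 0); apply: count_size.
Qed.

Lemma E_find N P : E N -> Eb (fun o e => P o (behead e) (head 0 e)) ->
  E (fun o e => find (P o e) (iota 0 (N o e))).
Proof.
move=> hN hP.
(* While nothing has been found the accumulator equals the loop index; afterwards it stays
   behind. *)
have aux o e m : iteri m (fun j acc => if (acc == j) && ~~ P o e j then j.+1 else acc) 0 = find (P o e) (iota 0 m).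
  elim: m => // m IH; rewrite iteriS IH -[in RHS]addn1 iotaD find_cat /= add0n size_iota has_find size_iota.
  have : find (P o e) (iota 0 m) <= m by rewrite -[X in _ <= X](size_iota 0) find_size.
  by case: ltngtP => // -> _; case: (P o e m) => //=; rewrite ?addn0 ?addn1.
apply: E_ext (E_rec hN (E_const g 0) (E_if (P := fun o e => (nth 0 e 0 == nth 0 e 1) && ~~ P o (behead (behead e)) (nth 0 e 1))
   _ (E_succ (E_nth g 1)) (E_nth g 0)) _).
- by move=> o e _; exact: aux.
- apply: E_and; first exact: E_eq (E_nth g 0) (E_nth g 1).
  by apply: E_neg; apply: E_ext (E_shift hP) => o e _; rewrite -nth0 nth_behead.
exists N; first exact: E_pbnd.
move=> o e j _ hj; rewrite aux; apply: leq_trans hj.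
by rewrite -[X in _ <= X](size_iota 0); apply: find_size.
Qed.

Lemma E_odd A : E A -> Eb (fun o e => odd (A o e)).
Proof.
by move=> h; apply: E_ext (E_mod h (E_const g 2)) => o e _; rewrite modn2.
Qed.

Lemma E_bool (P : _ -> _ -> bool) A B : Eb P -> Eb A -> Eb B -> Eb (fun o e => if P o e then A o e else B o e).
Proof.
by move=> hP hA hB; apply: E_ext (E_if hP hA hB) => o e _; case: (P o e).
Qed.

(** A hook, redefined after groups of definability lemmas so that the structural tactic recognises
    the new symbols. *)
Ltac es0 := fail.
Ltac es1 := cbv beta; first [ assumption | lazymatch goal with
  | |- TermClass.E _ (fun o e => nth 0 e _) => apply: E_nth
  | |- TermClass.E _ (fun o e => nth 0 (behead e) _) => apply: E_b1
  | |- TermClass.E _ (fun o e => nth 0 (behead (behead e)) _) => apply: E_b2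
  | |- TermClass.E _ (fun o e => head 0 e) => apply: E_var0
  | |- TermClass.E _ (fun o e => head 0 (behead e)) => apply: E_h1
  | |- TermClass.E _ (fun o e => addn _ _) => apply: E_add
  | |- TermClass.E _ (fun o e => muln _ _) => apply: E_mul
  | |- TermClass.E _ (fun o e => subn _ _) => apply: E_sub
  | |- TermClass.E _ (fun o e => divn _ _) => apply: E_div
  | |- TermClass.E _ (fun o e => modn _ _) => apply: E_mod
  | |- TermClass.E _ (fun o e => minn _ _) => apply: E_min
  | |- TermClass.E _ (fun o e => predn _) => apply: E_pred
  | |- TermClass.E _ (fun o e => cpow _ _ _) => apply: E_cpow
  | |- TermClass.E _ (fun o e => iter _ _ _) => apply: E_iterdiv
  | |- TermClass.E _ (fun o e => count (@?P o e) (iota 0 (@?N o e))) => refine (@E_count N P _ _)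
  | |- TermClass.E _ (fun o e => find (@?P o e) (iota 0 (@?N o e))) => refine (@E_find N P _ _)
  | |- TermClass.E _ (fun o e => nat_of_bool (all (@?P o e) (iota 0 (@?N o e)))) => refine (@E_all _ N P _ _)
  | |- TermClass.E _ (fun o e => nat_of_bool (has (@?P o e) (iota 0 (@?N o e)))) => refine (@E_ex _ N P _ _)
  | |- TermClass.E _ (fun o e => nat_of_bool (eq_op _ _)) => apply: E_eq
  | |- TermClass.E _ (fun o e => nat_of_bool (leq _ _)) => apply: E_le
  | |- TermClass.E _ (fun o e => nat_of_bool (andb _ _)) => apply: E_and
  | |- TermClass.E _ (fun o e => nat_of_bool (orb _ _)) => apply: E_or
  | |- TermClass.E _ (fun o e => nat_of_bool (implb _ _)) => apply: E_imp
  | |- TermClass.E _ (fun o e => nat_of_bool (negb _)) => apply: E_neg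
  | |- TermClass.E _ (fun o e => nat_of_bool (odd _)) => apply: E_odd
  | |- TermClass.E _ (fun o e => nat_of_bool (if _ then _ else _)) => apply: E_bool
  | |- TermClass.E _ (fun o e => if _ then _ else _) => apply: E_if
  | |- TermClass.E _ (fun o e => o _) => apply: E_inp
  | |- TermClass.E _ (fun o e => S _) => first [exact: E_const | apply: E_succ]
  | |- TermClass.E _ (fun o e => 0) => exact: E_const
  | _ => es0
  end | exact: E_const ].
Ltac es := repeat es1.

Lemma E_cnt A : E A -> E (fun o e => cnt o (A o e)).
Proof. by move=> hA; rewrite /cnt; es. Qed.

Ltac es_0 := lazymatch goal with
  | |- TermClass.E _ (fun o e => cnt _ _) => apply: E_cnt
  end.
Ltac es0 ::= es_0.

Lemma E_fpos A B : E A -> E B -> E (fun o e => fpos o (A o e) (B o e)).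
Proof.
move: A B; apply: (E_app2 (f := fun o a b => fpos o a b)); by rewrite /fpos; es.
Qed.

Ltac es_1 := first [ es_0 | lazymatch goal with
  | |- TermClass.E _ (fun o e => fpos _ _ _) => apply: E_fpos
  end ].
Ltac es0 ::= es_1.

Lemma E_flen A B : E A -> E B -> E (fun o e => flen o (A o e) (B o e)).
Proof. by move=> hA hB; rewrite /flen; es. Qed.

Lemma E_fbit A B C : E A -> E B -> E C -> Eb (fun o e => fbit o (A o e) (B o e) (C o e)).
Proof. by move=> hA hB hC; rewrite /fbit; es. Qed.

Ltac es_2 := first [ es_1 | lazymatch goal with
  | |- TermClass.E _ (fun o e => flen _ _ _) => apply: E_flen
  | |- TermClass.E _ (fun o e => nat_of_bool (fbit _ _ _ _)) => apply: E_fbit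
  end ].
Ltac es0 ::= es_2.

Lemma E_fval A B C D : E A -> E B -> E C -> E D -> E (fun o e => fval o (A o e) (B o e) (C o e) (D o e)).
Proof.
move: A B C D; apply: (E_app4 (f := fun o a b c d => fval o a b c d)).
apply: (E_rec (N := fun o e => flen o (nth 0 e 1) (nth 0 e 2) - nth 0 e 3) (I := fun o e => 0)
  (B := fun o e => minn (nth 0 e 2) (2 * nth 0 e 0 + fbit o (nth 0 e 3) (nth 0 e 4) (nth 0 e 5 + nth 0 e 1)))); es.
exists (fun o e => nth 0 e 0); first by apply: E_pbnd; es.
by move=> o e [|j] _ _ //=; rewrite geq_minl.
Qed.

Ltac es_3 := first [ es_2 | lazymatch goal with
  | |- TermClass.E _ (fun o e => fval _ _ _ _ _) => apply: E_fval
  end ].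
Ltac es0 ::= es_3.

Lemma E_canon A B C : E A -> E B -> E C -> Eb (fun o e => canon o (A o e) (B o e) (C o e)).
Proof. by move=> hA hB hC; rewrite /canon; es. Qed.

Lemma E_ntr A : E A -> E (fun o e => ntr o (A o e)).
Proof. by move=> hA; rewrite /ntr; es. Qed.

Ltac es_4 := first [ es_3 | lazymatch goal with
  | |- TermClass.E _ (fun o e => nat_of_bool (canon _ _ _ _)) => apply: E_canon
  | |- TermClass.E _ (fun o e => ntr _ _) => apply: E_ntr
  end ].
Ltac es0 ::= es_4.

Lemma E_validb A B : E A -> E B -> Eb (fun o e => validb o (A o e) (B o e)).
Proof.
move: A B; apply: (E_app2 (f := fun o a b => nat_of_bool (validb o a b))).
by rewrite /validb /valid_hd /canon_tr /wf_tr; es.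
Qed.

Lemma E_levels A B : E A -> E B -> E (fun o e => levels (A o e) (B o e)).
Proof. by move=> hA hB; rewrite /levels; es. Qed.

Lemma E_horizon A B : E A -> E B -> E (fun o e => horizon (A o e) (B o e)).
Proof. by move=> hA hB; rewrite /horizon; es; apply: E_levels. Qed.

Lemma E_reachD A B : E A -> E B -> E (fun o e => reachD (A o e) (B o e)).
Proof. by move=> hA hB; rewrite /reachD; es. Qed.

Ltac es_5 := first [ es_4 | lazymatch goal with
  | |- TermClass.E _ (fun o e => nat_of_bool (validb _ _ _)) => apply: E_validb
  | |- TermClass.E _ (fun o e => levels _ _) => apply: E_levels
  | |- TermClass.E _ (fun o e => horizon _ _) => apply: E_horizon
  | |- TermClass.E _ (fun o e => reachD _ _) => apply: E_reachD
  end ].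
Ltac es0 ::= es_5.

Lemma E_base A B : E A -> E B -> E (fun o e => base (A o e) (B o e)).
Proof. by move=> hA hB; rewrite /base; es. Qed.

Lemma E_colsz A : E A -> E (fun o e => colsz (A o e)).
Proof. by move=> hA; rewrite /colsz; es. Qed.

Ltac es_6 := first [ es_5 | lazymatch goal with
  | |- TermClass.E _ (fun o e => base _ _) => apply: E_base
  | |- TermClass.E _ (fun o e => colsz _) => apply: E_colsz
  end ].
Ltac es0 ::= es_6.

Lemma E_nodes A B : E A -> E B -> E (fun o e => nodes (A o e) (B o e)).
Proof. by move=> hA hB; rewrite /nodes; es. Qed.

Lemma E_dig A B C D : E A -> E B -> E C -> E D -> E (fun o e => dig (A o e) (B o e) (C o e) (D o e)).
Proof.
move: A B C D; apply: (E_app4 (f := fun o a b c d => dig a b c d)).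
by rewrite /dig; es.
Qed.

Ltac es_7 := first [ es_6 | lazymatch goal with
  | |- TermClass.E _ (fun o e => nodes _ _) => apply: E_nodes
  | |- TermClass.E _ (fun o e => dig _ _ _ _) => apply: E_dig
  end ].
Ltac es0 ::= es_7.

Lemma E_colv A B C D F G : E A -> E B -> E C -> E D -> E F -> E G ->
  E (fun o e => colv (A o e) (B o e) (C o e) (D o e) (F o e) (G o e)).
Proof.
move: A B C D F G; apply: (E_app6 (f := fun o a b c d f h => colv a b c d f h)).
by rewrite /colv; es.
Qed.

Lemma E_tq A B C : E A -> E B -> E C -> E (fun o e => tq o (A o e) (B o e) (C o e)).
Proof. by move=> *; rewrite /tq; es. Qed.
Lemma E_ta A B C : E A -> E B -> E C -> E (fun o e => ta o (A o e) (B o e) (C o e)).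
Proof. by move=> *; rewrite /ta; es. Qed.
Lemma E_tp A B C : E A -> E B -> E C -> E (fun o e => tp o (A o e) (B o e) (C o e)).
Proof. by move=> *; rewrite /tp; es. Qed.
Lemma E_tabs A B C : E A -> E B -> E C -> E (fun o e => tabs o (A o e) (B o e) (C o e)).
Proof. by move=> *; rewrite /tabs; es. Qed.
Lemma E_tneg A B : E A -> E B -> Eb (fun o e => tneg o (A o e) (B o e)).
Proof. by move=> *; rewrite /tneg; es. Qed.

Ltac es_8 := first [ es_7 | lazymatch goal with
  | |- TermClass.E _ (fun o e => colv _ _ _ _ _ _) => apply: E_colv
  | |- TermClass.E _ (fun o e => tq _ _ _ _) => apply: E_tq
  | |- TermClass.E _ (fun o e => ta _ _ _ _) => apply: E_ta
  | |- TermClass.E _ (fun o e => tp _ _ _ _) => apply: E_tp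
  | |- TermClass.E _ (fun o e => tabs _ _ _ _) => apply: E_tabs
  | |- TermClass.E _ (fun o e => nat_of_bool (tneg _ _ _)) => apply: E_tneg
  end ].
Ltac es0 ::= es_8.

Lemma E_aok1 A B C D F G : E A -> E B -> E C -> E D -> E F -> E G ->
  Eb (fun o e => aok1 o (A o e) (B o e) (C o e) (D o e) (F o e) (G o e)).
Proof.
move: A B C D F G; apply: (E_app6 (f := fun o a b c d f h => nat_of_bool (aok1 o a b c d f h))).
by rewrite /aok1; es.
Qed.

Ltac es_9 := first [ es_8 | lazymatch goal with
  | |- TermClass.E _ (fun o e => nat_of_bool (aok1 _ _ _ _ _ _ _)) => apply: E_aok1
  end ].
Ltac es0 ::= es_9.

Lemma E_aokb A B C D F G H : E A -> E B -> E C -> E D -> E F -> E G -> E H ->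
  Eb (fun o e => aokb o (A o e) (B o e) (C o e) (D o e) (F o e) (G o e) (H o e)).
Proof.
move: A B C D F G H; apply: (E_app7 (f := fun o a b c d f h i => nat_of_bool (aokb o a b c d f h i))).
by rewrite /aokb; es.
Qed.

Ltac es_10 := first [ es_9 | lazymatch goal with
  | |- TermClass.E _ (fun o e => nat_of_bool (aokb _ _ _ _ _ _ _ _)) => apply: E_aokb
  end ].
Ltac es0 ::= es_10.

Lemma E_eok1 A B C D F G H : E A -> E B -> E C -> E D -> E F -> E G -> E H ->
  Eb (fun o e => eok1 o (A o e) (B o e) (C o e) (D o e) (F o e) (G o e) (H o e)).
Proof.
move: A B C D F G H; apply: (E_app7 (f := fun o a b c d f h i => nat_of_bool (eok1 o a b c d f h i))).
by rewrite /eok1; es.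
Qed.

Ltac es_11 := first [ es_10 | lazymatch goal with
  | |- TermClass.E _ (fun o e => nat_of_bool (eok1 _ _ _ _ _ _ _ _)) => apply: E_eok1
  end ].
Ltac es0 ::= es_11.

Lemma E_eokb A B C D F G H : E A -> E B -> E C -> E D -> E F -> E G -> E H ->
  Eb (fun o e => eokb o (A o e) (B o e) (C o e) (D o e) (F o e) (G o e) (H o e)).
Proof.
move: A B C D F G H; apply: (E_app7 (f := fun o a b c d f h i => nat_of_bool (eokb o a b c d f h i))).
by rewrite /eokb; es.
Qed.

Lemma E_checky A B C D F G : E A -> E B -> E C -> E D -> E F -> E G ->
  Eb (fun o e => checky o (A o e) (B o e) (C o e) (D o e) (F o e) (G o e)).
Proof.
move: A B C D F G; apply: (E_app6 (f := fun o a b c d f h => nat_of_bool (checky o a b c d f h))).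
by rewrite /checky; es; apply: E_eokb; es.
Qed.

Lemma E_checkpq A B C D F : E A -> E B -> E C -> E D -> E F ->
  Eb (fun o e => checkpq o (A o e) (B o e) (C o e) (D o e) (F o e)).
Proof.
move: A B C D F; apply: (E_app5 (f := fun o a b c d f => nat_of_bool (checkpq o a b c d f))).
by rewrite /checkpq; apply: E_checky; es.
Qed.

Lemma E_checkb A B C : E A -> E B -> E C -> Eb (fun o e => checkb o (A o e) (B o e) (C o e)).
Proof.
move: A B C; apply: (E_app3 (f := fun o a b c => nat_of_bool (checkb o a b c))).
rewrite /checkb; apply: (E_all (P := fun o e p => all (fun q => checkpq o (nth 0 e 0) (nth 0 e 1) (nth 0 e 2) p q)
   (iota 0 (flen o (nth 0 e 1) 0)))); es.
by apply: E_checkpq; es.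
Qed.

Lemma E_stepb A B C D : E A -> E B -> E C -> E D -> Eb (fun o e => stepb o (A o e) (B o e) (C o e) (D o e)).
Proof.
move: A B C D; apply: (E_app4 (f := fun o a b c d => nat_of_bool (stepb o a b c d))).
by rewrite /stepb; es; apply: E_checkb; es.
Qed.

Lemma E_sh A B C : E A -> E B -> E C -> E (fun o e => sh (A o e) (B o e) (C o e)).
Proof.
move: A B C; apply: (E_app3 (f := fun o a b c => sh a b c)).
by rewrite /sh; es.
Qed.

Ltac es_12 := first [ es_11 | lazymatch goal with
  | |- TermClass.E _ (fun o e => sh _ _ _) => apply: E_sh
  | |- TermClass.E _ (fun o e => nat_of_bool (stepb _ _ _ _ _)) => apply: E_stepb
  end ].
Ltac es0 ::= es_12.

Lemma E_fE A B C : E A -> E B -> E C -> E (fun o e => fE (A o e) (B o e) (C o e)).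
Proof. by move: A B C; apply: (E_app3 (f := fun o a b c => fE a b c)); rewrite /fE; es. Qed.
Lemma E_fO A B C : E A -> E B -> E C -> E (fun o e => fO (A o e) (B o e) (C o e)).
Proof. by move: A B C; apply: (E_app3 (f := fun o a b c => fO a b c)); rewrite /fO; es. Qed.
Lemma E_fF A B C : E A -> E B -> E C -> E (fun o e => fF (A o e) (B o e) (C o e)).
Proof. by move: A B C; apply: (E_app3 (f := fun o a b c => fF a b c)); rewrite /fF; es. Qed.

Ltac es_13 := first [ es_12 | lazymatch goal with
  | |- TermClass.E _ (fun o e => fE _ _ _) => apply: E_fE
  | |- TermClass.E _ (fun o e => fO _ _ _) => apply: E_fO
  | |- TermClass.E _ (fun o e => fF _ _ _) => apply: E_fF
  end ].
Ltac es0 ::= es_13.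

Lemma E_segux A B C D : E A -> E B -> E C -> E D -> E (fun o e => segux (A o e) (B o e) (C o e) (D o e)).
Proof. by move=> *; rewrite /segux; es. Qed.
Lemma E_segvx A B C D : E A -> E B -> E C -> E D -> E (fun o e => segvx (A o e) (B o e) (C o e) (D o e)).
Proof. by move=> *; rewrite /segvx; es. Qed.
Lemma E_usuccx A B C D : E A -> E B -> E C -> E D -> E (fun o e => usuccx (A o e) (B o e) (C o e) (D o e)).
Proof. by move=> *; rewrite /usuccx; es. Qed.
Lemma E_ufailx A B C D : E A -> E B -> E C -> E D -> E (fun o e => ufailx (A o e) (B o e) (C o e) (D o e)).
Proof. by move=> *; rewrite /ufailx; es. Qed.

Ltac es_14 := first [ es_13 | lazymatch goal with
  | |- TermClass.E _ (fun o e => segux _ _ _ _) => apply: E_segux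
  | |- TermClass.E _ (fun o e => segvx _ _ _ _) => apply: E_segvx
  | |- TermClass.E _ (fun o e => usuccx _ _ _ _) => apply: E_usuccx
  | |- TermClass.E _ (fun o e => ufailx _ _ _ _) => apply: E_ufailx
  end ].
Ltac es0 ::= es_14.

Lemma E_odox A B C D F : E A -> E B -> E C -> E D -> E F ->
  E (fun o e => odox o (A o e) (B o e) (C o e) (D o e) (F o e)).
Proof. by move=> *; rewrite /odox; es. Qed.

Lemma E_savx A B C D : E A -> E B -> E C -> E D -> Eb (fun o e => savx o (A o e) (B o e) (C o e) (D o e)).
Proof.
move: A B C D; apply: (E_app4 (f := fun o a b c d => nat_of_bool (savx o a b c d))).
apply: E_eq; last by es.
apply: (E_rec (N := fun o e => 2 * cpow (nth 0 e 0) (2 * nodes (nth 0 e 0) (nth 0 e 1)) (levels (nth 0 e 0) (nth 0 e 1)))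
  (I := fun o e => 0) (B := fun o e => odox o (nth 0 e 2) (nth 0 e 3) (nth 0 e 4) (nth 0 e 5) (nth 0 e 0))); es.
  by apply: E_odox; es.
exists (fun o e => nth 0 e 0); first by apply: E_pbnd; es.
by move=> o e [|j] _ _ //=; rewrite geq_minl.
Qed.

Lemma E_pathb A B C D : E A -> E B -> E C -> E D -> Eb (fun o e => pathb o (A o e) (B o e) (C o e) (D o e)).
Proof. by move=> *; rewrite /pathb; es; apply: E_savx. Qed.

Lemma E_decideb : Eb (fun o e => decideb o (nth 0 e 0) (nth 0 e 1)).
Proof.
rewrite /decideb; apply: E_and; first by es.
apply: (E_ex (P := fun o e z0 => has (fun z1 => pathb o (nth 0 e 0) (nth 0 e 1) z0 z1)
   (iota 0 (nodes (nth 0 e 0) (nth 0 e 1))))); es.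
by apply: E_pathb; es.
Qed.

End Terms.
End Algorithm.

End Algorithm.
Import Algorithm.

(** * Correctness of the decision procedure *)

Module Decision.

Lemma fpos_le o n k : fpos o n k <= n.
Proof. by rewrite /fpos -[X in _ <= X](size_iota 0); apply: count_size. Qed.

Lemma flen_le o n k : flen o n k <= n.
Proof. by rewrite /flen; have := fpos_le o n k.+1; lia. Qed.

(** Bounds every update by the radius of the windows. *)
Lemma fval_lt o Z n k j : fval o Z n k j < 2 ^ n.
Proof.
apply: leq_trans (_ : 2 ^ (flen o n k - j) <= _); last first.
  by rewrite leq_exp2l //; have := flen_le o n k; lia.
rewrite /fval; elim: (flen o n k - j) => // m IH; rewrite iteriS expnS.
by apply: leq_ltn_trans (geq_minr _ _) _; case: (fbit _ _ _ _); lia.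
Qed.

Fixpoint num (b : nat) (f : nat -> nat) (m : nat) : nat :=
  if m is m'.+1 then f 0 + b * num b (fun j => f j.+1) m' else 0.

Lemma num_lt b f m : (forall j, f j < b) -> num b f m < b ^ m.
Proof.
elim: m f => // m IH f h /=; have h1 := IH (fun j => f j.+1) (fun j => h _).
rewrite expnS; apply: leq_trans (_ : b * (num b (fun j => f j.+1) m).+1 <= _).
  by rewrite mulnS -addSn leq_add2r.
by rewrite leq_mul2l h1 orbT.
Qed.

Lemma num_dig b f m j : (forall j, f j < b) -> j < m -> iter j (fun v => v %/ b) (num b f m) %% b = f j.
Proof.
elim: m f j => // m IH f [|j] h hj.
  by rewrite /= mulnC addnC modnMDl modn_small.
rewrite iterSr /= [f 0 + _]addnC mulnC divnMDl ?(leq_trans _ (h 0)) // divn_small // addn0.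
by apply: IH.
Qed.

Section Correctness.
Variables (c n Z : nat) (o : nat -> nat).
Notation levels := (levels c).
Notation horizon := (horizon c).
Notation base := (base c).
Notation nodes := (nodes c).
Notation dig := (dig c).
Notation colv := (colv c).
Variables k M D B : nat.
Hypothesis kE : k = 2 ^ (c * n.+1).
Hypothesis ME : M = 2 ^ k.
Hypothesis DE : D = 2 ^ n.
Hypothesis BE : B = M.+1 ^ (1 + (2 * D).+1 * colsz n).
Hypothesis cap : 2 * (2 * B) ^ k <= Z.
Let N := mkN o Z n.
Hypothesis wfN : wf N.

Lemma k_pos : 0 < k. Proof. by rewrite kE expn_gt0. Qed.
Lemma B_pos : 0 < B. Proof. by rewrite BE expn_gt0. Qed.

Lemma B_Z : 2 * B <= Z.
Proof.
apply: leq_trans cap; apply: leq_trans (_ : (2 * B) ^ k <= _); last by lia.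
by rewrite -{1}[2 * B]expn1; apply: leq_pexp2l; [rewrite muln_gt0 B_pos | apply: k_pos].
Qed.

Lemma MB : M.+1 <= B.
Proof. by rewrite BE -{1}[M.+1]expn1; apply: leq_pexp2l. Qed.

Lemma levelsE : levels Z n = k.
Proof.
rewrite /Algorithm.levels cpowE // -kE; apply/minn_idPr.
have : k < M by rewrite ME; apply: ltn_expl.
by have := MB; have := B_Z; lia.
Qed.

Lemma horizonE : horizon Z n = M.
Proof.
rewrite /Algorithm.horizon levelsE cpowE // -ME; apply/minn_idPr.
by have := MB; have := B_Z; lia.
Qed.

Lemma cn_pos : 0 < c -> n < k.
Proof.
move=> hc; apply: leq_trans (_ : n.+1 <= _) => //; apply: leq_trans (_ : c * n.+1 <= _).
  by rewrite leq_pmull.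
by rewrite kE; apply: ltnW; apply: ltn_expl.
Qed.

Hypothesis hc : 0 < c.

Lemma reachDE : reachD Z n = D.
Proof.
rewrite /reachD cpowE // -DE; apply/minn_idPr.
have : D <= M by rewrite DE ME leq_exp2l // ltnW // cn_pos.
by have := MB; have := B_Z; lia.
Qed.

Lemma baseE : base Z n = M.+1.
Proof. by rewrite /Algorithm.base horizonE. Qed.

Lemma nodesE : nodes Z n = B.
Proof.
rewrite /Algorithm.nodes baseE reachDE cpowE // -BE; apply/minn_idPr.
by have := B_Z; lia.
Qed.

(** The odometer never exceeds twice [(2 * B) ^ k], so under [cap] the saturating operations are
    exact. *)
Lemma savxE S T : savx c o Z n S T = rch B (stepb c o Z n) k S T.
Proof.
have hb : 0 < (2 * B) ^ k by rewrite expn_gt0 muln_gt0 B_pos.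
have hcpw i : i <= k -> cpow Z (2 * B) i = (2 * B) ^ i.
  move=> hi; rewrite cpowE ?muln_gt0 ?B_pos //; apply/minn_idPr.
  apply: leq_trans cap; apply: leq_trans (_ : (2 * B) ^ k <= _); last by lia.
  by rewrite leq_pexp2l // muln_gt0 B_pos.
have fk (P : pred nat) : find P (iota 0 k) <= k by rewrite -[X in _ <= X](size_iota 0) find_size.
have step1 s : s <= 2 * (2 * B) ^ k -> odox c o Z n S T s = odo B (stepb c o Z n) S T k s /\
    odo B (stepb c o Z n) S T k s <= 2 * (2 * B) ^ k.
  move=> hs; rewrite /odox /odo nodesE levelsE hcpw //; case: leqP => h.
    by split=> //; apply/minn_idPr; apply: leq_trans hs cap.
  rewrite /segux /segvx seguE segvE -/(fO B k s) -/(fE B k s).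
  have u1 : usuccx Z B k s = usucc B k s by rewrite /usuccx hcpw ?usuccE ?fk //; apply: B_pos.
  have u2 : ufailx Z B k s = ufail B k s by rewrite /ufailx hcpw ?ufailE ?fk //; apply: B_pos.
  have /andP[_ b1] := usucc_gt B_pos h; have /andP[_ b2] := ufail_gt B_pos h.
  rewrite u1 u2; case: (stepb _ _ _ _ _ _).
    by split; [apply/minn_idPr; apply: leq_trans cap; lia | lia].
  by split; [apply/minn_idPr; apply: leq_trans cap; lia | lia].
have it m : iteri m (fun _ s => odox c o Z n S T s) 0 = iter m (odo B (stepb c o Z n) S T k) 0 /\
    iter m (odo B (stepb c o Z n) S T k) 0 <= 2 * (2 * B) ^ k.
  by elim: m => // m [IH1 IH2]; rewrite iteriS IH1 iterS; apply: step1.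
rewrite /savx nodesE levelsE hcpw // (proj1 (it _)) savitch_odo ?B_pos //.
case: (rch _ _ _ _ _); first by rewrite mul1n eqxx.
by apply/eqP; lia.
Qed.

Notation ns := (flen o n 0).
Notation L := (M.-1).
Notation nt := (ntr o n).

Lemma M_gt1 : 1 < M.
Proof. by rewrite ME -[1]/(2 ^ 0) ltn_exp2l // k_pos. Qed.

Lemma in_trans q a e p : List.In (q, a, e, p) (trans N) <->
  exists t, [/\ t < nt, tq o Z n t = q, ta o Z n t = a, e = zval (tneg o n t) (tabs o Z n t) & tp o Z n t = p].
Proof.
have hI t : List.In t (iota 0 nt) <-> t < nt.
  have -> : (t < nt) = (t \in iota 0 nt) by rewrite mem_iota.
  elim: (iota 0 nt) => //= b l IH; rewrite inE; split=> [[->|/IH ->]|/orP[/eqP ->|/IH]]; rewrite ?eqxx ?orbT //; by [left | right].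
split=> [/List.in_map_iff [t [[<- <- <- <-] /hI ht]]|[t [ht <- <- -> <-]]]; first by exists t.
by apply/List.in_map_iff; exists t; split=> //; apply/hI.
Qed.

Lemma tp_lt t : t < nt -> tp o Z n t < ns.
Proof. by move=> ht; have [] := (proj2 wfN) _ _ _ _ (proj2 (in_trans _ _ _ _) (ex_intro _ t (And5 ht erefl erefl erefl erefl))). Qed.

Lemma tabs_le t : tabs o Z n t <= D.
Proof. by rewrite DE; apply: ltnW; apply: fval_lt. Qed.

Section Check.
Variables (z x : nat) (X : nat -> nat -> nat -> nat).
Hypothesis zx : dig Z n z 0 = x.
Hypothesis hx : x < M.
Hypothesis Xm : forall m p q, m <= D -> m <= x -> p <= ns -> q < ns -> colv Z n z (D - m) p q = X (x - m) p q.
Hypothesis Xp : forall m p q, m <= D -> x + m < M -> p <= ns -> q < ns -> colv Z n z (D + m) p q = X (x + m) p q.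

Lemma aokP q a p' y : p' <= ns -> aokb c o Z n z q a p' y <-> aok N L X x q a p' (Z.of_nat y).
Proof.
move=> hp'; have M1 := M_gt1.
have one t : t < nt -> aok1 c o Z n z p' y t <->
    ((0 <= Z.of_nat x + zval (tneg o n t) (tabs o Z n t) <= Z.of_nat L)%Z ->
     (Z.of_nat (X (Z.to_nat (Z.of_nat x + zval (tneg o n t) (tabs o Z n t))) p' (tp o Z n t)) <= Z.of_nat y)%Z).
  move=> ht; have tl := tp_lt ht; have ta := tabs_le t; rewrite /aok1 zx horizonE reachDE.
  case: (tneg o n t) => /=.
    split=> [/implyP h hr|h]; last apply/implyP => hle.
      have hle : tabs o Z n t <= x by lia.
      have := h hle; rewrite Xm //.
      by have -> : Z.to_nat (Z.of_nat x + - Z.of_nat (tabs o Z n t)) = x - tabs o Z n t by [lia]; lia.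
    rewrite Xm //; have -> : x - tabs o Z n t = Z.to_nat (Z.of_nat x + - Z.of_nat (tabs o Z n t)) by lia.
    by apply/leP; apply/Nat2Z.inj_le; apply: h; lia.
  split=> [/implyP h hr|h]; last apply/implyP => hle.
    have hle : x + tabs o Z n t < M by lia.
    have := h hle; rewrite Xp //.
    by have -> : Z.to_nat (Z.of_nat x + Z.of_nat (tabs o Z n t)) = x + tabs o Z n t by [lia]; lia.
  rewrite Xp //; have -> : x + tabs o Z n t = Z.to_nat (Z.of_nat x + Z.of_nat (tabs o Z n t)) by lia.
  by apply/leP; apply/Nat2Z.inj_le; apply: h; lia.
split=> [/allP h e q' /in_trans [t [ht e1 e2 -> <-]]|h].
  apply/one => //; have := h t; rewrite mem_iota ht e1 e2 !eqxx /=; exact.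
apply/allP => t; rewrite mem_iota /= add0n => ht; apply/implyP => /andP[/eqP e1 /eqP e2].
by apply/one => //; apply: h; apply/in_trans; exists t.
Qed.

Definition col_at (p q : nat) : Prop := X x p q <= L ->
  (final N q -> p < nstates N /\ final N p) /\
  forall a, a < nletters N -> aok N L X x q a (nstates N) (Z.of_nat (X x p q)) \/
    exists d p', [/\ List.In (p, a, d, p') (trans N), (0 <= Z.of_nat (X x p q) + d)%Z &
      aok N L X x q a p' (Z.of_nat (X x p q) + d)].

Lemma eokP p q a y : eokb c o Z n z p q a y <-> aok N L X x q a ns (Z.of_nat y) \/
    exists d p', [/\ List.In (p, a, d, p') (trans N), (0 <= Z.of_nat y + d)%Z &
      aok N L X x q a p' (Z.of_nat y + d)].
Proof.
have one t : t < nt -> eok1 c o Z n z q a y t <->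
    ((0 <= Z.of_nat y + zval (tneg o n t) (tabs o Z n t))%Z /\
     aok N L X x q a (tp o Z n t) (Z.of_nat y + zval (tneg o n t) (tabs o Z n t))).
  move=> ht; have tl := ltnW (tp_lt ht); rewrite /eok1; case: (tneg o n t) => /=.
    split=> [/andP[h1 /(aokP _ _ _ tl) h2]|[h1 h2]].
      by split; [lia | move: h2; rewrite Nat2Z.inj_sub //; apply/leP].
    have h3 : tabs o Z n t <= y by lia.
    rewrite h3; apply/(aokP _ _ _ tl); rewrite Nat2Z.inj_sub //; by apply/leP.
  rewrite (aokP _ _ _ tl) Nat2Z.inj_add; split=> [h|[]//]; split=> //; lia.
rewrite /eokb; split=> [/orP[/(aokP _ _ _ (leqnn ns))|/hasP [t]]|[h|[d [p' [/in_trans [t [ht e1 e2 -> <-]] h1 h2]]]]].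
- by left.
- rewrite mem_iota add0n /= => ht /andP[/andP[/eqP e1 /eqP e2] /(one _ ht) [h1 h2]].
  by right; exists (zval (tneg o n t) (tabs o Z n t)), (tp o Z n t); split=> //; apply/in_trans; exists t.
- by apply/orP; left; apply/aokP.
apply/orP; right; apply/hasP; exists t; first by rewrite mem_iota.
by rewrite e1 e2 !eqxx /=; apply/one.
Qed.

Lemma checkP : checkb c o Z n z <-> forall p q, p <= ns -> q < ns -> col_at p q.
Proof.
have M1 := M_gt1.
have one p q : p <= ns -> q < ns -> checkpq c o Z n z p q <-> col_at p q.
  move=> hp hq; have hD : colv Z n z D p q = X x p q by have := Xm (leq0n D) (leq0n x) hp hq; rewrite !subn0.
  rewrite /checkpq /checky horizonE reachDE hD /col_at.
  split=> [/implyP h hX|h].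
    have /h /andP[h1 /allP h2] : X x p q < M by lia.
    split=> [hf|a ha]; first by move: h1; rewrite /N /= in hf *; rewrite hf => /andP[].
    by apply/eokP; apply: h2; rewrite mem_iota.
  apply/implyP => hX; have /h [h1 h2] : X x p q <= L by lia.
  apply/andP; split; first by apply/implyP => /h1 [hp1 hp2]; apply/andP; split.
  by apply/allP => a; rewrite mem_iota add0n /= => ha; apply/eokP; apply: h2.
split=> [/allP h p q hp hq|h].
  apply/one => //; have := h p; rewrite mem_iota ltnS => /(_ hp)/allP/(_ q); rewrite mem_iota; exact.
apply/allP => p; rewrite mem_iota add0n /= ltnS => hp; apply/allP => q; rewrite mem_iota add0n /= => hq.
by apply/one => //; apply: h.
Qed.

End Check.

Lemma idx_lt i p q : p <= n -> q <= n -> (i * n.+1 + p) * n.+1 + q < i.+1 * colsz n.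
Proof. by move=> hp hq; rewrite /colsz; nia. Qed.

(** An entry [m] columns right of the centre becomes the central entry [m] windows later, so all
    windows are views of the table of central columns. *)
Lemma path_colok z0 z1 : dig Z n z0 0 = 0 -> rch B (stepb c o Z n) k z0 z1 ->
  exists2 X, colok N L X & forall p q, X 0 p q = colv Z n z0 D p q.
Proof.
move=> h0 /(rch_path B_pos) [f [f0 f1 fs]]; rewrite -ME in f1 fs.
have hs i : i < M -> [/\ dig Z n (f i.+1) 0 = (dig Z n (f i) 0).+1,
   forall j, j < 2 * D * colsz n -> dig Z n (f i.+1) j.+1 = dig Z n (f i) (j.+1 + colsz n) & checkb c o Z n (f i)].
  move=> /fs /and3P[/eqP h1 /allP h2 h3]; split=> // j hj; apply/eqP; apply: h2.
  by rewrite mem_iota add0n reachDE.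
have fd i : i <= M -> dig Z n (f i) 0 = i.
  elim: i => [|i IH] hi; first by rewrite f0.
  by have [-> _ _] := hs i hi; rewrite IH // ltnW.
have sh1 i i' p q : p <= n -> q <= n -> i < M -> i' < 2 * D -> colv Z n (f i.+1) i' p q = colv Z n (f i) i'.+1 p q.
  move=> hp hq hi hi'; have [_ h2 _] := hs i hi; rewrite /Algorithm.colv !add1n h2.
    by congr (dig _ _ _ _); rewrite /colsz; lia.
  apply: leq_trans (idx_lt i' hp hq) _; by rewrite leq_mul2r hi' orbT.
have shm m i i' p q : p <= n -> q <= n -> i + m <= M -> i' + m <= 2 * D ->
    colv Z n (f (i + m)) i' p q = colv Z n (f i) (i' + m) p q.
  move=> hp hq; elim: m i i' => [|m IH] i i' hi hi'; first by rewrite !addn0.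
  by rewrite addnS sh1 ?IH ?addSnnS //; lia.
have hns := flen_le o n 0.
exists (fun i p q => colv Z n (f i) D p q); last by move=> p q; rewrite f0.
move=> x p q hx hp hq; have M1 := M_gt1.
have hxM : x < M by lia.
have [_ _ hck] := hs x hxM.
have [m p1 q1 h1 h2 h3 h4|m p1 q1 h1 h2 h3 h4|/(_ hck) h _] :=
  @checkP (f x) x (fun i p q => colv Z n (f i) D p q) (fd x (ltnW hxM)) hxM.
- by rewrite -{1}(subnK h2) shm ?subnK //; lia.
- by rewrite shm //; lia.
by apply: h.
Qed.

Lemma colok_path X : colok N L X -> (forall x p q, X x p q <= L.+1) ->
  exists z0 z1, [/\ z0 < B, z1 < B, dig Z n z0 0 = 0, dig Z n z1 0 = M &
    (forall p q, p <= n -> q <= n -> colv Z n z0 D p q = X 0 p q) /\ rch B (stepb c o Z n) k z0 z1].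
Proof.
move=> hX hXL; have M1 := M_gt1; have hns := flen_le o n 0.
(* The first column of window [i] is column [i - D], hence the subtraction. Entries outside the
   table are set to 0; the range tests in [aok1] keep the checks away from them. *)
pose gd i j := if j is j'.+1 then
   let cx := i + j' %/ n.+1 %/ n.+1 in
   if (D <= cx) && (cx - D <= L) then X (cx - D) (j' %/ n.+1 %% n.+1) (j' %% n.+1) else 0
  else minn i M.
have gdM i j : gd i j < M.+1.
  case: j => [|j] /=; first by rewrite ltnS geq_minr.
  case: ifP => // _; have := hXL (i + j %/ n.+1 %/ n.+1 - D) (j %/ n.+1 %% n.+1) (j %% n.+1); lia.
pose len := 1 + (2 * D).+1 * colsz n.
pose f i := num M.+1 (gd i) len.
have fB i : f i < B by rewrite BE; apply: num_lt.
have fdig i j : j < len -> dig Z n (f i) j = gd i j by move=> hj; rewrite /Algorithm.dig baseE num_dig.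
have f0 i : i <= M -> dig Z n (f i) 0 = i by move=> hi; rewrite fdig //= (minn_idPl hi).
have fcol i i' p q : p <= n -> q <= n -> i' <= 2 * D ->
    colv Z n (f i) i' p q = if (D <= i + i') && (i + i' - D <= L) then X (i + i' - D) p q else 0.
  move=> hp hq hi'; rewrite /Algorithm.colv fdig; last first.
    rewrite /len ltn_add2l; apply: leq_trans (idx_lt i' hp hq) _; by rewrite leq_mul2r ltnS hi' orbT.
  rewrite add1n /=.
  have e1 : ((i' * n.+1 + p) * n.+1 + q) %/ n.+1 = i' * n.+1 + p by rewrite divnMDl // divn_small ?addn0.
  have e2 : ((i' * n.+1 + p) * n.+1 + q) %% n.+1 = q by rewrite modnMDl modn_small.
  have e3 : (i' * n.+1 + p) %/ n.+1 = i' by rewrite divnMDl // divn_small ?addn0.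
  have e4 : (i' * n.+1 + p) %% n.+1 = p by rewrite modnMDl modn_small.
  by rewrite e1 e2 e3 e4.
have hstep i : i < 0 + 2 ^ k -> stepb c o Z n (f i) (f i.+1).
  rewrite add0n -ME => hi; apply/and3P; split.
  - by rewrite !f0 // ltnW.
  - apply/allP => j; rewrite mem_iota add0n reachDE /= => hj.
    have hj1 : j.+1 < len by rewrite /len add1n ltnS; apply: leq_trans hj _; rewrite leq_mul2r; lia.
    have hj2 : j.+1 + colsz n < len by rewrite /len add1n addSn ltnS mulSn addnC ltn_add2l.
    rewrite !fdig // addSn /=.
    have -> : (j + colsz n) %/ n.+1 = j %/ n.+1 + n.+1 by rewrite /colsz addnC divnMDl // addnC.
    have -> : (j + colsz n) %% n.+1 = j %% n.+1 by rewrite /colsz addnC modnMDl.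
    have -> : (j %/ n.+1 + n.+1) %/ n.+1 = (j %/ n.+1 %/ n.+1).+1.
      by rewrite -{2}[n.+1]mul1n addnC divnMDl // add1n.
    by rewrite modnDr addnS addSn.
  apply/(@checkP (f i) i X (f0 i (ltnW hi)) hi).
  - move=> m p q h1 h2 h3 h4; rewrite fcol; [|lia|lia|lia].
    rewrite (_ : (D <= i + (D - m)) && (i + (D - m) - D <= L)); last by apply/andP; split; lia.
    by congr X; lia.
  - move=> m p q h1 h2 h3 h4; rewrite fcol; [|lia|lia|lia].
    rewrite (_ : (D <= i + (D + m)) && (i + (D + m) - D <= L)); last by apply/andP; split; lia.
    by congr X; lia.
  by move=> p q hp hq; apply: hX => //; lia.
exists (f 0), (f M); split=> //; [by apply: f0 | by apply: f0 |]; split.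
  by move=> p q hp hq; rewrite fcol //; [rewrite add0n leqnn subnn | lia].
by have := @path_rch B (stepb c o Z n) B_pos f k 0 (fun i _ => fB i) hstep; rewrite add0n -ME.
Qed.

End Correctness.

(** With [a = 2 ^ n.+1] the vertices and updates give [X <= a ^ 6], and the cut is at most
    [2 ^ (X ^ 40)]. Exponent 240 covers this, and one more makes the comparison strict. *)
Definition cexp : nat := 241.
(** With the same [a], a stack digit has at most [a ^ (cexp + 7)] bits and the stack holds
    [a ^ cexp] digits; the factor 2 in [cap] accounts for the last unit. *)
Definition zexp : nat := 2 * cexp + 8.
Definition bigZ (n : nat) : nat := 2 ^ (2 ^ (zexp * n.+1)).

Lemma succ_le_exp n : n.+1 <= 2 ^ n.+1.
Proof. by apply: ltnW; apply: ltn_expl. Qed.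

Lemma cap_bigZ n : 2 * (2 * (2 ^ 2 ^ (cexp * n.+1)).+1 ^ (1 + (2 * 2 ^ n).+1 * colsz n)) ^ (2 ^ (cexp * n.+1)) <= bigZ n.
Proof.
set a := 2 ^ n.+1; have a2 : 2 <= a by rewrite /a expnS; have : 0 < 2 ^ n by [rewrite expn_gt0]; lia.
have hn : n.+1 <= a := succ_le_exp n.
have ap i j : i <= j -> a ^ i <= a ^ j by move=> h; rewrite leq_pexp2l //; lia.
have ad i x y : x <= a ^ i -> y <= a ^ i -> x + y <= a ^ i.+1.
  move=> h1 h2; apply: leq_trans (leq_add h1 h2) _; rewrite addnn -mul2n expnS leq_mul2r a2 orbT //.
have e1 j : 1 <= a ^ j by rewrite expn_gt0; lia.
have ek : 2 ^ (cexp * n.+1) = a ^ cexp by rewrite mulnC expnM.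
have eb : bigZ n = 2 ^ (a ^ zexp) by rewrite /bigZ mulnC expnM.
rewrite eb ek; set K := a ^ cexp.
have hw : 1 + (2 * 2 ^ n).+1 * colsz n <= a ^ 5.
  apply: (ad _); first exact: e1.
  rewrite -expnS -/a -addn1 /colsz (expnD a 2 2).
  apply: leq_mul; last by rewrite expnS expn1; apply: leq_mul.
  by apply: (ad _); rewrite ?expn1 //; lia.
have hB : (2 ^ K).+1 ^ (1 + (2 * 2 ^ n).+1 * colsz n) <= 2 ^ (a ^ (cexp.+1 + 5)).
  apply: leq_trans (_ : (2 ^ (a ^ cexp.+1)) ^ (a ^ 5) <= _); last by rewrite -expnM -expnD.
  apply: leq_trans (_ : (2 ^ (a ^ cexp.+1)) ^ (1 + (2 * 2 ^ n).+1 * colsz n) <= _); last first.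
    by rewrite leq_pexp2l // expn_gt0.
  apply: expn_mono; apply: leq_trans (_ : 2 ^ K.+1 <= _).
    by rewrite expnS; have : 0 < 2 ^ K by [rewrite expn_gt0]; lia.
  rewrite leq_exp2l // -addn1; apply: (ad _) => //.
set Bx := _ ^ (1 + _) in hB *.
have hB2 : 2 * Bx <= 2 ^ (a ^ (cexp.+1 + 6)).
  apply: leq_trans (_ : 2 * 2 ^ (a ^ (cexp.+1 + 5)) <= _); first by rewrite leq_mul2l hB orbT.
  by rewrite -expnS leq_exp2l // addnS -addn1; apply: (ad _).
have hB3 : (2 * Bx) ^ K <= 2 ^ (a ^ (cexp.+1 + 6 + cexp)).
  apply: leq_trans (expn_mono _ hB2) _; by rewrite -expnM -expnD.
apply: leq_trans (_ : 2 * 2 ^ (a ^ (cexp.+1 + 6 + cexp)) <= _); first by rewrite leq_mul2l hB3 orbT.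
rewrite -expnS leq_exp2l // -addn1.
have -> : zexp = (cexp.+1 + 6 + cexp).+1 by [].
by apply: (ad _).
Qed.

Lemma Lbound_horizon N n : wf N -> nstates N <= n -> nletters N <= n ->
  Lbound (vert N) (2 ^ n) <= (2 ^ 2 ^ (cexp * n.+1)).-1.
Proof.
move=> [hi _] hs hl; set a := 2 ^ n.+1.
have a2 : 2 <= a by rewrite /a expnS; have : 0 < 2 ^ n by [rewrite expn_gt0]; lia.
have hn : n.+1 <= a := succ_le_exp n.
have ek : 2 ^ (cexp * n.+1) = a ^ cexp by rewrite mulnC expnM.
have cV : #|{: vert N}| = (nstates N).+1 * nstates N * (2 * nletters N).+1.
  by rewrite !card_prod !card_option !card_prod card_bool !card_ord.
have hK : 0 < Kn (vert N) (2 ^ n) by rewrite /Kn cV !muln_gt0 expn_gt0 /= andbT; lia.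
have hKa : X (vert N) (2 ^ n) <= a ^ 6.
  rewrite /X /Kn cV; apply: leq_trans (_ : a * a * (2 * a) * a + 2 <= _).
    rewrite leq_add2r; apply: leq_mul; last by rewrite leq_exp2l.
    by apply: leq_mul; [apply: leq_mul; lia | lia].
  by rewrite !expnS expn0; nia.
have := Lbound_X hK; rewrite /dexp => h; apply: leq_trans h _.
apply: leq_trans (_ : 2 ^ (a ^ 240) <= _).
  rewrite leq_exp2l //; apply: leq_trans (expn_mono 40 hKa) _; by rewrite -expnM.
rewrite ek; have h1 : a ^ 240 < a ^ cexp by rewrite ltn_exp2l.
have h2 : 2 ^ (a ^ 240) < 2 ^ (a ^ cexp) by rewrite ltn_exp2l.
by lia.
Qed.

Theorem decide_correct (x : seq sym) : HD_problem x <-> decideb cexp (orc x) (bigZ (size x)) (size x).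
Proof.
set n := size x; set Z := bigZ n; set o := orc x.
have hcap := cap_bigZ n; rewrite -/Z in hcap.
have hZ : 2 ^ n <= Z.
  rewrite /Z /bigZ leq_exp2l //; apply: leq_trans (_ : zexp * n.+1 <= _); first by rewrite /zexp; lia.
  by apply: ltnW; apply: ltn_expl.
have key : validb o Z n -> HD_problem x <->
   has (fun z0 => has (fun z1 => pathb cexp o Z n z0 z1) (iota 0 (nodes cexp Z n))) (iota 0 (nodes cexp Z n)).
  move=> hv; have [wfN eN] := mkN_encode hZ hv.
  have -> : HD_problem x <-> history_deterministic (mkN o Z n).
    by rewrite -(HD_problem_encode wfN) eN.
  have hns : flen o n 0 <= n := flen_le _ _ _.
  have q0n : fval o Z n 2 0 < flen o n 0 by case: wfN.
  have hnod := nodesE erefl erefl erefl erefl hcap isT.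
  have hD := reachDE erefl erefl erefl erefl hcap isT.
  have hM := horizonE erefl erefl erefl erefl hcap.
  have hsav := savxE o erefl erefl erefl erefl hcap isT.
  split=> [hd|/hasP [z0 _ /hasP [z1 _]]].
    have [X [hX h0 hXL]] := HD_colok (2 ^ 2 ^ (cexp * n.+1)).-1 wfN hd.
    have [z0 [z1 [b0 b1 d0 d1 [hc hr]]]] := colok_path erefl erefl erefl erefl hcap wfN isT hX hXL.
    apply/hasP; exists z0; first by rewrite mem_iota hnod.
    apply/hasP; exists z1; first by rewrite mem_iota hnod.
    rewrite /pathb d0 d1 hM hsav hr hD hc; [|lia|lia].
    by move: h0 => /= ->; rewrite !eqxx.
  rewrite /pathb hM hsav hD => /and4P[/eqP d0 /eqP hc0 _ hr].
  have [X hX hX0] := path_colok erefl erefl erefl erefl hcap wfN isT d0 hr.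
  apply: (@colok_HD (mkN o Z n) (2 ^ 2 ^ (cexp * n.+1)).-1 wfN (2 ^ n) _ _ X) => //.
  - by rewrite expn_gt0.
  - move=> q a d p /in_trans [t [_ _ _ -> _]]; have := @fval_lt o Z n (4 * t.+1 + 2) 1.
    by rewrite /tabs /zval; case: (tneg _ _ _); lia.
  - by apply: Lbound_horizon => //; apply: flen_le.
  by rewrite hX0.
rewrite /decideb; split=> [h|/andP[hv] /(key hv) //].
have hv : validb o Z n.
  by case: h => N [wfN [e _]]; have := @valid_encode N Z wfN; rewrite e; apply.
by rewrite hv; apply/key.
Qed.

Theorem HD_EXPSPACE : EXPSPACE HD_problem.
Proof.
pose g := #|{: sym}|.
have og (x : seq sym) : obnd g (orc x) by move=> i; apply: lcode_le.
have [tD [hD [cD cDb]]] := E_decideb cexp g.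
have [tN [hN [cN cNb]]] := E_mul (E_const g zexp) (E_succ (E_nth g 0)).
have [tB [hB [cB cBb]]] := E_mul (E_nth g 0) (E_nth g 0).
have [tI [hI [cI cIb]]] := E_const g 2.
(* Repeated squaring of 2 produces [bigZ]. It leaves the class [E], so its cost is estimated by
   hand, and the value is handed to the decision term as a variable. *)
pose tZ := TRec tN tI tB.
have itE m e : iteri m (fun j acc => nth 0 [:: acc, j & e] 0 * nth 0 [:: acc, j & e] 0) 2 = 2 ^ (2 ^ m).
  by elim: m => // m IH; rewrite iteriS IH /= -expnD addnn -mul2n -expnS.
have trE o m e : obnd g o -> trec o e tI tB m = 2 ^ (2 ^ m).
  by move=> ho; rewrite -(itE m e) /trec hI //; elim: m => //= m ->; rewrite hB.
have ZE (x : seq sym) : teval (orc x) [:: size x] tZ = bigZ (size x).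
  have -> : teval (orc x) [:: size x] tZ = trec (orc x) [:: size x] tI tB (teval (orc x) [:: size x] tN) by [].
  by rewrite trE // hN.
pose C := cD + cN + cB + cI.
have Zbig n : n < bigZ n /\ zexp * n.+1 <= bigZ n.
  have h : zexp * n.+1 <= bigZ n.
    rewrite /bigZ; apply: ltnW; apply: ltn_trans (ltn_expl _ (ltnSn 1)).
    by apply: ltn_expl.
  by split=> //; apply: leq_trans h; rewrite /zexp; lia.
apply: (@term_expspace _ (TLet tZ tD) HD_problem (zexp + (2 * C).+1)) => x.
  rewrite decide_correct -[teval _ _ _]/(teval (orc x) [:: teval (orc x) [:: size x] tZ; size x] tD) ZE hD //.
  by rewrite -[nth 0 _ 0]/(bigZ (size x)) -[nth 0 _ 1]/(size x); case: (decideb _ _ _ _).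
have [z1 z2] := Zbig (size x); set n := size x in z1 z2 *.
have Z2 : 2 <= bigZ n by rewrite /bigZ -{1}[2]expn1 leq_exp2l // expn_gt0.
have bnd e i : maxl e <= bigZ n -> i <= C -> (maxl e + 2) ^ i <= (2 * bigZ n) ^ C.
  move=> h1 h2; apply: leq_trans (_ : (2 * bigZ n) ^ i <= _); first by apply: expn_mono; lia.
  by rewrite leq_pexp2l //; lia.
have cost : tcost (orc x) [:: n] (TLet tZ tD) <= (2 * bigZ n) ^ C.
  have -> : tcost (orc x) [:: n] (TLet tZ tD) = maxn (maxn (tcost (orc x) [:: n] tN) (maxn (tcost (orc x) [:: n] tI)
      (\max_(j < teval (orc x) [:: n] tN) tcost (orc x) [:: trec (orc x) [:: n] tI tB j, (j : nat) & [:: n]] tB)))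
      (tcost (orc x) [:: teval (orc x) [:: n] tZ; n] tD) by [].
  have [c1 c2 c3 c4] : [/\ cD <= C, cN <= C, cB <= C & cI <= C] by rewrite /C; split; lia.
  have m1 : maxl [:: n] <= bigZ n by rewrite -[maxl _]/(maxn n 0) maxn0 ltnW.
  have m2 v w : v <= bigZ n -> w <= bigZ n -> maxl [:: v; w; n] <= bigZ n.
    by move=> h1 h2; rewrite -[maxl _]/(maxn v (maxn w (maxl [:: n]))) !geq_max h1 h2 m1.
  have m3 : maxl [:: bigZ n; n] <= bigZ n by rewrite -[maxl _]/(maxn (bigZ n) (maxl [:: n])) geq_max leqnn m1.
  rewrite ZE !geq_max; apply/andP; split; last by apply: leq_trans (cDb _ _ (og x)) (bnd _ _ m3 c1).
  apply/and3P; split.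
  - exact: leq_trans (cNb _ _ (og x)) (bnd _ _ m1 c2).
  - exact: leq_trans (cIb _ _ (og x)) (bnd _ _ m1 c4).
  apply/bigmax_leqP => j _; apply: leq_trans (cBb _ _ (og x)) (bnd _ _ _ c3).
  have hj : j < zexp * n.+1 by apply: leq_trans (ltn_ord j) _; rewrite hN.
  rewrite trE //; apply: m2; last by apply: leq_trans (ltnW hj) z2.
  by rewrite /bigZ leq_exp2l // leq_exp2l // ltnW.
apply: leq_trans cost _.
have a2 : 2 * bigZ n <= 2 ^ (2 ^ (zexp * n.+1)).+1 by rewrite expnS.
apply: leq_trans (expn_mono C a2) _; rewrite -expnM leq_exp2l // mulnDl expnD.
have hC : C < 2 ^ C by apply: ltn_expl.
have p0 : 0 < 2 ^ (zexp * n.+1) by rewrite expn_gt0.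
apply: leq_trans (_ : (2 * 2 ^ (zexp * n.+1)) * 2 ^ C <= _); first by apply: leq_mul; lia.
rewrite mulnAC mulnC leq_mul2l; apply/orP; right; rewrite -expnS leq_exp2l // mulnC.
by rewrite mulSn; lia.
Qed.

End Decision.
Import Decision.

Theorem theorem5 : EXPSPACE_complete HD_problem.
Proof. by split; [exact: HD_EXPSPACE | exact: HD_hard]. Qed.
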